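(* Let $\phi$ be an even Hecke–Maass cusp form on $\mathbb{X}$. Let $R_\phi$ be the number of inert nodal domains of $\phi$, $m_\phi$ the number of zeros of $\phi$ on $\delta$ (counting the cusp $i\infty$), and $n_\phi$ the number of sign changes of $\phi$ along $\delta$. Then \[ \tfrac12 n_\phi+1\le R_\phi\le m_\phi . \] If the nodal line $Z_\phi$ is nonsingular (i.e. $\phi$ and $\nabla\phi$ never vanish simultaneously), then there are exactly $\frac12 n_\phi+1$ inert nodal domains of $\phi$.
   Context: $\mathbb{X}=\mathrm{SL}_2(\mathbb{Z})\backslash\mathbb{H}$. An even Hecke–Maass cusp form is a real-valued $\phi$ on $\mathbb{H}$ with $y^2(\partial_x^2+\partial_y^2)\phi+(\frac14+t_\phi^2)\phi=0$, $t_\phi>0$, $\mathrm{SL}_2(\mathbb{Z})$-invariant, $\phi(-\bar z)=\phi(z)$, $L^2(\mathbb{X})$-normalized, eigenfunction of all Hecke operators, normalized so that $\phi>0$ on $\delta$ near the cusp. $\sigma$ is the isometry of $\mathbb{X}$ induced by $x+iy\mapsto-x+iy$, and $\delta$ its fixed set (the images of $\{iy:y\ge1\}$, $\{\frac12+iy:y\ge\sqrt3/2\}$ and $\{e^{i\theta}:\pi/3\le\theta\le\pi/2\}$), which is topologically a circle once the cusp $i\infty$ is added. $Z_\phi=\{\phi=0\}\subset\mathbb{X}$; nodal domains are the connected components of $\mathbb{X}\setminus Z_\phi$; a nodal domain $\Omega$ is inert if $\sigma(\Omega)=\Omega$ (equivalently, $\Omega$ meets $\delta$). The zeros of $\phi$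 on $\delta$ are listed cyclically as $i\infty=\tilde K_1,\tilde K_2,\dots,\tilde K_{m_\phi}$ (the cusp counted as a zero); $n_\phi$ is the number of those zeros at which $\phi|_\delta$ changes sign. *)

(* Defs.v *)
From HB Require Import structures.
From mathcomp Require Import all_boot all_order all_algebra generic_quotient finmap.
From mathcomp Require Import ring lra.
From mathcomp Require Import complex.
From mathcomp Require Import all_classical all_reals all_analysis.

Set Implicit Arguments.
Unset Strict Implicit.
Unset Printing Implicit Defensive.

Import Order.TTheory GRing.Theory Num.Theory.
Import numFieldNormedType.Exports.
Local Open Scope classical_set_scope.
Local Open Scope ring_scope.
Local Open Scope complex_scope.
Local Open Scope quotient_scope.

Definition hplane (R : realType) : set (R * R) := [set z | 0 < z.2].
Arguments hplane R : clear implicits.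

(* A set_type carries the subtype topology. *)
Definition upper (R : realType) := set_type (hplane R).

Definition mkupper (R : realType) (z : R * R) (hz : 0 < z.2) : upper R :=
  SigSub (mem_set hz : z \in hplane R).

Lemma upper_gt0 (R : realType) (z : upper R) : 0 < (val z).2.
Proof. exact: (set_valP z). Qed.

Definition toC (R : realType) (z : upper R) : R[i] := (val z).1 +i* (val z).2.

Definition mobius (R : realType) (g : 'M[int]_2) (z : R[i]) : R[i] :=
  ((g 0 0)%:~R * z + (g 0 1)%:~R) / ((g 1 0)%:~R * z + (g 1 1)%:~R).

Definition modular_rel (R : realType) (z w : upper R) : bool :=
  `[< exists2 g : 'M[int]_2, \det g = 1 & toC w = mobius g (toC z) >].

Lemma toC_inj (R : realType) : injective (@toC R).
Proof.
by move=> z w [h1 h2]; apply/val_inj/eqP; rewrite -pair_eqE /= h1 h2 !eqxx.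
Qed.

Lemma mobius_den (R : realType) (g : 'M[int]_2) (z : upper R) :
  \det g = 1 -> (g 1 0)%:~R * toC z + (g 1 1)%:~R != 0.
Proof.
move=> hg; apply/eqP => h.
have y0 := upper_gt0 z.
have intC (a : int) : (a%:~R : R[i]) = (a%:~R : R)%:C.
  by rewrite (rmorph_int (real_complex R)).
move: h; rewrite !intC /toC; case: (val z) y0 => x y /= y0.
move=> [] h1 h2.
have c0 : g 1 0 = 0.
  move: h2; rewrite mul0r !addr0 => /eqP.
  by rewrite mulf_eq0 (gt_eqF y0) orbF intr_eq0 => /eqP.
move: h1; rewrite c0 !mul0r subr0 add0r => /eqP; rewrite intr_eq0 => /eqP d0.
have /eqP := hg; rewrite (expand_det_row g 1) !big_ord_recl big_ord0 /=.
by rewrite [lift _ _](_ : _ = 1) ?c0 ?d0 ?mul0r ?addr0 //; apply: val_inj.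
Qed.

Lemma mobius1 (R : realType) (z : R[i]) : mobius 1%:M z = z.
Proof. by rewrite /mobius !mxE /= mul1r mul0r addr0 add0r divr1. Qed.

Lemma mobiusM (R : realType) (g h : 'M[int]_2) (z w : upper R) :
  \det g = 1 -> \det h = 1 -> toC w = mobius g (toC z) ->
  mobius h (toC w) = mobius (h *m g) (toC z).
Proof.
move=> hg hh hw.
have dg := mobius_den z hg.
have dhg : \det (h *m g) = 1 by rewrite det_mulmx hg hh.
have {dhg} := mobius_den z dhg.
rewrite {}hw /mobius !mxE !big_ord_recl !big_ord0 /=.
have -> : lift ord0 ord0 = 1 :> 'I_2 by apply: val_inj.
rewrite !addr0 !rmorphD !rmorphM /=.
move: (toC z) dg => t dg h2; field.
by rewrite dg andbT; exact: h2.
Qed.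

Lemma modular_equiv_rel (R : realType) : equiv_class_of (@modular_rel R).
Proof.
have tr : transitive (@modular_rel R).
  move=> w z v /asboolP[g hg zw] /asboolP[h hh wv]; apply/asboolP.
  exists (h *m g); first by rewrite det_mulmx hg hh.
  by rewrite wv; exact: mobiusM.
have sy (z w : upper R) : modular_rel z w -> modular_rel w z.
  move=> /asboolP[g hg zw]; apply/asboolP.
  have ha : \det (\adj g) = 1.
    have := congr1 determinant (mul_adj_mx g).
    by rewrite det_mulmx hg mulr1 det1.
  exists (\adj g) => //.
  by rewrite (mobiusM hg ha zw) mul_adj_mx hg mobius1.
split=> //.
- by move=> z; apply/asboolP; exists 1%:M; rewrite ?det1 ?mobius1.
- by move=> z w; apply/idP/idP; exact: sy.
Qed.

Canonical modular_equiv (R : realType) := EquivRelPack (@modular_equiv_rel R).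

Definition X (R : realType) : topologicalType :=
  quotient_topology {eq_quot (modular_equiv R)}.

Definition proj (R : realType) (z : upper R) : X R :=
  \pi_(quotient_topology {eq_quot (modular_equiv R)}) z.

Lemma sigmaH_subproof (R : realType) (z : upper R) :
  0 < ((- (val z).1, (val z).2) : R * R).2.
Proof. exact: upper_gt0. Qed.

Definition sigmaH (R : realType) (z : upper R) : upper R :=
  mkupper (sigmaH_subproof z).

Lemma modular_rel_sigmaH (R : realType) (z w : upper R) :
  modular_rel z w -> modular_rel (sigmaH z) (sigmaH w).
Proof.
move=> /asboolP[g hg zw]; apply/asboolP.
pose D : 'M[int]_2 := diag_mx (\row_j (-1) ^+ j).
have sE (t : upper R) : toC (sigmaH t) = - conjc (toC t).
  by rewrite /toC /=; apply/eqP; rewrite eq_complex /= opprK !eqxx.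
exists (D *m g *m D).
  by rewrite !det_mulmx hg mulr1 det_diag !big_ord_recl big_ord0 !mxE.
rewrite !sE zw /mobius mul_mx_diag mul_diag_mx !mxE /=.
rewrite fmorph_div !rmorphD !rmorphM /= !rmorph_int -mulNr.
congr (_ / _); ring.
Qed.

Definition sigmaX (R : realType) (q : X R) : X R := proj (sigmaH (repr q)).

Lemma sigmaX_proj (R : realType) (z : upper R) :
  sigmaX (proj z) = proj (sigmaH z).
Proof.
apply/eqmodP/modular_rel_sigmaH.
have /eqmodP : repr (proj z) = z %[mod {eq_quot modular_equiv R}] by exact: reprK.
exact.
Qed.

(* [phi] in the coordinates (x, y), extended by the irrelevant value 0 outside
   the upper half-plane. *)
Definition coord (R : realType) (phi : upper R -> R) (z : R * R) : R :=
  oapp phi 0 (insub z).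

Definition ex (R : realType) : R * R := (1, 0).
Definition ey (R : realType) : R * R := (0, 1).
Arguments ex {R}.
Arguments ey {R}.

(* C^2 on the upper half-plane; continuity of the second derivatives entails
   that of [u] and of its first derivatives. *)
Definition twice_cont_diff (R : realType) (u : R * R -> R) :=
  forall (z v w : R * R), 0 < z.2 ->
  [/\ derivable u z v, derivable ('D_v u) z w &
      {for z, continuous ('D_w ('D_v u))}].

Definition laplacian (R : realType) (u : R * R -> R) (z : R * R) : R :=
  'D_ex ('D_ex u) z + 'D_ey ('D_ey u) z.

Definition hecke (R : realType) (n : nat) (phi : upper R -> R) (z : upper R) : R :=
  (Num.sqrt n%:R)^-1 * \sum_(d <- divisors n) \sum_(0 <= b < d)
    coord phi (((n %/ d)%:R * (val z).1 + b%:R) / d%:R,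
               (n %/ d)%:R * (val z).2 / d%:R).

Definition fundamental_domain (R : realType) : set (R * R) :=
  [set z | [/\ 0 < z.2, `|z.1| <= 2^-1 & 1 <= z.1 ^+ 2 + z.2 ^+ 2]].
Arguments fundamental_domain R : clear implicits.

Record even_hecke_maass_cusp_form (R : realType) (phi : upper R -> R) : Prop := {
  hm_smooth : twice_cont_diff (coord phi);
  hm_eigen : exists2 t : R, 0 < t & forall z : upper R,
    (val z).2 ^+ 2 * laplacian (coord phi) (val z) + (4^-1 + t ^+ 2) * phi z = 0;
  hm_invariant : forall z w : upper R, modular_rel z w -> phi z = phi w;
  hm_even : forall z : upper R, phi (sigmaH z) = phi z;
  (* Automatic from square-integrability, as the eigenvalue is > 1/4. *)
  hm_cuspidal : forall y : R, 0 < y ->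
    (\int[lebesgue_measure]_(x in `[0%R, 1%R]) (coord phi (x, y))%:E = 0)%E;
  hm_normalized :
    (\int[lebesgue_measure \x lebesgue_measure]_(z in fundamental_domain R)
       ((coord phi z / z.2) ^+ 2)%:E = 1)%E;
  hm_hecke : forall n : nat, (0 < n)%N ->
    exists l : R, forall z : upper R, hecke n phi z = l * phi z;
  (* The leading term in the Fourier expansion of [phi] at the cusp is a multiple
     of cos(2 pi x), so [phi] has opposite signs near the cusp on the two ends
     x = 0 and x = 1/2 of delta; the sign is normalized on the end x = 0. *)
  hm_positive : \forall y \near +oo, 0 < coord phi (0, y)
}.

Definition nodal_line (R : realType) (phi : upper R -> R) : set (X R) :=
  @proj R @` [set z | phi z = 0].

Definition nodal_domains (R : realType) (phi : upper R -> R) : set (set (X R)) :=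
  connected_component (~` nodal_line phi) @` (~` nodal_line phi).

Definition inert_nodal_domains (R : realType) (phi : upper R -> R) : set (set (X R)) :=
  nodal_domains phi `&` [set Omega | @sigmaX R @` Omega = Omega].

Definition delta (R : realType) : set (X R) := [set q | sigmaX q = q].
Arguments delta R : clear implicits.

(* Parametrization of delta by the line, running through iy (y >= 1) downwards,
   the unit circle from i to e^(i pi / 3), then 1/2 + iy (y >= sqrt 3 / 2)
   upwards. The cusp is approached at both -oo and +oo. *)
Definition delta_coord (R : realType) (s : R) : R * R :=
  if s <= 0 then (0, 1 - s)
  else if s <= 2^-1 then (s, Num.sqrt (1 - s ^+ 2))
  else (2^-1, Num.sqrt 3 / 2 + (s - 2^-1)).

Lemma delta_coord_gt0 (R : realType) (s : R) : 0 < (delta_coord s).2.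
Proof.
rewrite /delta_coord; case: ifPn => [|s0] /=; first by lra.
case: ifPn => [s1|s1] /=; first by rewrite sqrtr_gt0; nra.
have : 0 < Num.sqrt 3 :> R by rewrite sqrtr_gt0.
by lra.
Qed.

Definition delta_path (R : realType) (s : R) : upper R :=
  mkupper (delta_coord_gt0 s).

(* [None] stands for the cusp, which closes up delta to a circle. *)
Definition delta_zeros (R : realType) (phi : upper R -> R) : set (option (X R)) :=
  None |` (Some @` (delta R `&` nodal_line phi)).

Definition opposite_signs (R : realType) (f : R -> R) (F G : set_system R) : Prop :=
  (\forall s \near F, f s < 0) /\ (\forall s \near G, 0 < f s) \/
  (\forall s \near F, 0 < f s) /\ (\forall s \near G, f s < 0).

Definition changes_sign_at (R : realType) (phi : upper R -> R)
    (p : option (X R)) : Prop :=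
  let f := phi \o @delta_path R in
  match p with
  | None => opposite_signs f -oo +oo
  | Some q => exists2 s : R, proj (delta_path s) = q & opposite_signs f s^'- s^'+
  end.

Definition sign_changes (R : realType) (phi : upper R -> R) : set (option (X R)) :=
  delta_zeros phi `&` [set p | changes_sign_at phi p].

Definition num_inert (R : realType) (phi : upper R -> R) : nat :=
  #|` fset_set (inert_nodal_domains phi)|.

Definition num_zeros (R : realType) (phi : upper R -> R) : nat :=
  #|` fset_set (delta_zeros phi)|.

Definition num_sign_changes (R : realType) (phi : upper R -> R) : nat :=
  #|` fset_set (sign_changes phi)|.

Definition nonsingular_nodal_line (R : realType) (phi : upper R -> R) : Prop :=
  forall z : upper R, ~ [/\ phi z = 0, 'D_ex (coord phi) (val z) = 0 &
                            'D_ey (coord phi) (val z) = 0].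

(* Main.v *)
(* X modulo sigma is the half strip {0 <= x <= 1/2, |z| >= 1}, and delta is its
   boundary. Near the cusp and, by evenness, near every point of delta, separation
   of variables in (hyperbolic) polar coordinates shows that phi is asymptotic to a
   single cosine mode; hence its zeros on delta are isolated, and finite in number.
   An inert domain meets delta, because X minus delta is disconnected by sigma.

   For a fine triangular grid in the half strip, colour a vertex by the sign of phi
   and draw the interface between the two colours. Interface lines enter the strip
   where phi goes from + to - along delta and, the grid being locally finite, a line
   never leaves through another entry. So any prescription of jumps at the n/2
   entries is realized by a two-valued function that is constant on the inert
   domains, and there are at least 2 ^ (1 + n/2) such functions: R >= 1 + n/2.
   If the nodal line is nonsingular, adjacent grid points of one sign lie in the same
   domain, and the lines through the entries use up all the exits. Then a two-valued
   function of the domains that does not jump at the entries is constant on delta,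
   which gives R <= 1 + n/2. *)

(* Two-valued functions are used because jumps modulo 2 cancel around a triangle: jumps prescribed
   on interface lines form a closed cochain on the half strip, so separating domains becomes
   combinatorics, whatever the shape of the nodal set at a singular zero. The dominating mode comes
   from convexity. The k-th mode satisfies [c'' = (k^2 - V) c] with [0 <= V <= 3/4], so unless it
   grows it is squeezed between multiples of [exp(- k t)] and [exp(- (k - 1/2) t)]. The loss of 1/2
   is harmless: the lowest mode present still beats all later ones by a factor [exp(- t/2)]. Growth
   contradicts boundedness near a point of delta and square integrability at the cusp. The mode 0 is
   removed separately, by cuspidality at the cusp and by the vanishing of phi at a zero. At the cusp
   the Hecke operators force the lowest mode to be k = 1. This gives opposite signs at the two ends
   of delta, and monotonicity in x, which controls the unbounded part of the strip. Signs along
   delta thus begin with + and end with -, falls outnumber rises by one, and with the cusp n is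
   twice the number of falls. *)
From HB Require Import structures.
From mathcomp Require Import all_boot all_order all_algebra generic_quotient finmap.
From mathcomp Require Import ring lra zify.
From mathcomp Require Import complex.
From mathcomp Require Import all_classical all_reals all_analysis measurable_realfun.
Require Import Defs.

Set Implicit Arguments.
Unset Strict Implicit.
Unset Printing Implicit Defensive.

Import Order.TTheory GRing.Theory Num.Theory.
Import numFieldNormedType.Exports.
Local Open Scope classical_set_scope.
Local Open Scope ring_scope.

(** * A linear equation of second order on a half-line *)

Lemma ge0_is_derive_le (R : realType) (f df : R -> R) (a b : R) : a <= b ->
  (forall x, a <= x <= b -> is_derive x 1 f (df x)) ->
  (forall x, a <= x <= b -> 0 <= df x) -> f a <= f b.
Proof.
move=> ab fd fp.
have fd' x : x \in `]a, b[%R -> is_derive x 1 f (df x).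
  by rewrite in_itv /= => /andP[h1 h2]; apply: fd; rewrite !ltW.
have fc : {within `[a, b], continuous f}.
  apply: derivable_within_continuous => x; rewrite in_itv /= => h.
  by have [] := fd x h.
have [c + E] := MVT_segment ab fd' fc.
rewrite in_itv /= => /fp h; rewrite -subr_ge0 E.
by rewrite mulr_ge0 // subr_ge0.
Qed.

Lemma is_derive_opp (R : realType) (f : R -> R) (x df : R) :
  is_derive x 1 f df -> is_derive x 1 (fun t => - f t) (- df).
Proof. exact: is_deriveN. Qed.

Lemma is_derive_locally0 (R : realType) (f : R -> R) (a t d : R) :
  (forall x, a <= x -> f x = 0) -> a < t -> is_derive t 1 f d -> d = 0.
Proof.
move=> f0 at_ fd.
have h : is_derive t (1 : R) f 0.
  apply: (@near_eq_is_derive _ _ _ (cst 0)) => //.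
  have : \forall x \near t, a < x by apply: lt_nbhsr.
  by apply: filterS => x h; rewrite /cst f0 // ltW.
by have [_ <-] := fd; have [_ <-] := h.
Qed.

(** Gronwall's inequality for the energy [c ^+ 2 + c1 ^+ 2]: its derivative is at most [1 + K] times
    itself in absolute value, so once zero at [s] it is zero in both directions of time. *)
Lemma ode2_eq0 (R : realType) (c c1 q : R -> R) (a b K : R) :
  (forall t, a <= t <= b -> is_derive t 1 c (c1 t)) ->
  (forall t, a <= t <= b -> is_derive t 1 c1 (q t * c t)) ->
  (forall t, a <= t <= b -> `|q t| <= K) ->
  forall s, a <= s <= b -> c s = 0 -> c1 s = 0 ->
  forall t, a <= t <= b -> c t = 0.
Proof.
move=> dc dc1 qK s sab cs c1s t tab.
have K0 : 0 <= K by apply: le_trans (qK s sab).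
pose E x := c x ^+ 2 + c1 x ^+ 2.
have Es : E s = 0 by rewrite /E cs c1s expr0n /= addr0.
have dE (r : R) x : a <= x <= b -> is_derive x 1 (fun x => E x * expR (r * x))
   ((2 * (1 + q x) * c x * c1 x + r * E x) * expR (r * x)).
  move=> xab; have h1 := dc x xab; have h2 := dc1 x xab.
  rewrite /E; apply: is_derive_eq; rewrite /GRing.scale /=; ring.
have bd x : a <= x <= b -> `|2 * (1 + q x) * c x * c1 x| <= (1 + K) * E x.
  move=> xab; rewrite /E.
  have h := qK x xab.
  have -> : 2 * (1 + q x) * c x * c1 x = (1 + q x) * (2 * c x * c1 x) by ring.
  rewrite normrM; apply: ler_pM => //.
    by apply: le_trans (ler_normD _ _) _; rewrite normr1 lerD2l.
  have h1 := sqr_ge0 (c x + c1 x); have h2 := sqr_ge0 (c x - c1 x).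
  by rewrite ler_norml; apply/andP; split; nra.
have E0 x : 0 <= E x by rewrite addr_ge0 // sqr_ge0.
have Et : E t = 0.
  apply/eqP; rewrite eq_le E0 andbT.
  have [st|st] := leP s t.
    have h : - (E s * expR (- (1 + K) * s)) <= - (E t * expR (- (1 + K) * t)).
      apply: (@ge0_is_derive_le R (fun x => - (E x * expR (- (1 + K) * x)))
        (fun x => - ((2 * (1 + q x) * c x * c1 x + - (1 + K) * E x) * expR (- (1 + K) * x)))); first by [].
        move=> x /andP[h1 h2]; have {}h : a <= x <= b by lra.
        by have h' := dE (- (1 + K)) x h; apply: is_derive_opp.
      move=> x /andP[h1 h2]; have {}h : a <= x <= b by lra.
      rewrite -mulNr mulr_ge0 ?expR_ge0 // mulNr.
      by have := bd x h; rewrite ler_norml => /andP[]; lra.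
    rewrite Es mul0r oppr0 oppr_ge0 in h.
    by rewrite pmulr_lle0 ?expR_gt0 in h.
  have h : E t * expR ((1 + K) * t) <= E s * expR ((1 + K) * s).
    apply: (@ge0_is_derive_le R (fun x => (E x * expR ((1 + K) * x)))
        (fun x => ((2 * (1 + q x) * c x * c1 x + (1 + K) * E x) * expR ((1 + K) * x)))) => //.
      exact: ltW.
      by move=> x /andP[h1 h2]; apply: dE; lra.
    move=> x /andP[h1 h2]; have {}h : a <= x <= b by lra.
    rewrite mulr_ge0 ?expR_ge0 //.
    by have := bd x h; rewrite ler_norml => /andP[]; lra.
  by rewrite Es mul0r pmulr_lle0 ?expR_gt0 in h.
have : c t ^+ 2 <= 0 by rewrite -Et /E lerDl sqr_ge0.
by rewrite le_eqVlt ltNge sqr_ge0 orbF sqrf_eq0 => /eqP.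
Qed.

Lemma linear_lower_bound (R : realType) (f df : R -> R) (a m : R) :
  (forall t, a <= t -> is_derive t 1 f (df t)) ->
  (forall t, a <= t -> m <= df t) ->
  forall t, a <= t -> f a + m * (t - a) <= f t.
Proof.
move=> fd fm t at_.
suff : f a - m * a <= f t - m * t by lra.
apply: (@ge0_is_derive_le R (fun t => f t - m * t) (fun t => df t - m)) => //.
  move=> x /andP[h _]; have h1 := fd x h.
  by apply: is_derive_eq; rewrite /GRing.scale /= mulr1.
by move=> x /andP[h _]; rewrite subr_ge0; exact: fm.
Qed.

(** [c] bends away from the axis, so it either grows or decays. The bound 3/4 is what the rate
    [k - 1 / 2] allows: [(k - 1 / 2) ^+ 2 <= k ^+ 2 - 3 / 4] for [1 <= k]. The lower rate [k] comes
    from [0 <= V]. Growth is excluded in the weak form of quadratic growth of [c ^+ 2], which is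
    what square integrability at the cusp contradicts. *)
Lemma mode_decay (R : realType) (c c1 V : R -> R) (k T : R) :
  1 <= k -> 0 < T ->
  (forall t, T <= t -> 0 <= V t <= 3 / 4) ->
  (forall t, T <= t -> is_derive t 1 c (c1 t)) ->
  (forall t, T <= t -> is_derive t 1 c1 ((k ^+ 2 - V t) * c t)) ->
  ~ (exists2 e : R, 0 < e & exists S, forall t, S <= t -> e * t ^+ 2 <= c t ^+ 2) ->
  (forall t, T <= t -> `|c t| <= `|c T| * expR (- (k - 1 / 2) * (t - T))) /\
  (forall t, T <= t -> `|c T| * expR (- k * (t - T)) <= `|c t|).
Proof.
move=> k1 T0 hV dc dc1 nogrow.
have dcc1 t : T <= t -> is_derive t 1 (fun t => c t * c1 t)
    (c1 t ^+ 2 + (k ^+ 2 - V t) * c t ^+ 2).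
  move=> h; have h1 := dc _ h; have h2 := dc1 _ h.
  by apply: is_derive_eq; rewrite /GRing.scale /=; ring.
have dc2 t : T <= t -> is_derive t 1 (fun t => c t ^+ 2) (2 * (c t * c1 t)).
  move=> h; have h1 := dc _ h.
  by apply: is_derive_eq; rewrite /GRing.scale /=; ring.
have q14 t : T <= t -> 4^-1 <= k ^+ 2 - V t by move=> /hV; nra.
(* A positive [c t * c1 t] would stay positive, its derivative being a sum of nonnegative terms; it
   then grows linearly, and [c ^+ 2] quadratically. *)
have cc1_le0 t : T <= t -> c t * c1 t <= 0.
  move=> Tt; rewrite leNgt; apply/negP => w0.
  have w_ge s : t <= s -> 0 <= c s * c1 s.
    move=> ts; apply: le_trans (ltW w0) _.
    apply: (@ge0_is_derive_le R (fun t => c t * c1 t)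
      (fun t => c1 t ^+ 2 + (k ^+ 2 - V t) * c t ^+ 2)); first by [].
      by move=> x /andP[h _]; apply: dcc1; lra.
    move=> x /andP[h _]; have := q14 x (le_trans Tt h); nra.
  have c2_ge s : t <= s -> c t ^+ 2 <= c s ^+ 2.
    move=> ts; apply: (@ge0_is_derive_le R (fun t => c t ^+ 2) (fun t => 2 * (c t * c1 t))); first by [].
      by move=> x /andP[h _]; apply: dc2; lra.
    by move=> x /andP[h _]; rewrite mulr_ge0 // w_ge.
  have m0 : 0 < c t ^+ 2.
    rewrite lt_neqAle sqr_ge0 andbT eq_sym sqrf_eq0; apply/eqP => h.
    by rewrite h mul0r ltxx in w0.
  set m := c t ^+ 2 in m0 c2_ge.
  have w_lin s : t <= s -> m / 4 * (s - t) <= c s * c1 s.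
    move=> ts.
    suff : c t * c1 t + m / 4 * (s - t) <= c s * c1 s by lra.
    apply: (linear_lower_bound (f := fun t => c t * c1 t)
      (df := fun t => c1 t ^+ 2 + (k ^+ 2 - V t) * c t ^+ 2) _ _ ts).
      by move=> x h; apply: dcc1; lra.
    move=> x h; have h1 := q14 x (le_trans Tt h); have h2 := c2_ge x h; nra.
  apply: nogrow; exists (m / 16); first by rewrite divr_gt0.
  exists (2 * t) => s hs.
  have ts : t <= s by lra.
  have : m - m / 4 * (t - t) ^+ 2 <= c s ^+ 2 - m / 4 * (s - t) ^+ 2.
    apply: (@ge0_is_derive_le R (fun s => c s ^+ 2 - m / 4 * (s - t) ^+ 2)
      (fun s => 2 * (c s * c1 s) - m / 4 * (2 * (s - t)))); first by [].
      move=> x /andP[h _]; have := dc2 x (le_trans Tt h) => h1.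
      by apply: is_derive_eq; rewrite /GRing.scale /=; ring.
    by move=> x /andP[h _]; have := w_lin x h; nra.
  rewrite subrr expr0n /= mulr0 subr0 => h.
  have h2 : s ^+ 2 / 4 <= (s - t) ^+ 2 by nra.
  have h3 : m / 4 * (s ^+ 2 / 4) <= m / 4 * (s - t) ^+ 2.
    by rewrite ler_wpM2l // divr_ge0 // ltW.
  by lra.
have c2_le t s : T <= t -> t <= s -> c s ^+ 2 <= c t ^+ 2.
  move=> Tt ts; rewrite -lerN2.
  apply: (@ge0_is_derive_le R (fun t => - (c t ^+ 2)) (fun t => - (2 * (c t * c1 t)))); first by [].
    by move=> x /andP[h _]; apply: is_derive_opp; apply: dc2; lra.
  by move=> x /andP[h _]; have := cc1_le0 x (le_trans Tt h); lra.
split.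
  pose mu := k - 1 / 2.
  have mu0 : 0 < mu by rewrite /mu; lra.
  (* The derivative of [c t ^+ 2 * expR (2 * mu * t)] is [2 * D t] times the exponential, so
     [D <= 0] is the upper bound. A positive [D] would increase at least at the rate [D t ^+ 2 / m],
     but it cannot exceed [mu * m]. *)
  pose D t := c t * c1 t + mu * c t ^+ 2.
  have dD t : T <= t -> is_derive t 1 D
      ((c1 t + mu * c t) ^+ 2 + (k ^+ 2 - V t - mu ^+ 2) * c t ^+ 2).
    move=> h; have h1 := dc _ h; have h2 := dc1 _ h.
    by rewrite /D; apply: is_derive_eq; rewrite /GRing.scale /=; ring.
  have qmu t : T <= t -> 0 <= k ^+ 2 - V t - mu ^+ 2.
    by move=> /hV; rewrite /mu; nra.
  have D_le0 t : T <= t -> D t <= 0.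
    move=> Tt; rewrite leNgt; apply/negP => D0.
    have D_ge s : t <= s -> D t <= D s.
      move=> ts; apply: (@ge0_is_derive_le R D
        (fun t => (c1 t + mu * c t) ^+ 2 + (k ^+ 2 - V t - mu ^+ 2) * c t ^+ 2)); first by [].
        by move=> x /andP[h _]; apply: dD; lra.
      move=> x /andP[h _]; have := qmu x (le_trans Tt h) => h1.
      by rewrite addr_ge0 ?sqr_ge0 // mulr_ge0 // sqr_ge0.
    have c20 : 0 < c t ^+ 2.
      rewrite lt_neqAle sqr_ge0 andbT eq_sym sqrf_eq0; apply/eqP => h.
      by move: D0; rewrite /D h expr0n /= mul0r mulr0 addr0 ltxx.
    set m := c t ^+ 2 in c20.
    have Dlin s : t <= s -> D t + D t ^+ 2 / m * (s - t) <= D s.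
      apply: (linear_lower_bound (f := D)
        (df := fun t => (c1 t + mu * c t) ^+ 2 + (k ^+ 2 - V t - mu ^+ 2) * c t ^+ 2)) => x h; first by apply: dD; lra.
      have h1 := qmu x (le_trans Tt h).
      have h2 := c2_le _ _ Tt h; rewrite -/m in h2.
      have h3 := D_ge x h.
      rewrite ler_pdivrMr //.
      have DE : D x = c x * (c1 x + mu * c x) by rewrite /D; ring.
      have h4 : D t ^+ 2 <= D x ^+ 2 by nra.
      apply: le_trans h4 _; rewrite DE; set w := c1 x + _.
      rewrite exprMn mulrDl.
      rewrite -[X in X <= _]addr0; apply: lerD; last first.
        by rewrite mulr_ge0 ?(ltW c20) // mulr_ge0 // sqr_ge0.
      by rewrite mulrC ler_wpM2l ?sqr_ge0.
    have Dub s : t <= s -> D s <= mu * m.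
      move=> ts; rewrite /D.
      have h1 := cc1_le0 s (le_trans Tt ts).
      have h2 := c2_le _ _ Tt ts; rewrite -/m in h2; nra.
    have g0 : 0 < D t ^+ 2 / m by rewrite divr_gt0 // exprn_gt0.
    set g := D t ^+ 2 / m in Dlin g0.
    (* The time at which the linear lower bound for [D] passes the upper bound [mu * m]. *)
    pose s := t + mu * m / g.
    have ts : t <= s by rewrite lerDl divr_ge0 // ltW // mulr_gt0.
    have h1 := Dlin s ts; have h2 := Dub s ts.
    have : g * (s - t) = mu * m.
      by rewrite /s addrC addKr mulrC divfK // gt_eqF.
    by lra.
  move=> t Tt.
  suff : c t ^+ 2 * expR (2 * mu * t) <= c T ^+ 2 * expR (2 * mu * T).
    move=> h.
    rewrite -(@ler_pXn2r _ 2) ?nnegrE // ?mulr_ge0 ?expR_ge0 //.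
    rewrite exprMn !real_normK ?num_real // -expRM_natl.
    move: h; rewrite -ler_pdivlMr ?expR_gt0 // -expRN => h.
    apply: le_trans h _; rewrite -[leLHS]mulrA -expRD.
    rewrite ler_wpM2l ?sqr_ge0 // ler_expR -/mu; lra.
  rewrite -lerN2.
  apply: (@ge0_is_derive_le R (fun t => - (c t ^+ 2 * expR (2 * mu * t)))
    (fun t => - (2 * D t * expR (2 * mu * t)))); first by [].
    move=> x /andP[h _]; apply: is_derive_opp; have h1 := dc _ h.
    by apply: is_derive_eq; rewrite /GRing.scale /= /D; ring.
  move=> x /andP[h _]; have := D_le0 _ h; have := expR_gt0 (2 * mu * x); nra.
suff main (e : R) : 0 < e * c T -> e ^+ 2 = 1 ->
    forall t, T <= t -> e * c T * expR (- k * (t - T)) <= e * c t.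
  have [h|h|->] := ltgtP (c T) 0; last by move=> t _; rewrite normr0 mul0r.
    move=> t Tt; have := main (-1) _ _ t Tt; rewrite !mulN1r oppr_gt0 h sqrrN expr1n.
    move=> /(_ isT erefl) {}main; rewrite ltr0_norm //; apply: le_trans main _.
    by rewrite -normrN ler_norm.
  move=> t Tt; have := main 1 _ _ t Tt; rewrite !mul1r h expr1n => /(_ isT erefl) {}main.
  rewrite gtr0_norm //; apply: le_trans main _; exact: ler_norm.
move=> ecT e2.
pose g t := e * c t; pose g1 t := e * c1 t.
have dg t : T <= t -> is_derive t 1 g (g1 t).
  move=> h; have h1 := dc _ h; rewrite /g.
  by apply: is_derive_eq; rewrite /GRing.scale /= /g1; ring.
have dg1 t : T <= t -> is_derive t 1 g1 ((k ^+ 2 - V t) * g t).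
  move=> h; have h1 := dc1 _ h; rewrite /g1.
  by apply: is_derive_eq; rewrite /GRing.scale /= /g; ring.
have e0 : e != 0 by apply/eqP => h; rewrite h mul0r ltxx in ecT.
(* At a zero, the monotonicity of [c ^+ 2] makes [c] vanish from there on, and uniqueness for the
   equation carries this back to [T]. *)
have gn0 t : T <= t -> g t != 0.
  move=> Tt; apply/eqP => gt0.
  have ct0 : c t = 0 by move/eqP: gt0; rewrite mulf_eq0 (negbTE e0) => /eqP.
  have cs0 s : t <= s -> c s = 0.
    move=> ts; have := c2_le _ _ Tt ts; rewrite ct0 expr0n /=.
    by rewrite le_eqVlt ltNge sqr_ge0 orbF sqrf_eq0 => /eqP.
  have c1t : c1 (t + 1) = 0.
    have h1 : T <= t + 1 by lra.
    by apply: (is_derive_locally0 cs0 _ (dc _ h1)); rewrite ltrDl.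
  have : c T = 0.
    apply: (@ode2_eq0 R c c1 (fun t => k ^+ 2 - V t) T (t + 1) (k ^+ 2)
      _ _ _ (t + 1)) => //.
    - by move=> x /andP[? _]; apply: dc.
    - by move=> x /andP[? _]; apply: dc1.
    - move=> x /andP[h _]; have := hV x h; rewrite ler_norml => ?.
      by apply/andP; split; nra.
    - by apply/andP; split; lra.
    - by apply: cs0; lra.
    - by apply/andP; split; lra.
  by move=> h; rewrite h mulr0 ltxx in ecT.
have gpos t : T <= t -> 0 < g t.
  move=> Tt; rewrite ltNge; apply/negP => g0.
  have [] := @IVT R g T t 0 Tt.
  - apply: derivable_within_continuous => x; rewrite in_itv /= => /andP[h _].
    by have [] := dg x h.
  - by rewrite ge_min le_max g0 orbT (ltW ecT).
  move=> x; rewrite in_itv /= => /andP[h _] h'.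
  by have := gn0 x h; rewrite h' eqxx.
(* [f' = k f - V g <= k f], so a negative value of [f] persists without rising; [g] would then fall
   at least linearly and become negative. Once [f] is nonnegative, [g t * expR (k * t)]
   increases. *)
pose f t := g1 t + k * g t.
have f_ge0 t : T <= t -> 0 <= f t.
  move=> Tt; rewrite leNgt; apply/negP => f0.
  have f_le s : t <= s -> f s <= f t.
    move=> ts.
    have : f s * expR (- k * s) <= f t * expR (- k * t).
      rewrite -lerN2.
      apply: (@ge0_is_derive_le R (fun t => - (f t * expR (- k * t)))
        (fun t => V t * g t * expR (- k * t))); first by [].
        move=> x /andP[h _]; have h0 := le_trans Tt h.
        have h1 := dg _ h0; have h2 := dg1 _ h0.
        by rewrite /f; apply: is_derive_eq; rewrite /GRing.scale /=; ring.
      move=> x /andP[h _]; have h0 := le_trans Tt h.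
      have /andP[h1 _] := hV _ h0; have h2 := gpos _ h0.
      by rewrite mulr_ge0 ?expR_ge0 // mulr_ge0 // ltW.
    rewrite -ler_pdivlMr ?expR_gt0 // -expRN => h; apply: le_trans h _.
    rewrite -[leLHS]mulrA -expRD -[leRHS]mulr1 ler_wnM2l ?(ltW f0) //.
    by rewrite -[leLHS]expR0 ler_expR; nra.
  have glin s : t <= s -> - g t + (- f t) * (s - t) <= - g s.
    apply: (linear_lower_bound (f := fun t => - g t)(df := fun t => - g1 t)) => x h.
      by apply: is_derive_opp; apply: dg; lra.
    have := f_le _ h; have := gpos _ (le_trans Tt h).
    by rewrite [f x]/f; nra.
  pose s := t + g t / - f t.
  have nf0 : 0 < - f t by rewrite oppr_gt0.
  have gt0 := gpos _ Tt.
  have ts : t <= s by rewrite lerDl divr_ge0 // ltW.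
  have := glin s ts; have := gpos s (le_trans Tt ts).
  have : (- f t) * (s - t) = g t by rewrite /s addrC addKr mulrC divfK // gt_eqF.
  by lra.
move=> t Tt; rewrite -/(g T) -/(g t).
suff : g T * expR (k * T) <= g t * expR (k * t).
  rewrite -ler_pdivrMr ?expR_gt0 // -expRN => h.
  apply: le_trans h; rewrite -[leRHS]mulrA -expRD ler_wpM2l ?(ltW ecT) // ler_expR; lra.
apply: (@ge0_is_derive_le R (fun t => g t * expR (k * t))
  (fun t => f t * expR (k * t))); first by [].
  move=> x /andP[h _]; have h1 := dg _ h.
  by apply: is_derive_eq; rewrite /GRing.scale /= /f; ring.
by move=> x /andP[h _]; rewrite mulr_ge0 ?expR_ge0 // f_ge0.
Qed.

(** A positive slope persists by convexity and makes [g] unbounded, so [g] decreases to its limit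
    0. *)
Lemma convex_cvg0_ge0 (R : realType) (g g1 g2 : R -> R) (T : R) :
  (forall t, T <= t -> is_derive t 1 g (g1 t)) ->
  (forall t, T <= t -> is_derive t 1 g1 (g2 t)) ->
  (forall t, T <= t -> 0 <= g2 t) ->
  (forall e : R, 0 < e -> exists S, forall t, S <= t -> `|g t| <= e) ->
  forall t, T <= t -> 0 <= g t.
Proof.
move=> dg dg1 g2p g0.
have g1_le0 t : T <= t -> g1 t <= 0.
  move=> Tt; rewrite leNgt; apply/negP => g1t.
  have g1_ge s : t <= s -> g1 t <= g1 s.
    move=> ts; apply: (@ge0_is_derive_le R g1 g2) => // x /andP[h _].
      by apply: dg1; lra.
    by apply: g2p; lra.
  have lin s : t <= s -> g t + g1 t * (s - t) <= g s.
    apply: (linear_lower_bound (f := g) (df := g1)) => // x h.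
    by apply: dg; lra.
  have [S hS] := g0 1 ltr01.
  pose s := Num.max S (t + (2 - g t) / g1 t).
  pose s' := Num.max s t.
  have /hS h1 : S <= s' by rewrite /s' /s !le_max lexx.
  have ts : t <= s' by rewrite /s' le_max lexx orbT.
  have h2 := lin _ ts.
  have h3 : t + (2 - g t) / g1 t <= s' by rewrite /s' /s !le_max lexx orbT.
  have h4 : 2 - g t <= g1 t * (s' - t).
    by rewrite mulrC -ler_pdivrMr // lerBrDl.
  by have := ler_norm (g s'); lra.
have gmono t s : T <= t -> t <= s -> g s <= g t.
  move=> Tt ts; rewrite -lerN2.
  apply: (@ge0_is_derive_le R (fun t => - g t) (fun t => - g1 t)) => // x /andP[h _].
    by apply: is_derive_opp; apply: dg; lra.
  by rewrite oppr_ge0; apply: g1_le0; lra.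
move=> t Tt; rewrite leNgt; apply/negP => gt0.
have [|S hS] := g0 (- g t / 2); first lra.
pose s := Num.max S t.
have /hS h1 : S <= s by rewrite /s le_max lexx.
have /(gmono _ _ Tt) h2 : t <= s by rewrite /s le_max lexx orbT.
by have := ler_norm (- g s); rewrite normrN; lra.
Qed.

Lemma expRN_small (R : realType) (A a e : R) : 0 < a -> 0 < e ->
  exists S, forall t, S <= t -> A * expR (- a * t) <= e.
Proof.
move=> a0 e0; exists (`|A| / e / a) => t; rewrite ler_pdivrMr // ler_pdivrMr // => h.
rewrite mulNr expRN ler_pdivrMr ?expR_gt0 //.
apply: le_trans (ler_norm A) _; apply: le_trans h _.
rewrite mulrC ler_wpM2l ?(ltW e0) // mulrC.
by apply: le_trans (expR_ge1Dx _); rewrite lerDr.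
Qed.

(** For [k = 0] solutions behave like [a + b t], and tending to 0 leaves only the zero solution. A
    bound [N] for [|c|] improves to [N / 2]: the functions [N * C / 4 * expR (- 2 * t)] plus or
    minus [c] are convex, because [N * C * expR (- 2 * t)] dominates [V * c], and they tend to 0,
    hence are nonnegative. The condition on [T] makes this barrier at most [N / 2]. *)
Lemma zero_mode_eq0 (R : realType) (c c1 V : R -> R) (C M T : R) :
  (forall t, T <= t -> is_derive t 1 c (c1 t)) ->
  (forall t, T <= t -> is_derive t 1 c1 (- V t * c t)) ->
  (forall t, T <= t -> 0 <= V t <= C * expR (- 2 * t)) ->
  C * expR (- 2 * T) <= 2 ->
  (forall t, T <= t -> `|c t| <= M) ->
  (forall e : R, 0 < e -> exists S, forall t, S <= t -> `|c t| <= e) ->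
  forall t, T <= t -> c t = 0.
Proof.
move=> dc dc1 hV CT cM c0.
have C0 : 0 <= C.
  have /andP[h1 h2] := hV T (lexx T).
  by rewrite -(@pmulr_lge0 _ (expR (- 2 * T))) ?expR_gt0 //; apply: le_trans h2.
have half N : 0 <= N -> (forall t, T <= t -> `|c t| <= N) ->
    forall t, T <= t -> `|c t| <= N / 2.
  move=> N0 cN.
  have sgn (e : R) : e ^+ 2 = 1 -> forall t, T <= t ->
      0 <= N * C / 4 * expR (- 2 * t) + e * c t.
    move=> e2.
    have e1 : `|e| = 1 by apply/eqP; rewrite -sqr_norm_eq1 e2.
    apply: (@convex_cvg0_ge0 R (fun t => N * C / 4 * expR (- 2 * t) + e * c t)
      (fun t => N * C / 4 * (- 2 * expR (- 2 * t)) + e * c1 t)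
      (fun t => N * C * expR (- 2 * t) - e * (V t * c t))).
    - move=> t Tt; have h1 := dc _ Tt.
      by apply: is_derive_eq; rewrite /GRing.scale /=; ring.
    - move=> t Tt; have h1 := dc1 _ Tt.
      by apply: is_derive_eq; rewrite /GRing.scale /=; field.
    - move=> t Tt; rewrite subr_ge0.
      apply: le_trans (ler_norm _) _; rewrite !normrM e1 mul1r mulrC -mulrA.
      have /andP[h1 h2] := hV _ Tt.
      by apply: ler_pM => //; [exact: cN | rewrite ger0_norm].
    - move=> d d0.
      have d2 : 0 < d / 2 by lra.
      have [S hS] := c0 _ d2.
      have NC : 0 <= N * C / 4 by rewrite divr_ge0 // mulr_ge0.
      have [S' hS'] := expRN_small (N * C / 4) (ltr0n R 2) d2.
      exists (Num.max S S') => t; rewrite ge_max => /andP[/hS h1 /hS' h2].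
      apply: le_trans (ler_normD _ _) _.
      rewrite [in X in _ + X]normrM e1 mul1r (@ger0_norm _ (_ * _)); last first.
        by rewrite mulr_ge0 ?expR_ge0.
      by lra.
  move=> t Tt.
  have h1 := sgn 1 (expr1n _ _) _ Tt; have h2 := sgn (-1) (etrans (sqrrN 1) (expr1n _ _)) _ Tt.
  have h3 : C * expR (- 2 * t) <= 2.
    apply: le_trans CT; rewrite ler_wpM2l // ler_expR; lra.
  have h4 : N * C / 4 * expR (- 2 * t) <= N / 2.
    have := ler_wpM2l N0 h3; lra.
  by rewrite ler_norml; apply/andP; split; lra.
move=> t Tt.
have M0 : 0 <= M by apply: le_trans (cM _ Tt).
have iter n s : T <= s -> `|c s| <= M / 2 ^+ n.
  elim: n s => [|n IH] s Ts; first by rewrite expr0 divr1; exact: cM.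
  have := half (M / 2 ^+ n) _ IH s Ts.
  rewrite exprSr invfM mulrA; apply.
  by rewrite divr_ge0 // exprn_ge0.
apply/eqP; rewrite -normr_le0 leNgt; apply/negP => ct.
pose n := Num.truncn (M / `|c t|).
have h1 : M / `|c t| < n.+1%:R by apply: truncnS_gt.
have h2 := iter n.+1 t Tt.
have h3 : (n.+1%:R : R) <= 2 ^+ n.+1 by rewrite -natrX ler_nat ltnW // ltn_expl.
move: h1; rewrite ltr_pdivrMr // ltNge => /negP; apply.
move: h2; rewrite ler_pdivlMr ?exprn_gt0 //; apply: le_trans.
by rewrite mulrC ler_wpM2l.
Qed.

(** * Interfaces on a triangular grid *)

Definition lattice := (int * int)%type.

(* The linear map (a, b) |-> (a - b, a) has order 6 and permutes cyclically the
   edge vectors of the grid with diagonals (1, 1), so [lft] and [rgt] give the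
   third vertices of the two triangles on an edge. *)
Definition lft (u w : lattice) : lattice :=
  (u.1 + (w.1 - u.1) - (w.2 - u.2), u.2 + (w.1 - u.1)).

Definition rgt (u w : lattice) : lattice :=
  (u.1 + (w.2 - u.2), u.2 + (w.2 - u.2) - (w.1 - u.1)).

(** The six edge vectors are [(1, 0)], [(0, 1)], [(1, 1)] and their opposites; the third bound
    excludes the other diagonal. *)
Definition adj (u w : lattice) : bool :=
  [&& `|w.1 - u.1| <= 1, `|w.2 - u.2| <= 1, `|w.1 - u.1 - (w.2 - u.2)| <= 1 & u != w].

Definition interface (reg col : pred lattice) (s : lattice * lattice) : bool :=
  [&& adj s.1 s.2, reg s.1, reg s.2, col s.1 & ~~ col s.2].

(** The third vertex [t] of the triangle on the left replaces the endpoint of its own colour, so the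
    new pair is the other two-coloured edge of this triangle, again with the coloured vertex
    first. *)
Definition fwd (col : pred lattice) (s : lattice * lattice) :=
  let t := lft s.1 s.2 in if col t then (t, s.2) else (s.1, t).

Definition bwd (col : pred lattice) (s : lattice * lattice) :=
  let t := rgt s.1 s.2 in if col t then (t, s.2) else (s.1, t).

Lemma adj_lft u w : adj u w -> adj (lft u w) w /\ adj u (lft u w).
Proof.
rewrite /adj /lft; case: u w => [a b] [c d] /=; rewrite !xpair_eqE; lia.
Qed.

Lemma adj_rgt u w : adj u w -> adj (rgt u w) w /\ adj u (rgt u w).
Proof.
rewrite /adj /rgt; case: u w => [a b] [c d] /=; rewrite !xpair_eqE; lia.
Qed.

Lemma lftK1 u w : rgt (lft u w) w = u.
Proof. rewrite /lft /rgt; case: u w => [a b] [c d] /=; congr pair; lia. Qed.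
Lemma lftK2 u w : rgt u (lft u w) = w.
Proof. rewrite /lft /rgt; case: u w => [a b] [c d] /=; congr pair; lia. Qed.
Lemma rgtK1 u w : lft (rgt u w) w = u.
Proof. rewrite /lft /rgt; case: u w => [a b] [c d] /=; congr pair; lia. Qed.
Lemma rgtK2 u w : lft u (rgt u w) = w.
Proof. rewrite /lft /rgt; case: u w => [a b] [c d] /=; congr pair; lia. Qed.

(** Seen from the new edge, the third vertex on the right is the endpoint just dropped; its colour
    tells [bwd] which endpoint to restore. *)
Lemma fwdP reg col s : interface reg col s -> reg (lft s.1 s.2) ->
  [/\ interface reg col (fwd col s), bwd col (fwd col s) = s &
      reg (rgt (fwd col s).1 (fwd col s).2)].
Proof.
case: s => u w /= /and5P[/= auw ru rw cu cw] rt; have [a1 a2] := adj_lft auw.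
rewrite /fwd /bwd /interface /=; case: ifP => ct /=.
  by rewrite lftK1 ru cu ct rw rt cw a1.
by rewrite lftK2 (negbTE cw) ru cu rw rt ct a2.
Qed.

Lemma bwdP reg col s : interface reg col s -> reg (rgt s.1 s.2) ->
  [/\ interface reg col (bwd col s), fwd col (bwd col s) = s &
      reg (lft (bwd col s).1 (bwd col s).2)].
Proof.
case: s => u w /= /and5P[/= auw ru rw cu cw] rt; have [a1 a2] := adj_rgt auw.
rewrite /fwd /bwd /interface /=; case: ifP => ct /=.
  by rewrite rgtK1 ru cu ct rw rt cw a1.
by rewrite rgtK2 (negbTE cw) ru cu rw rt ct a2.
Qed.

(* The value of [h] at the entry of the interface line through [s], if any. *)
Definition line_value (reg col : pred lattice) (h : pred (lattice * lattice)) s : bool :=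
  `[< exists2 m, ~~ reg (rgt (iter m (bwd col) s).1 (iter m (bwd col) s).2) /\
       (forall k, (k < m)%N -> reg (rgt (iter k (bwd col) s).1 (iter k (bwd col) s).2)) &
       h (iter m (bwd col) s) >].

Lemma line_value_entry reg col h s : ~~ reg (rgt s.1 s.2) ->
  line_value reg col h s = h s.
Proof.
move=> rs; apply/asboolP/idP => [[[|m] [_]] //|hs]; last by exists 0%N => //; split.
by move=> /(_ 0%N isT) /=; rewrite (negbTE rs).
Qed.

Lemma line_value_fwd reg col h s : interface reg col s -> reg (lft s.1 s.2) ->
  line_value reg col h (fwd col s) = line_value reg col h s.
Proof.
move=> is_ rs; have [_ sK rgs] := fwdP is_ rs.
apply/asboolP/asboolP => -[].
  move=> [|m] [h1 h2 h3]; first by rewrite /= rgs in h1.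
  move: h1 h3; rewrite iterSr sK => h1 h3; exists m => //; split=> // k km.
  by have := h2 k.+1; rewrite iterSr sK; apply.
move=> m [h1 h2 h3]; exists m.+1; last by rewrite iterSr sK.
split; first by rewrite iterSr sK.
by move=> [|k] km //; rewrite iterSr sK; apply: h2.
Qed.

(** A 1-cochain modulo 2: the jump that the function to be constructed makes along the edge. It
    vanishes on edges of one colour, and on the others it is the value carried by the interface line
    that crosses them. *)
Definition edge_value (reg col : pred lattice) h (u w : lattice) : bool :=
  if col u == col w then false else
  if col u then line_value reg col h (u, w) else line_value reg col h (w, u).

Lemma edge_valueC reg col h u w : edge_value reg col h u w = edge_value reg col h w u.
Proof. by rewrite /edge_value eq_sym; case: eqP => //; case: (col u); case: (col w). Qed.

(** A triangle has either no two-coloured edge or exactly two, and these are consecutive on one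
    interface line: their values agree and cancel modulo 2. *)
Lemma edge_value_closed (reg col : pred lattice) h u w : adj u w ->
  reg u -> reg w -> reg (lft u w) ->
  edge_value reg col h u w (+) edge_value reg col h w (lft u w) =
  edge_value reg col h u (lft u w).
Proof.
move=> auw ru rw rt; have [a1 a2] := adj_lft auw.
have sym x y : adj x y = adj y x.
  by rewrite /adj; case: x y => [a b] [c d] /=; rewrite !xpair_eqE; lia.
set t := lft u w in rt a1 a2 *.
have e1 : lft w t = u by rewrite /t /lft; case: u w {auw ru rw rt a1 a2 t} => [a b] [c d] /=; congr pair; lia.
have e2 : lft t u = w by rewrite /t /lft; case: u w {auw ru rw rt a1 a2 t e1} => [a b] [c d] /=; congr pair; lia.
have fw x y z : adj x y -> reg x -> reg y -> reg z -> lft x y = z ->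
   col x -> ~~ col y -> 
   line_value reg col h (x, y) = line_value reg col h (if col z then (z, y) else (x, z)).
  move=> axy rx ry rz lz cx cy; rewrite -(@line_value_fwd reg col h (x, y)) /=.
  - by rewrite /fwd /= lz.
  - by rewrite /interface /= axy rx ry cx cy.
  - by rewrite lz.
rewrite /edge_value; case cu : (col u); case cw : (col w); case ct : (col t) => //=.
- by rewrite (fw w t u) ?cu // ?cw ?ct // sym.
- by rewrite (fw u w t) ?cu ?cw ?ct //= addbb.
- by rewrite (fw u w t) ?cu ?cw ?ct //= addbF.
- by rewrite (fw t u w) ?cu ?cw ?ct //= 1?sym // addbF.
- by rewrite (fw w t u) ?cu ?cw ?ct //= 1?sym // addbb.
- by rewrite (fw t u w) ?cu ?cw ?ct //= 1?sym.
Qed.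

Definition strip (n : nat) : pred lattice :=
  fun u => [&& 0 <= u.1, u.1 <= n%:Z & 0 <= u.2].

(* The vertices on the boundary of the half strip {0, ..., n} x nat, numbered down
   the left side ([l <= 0]), along the bottom, and up the right side. *)
Definition bdpt (n : nat) (l : int) : nat * nat :=
  if l <= 0 then (0%N, `|l|%N) else if l <= n%:Z then (`|l|%N, 0%N) else (n, `|l - n%:Z|%N).

Lemma bdpt_left (n j : nat) : bdpt n (- j%:Z) = (0%N, j).
Proof. by rewrite /bdpt ifT; [congr pair|]; lia. Qed.

Lemma bdpt_bottom (n i : nat) : (i <= n)%N -> bdpt n i = (i, 0%N).
Proof.
move=> h; rewrite /bdpt; case: ifP => h1; first by congr pair; lia.
by rewrite ifT; [congr pair|]; lia.
Qed.

Lemma bdpt_right (n j : nat) : (0 < n)%N -> bdpt n (n + j)%N = (n, j).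
Proof.
move=> h; rewrite /bdpt ifF; last lia.
by case: ifP => h1; congr pair; lia.
Qed.

Lemma bdpt_step (n : nat) (l : int) : (0 < n)%N ->
  [\/ exists j : nat, [/\ l = - j.+1%:Z, bdpt n l = (0%N, j.+1) & bdpt n (l + 1) = (0%N, j)],
      exists i : nat, [/\ (i < n)%N, l = i, bdpt n l = (i, 0%N) & bdpt n (l + 1) = (i.+1, 0%N)] |
      exists j : nat, [/\ l = (n + j)%N, bdpt n l = (n, j) & bdpt n (l + 1) = (n, j.+1)]].
Proof.
move=> n0; have [l0|l0] := ltP l 0.
  apply: Or31; exists `|(l + 1)%R|%N.
  have e : l = - `|(l + 1)%R|.+1%:Z by lia.
  split=> //; first by rewrite {1}e bdpt_left.
  by have e2 : l + 1 = - `|(l + 1)%R|%:Z :> int by [lia]; rewrite {1}e2 bdpt_left.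
have [ln|ln] := ltP l n%:Z.
  apply: Or32; exists `|l|%N.
  have e : l = `|l|%N by lia.
  split=> //; [lia| by rewrite {1}e bdpt_bottom //; lia|].
  have e2 : l + 1 = `|l|.+1 :> int by lia.
  by rewrite {1}e2 bdpt_bottom //; lia.
apply: Or33; exists `|(l - n%:Z)%R|%N.
have e : l = (n + `|(l - n%:Z)%R|)%N by lia.
split=> //; first by rewrite {1}e bdpt_right.
have e2 : l + 1 = (n + `|(l - n%:Z)%R|.+1)%N :> int by lia.
by rewrite {1}e2 bdpt_right.
Qed.

(** A closed cochain on the half strip is the differential of a function. The boundary is numbered
    with the strip on its left, so a boundary edge from [true] to [false] has its right triangle
    outside: it is an entry, where the line value is the prescribed [h]. *)
Lemma strip_potential (n : nat) (col : nat -> nat -> bool) (h : int -> bool) (c : bool) :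
  (0 < n)%N ->
  exists f : nat -> nat -> bool,
  [/\ f 0%N 0%N = c,
     (forall i j, (i < n)%N -> col i j = col i.+1 j -> f i j = f i.+1 j),
     (forall i j, (i <= n)%N -> col i j = col i j.+1 -> f i j = f i j.+1) &
     (forall l, let u := bdpt n l in let w := bdpt n (l + 1) in
       col u.1 u.2 -> ~~ col w.1 w.2 -> f u.1 u.2 (+) f w.1 w.2 = h l)].
Proof.
move=> n0.
pose reg := strip n.
pose C : pred lattice := fun u => col `|u.1|%N `|u.2|%N.
(* Recovers the boundary number from the first endpoint of an entry, so that [H] reads [h] at the
   right place. *)
pose idx (u : lattice) : int := if u.1 == 0 then - u.2 else u.1 + u.2.
pose H : pred (lattice * lattice) := fun s => h (idx s.1).
pose X := edge_value reg C H.
pose vx (i j : nat) : lattice := (i%:Z, j%:Z).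
(* Integration of [X] along the bottom row from the corner, then up each column. The horizontal
   differences agree as well, by [cell]: a square is two triangles, whose common diagonal
   cancels. *)
pose f0 i := iteri i (fun a r => X (vx a 0%N) (vx a.+1 0%N) (+) r) c.
pose f i j := iteri j (fun b r => X (vx i b) (vx i b.+1) (+) r) (f0 i).
have fv i j : f i j.+1 = X (vx i j) (vx i j.+1) (+) f i j by [].
have f0S i : f i.+1 0%N = X (vx i 0%N) (vx i.+1 0%N) (+) f i 0%N by [].
have f00 : f 0%N 0%N = c by [].
clearbody f; clear f0.
have cell i j : (i < n)%N ->
    X (vx i j.+1) (vx i.+1 j.+1) = X (vx i j) (vx i j.+1) (+) X (vx i j) (vx i.+1 j)
      (+) X (vx i.+1 j) (vx i.+1 j.+1).
  move=> lt_in.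
  have lower : X (vx i j) (vx i.+1 j) (+) X (vx i.+1 j) (vx i.+1 j.+1) = X (vx i j) (vx i.+1 j.+1).
    have -> : vx i.+1 j.+1 = lft (vx i j) (vx i.+1 j).
      by rewrite /vx /lft /=; congr pair; lia.
    apply: edge_value_closed; rewrite /adj /reg /strip /lft /vx /= ?xpair_eqE; lia.
  have upper : X (vx i j) (vx i.+1 j.+1) (+) X (vx i.+1 j.+1) (vx i j.+1) = X (vx i j) (vx i j.+1).
    have -> : vx i j.+1 = lft (vx i j) (vx i.+1 j.+1).
      by rewrite /vx /lft /=; congr pair; lia.
    apply: edge_value_closed; rewrite /adj /reg /strip /lft /vx /= ?xpair_eqE; lia.
  rewrite -addbA lower -upper [X (vx i.+1 j.+1) _]edge_valueC.
  by rewrite [X in _ = X]addbC addbA addbb.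
have fh i j : (i < n)%N -> f i.+1 j = X (vx i j) (vx i.+1 j) (+) f i j.
  move=> lt_in; elim: j => [|j IH]; first exact: f0S.
  rewrite !fv IH cell //.
  by case: (X _ _); case: (X _ _); case: (X _ _); case: (f i j).
have X0 i j i' j' : col i j = col i' j' -> X (vx i j) (vx i' j') = false.
  by rewrite /X /edge_value /C /vx /= => ->; rewrite eqxx.
exists f; split.
- exact: f00.
- by move=> i j lt_in cc; rewrite fh // X0.
- by move=> i j le_in cc; rewrite fv X0.
move=> l u w cu cw.
have HX : X (vx u.1 u.2) (vx w.1 w.2) = h l.
  rewrite /X /edge_value.
  have -> : C (vx u.1 u.2) = true by [].
  have -> : C (vx w.1 w.2) = false by apply/negbTE.
  rewrite /= line_value_entry /H /=.
    congr h; rewrite /u; case: (bdpt_step l n0) => -[j] => [[e -> _]|[_ e -> _]|[e -> _]];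
      by rewrite /idx /vx /=; try (case: ifP => h3); lia.
  rewrite /reg /strip /rgt /= /u /w /bdpt.
  by case: ifP => h1; case: ifP => h2 /=; try (case: ifP => h3 /=); try (case: ifP => h4 /=); lia.
rewrite -HX.
rewrite /u /w; case: (bdpt_step l n0) => -[j].
- by move=> [_ -> ->] /=; rewrite fv -addbA addbb addbF [RHS]edge_valueC.
- by move=> [jn _ -> ->] /=; rewrite fh // [X in _ (+) X]addbC addbA addbb.
- by move=> [_ -> ->] /=; rewrite fv [X in _ (+) X]addbC addbA addbb.
Qed.

(* A backward interface line in a finite region cannot cycle before its exit,
   hence starts at an entry. *)
Lemma exit_entry (reg col : pred lattice) (s : lattice * lattice) (W H : nat) :
  (forall u, reg u -> (`|u.1| <= W)%N /\ (`|u.2| <= H)%N) ->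
  interface reg col s -> ~~ reg (lft s.1 s.2) ->
  exists2 m, ~~ reg (rgt (iter m (bwd col) s).1 (iter m (bwd col) s).2) &
    forall k, (k <= m)%N -> interface reg col (iter k (bwd col) s).
Proof.
move=> bnd is_ ls.
pose g k := iter k (bwd col) s.
pose stop k := ~~ reg (rgt (g k).1 (g k).2).
have step m : (forall k, (k < m)%N -> ~~ stop k) ->
    forall k, (k <= m)%N -> interface reg col (g k).
  move=> h; elim=> [|k IH] km //; rewrite /g iterS.
  have := h k km; rewrite /stop negbK => /(bwdP (IH (ltnW km))) [] //.
case: (pselect (exists m, stop m)) => [ex|nex].
  have sm := ex_minnP ex; case: sm => m sm mmin; exists m => //; apply: step => k km.
  by apply/negP => /mmin; rewrite leqNgt km.
have ns k : ~~ stop k by apply/negP => h; apply: nex; exists k.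
have gi k : interface reg col (g k) by apply: (step k).
have gr k : reg (rgt (g k).1 (g k).2) by have := ns k; rewrite negbK.
(* A repetition could be undone with [fwd] until [s] itself appears as [bwd] of some [g b]; then the
   triangle on the left of [s] would lie in the region. *)
have ginj a b : (a < b)%N -> g a <> g b.
  elim: a b => [|a IH] [|b] // ab.
    move=> e; have := (bwdP (gi b) (gr b)).
    by rewrite -[bwd col (g b)]/(g b.+1) -e /= => -[_ _]; rewrite (negbTE ls).
  move=> e; apply: (IH b) => //.
  have [_ <- _] := bwdP (gi a) (gr a); have [_ <- _] := bwdP (gi b) (gr b).
  by rewrite -[bwd col (g b)]/(g b.+1) -[bwd col (g a)]/(g a.+1) e.
pose enc (u : lattice) : 'I_(W + W).+1 * 'I_(H + H).+1 :=
  (inord `|u.1 + W%:Z|, inord `|u.2 + H%:Z|).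
have encI u w : reg u -> reg w -> enc u = enc w -> u = w.
  move=> /bnd [u1 u2] /bnd [w1 w2] [] /(congr1 val) /= + /(congr1 val) /=.
  rewrite !inordK; [|lia..] => e1 e2.
  by move: u1 u2 w1 w2 e1 e2; case: u w => [a b] [c d] /= *; congr pair; lia.
pose K := #|{: ('I_(W + W).+1 * 'I_(H + H).+1) * ('I_(W + W).+1 * 'I_(H + H).+1)}|.
pose e (k : 'I_K.+1) := (enc (g k).1, enc (g k).2).
have einj : injective e.
  move=> a b [e1 e2 e3 e4].
  have /and5P[_ a1 a2 _ _] := gi a; have /and5P[_ b1 b2 _ _] := gi b.
  have gab : g a = g b.
    rewrite [LHS]surjective_pairing [RHS]surjective_pairing; congr pair; apply: encI => //.
      by rewrite /enc e1 e2.
    by rewrite /enc e3 e4.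
  apply: val_inj; case: (ltngtP a b) => // h; exfalso; [exact: (ginj _ _ h)|].
  by apply: (ginj _ _ h).
have := leq_card e einj.
by rewrite card_ord ltnn.
Qed.

Lemma bdpt_strip (n : nat) (l : int) : ((bdpt n l).1 <= n)%N.
Proof. by rewrite /bdpt; case: ifP => h1 //; case: ifP => h2 //=; lia. Qed.

Definition rect (n L : nat) : pred lattice :=
  fun u => [&& 0 <= u.1, u.1 <= n%:Z, 0 <= u.2 & u.2 <= L%:Z].

(** [f] is constant along each side of an interface line, so the jump across a line is the same at
    all its edges. Behind every exit there is an entry, where the jump is 0 by hypothesis. Along the
    boundary [f] can thus change neither at an entry nor at an exit. The top row, coloured on an
    initial segment, has at most one two-coloured edge, and that one is an exit. *)
Lemma rect_rigid (n L : nat) (col f : nat -> nat -> bool) (i0 : nat) :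
  (0 < n)%N -> (0 < L)%N ->
  (forall i, (i <= n)%N -> col i L = (i < i0)%N) ->
  (forall i j, (i < n)%N -> (j <= L)%N -> col i j = col i.+1 j -> f i j = f i.+1 j) ->
  (forall i j, (i <= n)%N -> (j < L)%N -> col i j = col i j.+1 -> f i j = f i j.+1) ->
  (forall i j, (i < n)%N -> (j < L)%N -> col i j = col i.+1 j.+1 -> f i j = f i.+1 j.+1) ->
  f 0%N 0%N = false ->
  (forall l, - L%:Z <= l < (n + L)%:Z -> let u := bdpt n l in let w := bdpt n (l + 1) in
       col u.1 u.2 -> ~~ col w.1 w.2 -> f u.1 u.2 = f w.1 w.2) ->
  forall l, - L%:Z <= l <= (n + L)%:Z -> f (bdpt n l).1 (bdpt n l).2 = false.
Proof.
move=> n0 L0 ctop fhor fver fdia f00 fent.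
pose reg := rect n L.
pose C : pred lattice := fun u => col `|u.1|%N `|u.2|%N.
pose F : pred lattice := fun u => f `|u.1|%N `|u.2|%N.
pose vx (p : nat * nat) : lattice := (p.1%:Z, p.2%:Z).
have mono u w : adj u w -> reg u -> reg w -> C u = C w -> F u = F w.
  wlog h : u w / [|| (w.1 == u.1 + 1) && (w.2 == u.2), (w.1 == u.1) && (w.2 == u.2 + 1) |
                     (w.1 == u.1 + 1) && (w.2 == u.2 + 1)].
    move=> H auw ru rw cuw.
    case: (boolP [|| (w.1 == u.1 + 1) && (w.2 == u.2), (w.1 == u.1) && (w.2 == u.2 + 1) |
                     (w.1 == u.1 + 1) && (w.2 == u.2 + 1)]) => h; first exact: H.
    apply: esym; apply: H => //; move: auw h; rewrite /adj;
      case: u w {ru rw cuw} => [a b] [c d] /=; rewrite !xpair_eqE; lia.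
  move=> _; rewrite /reg /rect /C /F => ru rw cuw.
  case/or3P: h => /andP[/eqP h1 /eqP h2].
  - have e1 : `|w.1|%N = `|u.1|.+1 by lia.
    have e2 : `|w.2|%N = `|u.2|%N by lia.
    by rewrite e1 e2 in cuw *; apply: fhor => //; lia.
  - have e1 : `|w.1|%N = `|u.1|%N by lia.
    have e2 : `|w.2|%N = `|u.2|.+1 by lia.
    by rewrite e1 e2 in cuw *; apply: fver => //; lia.
  - have e1 : `|w.1|%N = `|u.1|.+1 by lia.
    have e2 : `|w.2|%N = `|u.2|.+1 by lia.
    by rewrite e1 e2 in cuw *; apply: fdia => //; lia.
have entry s : interface reg C s -> ~~ reg (rgt s.1 s.2) -> F s.1 = F s.2.
  move=> /and5P[as_ r1 r2 c1 c2] r3.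
  have [l [ll e1 e2]] : exists l, [/\ - L%:Z <= l < (n + L)%:Z, s.1 = vx (bdpt n l) & s.2 = vx (bdpt n (l + 1))].
    move: as_ r1 r2 c1 c2 r3; case: s => [[a b] [c d]] /=.
    rewrite /reg /rect /rgt /adj /= xpair_eqE => as_ r1 r2 c1 c2 r3.
    (* On the top row the coloured vertex is the left one, so the triangle on the right of the edge
       lies below the row and inside the rectangle, against [r3]. *)
    have [cL|ncL] := boolP ((b == L%:Z) && (d == L%:Z)).
      case/andP: cL => /eqP bL /eqP dL; exfalso.
      move: c1 c2; rewrite /C bL dL /= !ctop; lia.
    have [h|h|h] : [\/ [/\ a = 0, c = 0, b = d + 1 & 0 <= d],
       [/\ b = 0, d = 0 & c = a + 1] | [/\ a = n, c = n & d = b + 1]].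
    - have [?|?] := eqVneq b (d + 1); first by apply: Or31; split; lia.
      have [?|?] := eqVneq c (a + 1); first by apply: Or32; split; lia.
      by apply: Or33; split; lia.
    - case: h => a0 c0 bd d0; exists (- `|d|.+1%:Z).
      have -> : - `|d|.+1%:Z + 1 = - `|d|%:Z :> int by lia.
      by rewrite !bdpt_left /vx /=; split; [lia|congr pair; lia..].
    - case: h => b0 d0 ca; exists `|a|%N.
      have -> : `|a|%N%:Z + 1 = `|a|.+1 :> int by lia.
      by rewrite !bdpt_bottom; [|lia..]; rewrite /vx /=; split; [lia|congr pair; lia..].
    - case: h => an cn db; exists (n + `|b|)%N.
      have -> : (n + `|b|)%N%:Z + 1 = (n + `|b|.+1)%N :> int by lia.
      by rewrite !bdpt_right // /vx /=; split; [lia|congr pair; lia..].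
  by have := fent l ll; rewrite /F /vx e1 e2 /=; apply; move: c1 c2; rewrite /C e1 e2.
have exit s : interface reg C s -> ~~ reg (lft s.1 s.2) -> F s.1 = F s.2.
  move=> is_ ls.
  have [|m ms mi] := @exit_entry reg C s n L _ is_ ls.
    by move=> u; rewrite /reg /rect; lia.
  suff E k : (k <= m)%N -> F (iter k (bwd C) s).1 (+) F (iter k (bwd C) s).2 = F s.1 (+) F s.2.
    have := E m (leqnn m); rewrite (entry _ (mi m (leqnn m)) ms) addbb.
    by case: (F s.1); case: (F s.2).
  elim: k => // k IH km; rewrite -(IH (ltnW km)).
  have := mi _ km; have := mi _ (ltnW km); rewrite iterS.
  set s' := iter k _ s => /and5P[a1 a2 a3 a4 a5] /and5P[_ b2 b3 _ _].
  have [d1 d2] := adj_rgt a1.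
  move: b2 b3; rewrite /bwd; case: ifP => ct /= b2 b3.
    by congr (_ (+) _); apply: esym; apply: mono => //; rewrite ct.
  by congr (_ (+) _); apply: mono => //; rewrite ct (negbTE a5).
have step l : - L%:Z <= l < (n + L)%:Z ->
    F (vx (bdpt n l)) = F (vx (bdpt n (l + 1))).
  move=> hl.
  have [al rl rl' ol] : [/\ adj (vx (bdpt n l)) (vx (bdpt n (l + 1))), reg (vx (bdpt n l)),
      reg (vx (bdpt n (l + 1))) & ~~ reg (rgt (vx (bdpt n l)) (vx (bdpt n (l + 1))))].
    case: (bdpt_step l n0) => -[j] => [[lE -> ->]|[jn lE -> ->]|[lE -> ->]];
      rewrite /vx /adj /reg /rect /rgt /= ?xpair_eqE; split; lia.
  have [cc|] := eqVneq (C (vx (bdpt n l))) (C (vx (bdpt n (l + 1)))).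
    exact: mono.
  case c1 : (C (vx (bdpt n l))); case c2 : (C _) => // _.
    by apply: fent => //; rewrite -[col _ _]/(C (vx (bdpt n (l + 1)))) c2.
  apply: esym; apply: (exit (vx (bdpt n (l + 1)), vx (bdpt n l))) => /=.
    rewrite /interface /= rl rl' c1 c2 !andbT.
    by move: al; rewrite /adj; case: (vx _) => [? ?]; case: (vx _) => [? ?] /=;
      rewrite !xpair_eqE; lia.
  apply: contra ol; congr (is_true (reg _)); rewrite /lft /rgt.
  by case: (vx _) => [? ?]; case: (vx _) => [? ?] /=; congr pair; lia.
have up k : (k <= n + L)%N -> F (vx (bdpt n k)) = false.
  elim: k => [|k IH] kL; first exact: f00.
  have := step k%:Z; rewrite IH 1?ltnW // => h.
  have -> : k.+1%:Z = k%:Z + 1 by lia.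
  by rewrite -h //; lia.
have dn k : (k <= L)%N -> F (vx (bdpt n (- k%:Z))) = false.
  elim: k => [|k IH] kL; first exact: f00.
  have := step (- k.+1%:Z).
  have -> : - k.+1%:Z + 1 = - k%:Z :> int by lia.
  by rewrite IH 1?ltnW // => h; rewrite h //; lia.
move=> l hl; rewrite -[f _ _]/(F (vx (bdpt n l))).
have [l0|l0] := leP 0 l.
  have -> : l = `|l|%N by lia.
  by apply: up; lia.
have -> : l = - `|l|%N%:Z by lia.
by apply: dn; lia.
Qed.

(** * Cosine series *)

Definition int0pi (R : realType) (f : R -> R) : R :=
  \int[lebesgue_measure]_(x in `[0, pi]) f x.

Lemma continuous_int0pi (R : realType) (f : R -> R) : continuous f ->
  (@lebesgue_measure R).-integrable `[0, pi] (EFin \o f).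
Proof.
move=> cf; apply: continuous_compact_integrable; first exact: segment_compact.
exact: continuous_subspaceT.
Qed.

Lemma continuous_mul (R : realType) (f g : R -> R) :
  continuous f -> continuous g -> continuous (fun x => f x * g x).
Proof. by move=> cf cg x; apply: cvgM; [exact: cf|exact: cg]. Qed.

Lemma continuous_add (R : realType) (f g : R -> R) :
  continuous f -> continuous g -> continuous (fun x => f x + g x).
Proof. by move=> cf cg x; apply: cvgD; [exact: cf|exact: cg]. Qed.

Lemma continuous_const (R : realType) (a : R) : continuous (fun _ : R => a).
Proof. by move=> x; exact: cvg_cst. Qed.

Lemma continuous_cosM (R : realType) (k : R) : continuous (fun x : R => cos (k * x)).
Proof.
move=> x; apply: differentiable_continuous; apply/derivable1_diffP.
by apply: ex_derive.
Qed.

Lemma int0pi_lin (R : realType) (a b : R) (f g : R -> R) :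
  continuous f -> continuous g ->
  int0pi (fun x => a * f x + b * g x) = a * int0pi f + b * int0pi g.
Proof.
move=> cf cg; rewrite /int0pi RintegralD //; last first.
- by apply: (@continuous_int0pi R (fun x => b * g x)); apply: continuous_mul => //; exact: continuous_const.
- by apply: (@continuous_int0pi R (fun x => a * f x)); apply: continuous_mul => //; exact: continuous_const.
by rewrite !RintegralZl //; exact: continuous_int0pi.
Qed.

Lemma int0piZ (R : realType) (a : R) (f : R -> R) : continuous f ->
  int0pi (fun x => a * f x) = a * int0pi f.
Proof. by move=> cf; rewrite /int0pi RintegralZl //; exact: continuous_int0pi. Qed.

Lemma eq_int0pi (R : realType) (f g : R -> R) :
  (forall x, 0 <= x <= pi -> f x = g x) -> int0pi f = int0pi g.
Proof. by move=> fg; apply: eq_Rintegral => x; rewrite inE /= in_itv /=; exact: fg. Qed.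

Lemma int0pi_cst (R : realType) (m : R) : int0pi (fun=> m) = m * pi.
Proof.
rewrite /int0pi Rintegral_cst //= lebesgue_measure_itv /= lte_fin pi_gt0 /=.
by rewrite subr0.
Qed.

Lemma le_int0pi (R : realType) (f g : R -> R) : continuous f -> continuous g ->
  (forall x, 0 <= x <= pi -> f x <= g x) -> int0pi f <= int0pi g.
Proof.
move=> cf cg fg; apply: le_Rintegral => //; exact: continuous_int0pi.
Qed.

Lemma int0pi_norm (R : realType) (f : R -> R) (M : R) : continuous f ->
  (forall x, 0 <= x <= pi -> `|f x| <= M) -> `|int0pi f| <= M * pi.
Proof.
move=> cf fM; rewrite ler_norml -mulNr -!int0pi_cst; apply/andP; split;
  apply: le_int0pi => //; try exact: continuous_const.
  by move=> x /fM; rewrite ler_norml => /andP[].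
by move=> x /fM; rewrite ler_norml => /andP[].
Qed.

Lemma int0pi_ge (R : realType) (f : R -> R) (a b m : R) : continuous f ->
  (forall x, 0 <= x <= pi -> 0 <= f x) -> 0 <= m -> 0 <= a -> a <= b -> b <= pi ->
  (forall x, a <= x <= b -> m <= f x) -> m * (b - a) <= int0pi f.
Proof.
move=> cf f0 m0 a0 ab bpi fm.
have sub : `[a, b] `<=` `[0, pi]%classic.
  by move=> x /=; rewrite !in_itv /=; lra.
have intf : (@lebesgue_measure R).-integrable `[a, b] (EFin \o f).
  by apply: integrableS (continuous_int0pi cf).
have -> : m * (b - a) = \int[lebesgue_measure]_(x in `[a, b]) m.
  rewrite Rintegral_cst //= lebesgue_measure_itv /= lte_fin.
  by case: ltgtP ab => //= -> _; rewrite subrr.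
apply: (@le_trans _ _ (\int[lebesgue_measure]_(x in `[a, b]) f x)).
  apply: le_Rintegral => //.
    apply: continuous_compact_integrable; first exact: segment_compact.
    by apply: continuous_subspaceT => x; exact: cvg_cst.
rewrite /int0pi /Rintegral; apply: fine_le.
- exact: integrable_fin_num.
- by apply: integrable_fin_num => //; exact: continuous_int0pi.
apply: ge0_subset_integral => //.
  by apply: (measurable_int lebesgue_measure); exact: continuous_int0pi.
Qed.

Lemma int0pi_FTC (R : realType) (F f : R -> R) :
  (forall x : R, is_derive x 1 F (f x)) -> continuous f ->
  int0pi f = F pi - F 0.
Proof.
move=> dF cf; rewrite /int0pi /Rintegral (@continuous_FTC2 R f F) //.
- exact: pi_gt0.
- exact: continuous_subspaceT.
- have cF x : {for x, continuous F}.
    by apply: differentiable_continuous; apply/derivable1_diffP; have [] := dF x.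
  split.
  + by move=> x _; have [] := dF x.
  + exact/cvg_at_right_filter/cF.
  + exact/cvg_at_left_filter/cF.
- by move=> x _; rewrite derive1E; have [_] := dF x.
Qed.

Lemma int0pi_cosM (R : realType) (k : nat) :
  int0pi (fun x : R => cos (k%:R * x)) = if k == 0%N then pi else 0.
Proof.
case: eqP => [->|/eqP k0].
  under [X in int0pi X]funext do rewrite mul0r cos0.
  by rewrite int0pi_cst mul1r.
have kR : (k%:R : R) != 0 by rewrite pnatr_eq0.
have dF (x : R) : is_derive x 1 (fun x => k%:R^-1 * sin (k%:R * x)) (cos (k%:R * x)).
  apply: is_derive_eq; rewrite /GRing.scale /=.
  by rewrite mulr1 mulrC mulfK.
have -> := int0pi_FTC dF (@continuous_cosM R _).
rewrite mulr0 sin0 mulr0 subr0.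
suff -> : sin (k%:R * pi) = 0 :> R by rewrite mulr0.
elim: k {k0 kR dF} => [|k IH]; first by rewrite mul0r sin0.
by rewrite -natr1 mulrDl mul1r sinD IH mul0r sinpi mulr0 addr0.
Qed.

Lemma cosM_prod (R : realType) (j k : nat) (x : R) :
  cos (j%:R * x) * cos (k%:R * x) =
  (cos ((j + k)%:R * x) + cos ((maxn j k - minn j k)%:R * x)) / 2.
Proof.
wlog jk : j k / (j <= k)%N.
  move=> h; case/orP: (leq_total j k) => [jk|kj]; first exact: h.
  by rewrite mulrC addnC maxnC minnC; exact: h.
rewrite (maxn_idPr jk) (minn_idPl jk).
have -> : (j + k)%:R * x = j%:R * x + k%:R * x by rewrite natrD mulrDl.
have -> : (k - j)%:R * x = k%:R * x - j%:R * x by rewrite natrB // mulrBl.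
by rewrite cosD cosB; field.
Qed.

Lemma int0pi_cos_orth (R : realType) (j k : nat) : (0 < j)%N ->
  int0pi (fun x : R => cos (j%:R * x) * cos (k%:R * x)) = if j == k then pi / 2 else 0.
Proof.
move=> j0.
have -> : (fun x : R => cos (j%:R * x) * cos (k%:R * x)) =
   (fun x => 2^-1 * cos ((j + k)%:R * x) + 2^-1 * cos ((maxn j k - minn j k)%:R * x)).
  by apply/funext => x; rewrite cosM_prod; field.
rewrite int0pi_lin; [|exact: continuous_cosM..].
rewrite !int0pi_cosM addn_eq0 (gtn_eqF j0) /= mulr0 add0r.
case: (eqVneq j k) => [->|jk]; first by rewrite maxnn minnn subnn eqxx mulrC.
by rewrite ifF ?mulr0 //; lia.
Qed.

Definition annihilates_cos (R : realType) (f : R -> R) :=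
  continuous f /\ forall k : nat, int0pi (fun x => f x * cos (k%:R * x)) = 0.

(** By the product formula, multiplication by [cos x] only moves the index of the cosine. Degree 2
    in [cos x] covers the peak kernel of [annihilates_cos_le0]. *)
Lemma annihilates_cos_mul (R : realType) (f : R -> R) (a b c : R) :
  annihilates_cos f -> annihilates_cos (fun x => (a + b * cos x + c * cos x ^+ 2) * f x).
Proof.
have lin (g h : R -> R) (s t : R) : annihilates_cos g -> annihilates_cos h ->
    annihilates_cos (fun x => s * g x + t * h x).
  move=> [cg g0] [ch h0]; split.
    by apply: continuous_add; apply: continuous_mul => //; exact: continuous_const.
  move=> k.
  have -> : (fun x => (s * g x + t * h x) * cos (k%:R * x)) =
    (fun x => s * (g x * cos (k%:R * x)) + t * (h x * cos (k%:R * x))).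
    by apply/funext => x; ring.
  rewrite int0pi_lin ?g0 ?h0 ?mulr0 ?addr0 //; apply: continuous_mul => //; exact: continuous_cosM.
have mulcos (g : R -> R) : annihilates_cos g -> annihilates_cos (fun x => cos x * g x).
  move=> [cg g0]; split; first by apply: continuous_mul => //; exact: continuous_cos.
  move=> k.
  have -> : (fun x => cos x * g x * cos (k%:R * x)) =
    (fun x => 2^-1 * (g x * cos ((1 + k)%:R * x)) + 2^-1 * (g x * cos ((maxn 1 k - minn 1 k)%:R * x))).
    apply/funext => x; have := cosM_prod 1 k x; rewrite mul1r => h.
    by rewrite mulrAC h; field.
  rewrite int0pi_lin ?g0 ?mulr0 ?addr0 //; apply: continuous_mul => //; exact: continuous_cosM.
move=> hf; have h1 := mulcos _ hf; have h2 := mulcos _ h1.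
have := lin _ _ 1 c (lin _ _ a b hf h1) h2.
by congr annihilates_cos; apply/funext => x; ring.
Qed.

Lemma cos_gap (R : realType) (t0 d : R) : 0 <= t0 <= pi -> 0 < d ->
  exists2 e : R, 0 < e <= 1 & forall x, 0 <= x <= pi -> d <= `|x - t0| -> e <= `|cos x - cos t0|.
Proof.
move=> /andP[t00 t0p] d0.
have cmono (x y : R) : 0 <= x -> x < y -> y <= pi -> cos y < cos x.
  move=> x0 xy ypi; rewrite ltr_cos // in_itv /= ?x0 ?ypi ?(ltW (le_lt_trans x0 xy)) //.
  by rewrite (ltW (lt_le_trans xy ypi)).
have cmono' (x y : R) : 0 <= x -> x <= y -> y <= pi -> cos y <= cos x.
  by move=> x0; rewrite le_eqVlt => /predU1P[-> //|xy] ypi; rewrite ltW // cmono.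
(* Monotonicity of the cosine gives the gap on each side of [t0]. When [t0 + d] or [t0 - d] leaves
   the interval there is no point on that side and the default 1 is harmless. *)
pose a := if t0 + d <= pi then cos t0 - cos (t0 + d) else 1.
pose b := if 0 <= t0 - d then cos (t0 - d) - cos t0 else 1.
have a0 : 0 < a by rewrite /a; case: ifP => // h; rewrite subr_gt0 cmono // ltrDl.
have b0 : 0 < b by rewrite /b; case: ifP => // h; rewrite subr_gt0 cmono // gtrBl.
exists (Num.min 1 (Num.min a b)); first by rewrite !lt_min ltr01 a0 b0 ge_min lexx.
move=> x /andP[x0 xp]; rewrite ler_normr => /orP[] h.
  have h1 : t0 + d <= x by clear -h; lra.
  have h2 : a <= cos t0 - cos x by rewrite /a (le_trans h1 xp) lerD2l lerN2 cmono' // addr_ge0 // ltW.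
  rewrite distrC; apply: le_trans (ler_norm _); apply: le_trans h2.
  by rewrite !ge_min lexx orbT.
have h1 : x <= t0 - d by clear -h; lra.
have h2 : b <= cos x - cos t0.
  by rewrite /b (le_trans x0 h1) lerD2r cmono' // (le_trans _ t0p) // gerBl ltW.
apply: le_trans (ler_norm _); apply: le_trans h2.
by rewrite !ge_min lexx !orbT.
Qed.

Lemma segment_near (R : realType) (t0 m : R) : 0 <= t0 <= pi -> 0 < m -> m * 2 <= pi ->
  exists a b : R, a < b /\ [/\ 0 <= a, b <= pi & forall x, a <= x <= b -> `|x - t0| <= m].
Proof.
move=> /andP[t00 t0p] m0 mpi.
have [h|h] := leP (t0 + m) pi.
  exists t0, (t0 + m); rewrite ltrDl; split=> //; split=> // x /andP[h1 h2].
  by rewrite ger0_norm; clear -h1 h2; lra.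
exists (t0 - m), t0; rewrite gtrBl; split=> //; split=> [|//|x /andP[h1 h2]].
  by clear -h mpi; lra.
by rewrite ler0_norm; clear -h1 h2; lra.
Qed.

(** The powers of a kernel [p] peaked at [t0] are polynomials in [cos x], so [p x ^+ n * f x] has
    integral 0. If [f t0] were positive, the part near [t0] would be at least a multiple of
    [s ^+ n], while the part far away is at most a multiple of [r ^+ n] with [r < s]: impossible for
    large [n]. *)
Lemma annihilates_cos_le0 (R : realType) (f : R -> R) (t0 : R) :
  annihilates_cos f -> 0 <= t0 <= pi -> f t0 <= 0.
Proof.
move=> hf t0pi; rewrite leNgt; apply/negP => ft0.
have [cf _] := hf.
(* Between 0 and 1 because [|cos x - cos t0| <= 2]; on [[0, pi]] equal to 1 only at [t0]. *)
pose p (x : R) := 1 - (cos x - cos t0) ^+ 2 / 4.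
have p0 x : 0 <= p x.
  rewrite /p; have := cos_le1 x; have := cos_geN1 x; have := cos_le1 t0.
  by have := cos_geN1 t0; nra.
have p1 x : p x <= 1 by rewrite /p; have := sqr_ge0 (cos x - cos t0); lra.
have cp : continuous p.
  move=> x; apply: cvgB; first exact: cvg_cst.
  apply: cvgM; last exact: cvg_cst.
  have h : {for x, continuous (fun x : R => cos x - cos t0)}.
    by apply: cvgB; [exact: continuous_cos|exact: cvg_cst].
  by under eq_fun do rewrite expr2; apply: cvgM; exact: h.
have pf n : annihilates_cos (fun x => p x ^+ n * f x).
  elim: n => [|n IH]; first by under eq_fun do rewrite expr0 mul1r.
  have := annihilates_cos_mul (1 - cos t0 ^+ 2 / 4) (cos t0 / 2) (- 4^-1) IH.
  congr annihilates_cos; apply/funext => x.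
  have -> : p x ^+ n.+1 * f x = p x * (p x ^+ n * f x) by rewrite exprS mulrA.
  by set y := p x ^+ n * f x; rewrite /p; field.
have Ipf n : int0pi (fun x => p x ^+ n * f x) = 0.
  have [_ /(_ 0%N)] := pf n.
  by under [X in int0pi X]eq_fun do rewrite mul0r cos0 mulr1.
have [d d0 fd] : exists2 d : R, 0 < d & forall x, `|x - t0| < d -> f t0 / 2 <= f x.
  have f2 : 0 < f t0 / 2 by rewrite divr_gt0.
  have := cf t0 => /cvgrPdist_lt /(_ _ f2) /nbhs_ballP[d /= d0 hd].
  exists d => // x xd; have := hd x; rewrite /ball /= distrC => /(_ xd).
  by rewrite ltr_norml => /andP[_]; clear; lra.
have [e /andP[e0 e1] he] := cos_gap t0pi d0.
pose r := 1 - e ^+ 2 / 4.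
have r0 : 0 < r by clear -e0 e1; rewrite /r; nra.
have r1 : r < 1 by clear -e0; rewrite /r; nra.
have pr x : 0 <= x <= pi -> d <= `|x - t0| -> p x <= r.
  move=> xpi xd; have h := he x xpi xd; clear -h e0; rewrite /p /r -(real_normK (num_real (cos x - _))).
  by rewrite lerD2l lerN2 ler_pM2r ?invr_gt0 // ler_pXn2r ?nnegrE // ltW.
pose s := (1 + r) / 2.
have rs : r < s by clear -r1; rewrite /s; lra.
have s0 : 0 < s by clear -r0; rewrite /s; lra.
have [a [b [ab [a0 bpi abs]]]] : exists a b : R, a < b /\ [/\ 0 <= a, b <= pi &
    forall x, a <= x <= b -> s <= p x /\ `|x - t0| < d].
  have s1 : 0 < 1 - s by clear -r1; rewrite /s; lra.
  have := cp t0 => /cvgrPdist_lt /(_ _ s1) /nbhs_ballP[d' /= d'0 hd'].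
  have pt0 : p t0 = 1 by rewrite /p subrr expr0n /= mul0r subr0.
  have sp x : `|x - t0| < d' -> s <= p x.
    move=> xd; have := hd' x; rewrite /ball /= distrC pt0 => /(_ xd).
    by rewrite ltr_norml => /andP[_]; move: (p x) (s) => px s'; clear; lra.
  pose m := Num.min (Num.min d d') pi / 2.
  have m0 : 0 < m by rewrite divr_gt0 // !lt_min d0 d'0 pi_gt0.
  have mpi : m * 2 <= pi by rewrite divfK // !ge_min lexx orbT.
  have md : m < d.
    by have : m * 2 <= d by [rewrite divfK // !ge_min lexx]; clear -m0; lra.
  have md' : m < d'.
    by have : m * 2 <= d' by [rewrite divfK // !ge_min lexx !orbT]; clear -m0; lra.
  have [a [b [ab [a0 bpi hab]]]] := segment_near t0pi m0 mpi.
  exists a, b; split=> //; split=> // x /hab hx; split; first by apply: sp; exact: le_lt_trans md'.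
  exact: le_lt_trans md.
have [M fM] : exists M, forall x, 0 <= x <= pi -> `|f x| <= M.
  have [c _ hc] : exists2 c, c \in `[0, pi] & forall t, t \in `[0, pi] -> `|f t| <= `|f c|.
    apply: (@EVT_max R (fun t => `|f t|)); first exact: pi_ge0.
    by apply: continuous_subspaceT => x; apply: cvg_norm; exact: cf.
  by exists `|f c| => x hx; apply: hc; rewrite in_itv.
have M0 : 0 <= M by apply: le_trans (fM t0 t0pi).
(* Adding the constant [M * r ^+ n] makes the integrand nonnegative on all of [[0, pi]], so its
   integral is at least the part over [[a, b]]. *)
have key n : s ^+ n * (f t0 / 2) * (b - a) <= M * r ^+ n * pi.
  have cg : continuous (fun x => 1 * (p x ^+ n * f x) + 1 * (M * r ^+ n)).
    have [h _] := pf n.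
    apply: continuous_add; apply: continuous_mul => //; exact: continuous_const.
  have E : int0pi (fun x => 1 * (p x ^+ n * f x) + 1 * (M * r ^+ n)) = M * r ^+ n * pi.
    rewrite int0pi_lin ?Ipf ?int0pi_cst; first by ring.
      by have [] := pf n.
    exact: continuous_const.
  have rn : 0 <= M * r ^+ n by rewrite mulr_ge0 // exprn_ge0 // ltW.
  rewrite -E; apply: int0pi_ge => //.
  - move=> x xpi; rewrite !mul1r.
    have [h|h] := ltP `|x - t0| d.
      by rewrite addr_ge0 // mulr_ge0 ?exprn_ge0 //; apply: le_trans (fd _ h); rewrite divr_ge0 // ltW.
    have h3 : p x ^+ n <= r ^+ n by apply: lerXn2r; rewrite ?nnegrE ?p0 ?(ltW r0) //; exact: pr.
    have h4 : 0 <= p x ^+ n by rewrite exprn_ge0.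
    have : `|p x ^+ n * f x| <= M * r ^+ n.
      by rewrite normrM mulrC (ger0_norm h4) ler_pM // fM.
    by rewrite ler_norml => /andP[h5 _]; clear -h5; lra.
  - by rewrite !mulr_ge0 ?exprn_ge0 ?(ltW s0) ?(ltW ft0).
  - exact: ltW.
  - move=> x /abs[h1 /fd h2]; rewrite !mul1r -[leLHS]addr0; apply: lerD => //.
    apply: ler_pM; rewrite ?exprn_ge0 ?(ltW s0) ?divr_ge0 ?(ltW ft0) //.
    by apply: lerXn2r; rewrite ?nnegrE ?(ltW s0).
pose A := f t0 / 2 * (b - a).
have A0 : 0 < A by rewrite mulr_gt0 ?divr_gt0 // subr_gt0.
pose q := s / r - 1.
have q0 : 0 < q by rewrite /q subr_gt0 ltr_pdivlMr // mul1r.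
have grow n : 1 + q *+ n <= (s / r) ^+ n.
  elim: n => [|n IH]; first by rewrite mulr0n expr0 addr0.
  rewrite exprS mulrS; have sq : s / r = 1 + q by rewrite /q; ring.
  rewrite sq in IH *.
  have : 0 <= q *+ n by rewrite mulrn_wge0 // ltW.
  by clear -IH q0; nra.
have key2 n : (1 + q *+ n) * A <= M * pi.
  have rn : 0 < r ^+ n by rewrite exprn_gt0.
  apply: (@le_trans _ _ ((s / r) ^+ n * A)); first by rewrite ler_wpM2r ?(ltW A0).
  rewrite exprMn exprVn mulrAC ler_pdivrMr // /A mulrA.
  by have h := key n; clear -h; lra.
pose n := (Num.truncn (M * pi / A / q)).+1.
have h1 : M * pi / A / q < n%:R by apply: truncnS_gt.
have := key2 n; rewrite -ler_pdivlMr // leNgt => /negP; apply.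
by move: h1; rewrite ltr_pdivrMr // -mulr_natl; clear; lra.
Qed.

Lemma cos_uniqueness (R : realType) (f : R -> R) : annihilates_cos f ->
  forall t, 0 <= t <= pi -> f t = 0.
Proof.
move=> hf t tpi; apply/eqP; rewrite eq_le (annihilates_cos_le0 hf tpi) /=.
rewrite -oppr_le0; apply: (annihilates_cos_le0 (f := fun x => - f x)) => //.
have := annihilates_cos_mul (-1) 0 0 hf.
by congr annihilates_cos; apply/funext => x; rewrite !mul0r !addr0 mulN1r.
Qed.

Lemma geometric_tail (R : realType) (b : nat -> R) (C q : R) : 0 <= C -> 0 <= q < 1 ->
  (forall k, `|b k| <= C * q ^+ k) ->
  forall K m, `|\sum_(k < K + m) b k - \sum_(k < K) b k| <= C * q ^+ K / (1 - q).
Proof.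
move=> C0 /andP[q0 q1] hb K m.
apply: (@le_trans _ _ (C * q ^+ K * (1 - q ^+ m) / (1 - q))); last first.
  rewrite ler_wpM2r ?invr_ge0 ?subr_ge0 ?(ltW q1) // ler_piMr //.
    by rewrite mulr_ge0 ?exprn_ge0.
  by rewrite lerBlDr lerDl exprn_ge0.
elim: m => [|m IH]; first by rewrite addn0 subrr normr0 expr0 subrr mulr0 mul0r.
rewrite addnS big_ord_recr /= addrAC.
apply: le_trans (ler_normD _ _) _.
apply: le_trans (lerD IH (hb _)) _.
rewrite exprD exprS le_eqVlt; apply/orP; left; apply/eqP.
by field; lra.
Qed.

Lemma geometric_small (R : realType) (C q e : R) : 0 <= C -> 0 <= q < 1 -> 0 < e ->
  exists K0, forall K, (K0 <= K)%N -> C * q ^+ K / (1 - q) <= e.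
Proof.
move=> C0 /andP[q0 q1] e0.
have q1' : `|q| < 1 by rewrite ger0_norm.
have := @cvg_geometric R (C / (1 - q)) q q1' => /cvgrPdist_lt /(_ _ e0) [K0 _ hK].
exists K0 => K KK0; have := hK K KK0; rewrite /= sub0r normrN => h.
apply: le_trans (ltW h); apply: le_trans (ler_norm _) _.
by rewrite mulrAC.
Qed.

(** The series converges uniformly to a continuous [L] with the same coefficients as [g], so [g - L]
    annihilates the cosines and vanishes by [cos_uniqueness]. The zero mean makes [a 0] vanish, the
    one coefficient for which the factor [2 / pi] would be wrong. *)
Lemma cos_expansion (R : realType) (g : R -> R) (a : nat -> R) (C q : R) :
  continuous g -> int0pi g = 0 ->
  (forall k, a k = 2 / pi * int0pi (fun x => g x * cos (k%:R * x))) ->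
  0 <= C -> 0 <= q < 1 -> (forall k, `|a k| <= C * q ^+ k) ->
  forall K t, 0 <= t <= pi ->
  `|g t - \sum_(k < K) a k * cos (k%:R * t)| <= C * q ^+ K / (1 - q).
Proof.
move=> cg g0 aE C0 q01 aC.
have pi0 := pi_gt0 R.
pose S K (t : R) := \sum_(k < K) a k * cos (k%:R * t).
have bC (t : R) k : `|a k * cos (k%:R * t)| <= C * q ^+ k.
  by rewrite normrM; apply: le_trans (aC k); rewrite ler_piMr // cos_max.
have SS (t : R) K m : `|S (K + m)%N t - S K t| <= C * q ^+ K / (1 - q).
  exact: (geometric_tail C0 q01 (bC t)).
have [L hL] : exists L : R -> R, forall t K, `|L t - S K t| <= C * q ^+ K / (1 - q).
  have ex (t : R) : exists l, forall K, `|l - S K t| <= C * q ^+ K / (1 - q).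
    have cS : cvgn (fun K => S K t).
      apply: cauchy_cvg; apply: cauchy_exP => e e0.
      have e2 : 0 < e / 2 by lra.
      have [K0 hK0] := geometric_small C0 q01 e2.
      exists (S K0 t); exists K0 => // n /= K0n; rewrite /ball /= distrC.
      rewrite -(subnKC K0n); apply: le_lt_trans (SS _ _ _) _.
      by apply: le_lt_trans (hK0 _ (leqnn _)) _; lra.
    exists (limn (fun K => S K t)) => K.
    apply/ler_addgt0Pr => e e0.
    have := cS => /cvgrPdist_lt /(_ _ e0) [N _ hN].
    have h1 := hN (K + N)%N (leq_addl _ _).
    have h2 := SS t K N.
    have := ler_normD (limn (fun K => S K t) - S (K + N)%N t) (S (K + N)%N t - S K t).
    rewrite addrA subrK => h3; move: h1 => /=; lra.
  by exists (fun t => projT1 (cid (ex t))) => t; case: (cid _).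
have cS K : continuous (S K).
  rewrite /S; elim: K => [|K IH].
    by under eq_fun do rewrite big_ord0; exact: continuous_const.
  under eq_fun do rewrite big_ord_recr /=.
  apply: continuous_add => //; apply: continuous_mul; first exact: continuous_const.
  exact: continuous_cosM.
have cL : continuous L.
  move=> t; apply/cvgrPdist_lt => e e0.
  have e4 : 0 < e / 4 by lra.
  have [K0 hK0] := geometric_small C0 q01 e4.
  have := cS K0 t => /cvgrPdist_lt /(_ _ e4); apply: filterS => s hs.
  have h1 := le_trans (hL t K0) (hK0 _ (leqnn _)).
  have h2 := le_trans (hL s K0) (hK0 _ (leqnn _)).
  have -> : L t - L s = (L t - S K0 t) + (S K0 t - S K0 s) - (L s - S K0 s) by ring.
  have := ler_normB ((L t - S K0 t) + (S K0 t - S K0 s)) (L s - S K0 s).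
  have := ler_normD (L t - S K0 t) (S K0 t - S K0 s).
  lra.
have a0 : a 0%N = 0.
  rewrite aE; have -> : (fun x => g x * cos (0%:R * x)) = g.
    by apply/funext => x; rewrite mul0r cos0 mulr1.
  by rewrite g0 mulr0.
have IS K k : (k < K)%N -> int0pi (fun x => S K x * cos (k%:R * x)) = int0pi (fun x => g x * cos (k%:R * x)).
  move=> kK.
  have -> : int0pi (fun x => g x * cos (k%:R * x)) = a k * (pi / 2).
    by rewrite aE mulrAC mulrA (divfK (lt0r_neq0 pi0)) divff ?mul1r // pnatr_eq0.
  have E m : int0pi (fun x => S m x * cos (k%:R * x)) = if (k < m)%N then a k * (pi / 2) else 0.
    elim: m => [|m IH].
      under [X in int0pi X]eq_fun do rewrite /S big_ord0 mul0r.
      by rewrite int0pi_cst mul0r.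
    have -> : (fun x => S m.+1 x * cos (k%:R * x)) = (fun x => 1 * (S m x * cos (k%:R * x)) + a m * (cos (m%:R * x) * cos (k%:R * x))).
      by apply/funext => x; rewrite /S big_ord_recr /=; ring.
    rewrite int0pi_lin; last first.
    - by apply: continuous_mul; exact: continuous_cosM.
    - by apply: continuous_mul; [exact: cS|exact: continuous_cosM].
    rewrite IH mul1r.
    have [->|m0] := posnP m.
      rewrite a0 mul0r addr0; case: (k) => [|k'] //=.
      by rewrite a0 mul0r.
    rewrite int0pi_cos_orth //.
    rewrite ltnS [in RHS]leq_eqVlt [m == k]eq_sym; case: (eqVneq k m) => [->|h] /=.
      by rewrite ltnn add0r.
    by rewrite mulr0 addr0.
  by rewrite E kK.
have hz : annihilates_cos (fun x => g x - L x).
  split; first by move=> x; apply: cvgB; [exact: cg|exact: cL].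
  move=> k; apply/eqP; rewrite -normr_le0; apply/ler_addgt0Pr => e e0; rewrite add0r.
  have epi : 0 < e / pi by rewrite divr_gt0.
  have [K0 hK0] := geometric_small C0 q01 epi.
  pose K := (maxn K0 k).+1.
  have -> : (fun x => (g x - L x) * cos (k%:R * x)) =
     (fun x => 1 * (1 * (g x * cos (k%:R * x)) + (-1) * (S K x * cos (k%:R * x))) + 1 * ((S K x - L x) * cos (k%:R * x))).
    by apply/funext => x; ring.
  have c1 : continuous (fun x => g x * cos (k%:R * x)).
    by apply: continuous_mul => //; exact: continuous_cosM.
  have c2 : continuous (fun x => S K x * cos (k%:R * x)).
    by apply: continuous_mul => //; exact: continuous_cosM.
  have c3 : continuous (fun x => (S K x - L x) * cos (k%:R * x)).
    apply: continuous_mul; last exact: continuous_cosM.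
    by move=> x; apply: cvgB; [exact: cS|exact: cL].
  rewrite int0pi_lin //; last by apply: continuous_add; apply: continuous_mul => //; exact: continuous_const.
  rewrite int0pi_lin // IS; last by rewrite /K ltnS leq_maxr.
  rewrite !mul1r mulN1r subrr add0r.
  rewrite -(divfK (lt0r_neq0 pi0) e); apply: int0pi_norm => // x xpi.
  rewrite normrM; apply: (@le_trans _ _ `|S K x - L x|); first by rewrite ler_piMr // cos_max.
  rewrite distrC; apply: le_trans (hL _ _) (hK0 _ _).
  by rewrite /K leqW // leq_maxl.
move=> K t tpi.
have -> : g t = L t by apply/eqP; rewrite -subr_eq0; apply/eqP; apply: (cos_uniqueness hz).
exact: hL.
Unshelve. all: end_near. Qed.

Lemma sin_mulrn_le (R : realType) (k : nat) (x : R) : `|sin (k%:R * x)| <= k%:R * `|sin x|.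
Proof.
elim: k => [|k IH]; first by rewrite !mul0r sin0 normr0.
rewrite -natr1 !mulrDl !mul1r sinD; apply: le_trans (ler_normD _ _) _; rewrite !normrM.
have h1 := cos_max x; have h2 := cos_max (k%:R * x).
have h3 := normr_ge0 (sin x); have h4 := normr_ge0 (sin (k%:R * x)).
apply: lerD; first by apply: le_trans IH; rewrite ler_piMr.
by rewrite ler_piMl.
Qed.

(** A difference of cosines is a product of two sines, to each of which [sin_mulrn_le] applies. *)
Lemma cos_mulrn_dist (R : realType) (k : nat) (x y : R) :
  `|cos (k%:R * x) - cos (k%:R * y)| <= k%:R ^+ 2 * `|cos x - cos y|.
Proof.
pose a := (x + y) / 2; pose b := (x - y) / 2.
have E (z : R) : cos (z * x) - cos (z * y) = - 2 * (sin (z * a) * sin (z * b)).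
  have -> : z * x = z * a + z * b by rewrite /a /b; field.
  have -> : z * y = z * a - z * b by rewrite /a /b; field.
  by rewrite cosD cosB; ring.
have := E 1; rewrite !mul1r => ->; rewrite E !normrM normrN.
have h1 := sin_mulrn_le k a; have h2 := sin_mulrn_le k b.
have -> : k%:R ^+ 2 * (`|2| * (`|sin a| * `|sin b|)) =
  `|2| * ((k%:R * `|sin a|) * (k%:R * `|sin b|)) :> R by ring.
by rewrite ler_wpM2l // ler_pM.
Qed.

Lemma sqrn_le_expn (k : nat) : (k ^ 2 <= 2 * 2 ^ k)%N.
Proof.
case: k => [|[|[|k]]] //; elim: k => // k IH.
by move: IH; rewrite !expnS !expn0; lia.
Qed.

(** An error proportional to [|cos s - cos t|] is what later gives monotonicity in x at the cusp.
    The factor [k ^ 2] of [cos_mulrn_dist] is absorbed by [k ^ 2 <= 2 * 2 ^ k]; hence [2 * C],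
    [2 * q] and the condition [q < 2^-1]. *)
Lemma cos_expansion_dist (R : realType) (g : R -> R) (a : nat -> R) (C q : R) :
  continuous g -> int0pi g = 0 ->
  (forall k, a k = 2 / pi * int0pi (fun x => g x * cos (k%:R * x))) ->
  0 <= C -> 0 <= q -> q < 2^-1 -> (forall k, `|a k| <= C * q ^+ k) ->
  forall K s t, 0 <= s <= pi -> 0 <= t <= pi ->
  `|g s - g t - \sum_(k < K) a k * (cos (k%:R * s) - cos (k%:R * t))| <=
    2 * C * (2 * q) ^+ K / (1 - 2 * q) * `|cos s - cos t|.
Proof.
move=> cg g0 aE C0 q0 q12 aC K s t spi tpi.
have q01 : 0 <= q < 1 by lra.
set D := `|cos s - cos t|.
have D0 : 0 <= D by exact: normr_ge0.
pose b k := a k * (cos (k%:R * s) - cos (k%:R * t)).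
have bC k : `|b k| <= (2 * C * D) * (2 * q) ^+ k.
  rewrite /b normrM exprMn.
  have -> : 2 * C * D * (2 ^+ k * q ^+ k) = (C * q ^+ k) * (2 * 2 ^+ k * D) by ring.
  apply: ler_pM => //; apply: le_trans (cos_mulrn_dist _ _ _) _.
  rewrite ler_wpM2r // -!natrX -natrM ler_nat; exact: sqrn_le_expn.
have CD : 0 <= 2 * C * D by rewrite !mulr_ge0.
have q2 : 0 <= 2 * q < 1 by lra.
apply/ler_addgt0Pr => e e0.
have e2 : 0 < e / 2 by lra.
have [K0 hK0] := geometric_small C0 q01 e2.
have h1 := geometric_tail CD q2 bC K K0.
have hk : (K0 <= K + K0)%N by rewrite leq_addl.
have h2 := le_trans (cos_expansion cg g0 aE C0 q01 aC (K + K0) spi) (hK0 _ hk).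
have h3 := le_trans (cos_expansion cg g0 aE C0 q01 aC (K + K0) tpi) (hK0 _ hk).
set Ss := \sum_(k < K + K0) a k * cos (k%:R * s) in h2.
set St := \sum_(k < K + K0) a k * cos (k%:R * t) in h3.
have E : \sum_(k < K + K0) b k = Ss - St.
  by rewrite /Ss /St -sumrB; apply: eq_bigr => k _; rewrite /b mulrBr.
rewrite E in h1; rewrite -/(b _).
have -> : g s - g t - \sum_(k < K) a k * (cos (k%:R * s) - cos (k%:R * t)) =
  (Ss - St - \sum_(k < K) b k) + ((g s - Ss) - (g t - St)) by rewrite /b; ring.
apply: le_trans (ler_normD _ _) _.
have h4 := ler_normB (g s - Ss) (g t - St).
have -> : 2 * C * (2 * q) ^+ K / (1 - 2 * q) * D = 2 * C * D * (2 * q) ^+ K / (1 - 2 * q) by ring.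
by lra.
Qed.

Lemma int0pi_derive (R : realType) (f ft : R -> R -> R) (a b t M : R) : a < t < b ->
  (forall s, a < s < b -> continuous (f s)) ->
  (forall s x, a < s < b -> is_derive s 1 (f^~ x) (ft s x)) ->
  (forall s x, a < s < b -> 0 <= x <= pi -> `|ft s x| <= M) ->
  is_derive t 1 (fun s => int0pi (f s)) (int0pi (ft t)).
Proof.
move=> atb cf df bf.
have M0 : 0 <= M by apply: le_trans (bf t 0 atb _); rewrite // lexx pi_ge0.
have dE x y : a < x < b -> partial1of2 f x y = ft x y.
  by move=> hx; rewrite partial1of2E; have [_ ->] := df x y hx.
have cvg_d := @cvg_differentiation_under_integral R _ _ (@lebesgue_measure R) f
  `[0, pi] _ t a b.
have {}cvg_d : h^-1 *: (int0pi (f (h + t)) - int0pi (f t)) @[h --> 0^'] --> int0pi (ft t).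
  have -> : int0pi (ft t) = \int[lebesgue_measure]_(y in `[0, pi]) partial1of2 f t y.
    by apply: eq_Rintegral => x _; rewrite dE.
  apply: (cvg_d _ _ _ _ (fun=> M)) => //=.
  - by move=> x; rewrite in_itv /= => hx; apply: continuous_int0pi; exact: cf.
  - by move=> x y; rewrite in_itv /= => hx _; have [] := df x y hx.
  - by apply: continuous_int0pi; exact: continuous_const.
  - by move=> x y; rewrite !in_itv /= => hx hy; rewrite dE //; exact: bf.
have D : derivable (fun s => int0pi (f s)) t 1.
  by apply/cvg_ex; exists (int0pi (ft t)); under eq_fun do rewrite scaler1.
apply: DeriveDef => //.
apply/cvg_lim => //.
by under eq_fun do rewrite scaler1.
Qed.

(** * Separation of variables on a cylinder *)

(** The partial derivatives are carried as functions, so that the modes can be differentiated under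
    the integral, with [cyl_bound] as the domination. [cyl_neumann] removes the boundary terms when
    the equation is integrated against a cosine. *)
Record cylinder_solution (R : realType) (u ut utt ux uxx : R -> R -> R) (V : R -> R)
    (T0 : R) : Prop := {
  cyl_t : forall t x, T0 < t -> is_derive t (1 : R) (u^~ x) (ut t x);
  cyl_tt : forall t x, T0 < t -> is_derive t (1 : R) (ut^~ x) (utt t x);
  cyl_x : forall t x, T0 < t -> is_derive x (1 : R) (u t) (ux t x);
  cyl_xx : forall t x, T0 < t -> is_derive x (1 : R) (ux t) (uxx t x);
  cyl_ct : forall t, T0 < t -> continuous (ut t);
  cyl_ctt : forall t, T0 < t -> continuous (utt t);
  cyl_bound : forall a b, T0 < a -> a <= b -> exists M, forall t x,
    a <= t <= b -> 0 <= x <= pi -> `|ut t x| <= M /\ `|utt t x| <= M;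
  cyl_eq : forall t x, T0 < t -> utt t x + uxx t x + V t * u t x = 0;
  cyl_neumann : forall t, T0 < t -> ux t 0 = 0 /\ ux t pi = 0
}.

Definition mode (R : realType) (u : R -> R -> R) (k : nat) (t : R) : R :=
  int0pi (fun x => u t x * cos (k%:R * x)).

Lemma is_derive_continuous (R : realType) (f df : R -> R) :
  (forall x, is_derive x (1 : R) f (df x)) -> continuous f.
Proof.
move=> h x; apply: differentiable_continuous; apply/derivable1_diffP.
by have [] := h x.
Qed.

Lemma sin_natpi (R : realType) (k : nat) : sin (k%:R * pi) = 0 :> R.
Proof.
elim: k => [|k IH]; first by rewrite mul0r sin0.
by rewrite -natr1 mulrDl mul1r sinD IH mul0r sinpi mulr0 addr0.
Qed.

Lemma mode_derive (R : realType) (u ut utt ux uxx : R -> R -> R) (V : R -> R) (T0 : R)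
    (hu : cylinder_solution u ut utt ux uxx V T0) (k : nat) (t : R) : T0 < t ->
  is_derive t (1 : R) (mode u k) (mode ut k t) /\
  is_derive t (1 : R) (mode ut k) ((k%:R ^+ 2 - V t) * mode u k t).
Proof.
move=> Tt; have [h1 h2 h3 h4 h5 h6 h7 h8 h9] := hu.
pose a := (T0 + t) / 2; pose b := t + 1.
have atb : a < t < b by rewrite /a /b; lra.
have Ta : T0 < a by rewrite /a; lra.
have [|M hM] := h7 a b Ta; first by rewrite /a /b; lra.
have T0s s : a < s < b -> T0 < s by move=> /andP[]; lra.
have cu s : T0 < s -> continuous (u s) by move=> hs; exact: (is_derive_continuous (fun x => h3 s x hs)).
have ck := @continuous_cosM R k%:R.
split.
  apply: (@int0pi_derive R (fun t x => u t x * cos (k%:R * x)) (fun t x => ut t x * cos (k%:R * x)) a b t M) => //.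
  - by move=> s /T0s hs; apply: continuous_mul => //; exact: cu.
  - move=> s x /T0s hs; have h := h1 s x hs.
    by apply: is_derive_eq; rewrite /GRing.scale /=; ring.
  - move=> s x /andP[s1 s2] xpi; have [|//|h _] := hM s x; first by rewrite !ltW.
    by rewrite normrM; apply: le_trans h; rewrite ler_piMr // cos_max.
have -> : (k%:R ^+ 2 - V t) * mode u k t = mode utt k t.
  (* A primitive of [f], that is, two integrations by parts at once; it vanishes at 0 and at
     [pi]. *)
  pose F x := ux t x * cos (k%:R * x) + k%:R * (u t x * sin (k%:R * x)).
  pose f x := uxx t x * cos (k%:R * x) + k%:R ^+ 2 * (u t x * cos (k%:R * x)).
  have cuxx : continuous (uxx t).
    have -> : uxx t = (fun x => -1 * utt t x + - V t * u t x).
      by apply/funext => x; have := h8 t x Tt; lra.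
    apply: continuous_add; apply: continuous_mul; try exact: continuous_const.
      exact: h6.
    exact: cu.
  have c1 : continuous (fun x => u t x * cos (k%:R * x)).
    by apply: continuous_mul => //; exact: cu.
  have cf : continuous f.
    apply: continuous_add; apply: continuous_mul => //; exact: continuous_const.
  have dF x : is_derive x (1 : R) F (f x).
    have hx := h3 t x Tt; have hxx := h4 t x Tt.
    by rewrite /F; apply: is_derive_eq; rewrite /GRing.scale /f /=; ring.
  have If : int0pi f = 0.
    rewrite (int0pi_FTC dF cf) /F sin_natpi !mulr0 sin0 !mulr0.
    by have [-> ->] := h9 t Tt; rewrite !mul0r !addr0 subrr.
  have -> : mode utt k t = int0pi (fun x => -1 * f x + (k%:R ^+ 2 - V t) * (u t x * cos (k%:R * x))).
    apply: eq_int0pi => x _; rewrite /f.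
    have -> : utt t x = - uxx t x - V t * u t x by have := h8 t x Tt; lra.
    ring.
  by rewrite int0pi_lin // If mulr0 add0r.
apply: (@int0pi_derive R (fun t x => ut t x * cos (k%:R * x)) (fun t x => utt t x * cos (k%:R * x)) a b t M) => //.
- by move=> s /T0s hs; apply: continuous_mul => //; exact: h5.
- move=> s x /T0s hs; have h := h2 s x hs.
  by apply: is_derive_eq; rewrite /GRing.scale /=; ring.
- move=> s x /andP[s1 s2] xpi; have [|//|_ h] := hM s x; first by rewrite !ltW.
  by rewrite normrM; apply: le_trans h; rewrite ler_piMr // cos_max.
Qed.

(** Uniqueness is started at [T + 1], around which the mode vanishes on both sides, so that its
    derivative vanishes too. *)
Lemma mode_eq0 (R : realType) (u ut utt ux uxx : R -> R -> R) (V : R -> R) (T0 T : R)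
    (hu : cylinder_solution u ut utt ux uxx V T0) (k : nat) :
  T0 < T ->
  (forall a b, T0 < a -> a <= b -> exists K, forall t, a <= t <= b -> `|V t| <= K) ->
  (forall t, T <= t -> mode u k t = 0) -> forall t, T0 < t -> mode u k t = 0.
Proof.
move=> T0T bV cT t Tt.
pose a := Num.min t T; pose b := Num.max t (T + 1).
have ta : a <= t by rewrite ge_min lexx.
have tb : t <= b by rewrite le_max lexx.
have Ta : a <= T by rewrite ge_min lexx orbT.
have Tb : T + 1 <= b by rewrite le_max lexx orbT.
have T0a : T0 < a by rewrite lt_min Tt T0T.
have [|K hK] := bV a b T0a; first by lra.
apply: (@ode2_eq0 R (mode u k) (mode ut k) (fun t => k%:R ^+ 2 - V t) a b (k%:R ^+ 2 + K)
  _ _ _ (T + 1)).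
- by move=> s /andP[s1 s2]; have [] := mode_derive hu k (lt_le_trans T0a s1).
- by move=> s /andP[s1 s2]; have [] := mode_derive hu k (lt_le_trans T0a s1).
- move=> s hs; apply: le_trans (ler_normB _ _) _; apply: lerD; last exact: hK.
  by rewrite ger0_norm // sqr_ge0.
- by apply/andP; split; lra.
- by apply: cT; lra.
- have hT : T0 < T + 1 by lra.
  by apply: (is_derive_locally0 cT _ (mode_derive hu k hT).1); lra.
- by rewrite ta tb.
Qed.

(** [k] is the least index whose mode is nonzero at [T]. With [q = expR (- (t - T))] and
    [r ^+ 2 = q], the coefficients at time [t] are at most [C * q ^+ j] for [C = 2 * M / r], and the
    k-th is at least [A0 * q ^+ k]. The tail beyond [k] is of order
    [C * q ^+ k.+1 = 2 * M * r * q ^+ k]: smaller by the factor [r], which tends to 0. *)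
Lemma cylinder_asymptotics (R : realType) (u ut utt ux uxx : R -> R -> R) (V : R -> R)
    (T0 T : R) (hu : cylinder_solution u ut utt ux uxx V T0) :
  T0 < T -> 0 < T ->
  (forall a b, T0 < a -> a <= b -> exists K, forall t, a <= t <= b -> `|V t| <= K) ->
  (forall t, T <= t -> 0 <= V t <= 3 / 4) ->
  (forall t, T <= t -> int0pi (u t) = 0) ->
  (forall k, (0 < k)%N -> ~ (exists2 e : R, 0 < e & exists S, forall t, S <= t ->
     e * t ^+ 2 <= mode u k t ^+ 2)) ->
  (forall t x, T0 < t -> 0 <= x <= pi -> u t x = 0) \/
  exists k c A B S, [/\ (0 < k)%N, 0 < A & forall t, S <= t ->
    [/\ A * expR (- k%:R * t) <= `|c t|, `|c t| <= B * expR (- (k%:R - 1 / 2) * t),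
     (forall x, 0 <= x <= pi -> `|u t x - c t * cos (k%:R * x)| <= `|c t| / 2) &
     (forall x y, 0 <= x <= pi -> 0 <= y <= pi ->
       `|u t x - u t y - c t * (cos (k%:R * x) - cos (k%:R * y))| <=
         `|c t| / 2 * `|cos x - cos y|)]].
Proof.
move=> T0T Tpos bV V34 mean0 nogrow.
have [_ _ h3 _ _ _ _ _ _] := hu.
have pi0 := pi_gt0 R.
have cu t : T0 < t -> continuous (u t) by move=> ht; exact: (is_derive_continuous (fun x => h3 t x ht)).
have m00 t : T <= t -> mode u 0 t = 0.
  by move=> /mean0 <-; apply: eq_int0pi => x _; rewrite mul0r cos0 mulr1.
have dec k : (0 < k)%N -> (forall t, T <= t -> `|mode u k t| <= `|mode u k T| * expR (- (k%:R - 1 / 2) * (t - T))) /\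
    (forall t, T <= t -> `|mode u k T| * expR (- k%:R * (t - T)) <= `|mode u k t|).
  move=> k0; apply: (@mode_decay R _ (mode ut k) V) => //.
  - by rewrite ler1n.
  - by move=> t Tt; have [] := mode_derive hu k (lt_le_trans T0T Tt).
  - by move=> t Tt; have [] := mode_derive hu k (lt_le_trans T0T Tt).
  - exact: nogrow.
have mT0 k : mode u k T = 0 -> forall t, T <= t -> mode u k t = 0.
  case: k => [_|k hk t Tt]; first exact: m00.
  have [/(_ _ Tt) + _] := dec k.+1 isT.
  by rewrite hk normr0 mul0r normr_le0 => /eqP.
have [all0|] := pselect (forall k, mode u k T = 0).
  left => t x Tt xpi; apply: (cos_uniqueness (f := u t)) => //; split; first exact: cu.
  by move=> k; apply: (mode_eq0 hu T0T bV) => //; apply: mT0.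
move=> /existsNP ex; right.
have {}ex : exists k, mode u k T != 0 by case: ex => k /eqP; exists k.
have [k kT kmin] := ex_minnP ex.
have k0 : (0 < k)%N.
  by case: k kT {kmin} => //; rewrite m00 ?lexx ?eqxx.
have klt j : (j < k)%N -> forall t, T <= t -> mode u j t = 0.
  move=> jk; apply: mT0; apply/eqP; apply: contraTT isT => h.
  by have := kmin _ h; rewrite leqNgt jk.
pose a j t := 2 / pi * mode u j t.
have p2 : 0 < 2 / pi :> R by rewrite divr_gt0.
have aN j t : `|a j t| = 2 / pi * `|mode u j t| by rewrite normrM gtr0_norm.
have [M uM] : exists M, forall x, 0 <= x <= pi -> `|u T x| <= M.
  have [c _ hc] : exists2 c, c \in `[0, pi] & forall t, t \in `[0, pi] -> `|u T t| <= `|u T c|.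
    apply: (@EVT_max R (fun t => `|u T t|)); first exact: pi_ge0.
    by apply: continuous_subspaceT => x; apply: cvg_norm; exact: cu.
  by exists `|u T c| => x hx; apply: hc; rewrite in_itv.
have M0 : 0 <= M by apply: le_trans (uM 0 _); rewrite // lexx ltW.
have aT j : `|a j T| <= 2 * M.
  rewrite aN.
  have : `|mode u j T| <= M * pi.
    apply: int0pi_norm; first by apply: continuous_mul; [exact: cu|exact: continuous_cosM].
    by move=> x /uM h; rewrite normrM; apply: le_trans h; rewrite ler_piMr // cos_max.
  move=> h; have := ler_wpM2l (ltW p2) h.
  suff -> : 2 / pi * (M * pi) = 2 * M by [].
  by rewrite mulrACA mulVf ?mulr1 // gt_eqF.
pose A0 := `|a k T|.
have A00 : 0 < A0 by rewrite /A0 aN mulr_gt0 // normr_gt0.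
(* Chosen so that [D * r <= A0] makes both tails at most half of the leading term; the one for
   differences carries the extra factor [2 ^+ k]. *)
pose D := 32 * 2 ^+ k * M.
have h12 : 0 < 1 / 2 :> R by rewrite divr_gt0.
have h14 : 0 < 1 / 4 :> R by rewrite divr_gt0.
have [S1 hS1] := expRN_small (D * expR (1 / 2 * T)) h12 A00.
have [S2 hS2] := expRN_small (expR (1 / 2 * T)) h12 h14.
exists k, (a k), (A0 * expR (k%:R * T)), (2 * M * expR ((k%:R - 1 / 2) * T)), (Num.max T (Num.max S1 S2)).
split=> //; first by rewrite mulr_gt0 // expR_gt0.
move=> t; rewrite !ge_max => /and3P[Tt /hS1 hD /hS2 hr].
have T0t : T0 < t by exact: lt_le_trans Tt.
pose r := expR (- (1 / 2) * (t - T)).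
have r0 : 0 < r := expR_gt0 _.
have rE (x : R) : x * expR (1 / 2 * T) * expR (- (1 / 2) * t) = x * r.
  by rewrite -mulrA -expRD /r; congr (_ * expR _); ring.
rewrite rE in hD.
have {}hr : r <= 1 / 4 by have := rE 1; rewrite [1 * expR _]mul1r [1 * r]mul1r => <-.
pose q := r ^+ 2.
have q0 : 0 <= q by rewrite exprn_ge0 // ltW.
have qr : q <= r / 4 by clear -r0 hr; rewrite /q; nra.
have qE j : q ^+ j = expR (- j%:R * (t - T)).
  rewrite /q -exprM /r -expRM_natl; by congr expR; rewrite natrM; field.
pose C := 2 * M / r.
have C0 : 0 <= C by rewrite divr_ge0 ?mulr_ge0 // ltW.
have aC j : `|a j t| <= C * q ^+ j.
  have [->|j0] := posnP j; first by rewrite /a m00 // mulr0 normr0; apply: mulr_ge0 => //; exact: exprn_ge0.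
  have [/(_ _ Tt) h _] := dec j j0.
  rewrite aN; apply: (@le_trans _ _ (`|a j T| * expR (- (j%:R - 1 / 2) * (t - T)))).
    by rewrite !aN -[leRHS]mulrA ler_wpM2l // ltW.
  have -> : C * q ^+ j = 2 * M * expR (- (j%:R - 1 / 2) * (t - T)).
    rewrite /C qE -[_ / r * _]mulrA; congr (_ * _).
    by rewrite /r -expRN -expRD; congr expR; ring.
  by rewrite ler_wpM2r ?expR_ge0.
have ck_ge : A0 * q ^+ k <= `|a k t|.
  have [_ /(_ _ Tt) h] := dec k k0.
  by rewrite /A0 !aN qE -[leLHS]mulrA ler_wpM2l // ltW.
have sumk (F : nat -> R) : \sum_(j < k.+1) a j t * F j = a k t * F k.
  rewrite big_ord_recr /= big1 ?add0r // => j _.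
  by rewrite /a klt // mulr0 mul0r.
have aE j : a j t = 2 / pi * int0pi (fun x => u t x * cos (j%:R * x)) by [].
have q12 : q < 2^-1 by clear -qr hr; lra.
have qk0 : 0 <= q ^+ k by rewrite exprn_ge0.
have Dr : 2 ^+ k * M * r <= A0 / 32.
  rewrite /D in hD; clear -hD; rewrite ler_pdivlMr //.
  by move: (2 ^+ k) hD => X hD; lra.
split.
- apply: le_trans ck_ge; rewrite -mulrA -expRD qE ler_wpM2l ?(ltW A00) // ler_expR; clear; lra.
- have [/(_ _ Tt) h _] := dec k k0.
  rewrite aN; apply: (@le_trans _ _ (`|a k T| * expR (- (k%:R - 1 / 2) * (t - T)))).
    by rewrite !aN -[leRHS]mulrA ler_wpM2l // ltW.
  rewrite -[leRHS]mulrA -expRD; apply: ler_pM => //; rewrite ?expR_ge0 // ler_expR; clear; lra.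
- move=> x xpi; rewrite -(sumk (fun j => cos (j%:R * x))).
  have q01 : 0 <= q < 1 by rewrite q0; clear -q12; lra.
  have h := cos_expansion (cu _ T0t) (mean0 _ Tt) aE C0 q01 aC k.+1 xpi.
  apply: le_trans h _; rewrite ler_pdivlMr // mulrAC ler_pdivrMr; last by clear -q12; lra.
  have -> : C * q ^+ k.+1 * 2 = 4 * (M * r) * q ^+ k.
    by rewrite exprS /q /C; field; rewrite gt_eqF.
  have h1 : M * r <= 2 ^+ k * M * r.
    rewrite -mulrA ler_peMl ?mulr_ge0 ?(ltW r0) //.
    by rewrite -natrX ler1n expn_gt0.
  have h2 : 4 * (M * r) * q ^+ k <= A0 / 8 * q ^+ k by rewrite ler_wpM2r //; clear -h1 Dr; lra.
  by have a0 := normr_ge0 (a k t); clear -a0 h2 ck_ge q12 q0; nra.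
- move=> x y xpi ypi.
  rewrite -(sumk (fun j => cos (j%:R * x) - cos (j%:R * y))).
  have h := cos_expansion_dist (cu _ T0t) (mean0 _ Tt) aE C0 q0 q12 aC k.+1 xpi ypi.
  apply: le_trans h _; rewrite ler_wpM2r //.
  rewrite ler_pdivlMr // mulrAC ler_pdivrMr; last by clear -q12; lra.
  have -> : 2 * C * (2 * q) ^+ k.+1 * 2 = 16 * (2 ^+ k * M * r) * q ^+ k.
    by rewrite exprMn !exprS /q /C; field; rewrite gt_eqF.
  have h2 : 16 * (2 ^+ k * M * r) * q ^+ k <= A0 / 2 * q ^+ k by rewrite ler_wpM2r //; clear -Dr; lra.
  by have a0 := normr_ge0 (a k t); clear -a0 h2 ck_ge q12 q0 qr hr; nra.
Qed.

(** * Differentiable functions on the upper half-plane *)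

Lemma is_derive_ex (R : realType) (g : R * R -> R) (a b : R) :
  derivable g (a, b) ex -> is_derive a (1 : R) (fun s => g (s, b)) ('D_ex g (a, b)).
Proof.
have E : (fun h : R => h^-1 *: ((g \o shift (a, b)) (h *: ex) - g (a, b))) =
    (fun h : R => h^-1 *: (((fun s => g (s, b)) \o shift a) (h *: (1 : R)) - g (a, b))).
  apply/funext => h /=; congr (_ *: (g _ - _)).
  by apply/pair_equal_spec; split=> //=; rewrite /GRing.scale /= mulr0 add0r.
move=> dg; apply: DeriveDef; first by move: dg; rewrite /derivable E.
by rewrite /derive E.
Qed.

Lemma is_derive_ey (R : realType) (g : R * R -> R) (a b : R) :
  derivable g (a, b) ey -> is_derive b (1 : R) (fun s => g (a, s)) ('D_ey g (a, b)).
Proof.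
have E : (fun h : R => h^-1 *: ((g \o shift (a, b)) (h *: ey) - g (a, b))) =
    (fun h : R => h^-1 *: (((fun s => g (a, s)) \o shift b) (h *: (1 : R)) - g (a, b))).
  apply/funext => h /=; congr (_ *: (g _ - _)).
  by apply/pair_equal_spec; split=> //=; rewrite /GRing.scale /= mulr0 add0r.
move=> dg; apply: DeriveDef; first by move: dg; rewrite /derivable E.
by rewrite /derive E.
Qed.

Lemma MVT_dist (R : realType) (f df : R -> R) (s t : R) :
  (forall x, `|x - s| <= `|t - s| -> is_derive x (1 : R) f (df x)) ->
  exists2 c, `|c - s| <= `|t - s| & f t - f s = df c * (t - s).
Proof.
move=> fd.
have cont a b : (forall x, a <= x <= b -> `|x - s| <= `|t - s|) ->
    {within `[a, b], continuous f}.
  move=> h; apply: derivable_within_continuous => x; rewrite in_itv /= => /h xs.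
  by have [] := fd x xs.
have [st|ts] := leP s t.
  have h x : s <= x <= t -> `|x - s| <= `|t - s|.
    by move=> /andP[h1 h2]; rewrite !ger0_norm ?subr_ge0 // lerD2r.
  have [|c] := @MVT_segment R f df s t st _ (cont _ _ h).
    by move=> x; rewrite in_itv /= => /andP[h1 h2]; apply: fd; apply: h; rewrite !ltW.
  by rewrite in_itv /= => /h hc E; exists c.
have h x : t <= x <= s -> `|x - s| <= `|t - s|.
  by move=> /andP[h1 h2]; rewrite !(distrC _ s) !ger0_norm ?subr_ge0 ?(ltW ts) // lerD2l lerN2.
have [|c] := @MVT_segment R f df t s (ltW ts) _ (cont _ _ h).
  by move=> x; rewrite in_itv /= => /andP[h1 h2]; apply: fd; apply: h; rewrite !ltW.
rewrite in_itv /= => /h hc E; exists c => //.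
by rewrite -opprB E -mulrN opprB.
Qed.

Lemma near_pairP (R : realType) (P : R * R -> Prop) (z : R * R) :
  (\forall w \near z, P w) <->
  (exists2 d : R, 0 < d & forall x y, `|x - z.1| < d -> `|y - z.2| < d -> P (x, y)).
Proof.
split.
  move=> /nbhs_ballP[d /= d0 hd]; exists d => // x y h1 h2; apply: hd.
  by split; rewrite /ball /= distrC.
move=> [d d0 hd]; apply/nbhs_ballP; exists d => //= -[x y] [h1 h2].
by apply: hd; rewrite distrC; [exact: h1|exact: h2].
Qed.

Lemma continuous_pairP (R : realType) (g : R * R -> R) (z : R * R) :
  {for z, continuous g} <->
  (forall e : R, 0 < e -> exists2 d : R, 0 < d & forall x y,
    `|x - z.1| < d -> `|y - z.2| < d -> `|g (x, y) - g z| < e).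
Proof.
split.
  move=> /cvgrPdist_lt h e e0.
  have /near_pairP[d d0 hd] : \forall w \near z, `|g z - g w| < e by exact: h.
  by exists d => // x y h1 h2; rewrite distrC; exact: hd.
move=> h; apply/cvgrPdist_lt => e e0.
suff : \forall w \near z, `|g z - g w| < e by [].
have [d d0 hd] := h e e0; apply/near_pairP; exists d => // x y h1 h2.
by rewrite distrC; exact: hd.
Qed.

Definition C1_at (R : realType) (g : R * R -> R) (z : R * R) : Prop :=
  [/\ \forall w \near z, derivable g w ex /\ derivable g w ey,
      {for z, continuous ('D_ex g)} & {for z, continuous ('D_ey g)}].

(** The mean value theorem along the two legs of an axis-parallel path: [p] and [q] are partial
    derivatives at intermediate points. Continuity and the chain rule along curves both follow from
    this form. *)
Lemma C1_increment (R : realType) (g : R * R -> R) (z : R * R) (e : R) : C1_at g z -> 0 < e ->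
  exists2 d : R, 0 < d & forall a b, `|a| < d -> `|b| < d ->
    exists p q, [/\ `|p - 'D_ex g z| < e, `|q - 'D_ey g z| < e &
      g (z.1 + a, z.2 + b) - g z = p * a + q * b].
Proof.
case: z => z1 z2 [nd cx cy] e0.
have [d [d0 hdx hdy hcx hcy]] : exists d : R, [/\ 0 < d,
    forall x y, `|x - z1| < d -> `|y - z2| < d -> derivable g (x, y) ex,
    forall x y, `|x - z1| < d -> `|y - z2| < d -> derivable g (x, y) ey,
    forall x y, `|x - z1| < d -> `|y - z2| < d -> `|'D_ex g (x, y) - 'D_ex g (z1, z2)| < e &
    forall x y, `|x - z1| < d -> `|y - z2| < d -> `|'D_ey g (x, y) - 'D_ey g (z1, z2)| < e].
  have [a a0 ha] := (near_pairP _ _).1 nd.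
  have [b b0 hb] := (continuous_pairP _ _).1 cx e e0.
  have [c c0 hc] := (continuous_pairP _ _).1 cy e e0.
  exists (Num.min a (Num.min b c)); split; first by rewrite !lt_min a0 b0 c0.
  - move=> x y; rewrite !lt_min => /and3P[h1 h2 h3] /and3P[k1 k2 k3]; by have [] := ha x y h1 k1.
  - move=> x y; rewrite !lt_min => /and3P[h1 h2 h3] /and3P[k1 k2 k3]; by have [] := ha x y h1 k1.
  - move=> x y; rewrite !lt_min => /and3P[h1 h2 h3] /and3P[k1 k2 k3]; exact: hb.
  - move=> x y; rewrite !lt_min => /and3P[h1 h2 h3] /and3P[k1 k2 k3]; exact: hc.
exists d => // a b ad bd.
have d1 x : `|x - z1| <= `|z1 + a - z1| -> `|x - z1| < d.
  by rewrite addrAC subrr add0r => h; apply: le_lt_trans h ad.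
have d2 y : `|y - z2| <= `|z2 + b - z2| -> `|y - z2| < d.
  by rewrite addrAC subrr add0r => h; apply: le_lt_trans h bd.
have zz (t : R) : `|t - t| < d by rewrite subrr normr0.
have [x hx Ex] : exists2 x, `|x - z1| <= `|z1 + a - z1| &
    g (z1 + a, z2) - g (z1, z2) = 'D_ex g (x, z2) * (z1 + a - z1).
  apply: (@MVT_dist R (fun s => g (s, z2)) (fun s => 'D_ex g (s, z2))) => x /d1 hx.
  by apply: is_derive_ex; exact: hdx.
have [y hy Ey] : exists2 y, `|y - z2| <= `|z2 + b - z2| &
    g (z1 + a, z2 + b) - g (z1 + a, z2) = 'D_ey g (z1 + a, y) * (z2 + b - z2).
  apply: (@MVT_dist R (fun s => g (z1 + a, s)) (fun s => 'D_ey g (z1 + a, s))) => y /d2 hy.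
  by apply: is_derive_ey; apply: hdy => //; apply: d1.
exists ('D_ex g (x, z2)), ('D_ey g (z1 + a, y)); split.
- by apply: hcx => //; apply: d1.
- by apply: hcy; [apply: d1|apply: d2].
- rewrite /= -(subrK (g (z1 + a, z2)) (g (z1 + a, z2 + b))) Ey.
  by rewrite -addrA Ex !(addrAC _ a) !(addrAC _ b) !subrr !add0r addrC.
Qed.

Lemma C1_continuous (R : realType) (g : R * R -> R) (z : R * R) : C1_at g z ->
  {for z, continuous g}.
Proof.
move=> gz; apply/continuous_pairP => e e0.
have [d d0] := C1_increment gz ltr01; move: ('D_ex g z) ('D_ey g z) => A B hd.
pose K := `|A| + `|B| + 2.
have K0 : 0 < K by rewrite ltr_wpDl // addr_ge0.
pose r := Num.min d (e / K).
have r0 : 0 < r by rewrite lt_min d0 divr_gt0.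
exists r => // x y w1 w2.
have [||p [q [pz qz E]]] := hd (x - z.1) (y - z.2).
- by apply: lt_le_trans w1 _; rewrite ge_min lexx.
- by apply: lt_le_trans w2 _; rewrite ge_min lexx.
move: E; rewrite !(addrC _ (_ - _)) !subrK => E.
rewrite E.
have hp : `|p| <= `|A| + 1.
  by have := ler_normD (p - A) (A); rewrite subrK; clear -pz; lra.
have hq : `|q| <= `|B| + 1.
  by have := ler_normD (q - B) (B); rewrite subrK; clear -qz; lra.
have re : r * K <= e by rewrite -ler_pdivlMr // ge_min lexx orbT.
apply: le_lt_trans (ler_normD _ _) _; rewrite !normrM.
have h1 : `|p| * `|x - z.1| <= (`|A| + 1) * `|x - z.1| by rewrite ler_wpM2r.
have h2 : `|q| * `|y - z.2| <= (`|B| + 1) * `|y - z.2| by rewrite ler_wpM2r.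
have h3 : (`|A| + 1) * `|x - z.1| < (`|A| + 1) * r.
  by rewrite ltr_pM2l // ltr_wpDl.
have h4 : (`|B| + 1) * `|y - z.2| < (`|B| + 1) * r.
  by rewrite ltr_pM2l // ltr_wpDl.
by rewrite /K in re; clear -re h1 h2 h3 h4; lra.
Qed.

Lemma is_derive_cvg (R : realType) (f : R -> R) (s df : R) :
  is_derive s (1 : R) f df -> (fun h : R => h^-1 * (f (h + s) - f s)) @ 0^' --> df.
Proof.
move=> [fd <-]; move: fd; rewrite /derivable /derive /=.
have -> : (fun h : R => h^-1 *: (f (h *: (1 : R) + s) - f s)) = (fun h => h^-1 * (f (h + s) - f s)).
  by apply/funext => h; rewrite /GRing.scale /= mulr1.
by [].
Qed.

Lemma is_derive_along (R : realType) (g : R * R -> R) (X Y : R -> R) (s dX dY : R) :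
  C1_at g (X s, Y s) -> is_derive s (1 : R) X dX -> is_derive s (1 : R) Y dY ->
  is_derive s (1 : R) (fun s => g (X s, Y s))
    ('D_ex g (X s, Y s) * dX + 'D_ey g (X s, Y s) * dY).
Proof.
move=> gz dXs dYs; set z := (X s, Y s).
suff lim : (fun h : R => h^-1 * (g (X (h + s), Y (h + s)) - g z)) @ 0^' -->
    'D_ex g z * dX + 'D_ey g z * dY.
  have E : (fun h : R => h^-1 *: (((fun s => g (X s, Y s)) \o shift s) (h *: (1 : R)) - g z)) =
      (fun h : R => h^-1 * (g (X (h + s), Y (h + s)) - g z)).
    by apply/funext => h /=; rewrite /GRing.scale /= mulr1.
  apply: DeriveDef; first by rewrite /derivable E; apply/cvg_ex; eexists; exact: lim.
  by rewrite /derive E; apply/cvg_lim.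
have cX : {for s, continuous X}.
  by apply: differentiable_continuous; apply/derivable1_diffP; have [] := dXs.
have cY : {for s, continuous Y}.
  by apply: differentiable_continuous; apply/derivable1_diffP; have [] := dYs.
have qX := is_derive_cvg dXs; have qY := is_derive_cvg dYs.
have := fun e => @C1_increment R g z e gz; move: ('D_ex g z) ('D_ey g z) => A B inc.
pose M := `|dX| + `|dY| + `|A| + `|B| + 2.
have M0 : 0 < M by rewrite /M; have := normr_ge0 dX; have := normr_ge0 dY;
  have := normr_ge0 A; have := normr_ge0 B; clear; lra.
apply/cvgrPdist_le => e e0.
pose e' := Num.min 1 (e / (2 * M)).
have e'0 : 0 < e' by rewrite lt_min ltr01 divr_gt0 // mulr_gt0.
have e'1 : e' <= 1 by rewrite ge_min lexx.
have e'M : 2 * M * e' <= e.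
  by rewrite mulrC -ler_pdivlMr ?mulr_gt0 // ge_min lexx orbT.
have [d d0 hd] := inc e' e'0.
have cX0 : (fun h : R => X (h + s)) @ 0^' --> X s.
  apply: cvg_within_filter; apply: (@cvg_comp _ _ _ (fun h => h + s) X _ (nbhs s)) => //.
  have := @cvgD R R R (nbhs 0) _ id (cst s) 0 s; rewrite add0r; apply; first exact: cvg_id.
  exact: cvg_cst.
have cY0 : (fun h : R => Y (h + s)) @ 0^' --> Y s.
  apply: cvg_within_filter; apply: (@cvg_comp _ _ _ (fun h => h + s) Y _ (nbhs s)) => //.
  have := @cvgD R R R (nbhs 0) _ id (cst s) 0 s; rewrite add0r; apply; first exact: cvg_id.
  exact: cvg_cst.
have /cvgrPdist_lt /(_ _ d0) nX := cX0.
have /cvgrPdist_lt /(_ _ d0) nY := cY0.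
have /cvgrPdist_le /(_ _ e'0) nqX := qX.
have /cvgrPdist_le /(_ _ e'0) nqY := qY.
near=> h.
have [||p [q [pz qz E]]] := hd (X (h + s) - X s) (Y (h + s) - Y s).
- by rewrite distrC; near: h; exact: nX.
- by rewrite distrC; near: h; exact: nY.
move: E; rewrite /= !(addrC _ (_ - _)) !subrK => ->.
have xh : `|dX - h^-1 * (X (h + s) - X s)| <= e' by near: h; exact: nqX.
have yh : `|dY - h^-1 * (Y (h + s) - Y s)| <= e' by near: h; exact: nqY.
set u := h^-1 * (X _ - _) in xh; set v := h^-1 * (Y _ - _) in yh.
have -> : h^-1 * (p * (X (h + s) - X s) + q * (Y (h + s) - Y s)) = p * u + q * v.
  by rewrite /u /v; ring.
have -> : A * dX + B * dY - (p * u + q * v) =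
  ((A - p) * dX + p * (dX - u)) + ((B - q) * dY + q * (dY - v)) by ring.
have hp : `|p| <= `|A| + 1.
  by have := ler_normD (p - A) (A); rewrite subrK; clear -pz e'1; lra.
have hq : `|q| <= `|B| + 1.
  by have := ler_normD (q - B) (B); rewrite subrK; clear -qz e'1; lra.
apply: le_trans (ler_normD _ _) _.
have h1 := ler_normD ((A - p) * dX) (p * (dX - u)).
have h2 := ler_normD ((B - q) * dY) (q * (dY - v)).
rewrite !normrM in h1 h2.
have k1 : `|A - p| * `|dX| <= e' * `|dX| by rewrite ler_wpM2r // distrC ltW.
have k2 : `|B - q| * `|dY| <= e' * `|dY| by rewrite ler_wpM2r // distrC ltW.
have k3 : `|p| * `|dX - u| <= (`|A| + 1) * e' by apply: ler_pM.
have k4 : `|q| * `|dY - v| <= (`|B| + 1) * e' by apply: ler_pM.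
have E : M * e' = e' * `|dX| + e' * `|dY| + (`|A| + 1) * e' + (`|B| + 1) * e'.
  by rewrite /M; ring.
have Me : M * e' <= 2 * M * e'.
  by rewrite -mulrA; apply: ler_peMl; rewrite ?ler1n // mulr_ge0 // ltW.
clear -h1 h2 k1 k2 k3 k4 E Me e'M; lra.
Unshelve. all: end_near. Qed.

Lemma near_hplane (R : realType) (z : R * R) : 0 < z.2 -> \forall w \near z, 0 < w.2.
Proof.
move=> z0; apply/nbhs_ballP; exists z.2 => //= w [_].
by rewrite /ball /= ltr_norml => /andP[_]; lra.
Qed.

Lemma tcd_C1_D (R : realType) (f : R * R -> R) (z v : R * R) :
  twice_cont_diff f -> 0 < z.2 -> C1_at ('D_v f) z.
Proof.
move=> hf z0; split.
- apply: filterS (near_hplane z0) => w w0.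
  by split; [have [_ + _] := hf w v ex w0|have [_ + _] := hf w v ey w0].
- by have [_ _] := hf z v ex z0.
- by have [_ _] := hf z v ey z0.
Qed.

Lemma tcd_C1 (R : realType) (f : R * R -> R) (z : R * R) :
  twice_cont_diff f -> 0 < z.2 -> C1_at f z.
Proof.
move=> hf z0; split.
- apply: filterS (near_hplane z0) => w w0.
  by split; [have [+ _ _] := hf w ex ex w0|have [+ _ _] := hf w ey ey w0].
- exact/C1_continuous/tcd_C1_D.
- exact/C1_continuous/tcd_C1_D.
Qed.

Lemma even_is_derive0 (R : realType) (f : R -> R) (a d : R) :
  (forall h, f (a + h) = f (a - h)) -> is_derive a (1 : R) f d -> d = 0.
Proof.
move=> fE fd.
have d1 : is_derive (0 : R) (1 : R) (fun h => f (a + h)) d.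
  have h1 : is_derive (0 : R) (1 : R) (fun h => a + h) 1.
    by apply: is_derive_eq; rewrite add0r mulr1.
  have h2 : is_derive (a + 0) (1 : R) f d by rewrite addr0.
  by have := @is_derive1_comp R f (fun h => a + h) 0 d 1 h2 h1; rewrite mulr1.
have d2 : is_derive (0 : R) (1 : R) (fun h => f (a - h)) (- d).
  have h1 : is_derive (0 : R) (1 : R) (fun h => a - h) (-1).
    by apply: is_derive_eq; rewrite add0r mul1r.
  have h2 : is_derive (a - 0) (1 : R) f d by rewrite subr0.
  by have := @is_derive1_comp R f (fun h => a - h) 0 d (-1) h2 h1; rewrite mulrN1.
have E : (fun h => f (a + h)) = (fun h => f (a - h)) by apply/funext => h.
have [_ e1] := d1; have [_ e2] := d2; move: e1; rewrite E e2; lra.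
Qed.

Lemma is_derive_sum_prod (R : realType) (a b c d : R -> R) (t a' b' c' d' : R) :
  is_derive t (1 : R) a a' -> is_derive t (1 : R) b b' ->
  is_derive t (1 : R) c c' -> is_derive t (1 : R) d d' ->
  is_derive t (1 : R) (fun t => a t * b t + c t * d t)
    (a' * b t + a t * b' + (c' * d t + c t * d')).
Proof.
by move=> ha hb hc hd; apply: is_derive_eq; rewrite /GRing.scale /=; ring.
Qed.

(** * Conformal changes of coordinates *)

Definition joint_continuous (R : realType) (g : R -> R -> R) (T0 : R) : Prop :=
  forall t x, T0 < t -> {for (t, x), continuous (fun p : R * R => g p.1 p.2)}.

Lemma joint_continuousD (R : realType) (f g : R -> R -> R) (T0 : R) :
  joint_continuous f T0 -> joint_continuous g T0 ->
  joint_continuous (fun t x => f t x + g t x) T0.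
Proof. by move=> hf hg t x ht; apply: cvgD; [exact: hf|exact: hg]. Qed.

Lemma joint_continuousM (R : realType) (f g : R -> R -> R) (T0 : R) :
  joint_continuous f T0 -> joint_continuous g T0 ->
  joint_continuous (fun t x => f t x * g t x) T0.
Proof. by move=> hf hg t x ht; apply: cvgM; [exact: hf|exact: hg]. Qed.

Lemma joint_continuous_comp (R : realType) (G : R * R -> R) (X Y : R -> R -> R) (T0 : R) :
  joint_continuous X T0 -> joint_continuous Y T0 ->
  (forall t x, T0 < t -> {for (X t x, Y t x), continuous G}) ->
  joint_continuous (fun t x => G (X t x, Y t x)) T0.
Proof.
move=> hX hY hG t x ht; apply/continuous_pairP => e e0.
have [d d0 hd] := (continuous_pairP _ _).1 (hG t x ht) e e0.
have [a a0 ha] := (continuous_pairP _ _).1 (hX t x ht) d d0.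
have [b b0 hb] := (continuous_pairP _ _).1 (hY t x ht) d d0.
exists (Num.min a b); first by rewrite lt_min a0 b0.
move=> s y; rewrite !lt_min => /andP[h1 h2] /andP[h3 h4] /=.
by apply: hd; [exact: ha|exact: hb].
Qed.

Lemma joint_continuous_slice (R : realType) (g : R -> R -> R) (T0 t : R) :
  joint_continuous g T0 -> T0 < t -> continuous (g t).
Proof.
move=> hg ht x; apply/cvgrPdist_lt => e e0.
have [d d0 hd] := (continuous_pairP _ _).1 (hg t x ht) e e0.
apply/nbhs_ballP; exists d => //= y; rewrite /ball /= distrC => xy.
by rewrite distrC; apply: (hd t y) => //=; rewrite subrr normr0.
Qed.

Lemma joint_continuous_bounded (R : realType) (g : R -> R -> R) (T0 a b : R) :
  joint_continuous g T0 -> T0 < a -> a <= b ->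
  exists M, forall t x, a <= t <= b -> 0 <= x <= pi -> `|g t x| <= M.
Proof.
move=> hg Ta ab; pose A : set (R * R) := `[a, b]%classic `*` `[0, pi]%classic.
have cA : compact A by apply: compact_setX; exact: segment_compact.
have A0 : A !=set0.
  by exists (a, 0); split; rewrite /= in_itv /= ?lexx ?ab ?pi_ge0.
have [|c _ hc] := @compact_EVT_max (R * R)%type R (fun p : R * R => `|g p.1 p.2|) A A0 cA.
  apply: continuous_in_subspaceT => -[t x]; rewrite inE => -[/=].
  rewrite in_itv /= => /andP[h1 h2] _; apply: cvg_norm; apply: (hg t x); lra.
exists `|g c.1 c.2| => t x ht hx; apply: (hc (t, x)).
by rewrite inE; split; rewrite /= in_itv.
Qed.

(** [conf_norm] and [conf_orth] say that the gradients of [X] and [Y] are orthogonal and of equal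
    length; orientation may be reversed, as it is for the polar and the cusp coordinates below. *)
Record conformal_map (R : realType) (X Y Xt Yt Xx Yx Xtt Ytt Xxx Yxx : R -> R -> R)
    (T0 : R) : Prop := {
  conf_gt0 : forall t x, T0 < t -> 0 < Y t x;
  conf_Xt : forall t x, T0 < t -> is_derive t (1 : R) (X^~ x) (Xt t x);
  conf_Yt : forall t x, T0 < t -> is_derive t (1 : R) (Y^~ x) (Yt t x);
  conf_Xtt : forall t x, T0 < t -> is_derive t (1 : R) (Xt^~ x) (Xtt t x);
  conf_Ytt : forall t x, T0 < t -> is_derive t (1 : R) (Yt^~ x) (Ytt t x);
  conf_Xx : forall t x, T0 < t -> is_derive x (1 : R) (X t) (Xx t x);
  conf_Yx : forall t x, T0 < t -> is_derive x (1 : R) (Y t) (Yx t x);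
  conf_Xxx : forall t x, T0 < t -> is_derive x (1 : R) (Xx t) (Xxx t x);
  conf_Yxx : forall t x, T0 < t -> is_derive x (1 : R) (Yx t) (Yxx t x);
  conf_cX : joint_continuous X T0;
  conf_cY : joint_continuous Y T0;
  conf_cXt : joint_continuous Xt T0;
  conf_cYt : joint_continuous Yt T0;
  conf_cXtt : joint_continuous Xtt T0;
  conf_cYtt : joint_continuous Ytt T0;
  conf_norm : forall t x, T0 < t -> Xt t x ^+ 2 + Xx t x ^+ 2 = Yt t x ^+ 2 + Yx t x ^+ 2;
  conf_orth : forall t x, T0 < t -> Xt t x * Yt t x + Xx t x * Yx t x = 0;
  conf_harmX : forall t x, T0 < t -> Xtt t x + Xxx t x = 0;
  conf_harmY : forall t x, T0 < t -> Ytt t x + Yxx t x = 0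
}.

(** The chain rule for [f (X, Y)]: [p q r s] stand for the second and [m n] for the first
    derivatives of [f], [A B] and [C D] for those of [(X, Y)] in [t] and in [x], [a b] and [c d] for
    the second ones. *)
Lemma conformal_laplacian (R : realType) (p q r s m n A B C D a b c d : R) :
  A ^+ 2 + C ^+ 2 = B ^+ 2 + D ^+ 2 -> A * B + C * D = 0 -> a + c = 0 -> b + d = 0 ->
  ((p * A + q * B) * A + m * a + ((r * A + s * B) * B + n * b)) +
  ((p * C + q * D) * C + m * c + ((r * C + s * D) * D + n * d)) =
  (p + s) * (A ^+ 2 + C ^+ 2).
Proof.
move=> e2 e3 e4 e5.
transitivity (p * (A ^+ 2 + C ^+ 2) + s * (B ^+ 2 + D ^+ 2) + (q + r) * (A * B + C * D) +
  m * (a + c) + n * (b + d)); first by ring.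
by rewrite e3 e4 e5 -e2; ring.
Qed.

(** The hypothesis on [V] says that the hyperbolic metric has a density depending on [t] alone,
    which is what makes the variables separate. The two reflection hypotheses become the Neumann
    conditions. *)
Lemma conformal_cylinder (R : realType) (f : R * R -> R) (l : R)
    (X Y Xt Yt Xx Yx Xtt Ytt Xxx Yxx : R -> R -> R) (V : R -> R) (T0 : R) :
  twice_cont_diff f ->
  (forall z, 0 < z.2 -> z.2 ^+ 2 * laplacian f z + l * f z = 0) ->
  conformal_map X Y Xt Yt Xx Yx Xtt Ytt Xxx Yxx T0 ->
  (forall t x, T0 < t -> l * (Xt t x ^+ 2 + Xx t x ^+ 2) = V t * Y t x ^+ 2) ->
  (forall t x, T0 < t -> f (X t (- x), Y t (- x)) = f (X t x, Y t x)) ->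
  (forall t x, T0 < t -> f (X t (pi + x), Y t (pi + x)) = f (X t (pi - x), Y t (pi - x))) ->
  exists ut utt ux uxx,
    cylinder_solution (fun t x => f (X t x, Y t x)) ut utt ux uxx V T0.
Proof.
move=> hf fE [Y0 dXt dYt dXtt dYtt dXx dYx dXxx dYxx cX cY cXt cYt cXtt cYtt cnorm corth hX hY] VE ev0 evpi.
pose D1 (v : R * R) t x := 'D_v f (X t x, Y t x).
pose D2 (v w : R * R) t x := 'D_w ('D_v f) (X t x, Y t x).
pose ut t x := D1 ex t x * Xt t x + D1 ey t x * Yt t x.
pose utt t x := (D2 ex ex t x * Xt t x + D2 ex ey t x * Yt t x) * Xt t x + D1 ex t x * Xtt t x +
  ((D2 ey ex t x * Xt t x + D2 ey ey t x * Yt t x) * Yt t x + D1 ey t x * Ytt t x).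
pose ux t x := D1 ex t x * Xx t x + D1 ey t x * Yx t x.
pose uxx t x := (D2 ex ex t x * Xx t x + D2 ex ey t x * Yx t x) * Xx t x + D1 ex t x * Xxx t x +
  ((D2 ey ex t x * Xx t x + D2 ey ey t x * Yx t x) * Yx t x + D1 ey t x * Yxx t x).
have c1 v : joint_continuous (D1 v) T0.
  apply: (@joint_continuous_comp R ('D_v f) X Y) => // t x ht; apply: C1_continuous.
  by apply: tcd_C1_D => //=; exact: Y0.
have c2 v w : joint_continuous (D2 v w) T0.
  apply: (@joint_continuous_comp R ('D_w ('D_v f)) X Y) => // t x ht.
  by have [] := hf (X t x, Y t x) v w (Y0 t x ht).
have cut : joint_continuous ut T0.
  by apply: joint_continuousD; apply: joint_continuousM.
have cutt : joint_continuous utt T0.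
  have k v : joint_continuous (fun t x => D2 v ex t x * Xt t x + D2 v ey t x * Yt t x) T0.
    exact: (joint_continuousD (joint_continuousM (c2 v ex) cXt) (joint_continuousM (c2 v ey) cYt)).
  apply: joint_continuousD.
    exact: (joint_continuousD (joint_continuousM (k ex) cXt) (joint_continuousM (c1 ex) cXtt)).
  exact: (joint_continuousD (joint_continuousM (k ey) cYt) (joint_continuousM (c1 ey) cYtt)).
have dux t x : T0 < t -> is_derive x (1 : R) (fun x => f (X t x, Y t x)) (ux t x).
  move=> ht; apply: is_derive_along; [|exact: dXx|exact: dYx].
  by apply: tcd_C1 => //=; exact: Y0.
exists ut, utt, ux, uxx; split => //.
- move=> t x ht; apply: is_derive_along; [|exact: dXt|exact: dYt].
  by apply: tcd_C1 => //=; exact: Y0.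
- move=> t x ht.
  have h v := is_derive_along (tcd_C1_D v hf (Y0 t x ht : 0 < (X t x, Y t x).2)) (dXt t x ht) (dYt t x ht).
  exact: (is_derive_sum_prod (h ex) (dXtt t x ht) (h ey) (dYtt t x ht)).
- move=> t x ht.
  have h v := is_derive_along (tcd_C1_D v hf (Y0 t x ht : 0 < (X t x, Y t x).2)) (dXx t x ht) (dYx t x ht).
  exact: (is_derive_sum_prod (h ex) (dXxx t x ht) (h ey) (dYxx t x ht)).
- by move=> t ht; exact: joint_continuous_slice cut ht.
- by move=> t ht; exact: joint_continuous_slice cutt ht.
- move=> a b Ta ab.
  have [M1 h1] := joint_continuous_bounded cut Ta ab.
  have [M2 h2] := joint_continuous_bounded cutt Ta ab.
  exists (Num.max M1 M2) => t x ht hx; rewrite !le_max h1 // h2 //.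
  by rewrite orbT.
- move=> t x ht.
  have y0 := Y0 t x ht.
  have := fE (X t x, Y t x) y0; rewrite /laplacian /= -/(D2 ex ex t x) -/(D2 ey ey t x) => e1.
  have e2 := cnorm t x ht; have e3 := corth t x ht; have e4 := hX t x ht; have e5 := hY t x ht.
  have e6 := VE t x ht.
  have -> : utt t x + uxx t x = (D2 ex ex t x + D2 ey ey t x) * (Xt t x ^+ 2 + Xx t x ^+ 2).
    exact: conformal_laplacian e2 e3 e4 e5.
  set J := Xt t x ^+ 2 + Xx t x ^+ 2 in e6 *; set L := D2 ex ex t x + _ in e1 *.
  set F := f _ in e1 *.
  have Y2 : Y t x ^+ 2 != 0 by rewrite expf_neq0 // gt_eqF.
  apply: (mulfI Y2); rewrite mulr0.
  have -> : Y t x ^+ 2 * (L * J + V t * F) = (Y t x ^+ 2 * L + l * F) * J + (V t * Y t x ^+ 2 - l * J) * F by ring.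
  by rewrite e1 e6 subrr !mul0r addr0.
- move=> t ht; split; apply: even_is_derive0 (dux t _ ht).
    by move=> h; rewrite add0r sub0r ev0.
  by move=> h; rewrite evpi.
Qed.

(** * Hyperbolic polar coordinates *)

Lemma joint_continuous_fst (R : realType) (f : R -> R) (T0 : R) :
  continuous f -> joint_continuous (fun t _ => f t) T0.
Proof.
move=> cf t x _; apply: (@cvg_comp _ _ _ fst f _ (nbhs t)); last exact: cf.
exact: cvg_fst.
Qed.

Lemma joint_continuous_snd (R : realType) (f : R -> R) (T0 : R) :
  continuous f -> joint_continuous (fun _ x => f x) T0.
Proof.
move=> cf t x _; apply: (@cvg_comp _ _ _ snd f _ (nbhs x)); last exact: cf.
exact: cvg_snd.
Qed.

Lemma joint_continuous_cst (R : realType) (a T0 : R) : joint_continuous (fun _ _ => a) T0.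
Proof. by move=> t x _; exact: cvg_cst. Qed.

Definition ch (R : realType) (t : R) : R := (expR t + expR (- t)) / 2.
Definition sh (R : realType) (t : R) : R := (expR t - expR (- t)) / 2.

Lemma is_derive_ch (R : realType) (t : R) : is_derive t (1 : R) (@ch R) (sh t).
Proof. by rewrite /ch; apply: is_derive_eq; rewrite /GRing.scale /= /sh; ring. Qed.

Lemma is_derive_sh (R : realType) (t : R) : is_derive t (1 : R) (@sh R) (ch t).
Proof. by rewrite /sh; apply: is_derive_eq; rewrite /GRing.scale /= /ch; ring. Qed.

Lemma ch2B (R : realType) (t : R) : ch t ^+ 2 - sh t ^+ 2 = 1.
Proof.
have := expRD t (- t); rewrite subrr expR0 => h.
have -> : ch t ^+ 2 - sh t ^+ 2 = expR t * expR (- t) by rewrite /ch /sh; field.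
by rewrite h.
Qed.

Lemma sh_ge (R : realType) (t : R) : 0 < t -> t / 2 <= sh t.
Proof.
move=> t0; have h1 := expR_ge1Dx t.
have h2 : expR (- t) <= 1 by rewrite -expR0 ler_expR; lra.
by rewrite /sh; lra.
Qed.

Lemma sh_gt0 (R : realType) (t : R) : 0 < t -> 0 < sh t.
Proof. by move=> t0; have := sh_ge t0; lra. Qed.

Lemma ch_gt1 (R : realType) (t : R) : 0 < t -> 1 < ch t.
Proof.
move=> t0; have h1 := ch2B t; have h2 := sh_ge t0.
have h3 : 0 <= ch t by rewrite divr_ge0 // addr_ge0 // expR_ge0.
by nra.
Qed.

Lemma polar_den_gt0 (R : realType) (t x : R) : 0 < t -> 0 < ch t - cos x.
Proof. by move=> /ch_gt1 h; have := cos_le1 x; lra. Qed.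

(* Hyperbolic polar coordinates about (x0, y0): the point at w = exp(- t + i x) of
   the unit disc is sent to x0 + i y0 (1 + w) / (1 - w). *)
Definition polM (R : realType) (t x : R) : R := (ch t - cos x)^-1.
Definition polX (R : realType) (x0 y0 t x : R) : R := x0 - y0 * sin x * polM t x.
Definition polY (R : realType) (y0 t x : R) : R := y0 * sh t * polM t x.

Lemma polY_gt0 (R : realType) (y0 t x : R) : 0 < y0 -> 0 < t -> 0 < polY y0 t x.
Proof.
move=> y0p t0; apply: mulr_gt0; last by rewrite invr_gt0 polar_den_gt0.
by apply: mulr_gt0 => //; exact: sh_gt0.
Qed.

Lemma is_derive_polM_t (R : realType) (t x : R) : 0 < t ->
  is_derive t (1 : R) (fun s : R => polM s x) (- sh t * polM t x ^+ 2).
Proof.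
move=> t0; have n0 := lt0r_neq0 (polar_den_gt0 x t0).
have h := is_derive_ch t.
have h1 : is_derive t (1 : R) (fun t => ch t - cos x) (sh t).
  by apply: is_derive_eq; rewrite subr0.
have -> : - sh t * polM t x ^+ 2 = - (ch t - cos x) ^- 2 *: sh t.
  by rewrite /GRing.scale /= /polM exprVn !mulNr mulrC.
exact: (@is_deriveV R (fun t => ch t - cos x) t _ (1 : R) n0 h1).
Qed.

Lemma is_derive_polM_x (R : realType) (t x : R) : 0 < t ->
  is_derive x (1 : R) (polM t) (- sin x * polM t x ^+ 2).
Proof.
move=> t0; have n0 := lt0r_neq0 (polar_den_gt0 x t0).
have h1 : is_derive x (1 : R) (fun x => ch t - cos x) (sin x).
  by apply: is_derive_eq; rewrite /GRing.scale /=; ring.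
have -> : - sin x * polM t x ^+ 2 = - (ch t - cos x) ^- 2 *: sin x.
  by rewrite /GRing.scale /= /polM exprVn !mulNr mulrC.
exact: (@is_deriveV R (fun x => ch t - cos x) x _ (1 : R) n0 h1).
Qed.

(** A rotation of the angle, used to place the axis of symmetry of [f] at angle 0. *)
Lemma conformal_map_shift (R : realType) (X Y Xt Yt Xx Yx Xtt Ytt Xxx Yxx : R -> R -> R) (T0 a : R) :
  let s (g : R -> R -> R) := fun t x => g t (x + a) in
  conformal_map X Y Xt Yt Xx Yx Xtt Ytt Xxx Yxx T0 ->
  conformal_map (s X) (s Y) (s Xt) (s Yt) (s Xx) (s Yx) (s Xtt) (s Ytt) (s Xxx) (s Yxx) T0.
Proof.
move=> s [h1 h2 h3 h4 h5 h6 h7 h8 h9 h10 h11 h12 h13 h14 h15 h16 h17 h18 h19].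
have dx (f f' : R -> R -> R) : (forall t x, T0 < t -> is_derive x (1 : R) (f t) (f' t x)) ->
    forall t x, T0 < t -> is_derive x (1 : R) (s f t) (s f' t x).
  move=> hf t x ht.
  have k1 : is_derive x (1 : R) (fun x => x + a) 1 by apply: is_derive_eq; rewrite addr0.
  by have := @is_derive1_comp R (f t) (fun x => x + a) x _ 1 (hf t (x + a) ht) k1; rewrite mulr1.
have cx (f : R -> R -> R) : joint_continuous f T0 -> joint_continuous (s f) T0.
  move=> hf t x ht; apply/continuous_pairP => e e0.
  have [d d0 hd] := (continuous_pairP _ _).1 (hf t (x + a) ht) e e0.
  exists d => // t' x' /= ht' hx'; apply: (hd t' (x' + a)) => //=.
  by rewrite opprD addrACA subrr addr0.
split=> [t x|t x|t x|t x|t x|||||||||||t x|t x|t x|t x]; rewrite /s; [exact: h1|exact: h2|exact: h3|exact: h4|exact: h5|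
  exact: dx h6|exact: dx h7|exact: dx h8|exact: dx h9|exact: cx h10|exact: cx h11|exact: cx h12|exact: cx h13|
  exact: cx h14|exact: cx h15|exact: h16|exact: h17|exact: h18|exact: h19].
Qed.

(** The last identity expresses the hyperbolic metric as [(dt^2 + dx^2) / sh(t)^2]; it turns the
    eigenvalue [l] into the exponentially small potential [l / sh t ^+ 2]. *)
Lemma polar_conformal (R : realType) (x0 y0 : R) : 0 < y0 ->
  exists Xt Yt Xx Yx Xtt Ytt Xxx Yxx,
    conformal_map (polX x0 y0) (polY y0) Xt Yt Xx Yx Xtt Ytt Xxx Yxx 0 /\
    forall t x, 0 < t -> (Xt t x ^+ 2 + Xx t x ^+ 2) * sh t ^+ 2 = polY y0 t x ^+ 2.
Proof.
move=> y0p.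
pose M : R -> R -> R := @polM R.
pose Xt (t x : R) : R := y0 * sin x * sh t * M t x ^+ 2.
pose Xx (t x : R) : R := - y0 * (cos x * M t x - sin x ^+ 2 * M t x ^+ 2).
pose Yt (t x : R) : R := y0 * (ch t * M t x - sh t ^+ 2 * M t x ^+ 2).
pose Yx (t x : R) : R := - y0 * sh t * sin x * M t x ^+ 2.
pose Xtt (t x : R) : R := y0 * sin x * (ch t * M t x ^+ 2 - 2 * sh t ^+ 2 * M t x ^+ 3).
pose Ytt (t x : R) : R := y0 * (sh t * M t x - 3 * sh t * ch t * M t x ^+ 2 + 2 * sh t ^+ 3 * M t x ^+ 3).
pose Xxx (t x : R) : R := y0 * (sin x * M t x + 3 * sin x * cos x * M t x ^+ 2 - 2 * sin x ^+ 3 * M t x ^+ 3).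
pose Yxx (t x : R) : R := - y0 * sh t * (cos x * M t x ^+ 2 - 2 * sin x ^+ 2 * M t x ^+ 3).
have dMt (t x : R) : 0 < t -> is_derive t (1 : R) (fun s : R => M s x) (- sh t * M t x ^+ 2) by exact: is_derive_polM_t.
have dMx (t x : R) : 0 < t -> is_derive x (1 : R) (M t) (- sin x * M t x ^+ 2) by exact: is_derive_polM_x.
have cch : continuous (@ch R) by exact: (is_derive_continuous (@is_derive_ch R)).
have csh : continuous (@sh R) by exact: (is_derive_continuous (@is_derive_sh R)).
have jch := @joint_continuous_fst R _ 0 cch.
have jsh := @joint_continuous_fst R _ 0 csh.
have jcos := @joint_continuous_snd R _ 0 (@continuous_cos R).
have jsin := @joint_continuous_snd R _ 0 (@continuous_sin R).
have jM : joint_continuous M 0.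
  move=> t x t0; apply: cvgV; first exact: lt0r_neq0 (polar_den_gt0 x t0).
  by apply: cvgB; [exact: (jch t x t0)|exact: (jcos t x t0)].
have jc a := @joint_continuous_cst R a 0.
have jX n (f : R -> R -> R) : joint_continuous f 0 -> joint_continuous (fun t x => f t x ^+ n) 0.
  move=> hf; elim: n => [|n IH].
    exact: (jc 1).
  have -> : (fun t x => f t x ^+ n.+1) = (fun t x => f t x * f t x ^+ n).
    by apply/funext => t; apply/funext => x; rewrite exprS.
  exact: joint_continuousM.
have jN (f : R -> R -> R) : joint_continuous f 0 -> joint_continuous (fun t x => - f t x) 0.
  by move=> hf t x t0; apply: cvgN; exact: hf.
have MN t x : 0 < t -> M t x * (ch t - cos x) = 1.
  by move=> t0; rewrite mulVf // lt0r_neq0 // polar_den_gt0.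
have sc (x : R) : sin x ^+ 2 = 1 - cos x ^+ 2 by exact: sin2cos2.
have SC (t : R) : sh t ^+ 2 = ch t ^+ 2 - 1 by have := ch2B t; lra.
(* Using [M t x * (ch t - cos x) = 1], both [Xx] and [Yt] are brought to the same form, one of the
   Cauchy-Riemann equations. *)
have XxE t x : 0 < t -> Xx t x = y0 * (1 - ch t * cos x) * M t x ^+ 2.
  move=> t0; rewrite /Xx sc; have e := MN t x t0.
  have -> : cos x * M t x = cos x * (M t x * (ch t - cos x)) * M t x by rewrite e; ring.
  by ring.
have YtE t x : 0 < t -> Yt t x = y0 * (1 - ch t * cos x) * M t x ^+ 2.
  move=> t0; rewrite /Yt SC; have e := MN t x t0.
  have -> : ch t * M t x = ch t * (M t x * (ch t - cos x)) * M t x by rewrite e; ring.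
  by ring.
exists Xt, Yt, Xx, Yx, Xtt, Ytt, Xxx, Yxx; split; last first.
  move=> t x t0; rewrite XxE // /Xt /polY -/(M t x).
  have -> : (y0 * sin x * sh t * M t x ^+ 2) ^+ 2 + (y0 * (1 - ch t * cos x) * M t x ^+ 2) ^+ 2 =
    y0 ^+ 2 * M t x ^+ 4 * (sin x ^+ 2 * sh t ^+ 2 + (1 - ch t * cos x) ^+ 2) by ring.
  rewrite {1}SC sc.
  have -> : (1 - cos x ^+ 2) * (ch t ^+ 2 - 1) + (1 - ch t * cos x) ^+ 2 = (ch t - cos x) ^+ 2 by ring.
  have -> : y0 ^+ 2 * M t x ^+ 4 * (ch t - cos x) ^+ 2 = y0 ^+ 2 * M t x ^+ 2 * (M t x * (ch t - cos x)) ^+ 2 by ring.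
  by rewrite MN //; ring.
split.
- by move=> t x t0; exact: polY_gt0.
- move=> t x t0; have h1 := dMt t x t0; have h2 := is_derive_sh t.
  by rewrite /polX; apply: is_derive_eq; rewrite /GRing.scale /= /Xt /M; ring.
- move=> t x t0; have h1 := dMt t x t0; have h2 := is_derive_sh t.
  by rewrite /polY; apply: is_derive_eq; rewrite /GRing.scale /= /Yt /M; ring.
- move=> t x t0; have h1 := dMt t x t0; have h2 := is_derive_sh t.
  by rewrite /Xt; apply: is_derive_eq; rewrite /GRing.scale /= /Xtt /M; ring.
- move=> t x t0; have h1 := dMt t x t0; have h2 := is_derive_sh t; have h3 := is_derive_ch t.
  by rewrite /Yt; apply: is_derive_eq; rewrite /GRing.scale /= /Ytt /M; ring.
- move=> t x t0; have h1 := dMx t x t0.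
  by rewrite /polX; apply: is_derive_eq; rewrite /GRing.scale /= /Xx /M; ring.
- move=> t x t0; have h1 := dMx t x t0.
  by rewrite /polY; apply: is_derive_eq; rewrite /GRing.scale /= /Yx /M; ring.
- move=> t x t0; have h1 := dMx t x t0.
  by rewrite /Xx; apply: is_derive_eq; rewrite /GRing.scale /= /Xxx /M; ring.
- move=> t x t0; have h1 := dMx t x t0.
  by rewrite /Yx; apply: is_derive_eq; rewrite /GRing.scale /= /Yxx /M; ring.
- exact: (joint_continuousD (jc x0) (jN _ (joint_continuousM (joint_continuousM (jc y0) jsin) jM))).
- exact: (joint_continuousM (joint_continuousM (jc y0) jsh) jM).
- exact: (joint_continuousM (joint_continuousM (joint_continuousM (jc y0) jsin) jsh) (jX 2 _ jM)).
- apply: (joint_continuousM (jc y0)); apply: (joint_continuousD (joint_continuousM jch jM)).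
  exact: (jN _ (joint_continuousM (jX 2 _ jsh) (jX 2 _ jM))).
- apply: (joint_continuousM (joint_continuousM (jc y0) jsin)).
  apply: (joint_continuousD (joint_continuousM jch (jX 2 _ jM))).
  exact: (jN _ (joint_continuousM (joint_continuousM (jc 2) (jX 2 _ jsh)) (jX 3 _ jM))).
- apply: (joint_continuousM (jc y0)); apply: joint_continuousD; last first.
    exact: (joint_continuousM (joint_continuousM (jc 2) (jX 3 _ jsh)) (jX 3 _ jM)).
  apply: (joint_continuousD (joint_continuousM jsh jM)).
  exact: (jN _ (joint_continuousM (joint_continuousM (joint_continuousM (jc 3) jsh) jch) (jX 2 _ jM))).
- by move=> t x t0; rewrite XxE // YtE // /Xt /Yx; ring.
- by move=> t x t0; rewrite XxE // YtE // /Xt /Yx; ring.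
- move=> t x t0; have n0 := lt0r_neq0 (polar_den_gt0 x t0).
  have -> : Xtt t x + Xxx t x = y0 * sin x * (ch t * M t x ^+ 2 - 2 * sh t ^+ 2 * M t x ^+ 3 +
     M t x + 3 * cos x * M t x ^+ 2 - 2 * sin x ^+ 2 * M t x ^+ 3) by rewrite /Xtt /Xxx; ring.
  rewrite sc SC /M /polM; apply/eqP; rewrite mulf_eq0; apply/orP; right; apply/eqP.
  by field.
- move=> t x t0; have n0 := lt0r_neq0 (polar_den_gt0 x t0).
  have -> : Ytt t x + Yxx t x = y0 * sh t * (M t x - 3 * ch t * M t x ^+ 2 + 2 * sh t ^+ 2 * M t x ^+ 3 -
     cos x * M t x ^+ 2 + 2 * sin x ^+ 2 * M t x ^+ 3) by rewrite /Ytt /Yxx; ring.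
  rewrite sc SC /M /polM; apply/eqP; rewrite mulf_eq0; apply/orP; right; apply/eqP.
  by field.
Qed.

Lemma polar_angle (R : realType) (c s : R) : c ^+ 2 + s ^+ 2 = 1 ->
  exists x : R, cos x = c /\ sin x = s.
Proof.
move=> cs.
have c1 : -1 <= c <= 1 by rewrite -ler_norml -(@ler_pXn2r _ 2) ?nnegrE // expr1n real_normK ?num_real //; have := sqr_ge0 s; lra.
have ck : cos (acos c) = c by apply: acosK; rewrite in_itv.
have sk : sin (acos c) = `|s|.
  rewrite sin_acos // (_ : 1 - c ^+ 2 = s ^+ 2) ?sqrtr_sqr //; lra.
have [s0|s0] := leP 0 s.
  by exists (acos c); rewrite ck sk ger0_norm.
by exists (- acos c); rewrite cosN sinN ck sk ltr0_norm // opprK.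
Qed.

(** The parametrization is inverted by [w = (z - z0) / (z - conj z0)]: [|w|^2 = N / D] gives [t],
    and [w * D = A + i B] gives the angle, with [q = |w| * D]. *)
Lemma polar_surj (R : realType) (x0 y0 x y : R) : 0 < y0 -> 0 < y ->
  (x - x0) ^+ 2 + (y - y0) ^+ 2 != 0 ->
  exists t a : R, [/\ 0 < t, polX x0 y0 t a = x, polY y0 t a = y,
    expR (- 2 * t) * ((x - x0) ^+ 2 + (y + y0) ^+ 2) = (x - x0) ^+ 2 + (y - y0) ^+ 2 &
    exists2 q, 0 < q & q * cos a = (x - x0) ^+ 2 + y ^+ 2 - y0 ^+ 2 /\
      q * sin a = - 2 * y0 * (x - x0)].
Proof.
move=> y0p yp; set N := _ + _ => nz.
set D := (x - x0) ^+ 2 + (y + y0) ^+ 2.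
have N0 : 0 < N by rewrite lt0r nz addr_ge0 ?sqr_ge0.
have ND : D = N + 4 * (y * y0) by rewrite /D /N; ring.
have yy0 : 0 < y * y0 by rewrite mulr_gt0.
have D0 : 0 < D by rewrite ND; lra.
pose r := Num.sqrt (N / D).
have r0 : 0 < r by rewrite sqrtr_gt0 divr_gt0.
have r2 : r ^+ 2 = N / D by rewrite sqr_sqrtr // ltW // divr_gt0.
have r1 : r < 1.
  rewrite -(@ltr_pXn2r _ 2) ?nnegrE ?ltW // expr1n r2 ltr_pdivrMr // mul1r ND; lra.
pose A := (x - x0) ^+ 2 + y ^+ 2 - y0 ^+ 2.
pose B := - 2 * y0 * (x - x0).
have AB : A ^+ 2 + B ^+ 2 = N * D by rewrite /A /B /N /D; ring.
have Dn := lt0r_neq0 D0; have rn := lt0r_neq0 r0.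
have rD : (r * D) ^+ 2 = N * D by rewrite exprMn r2; field.
have rDn : r * D != 0 by rewrite mulf_neq0.
have [a [ca sa]] : exists a : R, cos a = A / (r * D) /\ sin a = B / (r * D).
  by apply: polar_angle; rewrite !expr_div_n -mulrDl AB rD divff // mulf_neq0 // lt0r_neq0.
have [t t0 et] : exists2 t : R, 0 < t & expR (- t) = r.
  exists (- ln r); first by rewrite oppr_gt0 ln_lt0 // r0.
  by rewrite opprK lnK.
have et' : expR t = r^-1 by rewrite -et expRN invrK.
exists t, a; split => //.
- rewrite /polX /polM ca sa /ch et et'.
  have -> : (r^-1 + r) / 2 - A / (r * D) = (2 * y0 ^+ 2) / (r * D).
    have -> : (r^-1 + r) / 2 = (1 + r ^+ 2) / (2 * r) by field.
    rewrite r2; have -> : 2 * y0 ^+ 2 = (D + N) / 2 - A by rewrite /D /N /A; field.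
    by field; rewrite ?rn ?Dn.
  by rewrite /B; field; rewrite rn Dn lt0r_neq0.
- rewrite /polY /polM ca /sh /ch et et'.
  have -> : (r^-1 + r) / 2 - A / (r * D) = (2 * y0 ^+ 2) / (r * D).
    have -> : (r^-1 + r) / 2 = (1 + r ^+ 2) / (2 * r) by field.
    rewrite r2; have -> : 2 * y0 ^+ 2 = (D + N) / 2 - A by rewrite /D /N /A; field.
    by field; rewrite ?rn ?Dn.
  have -> : (r^-1 - r) / 2 = (1 - r ^+ 2) / (2 * r) by field.
  rewrite r2; have -> : N = D - 4 * (y * y0) by rewrite ND; ring.
  by field; rewrite rn Dn lt0r_neq0.
- have -> : - 2 * t = - t + - t by ring.
  by rewrite expRD et -expr2 r2; field.
- exists (r * D); first by rewrite mulr_gt0.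
  by rewrite ca sa !(mulrC (r * D)) !divfK.
Qed.

Lemma ch_sh_ge (R : realType) (t : R) : 3 <= t ->
  [/\ expR t / 4 <= ch t - 1, expR t / 4 <= sh t & 0 <= ch t - sh t <= 1].
Proof.
move=> t3; have h1 := expR_ge1Dx t.
have h2 : expR (- t) <= 1 by rewrite -expR0 ler_expR; lra.
have h3 := expR_gt0 (- t).
by rewrite /ch /sh; split; lra.
Qed.

Lemma polar_cvg (R : realType) (x0 y0 t a : R) : 0 < y0 -> 3 <= t ->
  `|polX x0 y0 t a - x0| <= 8 * y0 * expR (- 1 * t) /\ `|polY y0 t a - y0| <= 8 * y0 * expR (- 1 * t).
Proof.
move=> y0p t3; have [h1 h2 /andP[h3 h4]] := ch_sh_ge t3.
have et := expR_gt0 t; have c1 := cos_le1 a; have cm1 := cos_geN1 a.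
have s1 := sin_le1 a; have sm1 := sin_geN1 a.
have m0 : 0 < ch t - cos a by lra.
have M0 : 0 < polM t a by rewrite invr_gt0.
have M4 : polM t a <= 4 * expR (- 1 * t).
  rewrite mulN1r expRN -[4]invrK -invfM lef_pV2 ?posrE //; first by lra.
  by rewrite mulr_gt0 // invr_gt0.
split.
  rewrite /polX addrAC subrr add0r normrN !normrM (gtr0_norm y0p) (gtr0_norm M0).
  have hs : `|sin a| <= 1 by rewrite ler_norml sm1 s1.
  have k1 : `|sin a| * polM t a <= 1 * polM t a by rewrite ler_wpM2r // ltW.
  have k2 : y0 * (`|sin a| * polM t a) <= y0 * (8 * expR (- 1 * t)).
    by rewrite ler_wpM2l ?(ltW y0p) //; have := expR_gt0 (- 1 * t); lra.
  by rewrite -[leLHS]mulrA; apply: le_trans k2 _; rewrite mulrCA mulrA.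
have -> : polY y0 t a - y0 = y0 * ((sh t - ch t + cos a) * polM t a).
  rewrite /polY {2}(_ : y0 = y0 * ((ch t - cos a) * polM t a)); first by ring.
  by rewrite mulfV ?mulr1 // lt0r_neq0.
rewrite !normrM (gtr0_norm y0p) (gtr0_norm M0).
have hs : `|sh t - ch t + cos a| <= 2 by rewrite ler_norml; lra.
have k1 : `|sh t - ch t + cos a| * polM t a <= 2 * polM t a by rewrite ler_wpM2r // ltW.
have k2 : y0 * (`|sh t - ch t + cos a| * polM t a) <= y0 * (8 * expR (- 1 * t)).
  by rewrite ler_wpM2l ?(ltW y0p) //; lra.
by apply: le_trans k2 _; rewrite mulrCA mulrA.
Qed.

(** The symmetry is evenness about the geodesic through [(x0, y0)] formed by the angles [a] and
    [a + pi]; the equation with [cos a] and [sin a] is that of this geodesic. On it the lowest mode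
    has [|cos (k x)| = 1] and everything else is at most half of it, so [f] cannot vanish near the
    centre. *)
Lemma polar_isolated_zero (R : realType) (f : R * R -> R) (l x0 y0 a : R) :
  twice_cont_diff f -> (forall z, 0 < z.2 -> z.2 ^+ 2 * laplacian f z + l * f z = 0) ->
  0 < l -> 0 < y0 -> f (x0, y0) = 0 ->
  (forall t x, 0 < t -> f (polX x0 y0 t (a - x), polY y0 t (a - x)) =
    f (polX x0 y0 t (a + x), polY y0 t (a + x))) ->
  (exists2 z, 0 < z.2 & f z != 0) ->
  exists2 r : R, 0 < r & forall x y, 0 < y -> `|x - x0| < r -> `|y - y0| < r ->
    (x - x0) ^+ 2 + (y - y0) ^+ 2 != 0 ->
    - 2 * y0 * (x - x0) * cos a = ((x - x0) ^+ 2 + y ^+ 2 - y0 ^+ 2) * sin a ->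
    f (x, y) != 0.
Proof.
move=> hf fE l0 y0p f0 sym [z1 z1p fz1].
have [Xt [Yt [Xx [Yx [Xtt [Ytt [Xxx [Yxx [cm nE]]]]]]]]] := polar_conformal x0 y0p.
have cm' := conformal_map_shift a cm.
pose V (t : R) := l / sh t ^+ 2.
pose u t x := f (polX x0 y0 t (x + a), polY y0 t (x + a)).
have sh0 := @sh_gt0 R.
have per (t x y : R) : cos x = cos y -> sin x = sin y ->
    f (polX x0 y0 t x, polY y0 t x) = f (polX x0 y0 t y, polY y0 t y).
  by move=> h1 h2; rewrite /polX /polY /polM h1 h2.
have [ut [utt [ux [uxx hu]]]] : exists ut utt ux uxx, cylinder_solution u ut utt ux uxx V 0.
  apply: (conformal_cylinder hf fE cm').
  - move=> t x t0; rewrite -nE // /V; have := lt0r_neq0 (sh0 t t0) => sn.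
    by field.
  - by move=> t x t0; rewrite addrC sym // addrC.
  - move=> t x t0.
    have -> : pi + x + a = a + (pi + x) by ring.
    rewrite -sym //; apply: per.
      have -> : pi - x + a = a - (pi + x) + pi + pi by ring.
      by rewrite !cosDpi opprK.
    have -> : pi - x + a = a - (pi + x) + pi + pi by ring.
    by rewrite !sinDpi opprK.
have V16 (t : R) : 3 <= t -> 0 <= V t <= 16 * l * expR (- 2 * t).
  move=> t3; have [_ h _] := ch_sh_ge t3.
  have et := expR_gt0 t.
  have s0 : 0 < sh t by lra.
  rewrite /V divr_ge0 ?sqr_ge0 ?(ltW l0) //=.
  have -> : - 2 * t = - t + - t by ring.
  rewrite expRD expRN -invfM -mulrA mulrCA ler_pM2l // -[16]invrK -invfM.
  rewrite lef_pV2 ?posrE ?exprn_gt0 // ?mulr_gt0 // ?invr_gt0 //.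
  have -> : 16^-1 * (expR t * expR t) = (expR t / 4) ^+ 2 by field.
  by rewrite ler_pXn2r ?nnegrE ?(ltW s0) ?divr_ge0 ?(ltW et).
have [S1 hS1] := expRN_small (16 * l) (ltr0n R 2) (@ltr0n R 1).
have [S2 hS2] := expRN_small (16 * l) (ltr0n R 2) (divr_gt0 (@ltr0n R 3) (@ltr0n R 4)).
have cf : {for (x0, y0), continuous f} by apply: C1_continuous; exact: tcd_C1.
have u0 (e : R) : 0 < e -> exists S, forall t x, S <= t -> `|u t x| <= e.
  move=> e0; have [d d0 hd] := (continuous_pairP _ _).1 cf e e0.
  have d20 : 0 < d / 2 by lra.
  have [S hS] := expRN_small (8 * y0) (@ltr01 R) d20.
  exists (Num.max S 3) => t x; rewrite ge_max => /andP[/hS h t3].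
  have [hx hy] := @polar_cvg R x0 y0 t (x + a) y0p t3.
  have := hd (polX x0 y0 t (x + a)) (polY y0 t (x + a)); rewrite f0 subr0 /= => k.
  apply: ltW; apply: k; [apply: le_lt_trans hx _|apply: le_lt_trans hy _]; clear -h d0; lra.
have [S3 hS3] := u0 1 ltr01.
pose T := Num.max (Num.max S1 S2) (Num.max S3 3).
have TS1 : S1 <= T by rewrite !le_max lexx.
have TS2 : S2 <= T by rewrite !le_max lexx orbT.
have TS3 : S3 <= T by rewrite !le_max lexx !orbT.
have T3 : 3 <= T by rewrite !le_max lexx !orbT.
have T0 : 0 < T by exact: lt_le_trans T3.
have cu t : 0 < t -> continuous (u t).
  move=> t0; have [_ _ h3 _ _ _ _ _ _] := hu.
  exact: (is_derive_continuous (fun x => h3 t x t0)).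
have cuk t k : 0 < t -> continuous (fun x => u t x * cos (k%:R * x)).
  by move=> t0; apply: continuous_mul; [exact: cu|exact: continuous_cosM].
have modeb (e t : R) k : 0 < t -> (forall x, `|u t x| <= e) -> `|mode u k t| <= e * pi.
  move=> t0 h; apply: int0pi_norm; first exact: cuk.
  move=> x _; rewrite normrM -[e]mulr1; apply: ler_pM => //.
  by rewrite ler_norml cos_geN1 cos_le1.
(* [f] vanishes at the centre, so the zero mode tends to 0 and [zero_mode_eq0] applies. *)
have mean0 t : T <= t -> int0pi (u t) = 0.
  move=> Tt; have m0E s : mode u 0 s = int0pi (u s).
    by apply: eq_int0pi => x _; rewrite mul0r cos0 mulr1.
  rewrite -m0E.
  have dm s : T <= s -> is_derive s (1 : R) (mode u 0) (mode ut 0 s) /\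
      is_derive s (1 : R) (mode ut 0) (- V s * mode u 0 s).
    move=> Ts; have s0 : 0 < s by exact: lt_le_trans Ts.
    by have := mode_derive hu 0 s0; rewrite expr0n sub0r.
  apply: (@zero_mode_eq0 R (mode u 0) (mode ut 0) V (16 * l) pi T) => //.
  - by move=> s /dm[].
  - by move=> s /dm[].
  - by move=> s Ts; apply: V16; exact: le_trans Ts.
  - by have h := hS1 T TS1; clear -h; lra.
  - move=> s Ts; rewrite -[pi]mul1r; apply: modeb; first exact: lt_le_trans Ts.
    by move=> x; apply: hS3; exact: le_trans Ts.
  - move=> e e0; have e1 : 0 < e / pi by rewrite divr_gt0 // pi_gt0.
    have [S hS] := u0 _ e1; exists (Num.max S 1) => s; rewrite ge_max => /andP[h1 h2].
    have := @modeb (e / pi) s 0%N; rewrite divfK ?lt0r_neq0 ?pi_gt0 //; apply; first exact: lt_le_trans h2.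
    by move=> x; exact: hS.
have [a1 b1 a10 ab|t Tt|k k0 [e e0 [S hS]]||] := @cylinder_asymptotics R u ut utt ux uxx V 0 T hu T0 T0 _ _ mean0.
- exists (l / (sh a1) ^+ 2) => t /andP[h1 h2].
  have t0 : 0 < t by exact: lt_le_trans h1.
  have s1 := sh0 _ a10; have s2 := sh0 _ t0.
  have s12 : sh a1 <= sh t.
    rewrite /sh ler_pM2r ?invr_gt0 //; have : expR a1 <= expR t by rewrite ler_expR.
    have : expR (- t) <= expR (- a1) by rewrite ler_expR lerN2.
    by clear; lra.
  rewrite ger0_norm /V ?divr_ge0 ?sqr_ge0 ?(ltW l0) // ler_pM2l // lef_pV2 ?posrE ?exprn_gt0 //.
  by rewrite ler_pXn2r ?nnegrE ?(ltW s1) ?(ltW s2).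
- have /andP[h1 h2] := V16 t (le_trans T3 Tt).
  by rewrite h1 /=; apply: le_trans h2 _; apply: hS2; exact: le_trans Tt.
(* From [T] on [u] is bounded by 1 and a mode by [pi]; [t] is so large that [e * t ^+ 2] exceeds
   [pi ^+ 2]. *)
- pose t := Num.max S (Num.max T (pi ^+ 2 / e + 1)).
  have tS : S <= t by rewrite !le_max lexx.
  have tT : T <= t by rewrite 2!le_max lexx orbT.
  have te : pi ^+ 2 / e + 1 <= t by rewrite 2!le_max lexx !orbT.
  have h1 := hS t tS.
  have h2 : `|mode u k t| <= pi.
    by rewrite -[pi]mul1r; apply: modeb; [exact: lt_le_trans tT|move=> x; apply: hS3; exact: le_trans tT].
  have h3 : mode u k t ^+ 2 <= pi ^+ 2.
    by rewrite -[leLHS]real_normK ?num_real // ler_pXn2r ?nnegrE // ?pi_ge0.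
  have t3 := le_trans T3 tT.
  have h4 : e * t <= e * t ^+ 2 by rewrite ler_pM2l // expr2 ler_peMl //; clear -t3; lra.
  have h5 : e * (pi ^+ 2 / e + 1) <= e * t by rewrite ler_pM2l.
  have h6 : e * (pi ^+ 2 / e + 1) = pi ^+ 2 + e by field; rewrite lt0r_neq0.
  by clear -h1 h3 h4 h5 h6 e0; lra.
- move=> uz; exfalso; case: z1 z1p fz1 => x1 y1 /= y1p; apply/negP; rewrite negbK.
  have [e|nz] := eqVneq ((x1 - x0) ^+ 2 + (y1 - y0) ^+ 2) 0.
    move/eqP: e; rewrite paddr_eq0 ?sqr_ge0 // !sqrf_eq0 !subr_eq0 => /andP[/eqP -> /eqP ->].
    by rewrite f0.
  have [t [th [t0 <- <- _ _]]] := polar_surj y0p y1p nz.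
  (* Folds the angle into [[0, pi]]; the symmetry takes care of the case where the sine changes
     sign. *)
  pose x := acos (cos (th - a)).
  have c1 : -1 <= cos (th - a) <= 1 by rewrite cos_geN1 cos_le1.
  have cx : cos x = cos (th - a) by apply: acosK; rewrite in_itv.
  have xpi : 0 <= x <= pi by rewrite acos_ge0 // acos_lepi.
  have := uz t x t0 xpi; rewrite /u => ux0; apply/eqP; rewrite -ux0.
  have : sin x = sin (th - a) \/ sin x = - sin (th - a).
    have : (sin x - sin (th - a)) * (sin x + sin (th - a)) = 0.
      by rewrite -subr_sqr !sin2cos2 cx subrr.
    move/eqP; rewrite mulf_eq0 subr_eq0 addr_eq0 => /orP[/eqP ->|/eqP ->]; by [left|right].
  case=> sx; last rewrite (addrC x a) -sym //.
    apply: per; rewrite -[th](subrK a).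
      by rewrite (cosD (th - a)) (cosD x) cx sx.
    by rewrite (sinD (th - a)) (sinD x) cx sx.
  apply: per; rewrite -{1}[th](subrK a) (addrC _ a).
    by rewrite (cosD a (th - a)) (cosB a x) cx sx; ring.
  by rewrite (sinD a (th - a)) (sinB a x) cx sx; ring.
- move=> [k [c [A [B [S [k0 A0 hS]]]]]].
pose S' := Num.max S 1.
(* In the distance relation of [polar_surj] the factor of [expR (- 2 * t)] is at least [y0 ^+ 2];
   hence coordinates within [r] of the centre force [S' <= t]. *)
pose r := y0 * expR (- S') / 2.
have es : 0 < expR (- S') by rewrite expR_gt0.
have r0 : 0 < r by rewrite divr_gt0 // mulr_gt0.
exists r => // x y yp xr yr nz geo.
have [t [th [t0 Ex Ey et [q q0 [qc qs]]]]] := polar_surj y0p yp nz.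
have St : S' <= t.
  rewrite leNgt; apply/negP => tS.
  have e2 : expR (- 2 * S') < expR (- 2 * t) by rewrite ltr_expR; clear -tS; lra.
  have hx : (x - x0) ^+ 2 <= r ^+ 2 by rewrite -[leLHS]real_normK ?num_real // ler_pXn2r ?nnegrE ?(ltW r0) // ltW.
  have hy : (y - y0) ^+ 2 <= r ^+ 2 by rewrite -[leLHS]real_normK ?num_real // ler_pXn2r ?nnegrE ?(ltW r0) // ltW.
  have rE : r ^+ 2 = y0 ^+ 2 * expR (- 2 * S') / 4.
    have -> : - 2 * S' = - S' + - S' by ring.
    by rewrite expRD /r; field.
  have D0 : y0 ^+ 2 <= (x - x0) ^+ 2 + (y + y0) ^+ 2 by have h := sqr_ge0 (x - x0); clear -h yp y0p; nra.
  have k1 : y0 ^+ 2 * expR (- 2 * S') < y0 ^+ 2 * expR (- 2 * t) by rewrite ltr_pM2l // exprn_gt0.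
  have k2 : expR (- 2 * t) * y0 ^+ 2 <= expR (- 2 * t) * ((x - x0) ^+ 2 + (y + y0) ^+ 2).
    by rewrite ler_wpM2l // expR_ge0.
  have k3 : 0 < y0 ^+ 2 * expR (- 2 * S') by rewrite mulr_gt0 ?exprn_gt0 ?expR_gt0.
  by clear -hx hy rE k1 k2 k3 et; lra.
have S't : S <= t by apply: le_trans St; rewrite le_max lexx.
have [cA cB hu1 _] := hS t S't.
have c0 : 0 < `|c t| by apply: lt_le_trans cA; rewrite mulr_gt0 // expR_gt0.
have sth : sin (th - a) = 0.
  apply/eqP; rewrite -(mulrI_eq0 _ (mulfI (lt0r_neq0 q0))) sinB mulrBr !mulrA qc qs; apply/eqP.
  by rewrite geo subrr.
have uE : exists2 x1, x1 = 0 \/ x1 = pi & f (x, y) = u t x1.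
  have c2 : cos (th - a) ^+ 2 = 1 by rewrite cos2sin2 sth expr0n subr0.
  have /orP[/eqP cc|/eqP cc] : (cos (th - a) == 1) || (cos (th - a) == -1) by rewrite -eqf_sqr c2 expr1n.
  - exists 0; first by left.
    rewrite /u add0r -Ex -Ey; apply: per; rewrite -{1}[th](subrK a).
      by rewrite cosD cc sth mul1r mul0r subr0.
    by rewrite sinD cc sth mul1r mul0r add0r.
  - exists pi; first by right.
    rewrite /u (addrC pi) -Ex -Ey; apply: per; rewrite -{1}[th](subrK a).
      by rewrite cosD cc sth mulN1r mul0r subr0 cosDpi.
    by rewrite sinD cc sth mulN1r mul0r add0r sinDpi.
have [x1 hx1 ->] := uE.
have x1pi : 0 <= x1 <= pi by case: hx1 => ->; rewrite lexx ?pi_ge0.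
have ck : cos (k%:R * x1) ^+ 2 = 1.
  case: hx1 => ->; first by rewrite mulr0 cos0 expr1n.
  by rewrite cos2sin2 sin_natpi expr0n subr0.
have := hu1 x1 x1pi; apply: contraTneq => ->; rewrite sub0r normrN normrM -ltNge.
have -> : `|cos (k%:R * x1)| = 1.
  by apply/eqP; rewrite -(@eqrXn2 _ 2) // real_normK ?num_real // ck expr1n.
by rewrite mulr1; clear -c0; lra.
Qed.

Lemma vertical_isolated_zero (R : realType) (f : R * R -> R) (l x0 y0 : R) :
  twice_cont_diff f -> (forall z, 0 < z.2 -> z.2 ^+ 2 * laplacian f z + l * f z = 0) ->
  0 < l -> 0 < y0 -> f (x0, y0) = 0 ->
  (forall x y, 0 < y -> f (2 * x0 - x, y) = f (x, y)) ->
  (exists2 z, 0 < z.2 & f z != 0) ->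
  exists2 r : R, 0 < r & forall y, 0 < y -> `|y - y0| < r -> y != y0 -> f (x0, y) != 0.
Proof.
move=> hf fE l0 y0p f0 sym nz.
have [|r r0 hr] := polar_isolated_zero (a := 0) hf fE l0 y0p f0 _ nz.
  move=> t x t0; rewrite sub0r add0r -sym.
    by rewrite /polX /polY /polM sinN cosN; congr (f (_, _)); ring.
  exact: polY_gt0.
exists r => // y yp yr yn; apply: hr => //; rewrite ?subrr ?normr0 //.
  by rewrite expr0n add0r expf_neq0 // subr_eq0.
by rewrite sin0 !mulr0 mul0r.
Qed.

(** In polar coordinates about a point of the unit circle, the inversion [z -> 1 / conj z] is the
    reflection of the angle about [a], where [(cos a, sin a) = (x0, y0)]. *)
Lemma circle_isolated_zero (R : realType) (f : R * R -> R) (l x0 y0 : R) :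
  twice_cont_diff f -> (forall z, 0 < z.2 -> z.2 ^+ 2 * laplacian f z + l * f z = 0) ->
  0 < l -> 0 < y0 -> x0 ^+ 2 + y0 ^+ 2 = 1 -> f (x0, y0) = 0 ->
  (forall x y, 0 < y -> f (x / (x ^+ 2 + y ^+ 2), y / (x ^+ 2 + y ^+ 2)) = f (x, y)) ->
  (exists2 z, 0 < z.2 & f z != 0) ->
  exists2 r : R, 0 < r & forall x y, 0 < y -> x ^+ 2 + y ^+ 2 = 1 ->
    `|x - x0| < r -> `|y - y0| < r -> (x - x0) ^+ 2 + (y - y0) ^+ 2 != 0 -> f (x, y) != 0.
Proof.
move=> hf fE l0 y0p xy0 f0 sym nz.
have [a [ca sa]] := polar_angle xy0.
have [|r r0 hr] := polar_isolated_zero (a := a) hf fE l0 y0p f0 _ nz; last first.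
  exists r => // x y yp xy xr yr n; apply: hr => //; rewrite ca sa.
  have -> : y ^+ 2 = 1 - x ^+ 2 by lra.
  have -> : y0 ^+ 2 = 1 - x0 ^+ 2 by lra.
  by ring.
move=> t x t0.
have Yp := polY_gt0 (a + x) y0p t0.
rewrite -(sym _ _ Yp).
have m0 := lt0r_neq0 (polar_den_gt0 (a + x) t0).
have m1 := lt0r_neq0 (polar_den_gt0 (a - x) t0).
have y02 : y0 ^+ 2 = 1 - x0 ^+ 2 by lra.
have cB : cos (a - x) = (x0 ^+ 2 - y0 ^+ 2) * cos (a + x) + 2 * x0 * y0 * sin (a + x).
  have -> : a - x = a + a - (a + x) by ring.
  by rewrite cosB cosD sinD ca sa; ring.
have sB : x0 * (ch t - cos (a - x)) - y0 * sin (a - x) = x0 * (ch t - cos (a + x)) - y0 * sin (a + x).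
  by rewrite cosB cosD sinB sinD ca sa; ring.
have s2 : sin (a + x) ^+ 2 = 1 - cos (a + x) ^+ 2 by exact: sin2cos2.
have sh2 : sh t ^+ 2 = ch t ^+ 2 - 1 by have := ch2B t; lra.
set c := cos (a + x) in m0 cB sB s2 *; set s := sin (a + x) in cB sB s2 *.
set c' := cos (a - x) in m1 cB sB *; set s' := sin (a - x) in sB *.
(* Dividing by [|z|^2] at the angle [a + x] replaces the denominator of that angle by the one of
   [a - x]; the numerators match by [sB]. *)
have nE : polX x0 y0 t (a + x) ^+ 2 + polY y0 t (a + x) ^+ 2 = (ch t - c') / (ch t - c).
  rewrite /polX /polY /polM -/c -/s.
  have -> : (x0 - y0 * s / (ch t - c)) ^+ 2 + (y0 * sh t / (ch t - c)) ^+ 2 =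
     (x0 ^+ 2 * (ch t - c) ^+ 2 - 2 * x0 * y0 * s * (ch t - c) + y0 ^+ 2 * (s ^+ 2 + sh t ^+ 2)) / (ch t - c) ^+ 2.
    by field.
  rewrite s2 sh2 cB y02.
  have -> : x0 ^+ 2 * (ch t - c) ^+ 2 - 2 * x0 * y0 * s * (ch t - c) + (1 - x0 ^+ 2) * (1 - c ^+ 2 + (ch t ^+ 2 - 1)) =
    (ch t - c) * (ch t - ((x0 ^+ 2 - (1 - x0 ^+ 2)) * c + 2 * x0 * y0 * s)) by ring.
  by field.
rewrite nE /polX /polY /polM -/c -/s -/c' -/s'; congr (f (_, _)).
  have -> : x0 - y0 * s' / (ch t - c') = (x0 * (ch t - c') - y0 * s') / (ch t - c') by field.
  by rewrite sB; field; rewrite m0 m1.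
by field; rewrite m0 m1.
Qed.

(** * Behaviour at the cusp *)

(** The integral of a nonnegative function is the supremum over the simple functions below it, and
    this supremum grows with the function. *)
Lemma ge0_le_integralT d (T : measurableType d) (R : realType) (mu : {measure set T -> \bar R})
    (f g : T -> \bar R) :
  (forall x, (0 <= f x)%E) -> (forall x, (f x <= g x)%E) ->
  (\int[mu]_x f x <= \int[mu]_x g x)%E.
Proof.
move=> f0 fg; have g0 x : (0 <= g x)%E := le_trans (f0 x) (fg x).
rewrite !ge0_integralTE //; apply: le_ereal_sup => _ [h /= hf <-].
by exists h => // x /=; apply: le_trans (hf x) (fg x).
Qed.

(** The preimage of an open interval is open, hence a countable union of rational squares. *)
Lemma continuous2_measurable (R : realType) (G : R * R -> R) : continuous G ->
  measurable_fun setT (G : measurableTypeR R * measurableTypeR R -> measurableTypeR R).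
Proof.
move=> cG; apply: (measurability _ (RGenOpens.measurableE R)).
move=> _ [_ [a [b ->] <-]]; rewrite setTI.
set U := G @^-1` _.
have oU : open U by apply: open_comp; [move=> z _; exact: cG|exact: interval_open].
pose box (q : rat * rat * rat) : set (R * R) :=
  ball (ratr q.1.1 : R) (ratr q.2 : R) `*` ball (ratr q.1.2 : R) (ratr q.2 : R).
have -> : U = \bigcup_(q in [set q | box q `<=` U]) box q.
  apply/seteqP; split=> [[x y] Uz|z [q /= qU] qz]; last exact: qU.
  have /near_pairP[d d0 hd] : \forall w \near (x, y), U w by exact: open_nbhs_nbhs.
  have d20 : 0 < d / 2 by lra.
  have [r] := rat_in_itvoo (d20).
  rewrite in_itv /= => /andP[r0 rd].
  have xr : x - ratr r < x + ratr r by lra.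
  have yr : y - ratr r < y + ratr r by lra.
  have [p] := rat_in_itvoo xr.
  rewrite in_itv /= => /andP[p0 p1].
  have [q] := rat_in_itvoo yr.
  rewrite in_itv /= => /andP[q0 q1].
  exists (p, q, r); last by split; rewrite /= /ball /= ltr_norml; lra.
  move=> [x' y'] [/=]; rewrite /ball /= => h1 h2; apply: hd => /=.
    by move: h1; rewrite !ltr_norml => /andP[h3 h4]; apply/andP; split; lra.
  by move: h2; rewrite !ltr_norml => /andP[h3 h4]; apply/andP; split; lra.
rewrite bigcup_mkcond; apply: countable_bigcupT_measurable => // q.
case: ifP => _; last exact: measurable0.
apply: measurableX; exact: measurable_ball.
Qed.

(** Tonelli on the rectangle [[0, 1/2] x [Y, Y + L]], which lies in the fundamental domain since
    [1 <= Y]: with [L = 2 / m] it would carry a mass of at least 2, against the total 1. *)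
Lemma cusp_no_growth (R : realType) (f : R * R -> R) (m Y : R) :
  (forall z, 0 < z.2 -> {for z, continuous f}) ->
  (\int[lebesgue_measure \x lebesgue_measure]_(z in fundamental_domain R)
       ((f z / z.2) ^+ 2)%:E = 1)%E ->
  0 < m -> 1 <= Y ->
  ~ (forall y, Y <= y -> (m%:E <= \int[lebesgue_measure]_(x in `[0%R, 2^-1%R]) ((f (x, y) / y) ^+ 2)%:E)%E).
Proof.
move=> cf hn m0 Y1 hY.
pose L := 2 / m.
have L0 : 0 < L by rewrite divr_gt0.
(* Cutting the second coordinate off below at [Y] makes the integrand continuous on the whole plane
   and changes nothing on [rect]. *)
pose G (z : R * R) := (f (z.1, Num.max z.2 Y) / Num.max z.2 Y) ^+ 2.
have cG : continuous G.
  move=> z; have mY : 0 < Num.max z.2 Y by rewrite lt_max; apply/orP; right; lra.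
  have cm : {for z, continuous (fun w : R * R => Num.max w.2 Y)}.
    apply: (@continuous_max R (R * R)%type snd (cst Y)); [exact: cvg_snd|exact: cvg_cst].
  apply: (@cvg_comp _ _ _ _ (fun t : R => t ^+ 2) _ (nbhs (f (z.1, Num.max z.2 Y) / Num.max z.2 Y))); last exact: exprn_continuous.
  apply: cvgM; last by apply: cvgV => //; exact: lt0r_neq0.
  apply: (@cvg_comp _ _ _ (fun w : R * R => (w.1, Num.max w.2 Y)) f _ (nbhs (z.1, Num.max z.2 Y))); last exact: cf.
  apply: (@cvg_pair _ _ _ (nbhs z) (nbhs z.1) (nbhs (Num.max z.2 Y))); [exact: cvg_fst|exact: cm].
have mG := continuous2_measurable cG.
pose rect : set (R * R) := `[0, 2^-1]%classic `*` `[Y, Y + L]%classic.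
have rectF : rect `<=` fundamental_domain R.
  move=> [x y] []; rewrite /= !in_itv /= => /andP[x0 x1] /andP[y0 y1].
  have y2 : 1 <= y ^+ 2 by rewrite expr_ge1 //; lra.
  have x2 := sqr_ge0 x.
  by split; [|rewrite ger0_norm|]; rewrite /=; lra.
pose H : (measurableTypeR R * measurableTypeR R)%type -> \bar R := (fun z => (G z)%:E) \_ rect.
have H0 z : (0 <= H z)%E by rewrite /H patchE; case: ifP => // _; rewrite lee_fin sqr_ge0.
have mrect : measurable (rect : set (measurableTypeR R * measurableTypeR R)).
  by apply: measurableX.
have mH : measurable_fun setT H.
  apply/(measurable_restrictT _ mrect).
  by apply: measurable_funTS; apply/measurable_EFinP.
have H1 : (\int[lebesgue_measure \x lebesgue_measure]_z H z <= 1)%E.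
  rewrite -hn [leRHS]integral_mkcond; apply: ge0_le_integralT => // z.
  rewrite /H !patchE; case: ifPn => [|_]; last first.
    by case: ifPn => // _; rewrite lee_fin sqr_ge0.
  rewrite inE => zr; rewrite mem_set; last exact: rectF.
  case: zr => _; rewrite /= in_itv /= => /andP[y0 _].
  by rewrite lee_fin /G max_l // -surjective_pairing.
move: H1; rewrite (fubini_tonelli2 H) //; apply/negP; rewrite -ltNge.
apply: (@lt_le_trans _ _ (\int[lebesgue_measure]_(y in `[Y, (Y + L)%R]) m%:E)%E).
  rewrite integral_cst //= lebesgue_measure_itv /= lte_fin ltrDl L0 -EFinD -EFinM lte_fin.
  by rewrite addrAC subrr add0r /L mulrC divfK ?lt0r_neq0 // ltr1n.
rewrite integral_mkcond; apply: ge0_le_integralT => y.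
  by rewrite patchE; case: ifPn => // _; rewrite lee_fin ltW.
rewrite patchE; case: ifPn => [|_]; last exact: integral_ge0.
rewrite inE /= in_itv /= => /andP[y0 y1].
apply: le_trans (hY y y0) _; rewrite integral_mkcond.
apply: ge0_le_integralT => x.
  by rewrite patchE; case: ifPn => // _; rewrite lee_fin sqr_ge0.
rewrite /H !patchE; case: ifPn => [|_]; last by case: ifPn => // _; rewrite lee_fin sqr_ge0.
rewrite inE /= => xI; rewrite mem_set; first by rewrite /G /= max_l.
by split => //=; rewrite in_itv /= y0 y1.
Qed.

Lemma int0pi_scale (R : realType) (h : R -> R) : continuous h ->
  int0pi (fun x => h (x / (2 * pi))) = 2 * pi * \int[lebesgue_measure]_(x in `[0, 2^-1]) h x.
Proof.
move=> ch; have pi0 := pi_gt0 R; have pn := lt0r_neq0 pi0.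
pose c : R := (2 * pi)^-1.
have c0 : 0 < c by rewrite invr_gt0 mulr_gt0.
pose F (x : R) := x / (2 * pi).
have dF (x : R) : is_derive x (1 : R) F c.
  have h1 : is_derive x (1 : R) (fun x : R => x * c) (0 * x + c * 1) by apply: is_derive_eq; rewrite /GRing.scale /=; ring.
  by move: h1; rewrite mul0r add0r mulr1.
have F'E : derive1 F = cst c by apply/funext => x; rewrite derive1E derive_val.
have cF : continuous F by exact: (is_derive_continuous dF).
have chF : continuous (h \o F) by move=> x; apply: continuous_comp; [exact: cF|exact: ch].
have F0 : F 0 = 0 by rewrite /F mul0r.
have Fpi : F pi = 2^-1 by rewrite /F; move: (pi) pn => p pn; field.
have E : (\int[lebesgue_measure]_(x in `[F 0%R, F pi]) (h x)%:E =
    \int[lebesgue_measure]_(x in `[0%R, pi]) (((h \o F) * derive1 F) x)%:E)%E.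
  apply: integration_by_substitution_increasing.
  - exact: ltW.
  - by move=> x y _ _ xy; rewrite /F ltr_pM2r.
  - by move=> x _; rewrite F'E; exact: cvg_cst.
  - by rewrite F'E; exact: is_cvg_cst.
  - by rewrite F'E; exact: is_cvg_cst.
  - split; first by move=> x _; have [] := dF x.
      by apply: cvg_at_right_filter; exact: cF.
    by apply: cvg_at_left_filter; exact: cF.
  - exact: continuous_subspaceT.
rewrite /Rintegral; move: E; rewrite F0 Fpi => ->.
have -> : fine (\int[lebesgue_measure]_(x in `[0%R, pi]) (((h \o F) * derive1 F) x)%:E) =
    int0pi (fun x => c * h (F x)).
  by congr fine; apply: eq_integral => x _; rewrite F'E /= mulrC.
by rewrite (int0piZ _ chF) mulrA divff ?mul1r // mulf_neq0.
Qed.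

Lemma half_integral_eq0 (R : realType) (g : R -> R) : continuous g ->
  (forall x : R, g (1 - x) = g x) ->
  (\int[lebesgue_measure]_(x in `[0%R, 1%R]) (g x)%:E = 0)%E ->
  \int[lebesgue_measure]_(x in `[0, 2^-1]) g x = 0.
Proof.
move=> cg gs g0.
have ig (a b : R) : lebesgue_measure.-integrable `[a, b] (EFin \o g).
  by apply: continuous_compact_integrable; [exact: segment_compact|exact: continuous_subspaceT].
have h01 : ((0 : R) <= (2^-1 : R) <= 1)%R by apply/andP; split; lra.
have E1 : \int[lebesgue_measure]_(x in `[0, 2^-1]) g x = \int[lebesgue_measure]_(x in `[2^-1, 1]) g x.
  rewrite Rintegration_by_substitution_onem //; last exact: continuous_subspaceT.
  rewrite (_ : unstable.onem 2^-1 = 2^-1 :> R); last by rewrite /unstable.onem; lra.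
  by congr fine; apply: eq_integral => x _; rewrite /unstable.onem gs.
have E2 := @Rintegral_itvB R g (BLeft 0) (BRight 1) 2^-1 (ig 0 1).
have E3 : \int[lebesgue_measure]_(t in `[0, 1]) g t = 0 by rewrite /Rintegral g0.
move: E2; rewrite E3 (@Rintegral_itv_obnd_cbnd R 2^-1 (BRight 1)); last first.
  apply: integrableS (ig 2^-1 1) => //; apply: subset_itvr; by rewrite bnd_simp.
rewrite -E1 !bnd_simp => /(_ _ _) E2.
suff : 0 - \int[lebesgue_measure]_(x in `[0, 2^-1]) g x = \int[lebesgue_measure]_(x in `[0, 2^-1]) g x by lra.
by apply: E2; lra.
Qed.

(** Integrate [(g x * cos (k x) - a) ^+ 2 >= 0] with [a] the mean [I / pi], and bound the squared
    cosine by 1. *)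
Lemma int0pi_cauchy_schwarz (R : realType) (g : R -> R) (k : nat) : continuous g ->
  int0pi (fun x => g x * cos (k%:R * x)) ^+ 2 <= pi * int0pi (fun x => g x ^+ 2).
Proof.
move=> cg; have pi0 := pi_gt0 R; have pn := lt0r_neq0 pi0.
set I := int0pi _; pose a := I / pi.
have cgc : continuous (fun x => g x * cos (k%:R * x)).
  by apply: continuous_mul => //; exact: continuous_cosM.
have h : int0pi (fun x => (2 * a) * (g x * cos (k%:R * x)) + - a ^+ 2 * 1) <= int0pi (fun x => g x ^+ 2).
  apply: le_int0pi.
  - apply: (@continuous_add R (fun x => (2 * a) * (g x * cos (k%:R * x))) (fun x => - a ^+ 2 * 1)).
      by apply: continuous_mul => //; exact: continuous_const.
    exact: continuous_const.
  - by apply: (continuous_mul cg cg).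
  - move=> x _; have h1 : cos (k%:R * x) ^+ 2 <= 1 by rewrite cos2sin2; have := sqr_ge0 (sin (k%:R * x)); lra.
     have h2 := sqr_ge0 (g x).
    have h3 := sqr_ge0 (g x * cos (k%:R * x) - a).
    have h4 : (g x * cos (k%:R * x)) ^+ 2 <= g x ^+ 2 by rewrite exprMn ler_piMr.
    rewrite sqrrB in h3; move: h3 h4; clear; set u := _ * cos _ => h3 h4; lra.
move: h; rewrite (@int0pi_lin R _ _ _ (fun=> 1)) //; last exact: continuous_const.
rewrite int0pi_cst -/I /a => h.
have E : 2 * (I / pi) * I + - (I / pi) ^+ 2 * (1 * pi) = I ^+ 2 / pi by clear -pn; move: (pi) pn => p pn; field.
by move: h; rewrite E ler_pdivrMr // mulrC.
Qed.

(** * The modular action in real coordinates *)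

(** Real and imaginary parts of [(a z + b) / (c z + d)]; the imaginary part has numerator
    [(a d - b c) y], written here for determinant 1. *)
Definition mob (R : realType) (a b c d : int) (z : R * R) : R * R :=
  let N := (c%:~R * z.1 + d%:~R) ^+ 2 + (c%:~R * z.2) ^+ 2 in
  (((a%:~R * z.1 + b%:~R) * (c%:~R * z.1 + d%:~R) + a%:~R * c%:~R * z.2 ^+ 2) / N, z.2 / N).

Lemma det2 (g : 'M[int]_2) : \det g = g 0 0 * g 1 1 - g 0 1 * g 1 0.
Proof.
rewrite (expand_det_row g 0) !big_ord_recl big_ord0 /cofactor !det_mx11 !mxE /=.
have -> : lift 0 0 = 1 :> 'I_2 by apply: val_inj.
have -> : lift 1 0 = 0 :> 'I_2 by apply: val_inj.
by rewrite /bump /= expr0 mul1r addn0 expr1 addr0 mulN1r mulrN.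
Qed.

Lemma modular_relP (R : realType) (z w : upper R) : modular_rel z w <->
  exists a b c d : int, a * d - b * c = 1 /\ val w = mob a b c d (val z).
Proof.
have key (g : 'M[int]_2) : \det g = 1 ->
    mobius g (toC z) = ((mob (g 0 0) (g 0 1) (g 1 0) (g 1 1) (val z)).1 +i*
      (mob (g 0 0) (g 0 1) (g 1 0) (g 1 1) (val z)).2)%C.
  move=> hg; have := mobius_den z hg.
  have intC (a : int) : (a%:~R : R[i]) = (a%:~R : R)%:C%C.
    by rewrite (rmorph_int (real_complex R)).
  have : (((g 0 0)%:~R * (g 1 1)%:~R - (g 0 1)%:~R * (g 1 0)%:~R) = 1 :> R)
    by rewrite -!intrM -intrB -det2 hg.
  rewrite /mobius !intC /toC /mob; case: (val z) => x y /=.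
  move: ((g 0 0)%:~R) ((g 0 1)%:~R) ((g 1 0)%:~R) ((g 1 1)%:~R) => a b c d h.
  have VE : (c%:C * (x +i* y) + d%:C)%C = ((c * x + d) +i* (c * y))%C.
    by apply/eqP; rewrite eq_complex /=; apply/andP; split; apply/eqP; ring.
  have UE : (a%:C * (x +i* y) + b%:C)%C = ((a * x + b) +i* (a * y))%C.
    by apply/eqP; rewrite eq_complex /=; apply/andP; split; apply/eqP; ring.
  rewrite UE VE => V0.
  have N0 : (c * x + d) ^+ 2 + (c * y) ^+ 2 != 0.
    move: V0; apply: contraNneq => /eqP.
    by rewrite paddr_eq0 ?sqr_ge0 // !sqrf_eq0 => /andP[/eqP -> /eqP ->].
  apply/eqP; rewrite eq_complex /=; apply/andP; split; apply/eqP.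
    by field.
  have -> : y / ((c * x + d) ^+ 2 + (c * y) ^+ 2) = (a * d - b * c) * y / ((c * x + d) ^+ 2 + (c * y) ^+ 2).
    by rewrite h mul1r.
  by field.
split.
  move=> /asboolP[g hg zw]; exists (g 0 0), (g 0 1), (g 1 0), (g 1 1).
  rewrite -det2; split=> //; move: zw; rewrite key // => -[h1 h2].
  by move: h1 h2; rewrite -[sval w]/(val w); case: (val w) => p q /= -> ->.
move=> [a [b [c [d [h zw]]]]]; apply/asboolP.
pose g : 'M[int]_2 := \matrix_(i, j) if i == 0 then if j == 0 then a else b else if j == 0 then c else d.
have hg : \det g = 1 by rewrite det2 !mxE.
by exists g => //; rewrite key // !mxE /= /toC zw.
Qed.

Lemma coordE (R : realType) (phi : upper R -> R) (z : R * R) (hz : 0 < z.2) :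
  coord phi z = phi (mkupper hz).
Proof.
rewrite /coord; case: insubP => [w hw wz|]; last by rewrite mem_set.
by congr phi; apply: val_inj.
Qed.

Lemma coord_val (R : realType) (phi : upper R -> R) (z : upper R) : coord phi (val z) = phi z.
Proof. by rewrite (coordE phi (upper_gt0 z)); congr phi; apply: val_inj. Qed.

Lemma mob_den_gt0 (R : realType) (a b c d : int) (z : R * R) : a * d - b * c = 1 -> 0 < z.2 ->
  0 < (c%:~R * z.1 + d%:~R) ^+ 2 + (c%:~R * z.2) ^+ 2 :> R.
Proof.
move=> h z0; rewrite lt0r addr_ge0 ?sqr_ge0 // andbT paddr_eq0 ?sqr_ge0 // !sqrf_eq0.
rewrite mulf_eq0 (gt_eqF z0) orbF intr_eq0; apply/negP => /andP[h1 /eqP c0].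
by move: h1 h; rewrite c0 mul0r add0r intr_eq0 => /eqP ->; rewrite !mulr0 subrr.
Qed.

Lemma coord_mob (R : realType) (phi : upper R -> R) (a b c d : int) (z : R * R) :
  even_hecke_maass_cusp_form phi -> a * d - b * c = 1 -> 0 < z.2 ->
  coord phi (mob a b c d z) = coord phi z.
Proof.
move=> hphi h z0.
have w0 : 0 < (mob a b c d z).2 by rewrite divr_gt0 // (mob_den_gt0 h).
rewrite (coordE phi z0) (coordE phi w0); apply/esym/(hm_invariant hphi)/modular_relP.
by exists a, b, c, d.
Qed.

Lemma coord_even (R : realType) (phi : upper R -> R) (x y : R) :
  even_hecke_maass_cusp_form phi -> 0 < y -> coord phi (- x, y) = coord phi (x, y).
Proof.
move=> hphi y0; have h1 : 0 < (x, y).2 by [].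
rewrite (coordE phi h1) -(hm_even hphi) -coord_val; congr (coord phi _).
Qed.

Lemma coord_shift (R : realType) (phi : upper R -> R) (x y : R) :
  even_hecke_maass_cusp_form phi -> 0 < y -> coord phi (1 - x, y) = coord phi (x, y).
Proof.
move=> hphi y0; rewrite -[RHS]coord_even // -(@coord_mob R phi 1 1 0 1 (- x, y)) //.
by rewrite /mob /=; congr (coord phi (_, _)); field.
Qed.

Lemma coord_inversion (R : realType) (phi : upper R -> R) (x y : R) :
  even_hecke_maass_cusp_form phi -> 0 < y ->
  coord phi (x / (x ^+ 2 + y ^+ 2), y / (x ^+ 2 + y ^+ 2)) = coord phi (x, y).
Proof.
move=> hphi y0; have n0 : x ^+ 2 + y ^+ 2 != 0.
  by rewrite lt0r_neq0 // ltr_wpDl ?sqr_ge0 // exprn_gt0.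
rewrite -[RHS]coord_even // -(@coord_mob R phi 0 (-1) 1 0 (- x, y)) //.
rewrite /mob /=.
have -> : (1%:~R * - x + 0%:~R) ^+ 2 + (1%:~R * y) ^+ 2 = x ^+ 2 + y ^+ 2 :> R by ring.
by congr (coord phi (_ / _, _)); ring.
Qed.

Lemma coord_pde (R : realType) (phi : upper R -> R) : even_hecke_maass_cusp_form phi ->
  exists2 l : R, 0 < l & forall z, 0 < z.2 ->
    z.2 ^+ 2 * laplacian (coord phi) z + l * coord phi z = 0.
Proof.
move=> hphi; have [t t0 ht] := hm_eigen hphi.
exists (4^-1 + t ^+ 2); first by rewrite addr_gt0 ?invr_gt0 // exprn_gt0.
by move=> z z0; rewrite (coordE phi z0); exact: (ht (mkupper z0)).
Qed.

(** For [c = 1 / (2 * pi)] the interval [[0, pi]] corresponds to the half period [[0, 1/2]], and the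
    potential becomes [l / t ^+ 2]. *)
Lemma scaling_conformal (R : realType) (c : R) : 0 < c ->
  conformal_map (fun _ x => x * c) (fun t _ => t * c) (fun _ _ => 0) (fun _ _ => c)
    (fun _ _ => c) (fun _ _ => 0) (fun _ _ => 0) (fun _ _ => 0) (fun _ _ => 0)
    (fun _ _ => 0) 0.
Proof.
move=> c0.
have d1 (x : R) : is_derive x (1 : R) (fun x : R => x * c) c.
  have h : is_derive x (1 : R) (fun x : R => x * c) (x * 0 + c * 1).
    by apply: is_derive_eq; rewrite /GRing.scale /=; ring.
  by move: h; rewrite mulr0 add0r mulr1.
have d0 (a x : R) : is_derive x (1 : R) (fun _ : R => a) 0 by apply: is_derive_eq.
have cM : continuous (fun x : R => x * c) by exact: (is_derive_continuous d1).
have j1 : joint_continuous (fun (_ : R) x => x * c) 0.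
  move=> t x _; apply: (@cvg_comp _ _ _ snd (fun x => x * c) _ (nbhs x)); last exact: cM.
  exact: cvg_snd.
have j2 : joint_continuous (fun (t _ : R) => t * c) 0.
  move=> t x _; apply: (@cvg_comp _ _ _ fst (fun x => x * c) _ (nbhs t)); last exact: cM.
  exact: cvg_fst.
have j0 a : joint_continuous (fun _ _ : R => a) 0 by move=> t x _; exact: cvg_cst.
split => //; try (by move=> t x _; exact: d1); try (by move=> t x _; exact: d0).
- by move=> t x t0; rewrite mulr_gt0.
- by move=> t x _; rewrite expr0n /= add0r addr0.
- by move=> t x _; rewrite mulr0 mul0r addr0.
- by move=> t x _; rewrite addr0.
- by move=> t x _; rewrite addr0.
Qed.

(* If the mode [k > 1] were dominant, then in T_k F at (0, k t) the terms with [d = k]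
   would have size exp(- k t), and all the others O(exp(- 3/2 k t)). *)
Lemma cusp_hecke (R : realType) (F : R -> R -> R) (k : nat) (L A B S : R) (c : R -> R) :
  (forall x t, F (1 - x) t = F x t) ->
  (1 < k)%N -> 0 < A ->
  (forall t, S <= t ->
    [/\ A * expR (- k%:R * t) <= `|c t|, `|c t| <= B * expR (- (k%:R - 1 / 2) * t) &
      forall x, 0 <= x <= 2^-1 -> `|F x t - c t * cos (k%:R * (x * (2 * pi)))| <= `|c t| / 2]) ->
  (forall t, 0 < t -> (Num.sqrt k%:R)^-1 * \sum_(d <- divisors k) \sum_(0 <= b < d)
     F (b%:R / d%:R) ((k %/ d)%:R * t / d%:R) = L * F 0 t) -> False.
Proof.
move=> Fsym k1 A0 hS hecke.
have k0 : (0 < k)%N by exact: ltnW.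
have kR : 2 <= k%:R :> R by rewrite ler_nat.
have kp : 0 < k%:R :> R by lra.
have cos2pi (m : nat) (y : R) : cos (m%:R * (2 * pi) - y) = cos y.
  elim: m => [|m IH]; first by rewrite mul0r sub0r cosN.
  have -> : m.+1%:R * (2 * pi) - y = (m%:R * (2 * pi) - y) + pi + pi by rewrite -natr1; ring.
  by rewrite !cosDpi opprK IH.
have hF t x : S <= t -> 0 <= x <= 1 -> `|F x t - c t * cos (k%:R * (x * (2 * pi)))| <= `|c t| / 2.
  move=> St /andP[x0 x1]; have [_ _ h] := hS t St.
  have [x2|x2] := leP x 2^-1; first by apply: h; rewrite x0.
  have := h (1 - x); rewrite Fsym.
  have -> : k%:R * ((1 - x) * (2 * pi)) = k%:R * (2 * pi) - k%:R * (x * (2 * pi)) by ring.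
  by rewrite cos2pi; apply; lra.
have B0 : 0 <= B.
  have [h1 h2 _] := hS S (lexx S).
  rewrite -(@pmulr_lge0 _ (expR (- (k%:R - 1 / 2) * S))) ?expR_gt0 //.
  by apply: le_trans h2.
have hF2 t x : S <= t -> 0 <= x <= 1 -> `|F x t| <= 2 * B * expR (- (k%:R - 1 / 2) * t).
  move=> St xI; have h1 := hF t x St xI; have [_ h2 _] := hS t St.
  have h3 : `|c t * cos (k%:R * (x * (2 * pi)))| <= `|c t|.
    rewrite normrM -[leRHS]mulr1 ler_wpM2l //.
    by rewrite ler_norml cos_geN1 cos_le1.
  have h4 := ler_normD (F x t - c t * cos (k%:R * (x * (2 * pi)))) (c t * cos (k%:R * (x * (2 * pi)))).
  rewrite subrK in h4; have h5 := normr_ge0 (c t).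
  by rewrite -mulrA; clear -h1 h2 h3 h4 h5; lra.
pose NN : R := \sum_(d <- divisors k | d != k) 1.
have NN0 : 0 <= NN by apply: sumr_ge0.
have sk : 0 < Num.sqrt k%:R :> R by rewrite sqrtr_gt0.
pose D := NN * (k%:R * (2 * B)) + Num.sqrt k%:R * `|L| * (2 * B).
have h12 : 0 < 2^-1 :> R by rewrite invr_gt0.
have A4 : 0 < A / 2 / 2 by rewrite !divr_gt0.
have [S1 hS1] := expRN_small D h12 A4.
pose t := Num.max (Num.max S 1) S1.
have tS : S <= t by rewrite !le_max lexx.
have t1 : 1 <= t by rewrite !le_max lexx orbT.
have tS1 : S1 <= t by rewrite !le_max lexx orbT.
have t0 : 0 < t by exact: lt_le_trans t1.
(* All errors are compared with [exp(- 3/2 k t)]. A divisor [d != k] evaluates [F] at height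
   [a ^+ 2 * t] with [a = k / d >= 2], and [4 * (k - 1 / 2) >= 3 / 2 * k]. The right-hand side is at
   height [k * t], where [k * (k - 1 / 2) >= 3 / 2 * k] uses [2 <= k]. *)
have mono (s q : R) : q * k%:R <= s * (k%:R - 1 / 2) -> expR (- (k%:R - 1 / 2) * (s * t)) <= expR (- q * k%:R * t).
  move=> h; rewrite ler_expR !mulNr lerN2 mulrA ler_pM2r //; rewrite mulrC in h.
  by rewrite mulrC (mulrC _ s).
pose E := expR (- (3 / 2) * k%:R * t).
have E0 : 0 < E by rewrite expR_gt0.
have rest (d : nat) : (d \in divisors k) -> d != k ->
    `|\sum_(0 <= b < d) F (b%:R / d%:R) ((k %/ d)%:R * (k%:R * t) / d%:R)| <= k%:R * (2 * B) * E.
  rewrite -dvdn_divisors // => dk dnk.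
  have d0 : (0 < d)%N by exact: dvdn_gt0 dk.
  have dR : 0 < d%:R :> R by rewrite ltr0n.
  have dlk : (d <= k)%N by exact: dvdn_leq.
  pose a := (k %/ d)%N.
  have ak : k = (a * d)%N by rewrite /a divnK.
  have a2 : (2 <= a)%N.
    case: a ak => [|[|//]]; first by move=> h; move: k0; rewrite h.
    by rewrite mul1n => h; move: dnk; rewrite h eqxx.
  have aR : 2 <= a%:R :> R by rewrite ler_nat.
  have tE : a%:R * (k%:R * t) / d%:R = a%:R ^+ 2 * t.
    by rewrite ak natrM; field; rewrite lt0r_neq0.
  rewrite -/a tE.
  have a4 : 4 <= a%:R ^+ 2 :> R by clear -aR; nra.
  have St : S <= a%:R ^+ 2 * t by apply: le_trans tS _; rewrite ler_peMl // ?ltW //; clear -a4; lra.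
  apply: le_trans (ler_norm_sum _ _ _) _.
  apply: (@le_trans _ _ (\sum_(0 <= b < d) (2 * B * E))).
    rewrite big_nat [leRHS]big_nat; apply: ler_sum => b /andP[_ bd].
    have bI : 0 <= (b%:R / d%:R : R) <= 1.
      by rewrite divr_ge0 //= ler_pdivrMr // mul1r ler_nat ltnW.
    apply: le_trans (hF2 _ _ St bI) _; rewrite ler_wpM2l ?mulr_ge0 // /E.
    by apply: mono; clear -a4 kR; nra.
  rewrite sumr_const_nat subn0 -[leLHS]mulr_natl -[leRHS]mulrA; apply: ler_wpM2r; last by rewrite ler_nat.
  by rewrite !mulr_ge0 // ltW.
(* For [d = k] the height is [t] and the points are [b / k], where the k-th cosine equals 1: all [k]
   terms have the sign of [c t] and cannot cancel. *)
have main : k%:R * (A * expR (- k%:R * t) / 2) <= `|\sum_(0 <= b < k) F (b%:R / k%:R) ((k %/ k)%:R * (k%:R * t) / k%:R)|.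
  have -> : (k %/ k)%:R * (k%:R * t) / k%:R = t.
    by rewrite divnn k0 mul1r mulrAC divff ?mul1r // lt0r_neq0.
  have [h1 _ _] := hS t tS.
  have c0 : c t != 0.
    by apply: contraTneq h1 => ->; rewrite normr0 -ltNge mulr_gt0 // expR_gt0.
  have bnd b : (b < k)%N -> `|c t| / 2 <= Num.sg (c t) * F (b%:R / k%:R) t.
    move=> bk; have bI : 0 <= (b%:R / k%:R : R) <= 1.
      by rewrite divr_ge0 //= ?(ltW kp) // ler_pdivrMr // mul1r ler_nat ltnW.
    have := hF t _ tS bI.
    have -> : k%:R * (b%:R / k%:R * (2 * pi)) = b%:R * (2 * pi) - 0 :> R.
      by rewrite subr0; field; rewrite lt0r_neq0.
    rewrite cos2pi cos0 mulr1.
    have [cp|cn] := ltP 0 (c t).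
      by rewrite gtr0_sg // (gtr0_norm cp) mul1r ler_norml => /andP[h _]; clear -h; lra.
    have cn' : c t < 0 by rewrite lt_neqAle c0.
    by rewrite ltr0_sg // (ltr0_norm cn') mulN1r ler_norml => /andP[_ h]; clear -h; lra.
  have s1 : `|Num.sg (c t)| = 1 by rewrite normr_sg c0.
  set Q0 := \sum_(0 <= b < k) _.
  have <- : `|Num.sg (c t) * Q0| = `|Q0| by rewrite normrM s1 mul1r.
  apply: le_trans (ler_norm _).
  rewrite /Q0 mulr_sumr; apply: (@le_trans _ _ (\sum_(0 <= b < k) (`|c t| / 2))).
    rewrite sumr_const_nat subn0 -[leRHS]mulr_natl ler_wpM2l ?(ltW kp) //.
    by rewrite ler_pM2r // invr_gt0.
  by rewrite big_nat [leRHS]big_nat; apply: ler_sum => b /andP[_ bk]; exact: bnd.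
have kt0 : 0 < k%:R * t by rewrite mulr_gt0.
have kdiv : k \in divisors k by rewrite -dvdn_divisors.
have := hecke (k%:R * t) kt0.
rewrite (bigD1_seq k) ?divisors_uniq //=.
set P := \sum_(0 <= b < k) _ in main *; set Q := \sum_(d <- divisors k | d != k) _ => h.
have Qb : `|Q| <= NN * (k%:R * (2 * B)) * E.
  apply: le_trans (ler_norm_sum _ _ _) _; rewrite -mulrA mulr_suml.
  rewrite big_seq_cond [leRHS]big_seq_cond; apply: ler_sum => d /andP[h1 h2].
  by rewrite mul1r; exact: rest.
have Fb : `|F 0 (k%:R * t)| <= 2 * B * E.
  have St : S <= k%:R * t by apply: le_trans tS _; rewrite ler_peMl // ?ltW //; clear -kR; lra.
  apply: le_trans (hF2 _ 0 St _) _; first by rewrite lexx ler01.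
  by rewrite ler_wpM2l ?mulr_ge0 // /E; apply: mono; clear -kR; nra.
have PE : P = Num.sqrt k%:R * L * F 0 (k%:R * t) - Q.
  have : P + Q = Num.sqrt k%:R * (L * F 0 (k%:R * t)) by rewrite -h mulrA mulfV ?mul1r // lt0r_neq0.
  by move=> h'; rewrite -mulrA -h' addrK.
have Pb : `|P| <= D * E.
  have h1 := ler_normB (Num.sqrt k%:R * L * F 0 (k%:R * t)) Q.
  rewrite -PE !normrM (gtr0_norm sk) in h1.
  have h2 : Num.sqrt k%:R * `|L| * `|F 0 (k%:R * t)| <= Num.sqrt k%:R * `|L| * (2 * B * E).
    by rewrite ler_wpM2l // mulr_ge0 // ltW.
  rewrite /D mulrDl addrC -[X in X + _]mulrA.
  by apply: le_trans h1 _; apply: lerD.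
have EE : E = expR (- k%:R * t) * expR (- (2^-1 * k%:R) * t).
  by rewrite -expRD /E; congr expR; field.
have h1 := hS1 t tS1.
have e1 := expR_gt0 (- k%:R * t).
have D0 : 0 <= D by rewrite addr_ge0 // !mulr_ge0 // ltW.
have h2 : D * expR (- (2^-1 * k%:R) * t) <= D * expR (- 2^-1 * t).
  by rewrite ler_wpM2l // ler_expR !mulNr lerN2 ler_pM2r //; clear -kR; lra.
have h3 : D * E <= A / 2 / 2 * expR (- k%:R * t).
  rewrite EE mulrCA mulrC ler_pM2r //; exact: le_trans h2 h1.
have h4 : 2 * (A * expR (- k%:R * t) / 2) <= k%:R * (A * expR (- k%:R * t) / 2).
  by rewrite ler_pM2r // divr_gt0 // mulr_gt0.
have h5 : 0 < A * expR (- k%:R * t) by rewrite mulr_gt0.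
have h6 : A / 2 / 2 * expR (- k%:R * t) = A * expR (- k%:R * t) / 4 by field.
by clear -main Pb h3 h4 h5 h6; lra.
Qed.

(** The lowest mode is [cos (2 pi x)] by [cusp_hecke], with a positive coefficient by [hm_positive].
    Its values at 0 and 1/2 give the two signs, and the estimate for differences, relative to the
    difference of cosines, gives the monotonicity. *)
Lemma cusp_behaviour (R : realType) (phi : upper R -> R) : even_hecke_maass_cusp_form phi ->
  exists2 Y : R, 1 <= Y & forall y, Y <= y ->
    [/\ 0 < coord phi (0, y), coord phi (2^-1, y) < 0 &
        forall x x', 0 <= x -> x <= x' -> x' <= 2^-1 -> coord phi (x', y) <= coord phi (x, y)].
Proof.
move=> hphi; set f := coord phi.
have pi0 := pi_gt0 R; have pn := lt0r_neq0 pi0.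
have hf := hm_smooth hphi.
have [l l0 pde] := coord_pde hphi.
pose c : R := (2 * pi)^-1.
have c0 : 0 < c by rewrite invr_gt0 mulr_gt0.
have cK : c * (2 * pi) = 1 by rewrite /c mulVf // mulf_neq0.
pose V (t : R) := l / t ^+ 2.
pose u t x := f (x * c, t * c).
have pic : pi * c = 2^-1 by rewrite /c; clear -pn; move: (pi) pn => p pn; field.
have shift x y : 0 < y -> f (1 - x, y) = f (x, y) by exact: coord_shift.
have [ut [utt [ux [uxx hu]]]] : exists ut utt ux uxx, cylinder_solution u ut utt ux uxx V 0.
  apply: (conformal_cylinder hf pde (scaling_conformal c0)).
  - move=> t x t0; rewrite /V; have tn := lt0r_neq0 t0; field.
    exact: tn.
  - by move=> t x t0; rewrite mulNr /f coord_even // mulr_gt0.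
  - move=> t x t0; rewrite -[RHS]shift; last by rewrite mulr_gt0.
    have E : (pi + x) * c = 1 - (pi - x) * c by rewrite mulrDl mulrBl pic; lra.
    by rewrite -E.
have cf z : 0 < z.2 -> {for z, continuous f} by move=> z0; apply: C1_continuous; exact: tcd_C1.
have cfy y : 0 < y -> continuous (fun x => f (x, y)).
  move=> y0 x; apply: (@cvg_comp _ _ _ (fun x => (x, y)) f _ (nbhs (x, y))); last exact: cf.
  by apply: (@cvg_pair _ _ _ (nbhs x) (nbhs x) (nbhs y)); [exact: cvg_id|exact: cvg_cst].
have [Y1 hY1] : exists Y1 : R, forall y, Y1 <= y -> 0 < f (0, y).
  have [Y1 [_ hY1]] := hm_positive hphi; exists (Y1 + 1) => y hy; apply: hY1 => /=; lra.
(* From here on [t <= t ^+ 2], so that [l / t ^+ 2 <= 3 / 4]. *)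
pose T := Num.max 1 (4 / 3 * (l + 1)).
have T1 : 1 <= T by rewrite le_max lexx.
have Tl : 4 / 3 * (l + 1) <= T by rewrite le_max lexx orbT.
have T0 : 0 < T by lra.
have cut t : continuous (fun x => f (x, t * c)) -> continuous (u t).
  move=> h x; apply: (@cvg_comp _ _ _ (fun x : R => x * c) (fun x => f (x, t * c)) _ (nbhs (x * c))); last exact: h.
  exact: mulrr_continuous.
have mean0 t : T <= t -> int0pi (u t) = 0.
  move=> Tt; have tc : 0 < t * c by rewrite mulr_gt0 //; lra.
  rewrite (@int0pi_scale R (fun x => f (x, t * c))); last exact: cfy.
  rewrite half_integral_eq0 ?mulr0 //; first exact: cfy.
    by move=> x; exact: shift.
  exact: (hm_cuspidal hphi).
have [a1 b1 a10 ab|t Tt|k k0 [e e0 [S hS]]||] := @cylinder_asymptotics R u ut utt ux uxx V 0 T hu T0 T0 _ _ mean0.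
- exists (l / a1 ^+ 2) => t /andP[h1 h2].
  have t0 : 0 < t by lra.
  rewrite ger0_norm /V ?divr_ge0 ?sqr_ge0 ?(ltW l0) // ler_pM2l // lef_pV2 ?posrE ?exprn_gt0 //.
  by rewrite ler_pXn2r ?nnegrE ?(ltW a10) ?(ltW t0).
- have t0 : 0 < t by lra.
  rewrite /V divr_ge0 ?sqr_ge0 ?(ltW l0) //= ler_pdivrMr ?exprn_gt0 //.
  have t1 := le_trans T1 Tt.
  have h1 : t <= t ^+ 2 by rewrite expr2 ler_peMl // ltW.
  by clear -Tl Tt h1; lra.
(* With [t = 2 * pi * y], Cauchy-Schwarz turns [e * t ^+ 2 <= mode u k t ^+ 2] into a lower bound
   [2 * e] for the integral of [(f / y) ^+ 2] at every large height [y]. *)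
- pose Y := Num.max 1 (S * c).
  have Yp : 1 <= Y by rewrite le_max lexx.
  have YS : S * c <= Y by rewrite le_max lexx orbT.
  have e20 : 0 < 2 * e by lra.
  apply: (@cusp_no_growth R f (2 * e) Y cf (hm_normalized hphi) e20 Yp) => y Yy.
  have y0 : 0 < y by apply: lt_le_trans Yy; exact: lt_le_trans Yp.
  pose t := y * (2 * pi).
  have tc : t * c = y by rewrite /t mulrAC -mulrA cK mulr1.
  have St : S <= t by rewrite -(@ler_pM2r _ c) // tc; exact: le_trans Yy.
  have cy := cfy y y0.
  have h1 := hS t St.
  have h2 := @int0pi_cauchy_schwarz R (u t) k.
  have cu : continuous (u t) by apply: cut; rewrite tc.
  have E : int0pi (fun x => u t x ^+ 2) = 2 * pi * \int[lebesgue_measure]_(x in `[0, 2^-1]) (f (x, y) ^+ 2).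
    rewrite -(@int0pi_scale R (fun x => f (x, y) ^+ 2)); last exact: (continuous_mul cy cy).
    by apply: eq_int0pi => x _; rewrite /u tc.
  have cg : continuous (fun x => (f (x, y) / y) ^+ 2).
    by apply: (@continuous_mul R (fun x => f (x, y) / y) (fun x => f (x, y) / y));
      apply: continuous_mul => //; exact: continuous_const.
  have ig (g : R -> R) : continuous g -> lebesgue_measure.-integrable (`[0%R, 2^-1%R]%classic : set R) (EFin \o g).
    move=> hg; apply: continuous_compact_integrable; first exact: segment_compact.
    exact: continuous_subspaceT.
  have -> : (\int[lebesgue_measure]_(x in `[0%R, 2^-1%R]) ((f (x, y) / y) ^+ 2)%:E)%E =
    (\int[lebesgue_measure]_(x in `[0, 2^-1]) ((f (x, y) / y) ^+ 2))%:E.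
    by rewrite /Rintegral fineK //; apply: integrable_fin_num => //; exact: (ig _ cg).
  rewrite lee_fin.
  have -> : \int[lebesgue_measure]_(x in `[0, 2^-1]) ((f (x, y) / y) ^+ 2) =
     \int[lebesgue_measure]_(x in `[0, 2^-1]) (f (x, y) ^+ 2) / y ^+ 2.
    rewrite -RintegralZr //; last exact: (ig _ (continuous_mul cy cy)).
    by apply: eq_Rintegral => x _; rewrite expr_div_n.
  have h3 := le_trans h1 (h2 cu); move: h3; rewrite E /t => h3.
  rewrite ler_pdivlMr ?exprn_gt0 //.
  have p2 : 0 < 2 * pi ^+ 2 :> R by rewrite mulr_gt0 // exprn_gt0.
  rewrite -(@ler_pM2l _ (2 * pi ^+ 2)) //; clear -h3; move: h3; set I := Rintegral _ _ _.
  have -> : e * (y * (2 * pi)) ^+ 2 = 2 * pi ^+ 2 * (2 * e * y ^+ 2) by ring.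
  by have -> : pi * (2 * pi * I) = 2 * pi ^+ 2 * I by ring.
- move=> uz; exfalso.
  pose y := Num.max Y1 1; have y0 : 0 < y by rewrite lt_max ltr01 orbT.
  have yY : Y1 <= y by rewrite le_max lexx.
  have := hY1 y yY; have := uz (y * (2 * pi)) 0; rewrite /u mul0r -mulrA (mulrC _ c) cK mulr1.
  by rewrite mulr_gt0 ?mulr_gt0 // lexx ltW // => -> //; rewrite ltxx.
- move=> [k [a [A [B [S [k0 A0 hS]]]]]].
pose S' := Num.max S 1.
have S'1 : 1 <= S' by rewrite le_max lexx orbT.
have SS' : S <= S' by rewrite le_max lexx.
have k1 : k = 1%N.
  apply/eqP; rewrite eqn_leq k0 andbT leqNgt; apply/negP => k1.
  have [L hL] := hm_hecke hphi k0.
  apply: (@cusp_hecke R (fun x t => if 0 < t then f (x, t * c) else 0) k L A B S' a) => //.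
  - by move=> x t; case: ifP => // t0; apply: shift; rewrite mulr_gt0.
  - move=> t St; have t0 : 0 < t by apply: lt_le_trans St; exact: lt_le_trans S'1.
    have [h1 h2 h3 _] := hS t (le_trans SS' St); split=> // x /andP[x0 x1].
    rewrite t0; have := h3 (x * (2 * pi)); rewrite /u -mulrA (mulrC (2 * pi)) cK mulr1; apply.
    rewrite mulr_ge0 //=; last by rewrite mulr_ge0 // ltW.
    by rewrite mulrA -[leRHS]mul1r ler_pM2r //; clear -x1; lra.
  - move=> t t0; rewrite t0.
    have tc : 0 < (0 : R, t * c).2 by rewrite /= mulr_gt0.
    have := hL (mkupper tc); rewrite /hecke /= -coordE -/f => <-.
    congr (_ * _); apply: eq_big_seq => d; rewrite -dvdn_divisors // => dk.
    have d0 : (0 < d)%N by exact: dvdn_gt0 dk.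
    have kd : (0 < k %/ d)%N by rewrite divn_gt0 // dvdn_leq.
    apply: eq_bigr => b _; rewrite divr_gt0 ?ltr0n ?mulr_gt0 ?ltr0n //.
    by congr (f (_, _)); [rewrite mulr0 add0r|rewrite mulrAC mulrA].
rewrite k1 in hS.
pose Y := Num.max (Num.max 1 Y1) (S' * c).
have Yp : 1 <= Y by rewrite !le_max lexx.
have YY1 : Y1 <= Y by rewrite !le_max lexx orbT.
have YS : S' * c <= Y by rewrite !le_max lexx orbT.
exists Y => // y Yy.
have f0 := hY1 y (le_trans YY1 Yy).
pose t := y * (2 * pi).
have tc : t * c = y by rewrite /t mulrAC -mulrA cK mulr1.
have St : S <= t.
  by apply: le_trans SS' _; rewrite -(@ler_pM2r _ c) // tc; exact: le_trans Yy.
have [h1 _ h3 h4] := hS t St.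
have an : 0 < `|a t| by apply: lt_le_trans h1; rewrite mulr_gt0 // expR_gt0.
have uE x : u t (x * (2 * pi)) = f (x, y) by rewrite /u tc -mulrA (mulrC (2 * pi)) cK mulr1.
have i0 : 0 <= (0 : R) <= pi by rewrite lexx ltW.
have ipi : 0 <= (pi : R) <= pi by rewrite lexx ltW.
have a0 : 0 < a t.
  have := h3 0 i0; rewrite mulr0 cos0 mulr1 -{1}(mul0r (2 * pi)) uE.
  have [//|an'] := ltP 0 (a t).
  rewrite (ler0_norm an') in an *; rewrite ler_norml => /andP[_ h].
  by move: (f _) h f0 => w h f0; clear -h f0 an; lra.
split=> //.
  have := h3 pi ipi; rewrite mul1r cospi mulrN1.
  have {1}-> : pi = 2^-1 * (2 * pi) :> R by rewrite mulrA mulVf // mul1r.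
  by rewrite uE (gtr0_norm a0) ler_norml => /andP[_]; move: (f _) => w h; clear -h a0; lra.
move=> x x' x0 xx x1.
have xI (s : R) : 0 <= s -> s <= 2^-1 -> 0 <= s * (2 * pi) <= pi.
  move=> s0 s1; rewrite !mulr_ge0 ?(ltW pi0) //=.
  by rewrite mulrA -[leRHS]mul1r ler_pM2r //; clear -s1; lra.
have I1 := xI x x0 (le_trans xx x1); have I2 := xI x' (le_trans x0 xx) x1.
have := h4 _ _ I1 I2; rewrite !uE !mul1r (gtr0_norm a0).
have cc : cos (x' * (2 * pi)) <= cos (x * (2 * pi)).
  rewrite leNgt; apply/negP => cl; have := cl.
  rewrite ltr_cos ?in_itv //= ltNge => /negP; apply; rewrite ler_pM2r //.
  by rewrite mulr_gt0.
have -> : `|cos (x * (2 * pi)) - cos (x' * (2 * pi))| = cos (x * (2 * pi)) - cos (x' * (2 * pi)).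
  by rewrite ger0_norm // subr_ge0.
rewrite ler_norml => /andP[h5 _].
have : 0 <= a t / 2 * (cos (x * (2 * pi)) - cos (x' * (2 * pi))).
  by rewrite mulr_ge0 ?subr_ge0 // divr_ge0 // ltW.
by move: (f _) (f _) h5 => v w h5 h6; clear -h5 h6; lra.
Qed.

(** * Reduction theory *)

(** This is [|m z + n|^2]; the height of [mob a b c d z] is [z.2 / nrm c d z]. *)
Definition nrm (R : realType) (m n : int) (z : R * R) : R :=
  (m%:~R * z.1 + n%:~R) ^+ 2 + (m%:~R * z.2) ^+ 2.

Lemma sqrz_ge1 (m : int) : m != 0 -> 1 <= m ^+ 2.
Proof.
move=> m0; have : 0 < m ^+ 2 by rewrite lt0r sqrf_eq0 m0 sqr_ge0.
by move: (m ^+ 2) => p; lia.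
Qed.

Lemma sqrz_ge4 (m : int) : 0 <= m -> 1 < m ^+ 2 -> 4 <= m ^+ 2.
Proof. by case: m => // -[|[|m]] // _ _; rewrite expr2; nia. Qed.

Lemma nrm_gt0 (R : realType) (m n : int) (z : R * R) : 0 < z.2 ->
  (m != 0) || (n != 0) -> 0 < nrm m n z.
Proof.
move=> z0 mn; rewrite lt0r addr_ge0 ?sqr_ge0 // andbT paddr_eq0 ?sqr_ge0 // !sqrf_eq0.
rewrite mulf_eq0 (gt_eqF z0) orbF intr_eq0; apply/negP => /andP[h1 /eqP m0].
by move: h1 mn; rewrite m0 mul0r add0r intr_eq0 => /eqP ->; rewrite eqxx.
Qed.

Lemma det1_neq0 (a b c d : int) : a * d - b * c = 1 -> (c != 0) || (d != 0).
Proof.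
move=> h; rewrite -negb_and; apply/negP => /andP[/eqP c0 /eqP d0].
by move: h; rewrite c0 d0 !mulr0 subrr.
Qed.

Lemma det1_mul_neq0 (a b c d m n : int) : a * d - b * c = 1 -> (m != 0) || (n != 0) ->
  (m * a + n * c != 0) || (m * b + n * d != 0).
Proof.
move=> h; rewrite -!negb_and; apply: contra => /andP[/eqP h1 /eqP h2].
have m0 : m = (m * a + n * c) * d - (m * b + n * d) * c.
  by rewrite -[LHS]mulr1 -h; ring.
have n0 : n = (m * b + n * d) * a - (m * a + n * c) * b.
  by rewrite -[LHS]mulr1 -h; ring.
by apply/andP; split; apply/eqP; [rewrite m0|rewrite n0]; rewrite h1 h2 !mul0r subrr.
Qed.

Lemma det1R (R : realType) (a b c d : int) : a * d - b * c = 1 ->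
  a%:~R * d%:~R - b%:~R * c%:~R = 1 :> R.
Proof. by move=> h; rewrite -!intrM -intrB h. Qed.

Lemma nrm_mob (R : realType) (a b c d m n : int) (z : R * R) : a * d - b * c = 1 -> 0 < z.2 ->
  nrm m n (mob a b c d z) = nrm (m * a + n * c) (m * b + n * d) z / nrm c d z.
Proof.
move=> h z0; have := lt0r_neq0 (nrm_gt0 z0 (det1_neq0 h)).
have := det1R R h; clear h; rewrite /nrm /mob /= !intrD !intrM; case: z z0 => x y /= _.
move: (a%:~R) (b%:~R) (c%:~R) (d%:~R) (m%:~R) (n%:~R) => {}a {}b {}c {}d {}m {}n h1 N0.
have E : (m * (y / ((c * x + d) ^+ 2 + (c * y) ^+ 2))) ^+ 2 =
    (m * (a * d - b * c) * y) ^+ 2 / ((c * x + d) ^+ 2 + (c * y) ^+ 2) ^+ 2.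
  by rewrite h1 mulr1 mulrA expr_div_n.
by rewrite E; field.
Qed.

Lemma fd_gt0 (R : realType) (z : R * R) : fundamental_domain R z -> 0 < z.2.
Proof. by case. Qed.

(** As [|z| >= 1] and [|2 x| <= 1], the form is at least [m ^+ 2 - |m n| + n ^+ 2], a positive
    integer. *)
Lemma nrm_fd (R : realType) (z : R * R) (m n : int) : fundamental_domain R z ->
  (m != 0) || (n != 0) -> 1 <= nrm m n z.
Proof.
move=> [z0 zx zz] mn.
have h1 : 1 <= m ^+ 2 + n ^+ 2 - `|m * n|.
  rewrite normrM -[m ^+ 2]real_normK ?num_real // -[n ^+ 2]real_normK ?num_real //.
  move: mn; rewrite -[m == 0]normr_eq0 -[n == 0]normr_eq0.
  move: (normr_ge0 m) (normr_ge0 n); move: `|m| `|n| => p q p0 q0 /orP pq.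
  have : 0 < p ^+ 2 + q ^+ 2 - p * q; last by lia.
  by case: pq => /eqP pq; nia.
have h2 : 1 <= m%:~R ^+ 2 + n%:~R ^+ 2 - `|m%:~R * n%:~R| :> R.
  by move: h1; rewrite -(ler_int R) intrB intrD intr_norm intrM !rmorphXn.
have -> : nrm m n z = m%:~R ^+ 2 * (z.1 ^+ 2 + z.2 ^+ 2) + 2 * z.1 * (m%:~R * n%:~R) + n%:~R ^+ 2.
  by rewrite /nrm; ring.
move: h2; set M := m%:~R; set N := n%:~R => h2.
have h3 : M ^+ 2 <= M ^+ 2 * (z.1 ^+ 2 + z.2 ^+ 2) by rewrite ler_peMr // sqr_ge0.
have h4 : - `|M * N| <= 2 * z.1 * (M * N).
  suff : `|2 * z.1 * (M * N)| <= `|M * N| by rewrite ler_norml => /andP[].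
  rewrite normrM ler_piMl // normrM ger0_norm //; move: zx; clear; lra.
by clear -h2 h3 h4; lra.
Qed.

Lemma mob_im (R : realType) (a b c d : int) (z : R * R) : (mob a b c d z).2 = z.2 / nrm c d z.
Proof. by []. Qed.

Lemma mob_trans (R : realType) (a b d : int) (z : R * R) : a * d - b * 0 = 1 ->
  exists k : int, mob a b 0 d z = (z.1 + k%:~R, z.2).
Proof.
rewrite mulr0 subr0 => ad; exists (b * d).
have d2 : d%:~R ^+ 2 = 1 :> R.
  rewrite -rmorphXn /= (_ : d ^+ 2 = 1) //.
  have : (d %| 1)%Z by apply/dvdzP; exists a.
  by rewrite dvdz1 => /eqP h; rewrite -[LHS]real_normK ?num_real // -abszE h.
rewrite /mob !mul0r !mulr0 add0r mul0r addr0 expr0n addr0 d2 !divr1 intrM; congr (_, _).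
have adR : a%:~R * d%:~R = 1 :> R by rewrite -intrM ad.
by rewrite mulrDl mulrAC adR mul1r.
Qed.

Lemma mob_shift (R : realType) (a b c d k : int) (z : R * R) : 0 < nrm c d z ->
  mob (a - k * c) (b - k * d) c d z = ((mob a b c d z).1 - k%:~R, (mob a b c d z).2).
Proof.
move=> /lt0r_neq0; rewrite /nrm /mob /= !intrB !intrM; case: z => x y /=.
by move: (k%:~R) (c%:~R) (d%:~R) (a%:~R) (b%:~R) => *; congr (_, _); field.
Qed.

(** By [nrm_fd] each point is at least as high as the other, so the heights agree. If both matrices
    have a nonzero lower left entry, [nrm c d = 1] puts both points on the unit circle; otherwise
    one of the matrices is a translation. *)
Lemma fd_unique (R : realType) (z w : upper R) : modular_rel z w ->
  fundamental_domain R (val z) -> fundamental_domain R (val w) ->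
  (exists k : int, val w = ((val z).1 + k%:~R, (val z).2)) \/
  [/\ (val z).1 ^+ 2 + (val z).2 ^+ 2 = 1, (val w).1 ^+ 2 + (val w).2 ^+ 2 = 1 &
      (val w).2 = (val z).2].
Proof.
move=> zw fz fw; have wz : modular_rel w z by have [_ sym _] := modular_equiv_rel R; rewrite sym.
have half (p q : R * R) (a b c d : int) : fundamental_domain R p -> fundamental_domain R q ->
    a * d - b * c = 1 -> q = mob a b c d p -> q.2 <= p.2 /\ (q.2 = p.2 -> c != 0 -> p.1 ^+ 2 + p.2 ^+ 2 = 1).
  move=> fp fq h E; have p0 := fd_gt0 fp.
  have N1 := nrm_fd fp (det1_neq0 h).
  have N0 : 0 < nrm c d p by lra.
  have qE : q.2 = p.2 / nrm c d p by rewrite E.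
  split; first by rewrite qE ler_pdivrMr // ler_peMr // ltW.
  rewrite qE => /eqP e1 c0.
  have {}e1 : nrm c d p = 1.
    have e2 : p.2 = p.2 * nrm c d p by rewrite -[LHS](divfK (lt0r_neq0 N0)) (eqP e1).
    by apply/esym/(mulfI (lt0r_neq0 p0)); rewrite mulr1.
  have [_ px pp] := fp; apply/eqP; rewrite eq_le pp andbT.
  have cdN : `|d| <= d ^+ 2 + 0 by rewrite addr0 -[leRHS]real_normK ?num_real //; have := normr_ge0 d; nia.
  have c1 : 1 <= c ^+ 2 by exact: sqrz_ge1.
  have y34 : 3 / 4 <= p.2 ^+ 2.
    have : p.1 ^+ 2 <= (2^-1) ^+ 2 by rewrite -[leLHS]real_normK ?num_real // ler_pXn2r ?nnegrE.
    by move: pp; clear; lra.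
  (* As the squared height is at least 3/4, [4 <= c ^+ 2] would give [3 <= nrm c d p]. *)
  have c1' : c ^+ 2 = 1.
    apply/eqP; rewrite eq_le c1 andbT leNgt; apply/negP => c2.
    have c4 : 4 <= c ^+ 2.
      have := real_normK (num_real c) => <-; have : 1 < `|c| ^+ 2 by rewrite real_normK ?num_real.
      by apply: sqrz_ge4; exact: normr_ge0.
    have c4R : 4 <= c%:~R ^+ 2 :> R by rewrite -rmorphXn /= (ler_int R 4).
    have : 3 <= (c%:~R * p.2) ^+ 2 by rewrite exprMn; nra.
    by move: e1; rewrite /nrm; have := sqr_ge0 (c%:~R * p.1 + d%:~R); lra.
  have c1R : c%:~R ^+ 2 = 1 :> R by rewrite -rmorphXn /= c1'.
  (* With [nrm c d p = 1] and [c ^+ 2 = 1] this reads [1 = |p|^2 + 2 x c d + d^2]; since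
     [|2 x c d| <= |d| <= d^2], it follows that [|p|^2 <= 1]. *)
  have E1 : nrm c d p = c%:~R ^+ 2 * (p.1 ^+ 2 + p.2 ^+ 2) + 2 * p.1 * (c%:~R * d%:~R) + d%:~R ^+ 2.
    by rewrite /nrm; ring.
  rewrite e1 c1R mul1r in E1.
  have nc : `|c%:~R : R| = 1 by apply/eqP; rewrite -(@eqrXn2 _ 2) // real_normK ?num_real // c1R expr1n.
  have h4 : - `|d%:~R : R| <= 2 * p.1 * (c%:~R * d%:~R).
    suff : `|2 * p.1 * (c%:~R * d%:~R)| <= `|d%:~R : R| by rewrite ler_norml => /andP[].
    rewrite !normrM nc mul1r ler_piMl // ger0_norm //; move: px; clear; lra.
  have dd : `|d%:~R| <= d%:~R ^+ 2 :> R.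
    by move: cdN; rewrite addr0 -(ler_int R) intr_norm rmorphXn.
  by clear -E1 h4 dd; lra.
have [a [b [c [d [h E]]]]] := (modular_relP z w).1 zw.
have [a' [b' [c' [d' [h' E']]]]] := (modular_relP w z).1 wz.
have [le1 k1] := half _ _ _ _ _ _ fz fw h E.
have [le2 k2] := half _ _ _ _ _ _ fw fz h' E'.
have e : (val w).2 = (val z).2 by apply/eqP; rewrite eq_le le1 le2.
have [c0|c0] := eqVneq c 0.
  by left; rewrite E; move: h; rewrite c0 => h; exact: mob_trans.
have [c0'|c0'] := eqVneq c' 0; last by right; split; [exact: k1|exact: k2|].
left; move: h'; rewrite c0' => h'; have [k hk] := mob_trans (val w) h'.
exists (- k); rewrite E' c0' hk /= rmorphN /= addrK.
by case: (val w).
Qed.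

(** The imaginary part gives [m ^+ 2 * y1 ^+ 2 <= B], which bounds [m]; the real part then bounds
    [n], uniformly over the region. *)
Lemma nrm_bound (R : realType) (y1 A B : R) : 0 < y1 -> exists M : nat,
  forall (m n : int) (z : R * R), y1 <= z.2 -> `|z.1| <= A -> nrm m n z <= B ->
  (`|m| <= M)%N /\ (`|n| <= M)%N.
Proof.
move=> y10; pose C := B / y1 ^+ 2.
exists (`|Num.ceil (`|C| + (1 + `|B| + `|C| * `|A|))|)%N => m n z yz xz hB.
set D := `|C| + _.
have D0 : 0 <= D by rewrite /D !addr_ge0 // ?mulr_ge0.
have key (k : int) : `|k%:~R : R| <= D -> (`|k| <= `|Num.ceil D|)%N.
  move=> h; rewrite -lez_nat !abszE -intr_norm in h *.
  have c0 : 0 <= Num.ceil D by rewrite ceil_ge0; lra.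
  rewrite (ger0_norm c0) -(ler_int R); apply: le_trans h _; exact: ceil_ge.
have h1 : (m%:~R * z.2) ^+ 2 <= B by move: hB; rewrite /nrm; have := sqr_ge0 (m%:~R * z.1 + n%:~R); lra.
have h2 : (m%:~R * z.1 + n%:~R) ^+ 2 <= B by move: hB; rewrite /nrm; have := sqr_ge0 (m%:~R * z.2); lra.
have y2 : y1 ^+ 2 <= z.2 ^+ 2 by rewrite ler_pXn2r ?nnegrE //; clear -y10 yz; lra.
have mC : m%:~R ^+ 2 <= C.
  rewrite /C ler_pdivlMr ?exprn_gt0 //; apply: le_trans h1; rewrite exprMn.
  by rewrite ler_wpM2l ?sqr_ge0.
have mm : `|m%:~R : R| <= C.
  apply: le_trans mC; rewrite -rmorphXn -intr_norm ler_int.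
  by rewrite -[leRHS]real_normK ?num_real //; have h := normr_ge0 m; clear -h; nia.
have CC : C <= `|C| := ler_norm _.
have BB : B <= `|B| := ler_norm _.
have AA : `|z.1| <= `|A| by apply: le_trans xz (ler_norm _).
split; apply: key; rewrite /D.
  by have h6 := mulr_ge0 (normr_ge0 C) (normr_ge0 A); have h7 := normr_ge0 B; clear -h6 h7 mm CC; lra.
have h3 : `|m%:~R * z.1 + n%:~R| <= 1 + B.
  have := sqr_ge0 (`|m%:~R * z.1 + n%:~R| - 1); rewrite sqrrB real_normK ?num_real //.
  by have := normr_ge0 (m%:~R * z.1 + n%:~R); move: h2; clear; lra.
have h4 : `|m%:~R * z.1| <= `|C| * `|A| by rewrite normrM; apply: ler_pM => //; exact: le_trans CC.
have h5 := ler_normB (m%:~R * z.1 + n%:~R) (m%:~R * z.1).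
rewrite addrAC subrr add0r in h5.
by have h6 := normr_ge0 C; clear -h3 h4 h5 h6 BB; lra.
Qed.

(** The pair [(C, D)] minimizes [|C z + D|] over the nonzero pairs, that is, maximizes the height.
    Minimality makes it coprime and [Bezoutz] completes it to a matrix. After translation into
    [|x| <= 1/2], minimality applied to the pair [(1, - k)] puts the point outside the unit disc. *)
Lemma fd_reduction (R : realType) (z : R * R) : 0 < z.2 ->
  exists a b c d : int, a * d - b * c = 1 /\ fundamental_domain R (mob a b c d z).
Proof.
move=> z0.
have [K hK] := @nrm_bound R z.2 `|z.1| 1 z0.
pose c (i : 'I_(2 * K).+1) : int := i%:Z - K%:Z.
pose F (p : 'I_(2 * K).+1 * 'I_(2 * K).+1) := nrm (c p.1) (c p.2) z.
pose P (p : 'I_(2 * K).+1 * 'I_(2 * K).+1) := (c p.1 != 0) || (c p.2 != 0).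
have box (m n : int) : (`|m| <= K)%N -> (`|n| <= K)%N -> exists p, c p.1 = m /\ c p.2 = n.
  move=> hm hn.
  have im : (`|(m + K%:Z)%R| < (2 * K).+1)%N by lia.
  have jn : (`|(n + K%:Z)%R| < (2 * K).+1)%N by lia.
  by exists (Ordinal im, Ordinal jn); rewrite /c /=; split; lia.
have n01 : nrm 0 1 z = 1 by rewrite /nrm !mul0r add0r expr0n addr0 expr1n.
have [p0 [p01 p02]] : exists p, c p.1 = 0 /\ c p.2 = 1.
  have h01 : nrm 0 1 z <= 1 by rewrite n01.
  by have [_ k1] := hK 0 1 z (lexx _) (lexx _) h01; exact: box.
have Pp0 : P p0 by rewrite /P p02 orbT.
case: (Order.TotalTheory.arg_minP F Pp0) => p Pp hp.
have minF (m n : int) : (m != 0) || (n != 0) -> F p <= nrm m n z.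
  move=> mn; have [h|h] := leP (nrm m n z) 1.
    have [hm hn] := hK m n z (lexx _) (lexx _) h.
    have [q [q1 q2]] := box m n hm hn.
    by have := hp q; rewrite /P /F q1 q2 => /(_ mn).
  by apply: le_trans (hp p0 Pp0) _; rewrite /F p01 p02 n01 ltW.
have Fp0 : 0 < F p by exact: nrm_gt0.
pose C := c p.1; pose D := c p.2.
pose g := gcdz C D.
have g0 : 0 < g.
  rewrite lt0r andbT; apply: contraL Pp; rewrite gcdz_eq0 => /andP[/eqP h1 /eqP h2].
  by rewrite /P -/C -/D h1 h2.
have g1 : g = 1.
  have /dvdzP[C1 hC1] := dvdz_gcdl C D; have /dvdzP[D1 hD1] := dvdz_gcdr C D.
  rewrite -/g in hC1 hD1.
  have n1 : (C1 != 0) || (D1 != 0).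
    rewrite -negb_and; apply: contraL Pp => /andP[/eqP h1 /eqP h2].
    by rewrite /P -/C -/D hC1 hD1 h1 h2 !mul0r.
  have := minF _ _ n1.
  have -> : F p = g%:~R ^+ 2 * nrm C1 D1 z.
    by rewrite /F -/C -/D hC1 hD1 /nrm !intrM; ring.
  rewrite ger_pMl; last exact: nrm_gt0.
  rewrite -rmorphXn /= (ler_int R _ 1) => h; nia.
have [u [v uv]] := Bezoutz C D.
rewrite -/g g1 in uv.
have det : v * D - (- u) * C = 1 by rewrite -uv; ring.
pose w := mob v (- u) C D z.
have w0 : 0 < w.2 by rewrite divr_gt0.
have wge (m n : int) : (m != 0) || (n != 0) -> 1 <= nrm m n w.
  move=> mn; rewrite nrm_mob // ler_pdivlMr // mul1r; apply: minF.
  exact: (det1_mul_neq0 det).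
pose k := Num.floor (w.1 + 2^-1).
have det' : (v - k * C) * D - (- u - k * D) * C = 1 by rewrite -det; ring.
have E : mob (v - k * C) (- u - k * D) C D z = (w.1 - k%:~R, w.2).
  exact: mob_shift.
exists (v - k * C), (- u - k * D), C, D; split=> //; rewrite E.
have /andP[k1 k2] := floor_itv (w.1 + 2^-1).
rewrite -/k intrD mulr1z in k1 k2.
have key (r q : R) : q <= r + 2^-1 -> r + 2^-1 < q + 1 -> `|r - q| <= 2^-1.
  by move=> h1 h2; rewrite ler_norml; apply/andP; split; lra.
split=> //=; first exact: key.
by have := wge 1 (- k) isT; rewrite /nrm rmorphN /= !mul1r.
Qed.

(** A point [w] of the fundamental domain has height at least 1/2, which bounds
    [|c z + d|^2 = y / w.2]. Then [|a z + b|^2 = |w|^2 * |c z + d|^2] is bounded as well, and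
    [nrm_bound] applies to both rows. *)
Lemma fd_locally_finite (R : realType) (z0 : R * R) : 0 < z0.2 -> exists M : nat,
  \forall z \near z0, 0 < z.2 /\ forall a b c d : int, a * d - b * c = 1 ->
    fundamental_domain R (mob a b c d z) ->
    [/\ (`|a| <= M)%N, (`|b| <= M)%N, (`|c| <= M)%N & (`|d| <= M)%N].
Proof.
move=> y00; pose y0 := z0.2; pose A := `|z0.1| + y0.
have y10 : 0 < y0 / 2 by rewrite divr_gt0.
have [M1 h1] := @nrm_bound R (y0 / 2) A (4 * y0) y10.
have [M2 h2] := @nrm_bound R (y0 / 2) A (y0 + 1 + (2 * y0) ^+ 2) y10.
exists (maxn M1 M2); apply/near_pairP; exists (y0 / 2) => // x y hx hy.
have y1 : y0 / 2 <= y by move: hy; rewrite ltr_norml => /andP[]; lra.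
have y2 : y <= 2 * y0 by move: hy; rewrite ltr_norml => /andP[]; lra.
have yp : 0 < y by lra.
have xA : `|x| <= A.
  by rewrite /A; have := ler_normD (x - z0.1) z0.1; rewrite subrK; lra.
split=> // a b c d h fw.
have N0 : 0 < nrm c d (x, y) by exact: nrm_gt0 (det1_neq0 h).
have [w0 wx ww] := fw; rewrite mob_im /= in w0.
set w := mob a b c d (x, y) in fw w0 wx ww *.
have x4 : w.1 ^+ 2 <= (2^-1) ^+ 2 by rewrite -[leLHS]real_normK ?num_real // ler_pXn2r ?nnegrE.
have w12 : 2^-1 <= w.2.
  rewrite leNgt; apply/negP => h3.
  have : w.2 ^+ 2 <= (2^-1) ^+ 2 by rewrite ler_pXn2r ?nnegrE //; apply: ltW.
  by move: ww x4; clear; lra.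
have NB : nrm c d (x, y) <= 4 * y0.
  by move: w12; rewrite mob_im /= ler_pdivlMr // => h3; clear -h3 y2; lra.
have [c1 d1] := h1 c d (x, y) y1 xA NB.
have NA : nrm a b (x, y) <= y0 + 1 + (2 * y0) ^+ 2.
  have E := @nrm_mob R a b c d 1 0 (x, y) h yp.
  rewrite !mul1r !mul0r !addr0 in E.
  have -> : nrm a b (x, y) = nrm 1 0 w * nrm c d (x, y) by rewrite E divfK // lt0r_neq0.
  rewrite {1}/nrm mul1r addr0 mul1r mulrDl.
  have k1 : w.1 ^+ 2 * nrm c d (x, y) <= 4^-1 * (4 * y0).
    apply: ler_pM => //; [exact: sqr_ge0|exact: ltW|].
    by move: x4; clear; lra.
  have -> : w.2 ^+ 2 * nrm c d (x, y) = y ^+ 2 / nrm c d (x, y).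
    by rewrite mob_im /=; field; rewrite lt0r_neq0.
  have yy : y ^+ 2 <= (2 * y0) ^+ 2 by rewrite ler_pXn2r ?nnegrE //; clear -yp y2; lra.
  have k2 : y ^+ 2 / nrm c d (x, y) <= 1 + y ^+ 2.
    rewrite ler_pdivrMr //.
    have [c0|c0] := eqVneq c 0.
      have d0 : d != 0 by have := det1_neq0 h; rewrite c0 eqxx.
      have d2 : 1 <= d ^+ 2 by exact: sqrz_ge1.
      have d2R : 1 <= d%:~R ^+ 2 :> R by rewrite -rmorphXn /= (ler_int R 1).
      by rewrite /nrm c0 !mul0r add0r expr0n addr0; have h3 := sqr_ge0 y; clear -h3 d2R; nra.
    have c2 : 1 <= c ^+ 2 by exact: sqrz_ge1.
    have c2R : 1 <= c%:~R ^+ 2 :> R by rewrite -rmorphXn /= (ler_int R 1).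
    have k3 : y ^+ 2 <= nrm c d (x, y).
      have h3 := sqr_ge0 (c%:~R * x + d%:~R); have h4 := sqr_ge0 y.
      by rewrite /nrm /= exprMn; clear -h3 h4 c2R; nra.
    by apply: le_trans k3 _; rewrite ler_peMl ?(ltW N0) // lerDl sqr_ge0.
  by clear -k1 k2 yy; lra.
have [a1 b1] := h2 a b (x, y) y1 xA NA.
by split; rewrite leq_max ?a1 ?b1 ?c1 ?d1 ?orbT.
Qed.

(** * The quotient map and the folding onto the half strip *)

Lemma hplane_base (R : realType) : 0 < ((0, 1) : R * R).2.
Proof. exact: ltr01. Qed.

(** [proj] on all pairs of reals, with the point [i] as default outside the half-plane, so that
    neighbourhoods can be taken in the plane. *)
Definition pr (R : realType) (z : R * R) : X R :=
  proj (insubd (mkupper (hplane_base R)) z).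

Lemma prE (R : realType) (z : R * R) (hz : 0 < z.2) : pr z = proj (mkupper hz).
Proof.
rewrite /pr /insubd; case: insubP => [w _ wz|]; last by rewrite mem_set.
by congr proj; apply: val_inj.
Qed.

Lemma pr_val (R : realType) (z : upper R) : pr (val z) = proj z.
Proof. by rewrite (prE (upper_gt0 z)); congr proj; apply: val_inj. Qed.

Lemma pr_surj (R : realType) (q : X R) : exists2 z : R * R, 0 < z.2 & pr z = q.
Proof.
exists (val (repr q)); first exact: upper_gt0.
by rewrite pr_val; exact: reprK.
Qed.

Lemma pr_eq (R : realType) (z w : R * R) : 0 < z.2 -> 0 < w.2 ->
  pr z = pr w <-> exists a b c d : int, a * d - b * c = 1 /\ w = mob a b c d z.
Proof.
move=> z0 w0; rewrite (prE z0) (prE w0); split.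
  by move/eqmodP => /modular_relP.
by move=> h; apply/eqmodP/modular_relP.
Qed.

Lemma pr_mob (R : realType) (a b c d : int) (z : R * R) : a * d - b * c = 1 -> 0 < z.2 ->
  pr (mob a b c d z) = pr z.
Proof.
move=> h z0; apply/esym/pr_eq => //; last by exists a, b, c, d.
by rewrite divr_gt0 // nrm_gt0 // (det1_neq0 h).
Qed.

Lemma sigmaX_pr (R : realType) (x y : R) : 0 < y -> sigmaX (pr (x, y)) = pr (- x, y).
Proof.
move=> y0; have h : 0 < (x, y).2 by [].
by rewrite (prE h) sigmaX_proj -pr_val.
Qed.

Lemma pr_shift (R : realType) (k : int) (x y : R) : 0 < y -> pr (x + k%:~R, y) = pr (x, y).
Proof.
move=> y0; rewrite -[RHS](@pr_mob R 1 k 0 1) //; last by rewrite mulr1 mulr0 subr0.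
rewrite /mob /= mulr0z mulr1z; congr (pr (_, _)).
  by rewrite !mul0r !add0r !mul1r mul0r addr0 expr1n expr0n addr0 divr1 mulr1.
by rewrite !mul0r add0r expr1n expr0n addr0 divr1.
Qed.

Lemma pr_circle (R : realType) (x y : R) : 0 < y -> x ^+ 2 + y ^+ 2 = 1 ->
  pr (- x, y) = pr (x, y).
Proof.
move=> y0 xy; rewrite -[RHS](@pr_mob R 0 (-1) 1 0) //.
rewrite /mob /= !mulr0z !mulr1z mulrNz mulr1z !mul1r addr0 xy !divr1.
by congr (pr (_, _)); ring.
Qed.

Lemma near_lt (R : realType) (g : R * R -> R) (z : R * R) (a : R) :
  {for z, continuous g} -> g z < a -> \forall w \near z, g w < a.
Proof.
move=> /cvgrPdist_lt cg ga; have h : 0 < a - g z by lra.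
have n1 : \forall w \near z, `|g z - g w| < a - g z by exact: cg.
by apply: filterS n1 => w; rewrite ltr_norml => /andP[]; lra.
Qed.

Lemma near_gt (R : realType) (g : R * R -> R) (z : R * R) (a : R) :
  {for z, continuous g} -> a < g z -> \forall w \near z, a < g w.
Proof.
move=> cg ga; have cN : {for z, continuous (fun w => - g w)} by exact: cvgN.
have h : - g z < - a by lra.
by apply: filterS (near_lt cN h) => w; lra.
Qed.

Lemma mob_continuous (R : realType) (a b c d : int) (z : R * R) : a * d - b * c = 1 -> 0 < z.2 ->
  {for z, continuous (@mob R a b c d)}.
Proof.
move=> h z0; have N0 := lt0r_neq0 (nrm_gt0 z0 (det1_neq0 h)).
have c1 : {for z, continuous (@fst R R)} by exact: cvg_fst.
have c2 : {for z, continuous (@snd R R)} by exact: cvg_snd.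
have aff (m n : int) : {for z, continuous (fun z : R * R => m%:~R * z.1 + n%:~R)}.
  by apply: cvgD; [apply: cvgM => //; exact: cvg_cst|exact: cvg_cst].
have sqc (g : R * R -> R) : {for z, continuous g} -> {for z, continuous (fun z => g z ^+ 2)}.
  by move=> hg; apply: (@cvg_comp _ _ _ g (fun t => t ^+ 2) _ (nbhs (g z))) => //; exact: exprn_continuous.
have cN : {for z, continuous (fun z : R * R => (c%:~R * z.1 + d%:~R) ^+ 2 + (c%:~R * z.2) ^+ 2)}.
  apply: cvgD; first exact: sqc.
  by apply: (sqc (fun z : R * R => c%:~R * z.2)); apply: cvgM => //; exact: cvg_cst.
apply: (@cvg_pair _ _ _ (nbhs z) (nbhs (mob a b c d z).1) (nbhs (mob a b c d z).2)).
  apply: cvgM; last exact: cvgV.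
  apply: cvgD; first by apply: cvgM; exact: aff.
  by apply: cvgM; [exact: cvg_cst|exact: sqc].
by apply: cvgM => //; exact: cvgV.
Qed.

(** The projection is continuous and open: the saturation [W] of the set [N] of points near which
    [P] holds is open, because the modular group acts by continuous maps. *)
Lemma nbhs_pr (R : realType) (z : R * R) (P : set (X R)) : 0 < z.2 ->
  nbhs (pr z) P <-> (\forall w \near z, P (pr w)).
Proof.
move=> z0; split.
  rewrite nbhsE => -[U [oO Oz] OP].
  have [W oW WO] : exists2 W : set (R * R), open W & set_val @^-1` W = @proj R @^-1` U by [].
  have Wz : W z.
    have : (@proj R @^-1` U) (mkupper z0) by rewrite /= -prE.
    by rewrite -WO.
  have nW : \forall w \near z, W w by exact: open_nbhs_nbhs.
  apply: filterS2 nW (near_hplane z0) => w Ww w0; apply: OP.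
  have : (set_val @^-1` W) (mkupper w0) by [].
  by rewrite WO /= -prE.
move=> nP.
pose N : set (R * R) := [set w : R * R | 0 < w.2 /\ \forall v \near w, P (pr v)].
pose W : set (R * R) := [set w : R * R | 0 < w.2 /\ exists a b c d : int, a * d - b * c = 1 /\ N (mob a b c d w)].
have NW w : N w -> W w.
  move=> Nw; split; first by case: Nw.
  exists 1, 0, 0, 1; split=> //; rewrite /mob !mul0r !add0r mul1r mulr0 mul0r !addr0 expr1n expr0n addr0 !divr1 mulr1.
  by case: w Nw.
have oN : open N.
  rewrite openE => w [w0 hw]; have := hw; rewrite -nbhs_nearE nbhsE => -[U [oO Ow] OP].
  have nO : \forall v \near w, U v by exact: open_nbhs_nbhs.
  apply: filterS2 nO (near_hplane w0) => v Ov v0; split=> //.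
  by apply: filterS OP _; exact: open_nbhs_nbhs.
have oW : open W.
  rewrite openE => w [w0 [a [b [c [d [h Nw]]]]]].
  have cm := mob_continuous h w0.
  have nN : \forall v \near w, N (mob a b c d v) by apply: cm; exact: open_nbhs_nbhs.
  apply: filterS2 nN (near_hplane w0) => v Nv v0; split=> //.
  by exists a, b, c, d.
pose O : set (X R) := [set q | exists2 w, N w & q = pr w].
rewrite nbhsE; exists O; last first.
  by move=> q [w [w0 hw] ->]; exact: nbhs_singleton hw.
split; last by exists z => //; split.
have -> : open O = open (@proj R @^-1` O) by [].
exists W => //; apply/seteqP; split=> u.
  move=> [u0 [a [b [c [d [h Nu]]]]]]; exists (mob a b c d (val u)) => //.
  by rewrite pr_mob ?pr_val.
move=> [w [w0 hw]]; rewrite -pr_val => /pr_eq -/(_ (upper_gt0 u) w0) [a [b [c [d [h E]]]]].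
split; first exact: upper_gt0.
by exists a, b, c, d; split=> //; rewrite -E.
Qed.

Lemma pr_continuous (R : realType) (z : R * R) : 0 < z.2 -> {for z, continuous (@pr R)}.
Proof. by move=> z0 P /(nbhs_pr P z0). Qed.

Lemma sigmaX_invol (R : realType) (q : X R) : sigmaX (sigmaX q) = q.
Proof. by have [[x y] /= y0 <-] := pr_surj q; rewrite !sigmaX_pr // opprK. Qed.

Lemma sigmaX_continuous (R : realType) : continuous (@sigmaX R).
Proof.
move=> q P; have [[x y] /= y0 <-] := pr_surj q.
rewrite sigmaX_pr // => /(nbhs_pr P (y0 : 0 < (- x, y).2)) /near_pairP[e e0 he].
suff : nbhs (pr (x, y)) (@sigmaX R @^-1` P) by [].
apply/nbhs_pr => //.
have n1 : \forall w \near (x, y), 0 < w.2 -> P (sigmaX (pr w)).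
  apply/near_pairP; exists e => // x' y' /= hx hy y'0; rewrite sigmaX_pr //.
  by apply: he => //=; rewrite -opprB normrN opprK addrC.
by apply: filterS2 (near_hplane (y0 : 0 < (x, y).2)) n1 => w w0 h; exact: h w0.
Qed.

Lemma fd_exists (R : realType) (q : X R) : exists z, fundamental_domain R z /\ pr z = q.
Proof.
have [z z0 <-] := pr_surj q.
have [a [b [c [d [h fz]]]]] := fd_reduction z0.
by exists (mob a b c d z); rewrite pr_mob.
Qed.

(** The quotient map by [sigmaX], with values in the closed half strip. The choice of a
    representative is harmless: equivalent points of the fundamental domain differ at most in the
    sign of the abscissa. *)
Definition fold (R : realType) (q : X R) : R * R :=
  let w := projT1 (cid (fd_exists q)) in (`|w.1|, w.2).

Lemma foldE (R : realType) (z : R * R) : fundamental_domain R z -> fold (pr z) = (`|z.1|, z.2).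
Proof.
move=> fz; rewrite /fold; case: cid => /= w [fw wz].
have z0 := fd_gt0 fz; have w0 := fd_gt0 fw.
have rel : modular_rel (mkupper z0) (mkupper w0).
  by apply/eqmodP; move: wz; rewrite (prE z0) (prE w0).
have [[k /= E]|[/= h1 h2 h3]] := fd_unique rel fz fw.
  have [_ zx _] := fz; have [_ wx _] := fw.
  move: wx; rewrite E /= => wx; congr (_, _).
  have [k0|k0] := eqVneq k 0; first by rewrite k0 addr0.
  have k1 : 1 <= `|k%:~R| :> R by rewrite -intr_norm (ler_int R 1); move: k0; lia.
  have := ler_normB (z.1 + k%:~R) z.1; rewrite addrAC subrr add0r.
  by move: zx wx k1; clear; lra.
congr (_, _) => //; apply/eqP; rewrite -(@eqrXn2 _ 2) // !real_normK ?num_real //.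
by apply/eqP; move: h1 h2; rewrite h3; lra.
Qed.

Lemma fold_in (R : realType) (q : X R) :
  [/\ 0 < (fold q).2, 0 <= (fold q).1, (fold q).1 <= 2^-1 & 1 <= (fold q).1 ^+ 2 + (fold q).2 ^+ 2].
Proof.
by rewrite /fold; case: cid => /= w [[w0 wx ww] _]; split=> //; rewrite real_normK ?num_real.
Qed.

Lemma fold_pr (R : realType) (q : X R) : pr (fold q) = q \/ sigmaX (pr (fold q)) = q.
Proof.
rewrite /fold; case: cid => /= w [[w0 wx ww] <-].
have [w1|w1] := leP 0 w.1; first by left; rewrite ger0_norm // -surjective_pairing.
by right; rewrite ltr0_norm // sigmaX_pr // opprK -surjective_pairing.
Qed.

Lemma fold_fd (R : realType) (q : X R) : fundamental_domain R (fold q).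
Proof. by have [h1 h2 h3 h4] := fold_in q; split=> //; rewrite ger0_norm. Qed.

(** Near [z0] only finitely many matrices reach the fundamental domain. One that moves [z0] into it
    computes [fold] at [z0] and is continuous; one that moves [z0] outside this closed set does so
    for a whole neighbourhood. *)
Lemma fold_continuous (R : realType) : continuous (@fold R).
Proof.
move=> q; have [z0 z00 <-] := pr_surj q.
have [a0 [b0 [c0 [d0 [h0 f0]]]]] := fd_reduction z00.
rewrite -(pr_mob h0 z00) /continuous_at (foldE f0) => P /near_pairP[e e0 he].
suff : nbhs (pr z0) (@fold R @^-1` P) by rewrite pr_mob.
apply/nbhs_pr => //.
have [M [r r0 hM]] : exists M, exists2 d : R, 0 < d & forall x y, `|x - z0.1| < d -> `|y - z0.2| < d ->
    0 < y /\ forall a b c d : int, a * d - b * c = 1 -> fundamental_domain R (mob a b c d (x, y)) ->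
    [/\ (`|a| <= M)%N, (`|b| <= M)%N, (`|c| <= M)%N & (`|d| <= M)%N].
  by have [M /near_pairP[d d1 hd]] := fd_locally_finite z00; exists M, d.
pose I := 'I_(2 * M).+1; pose i2 (i : I) : int := i%:Z - M%:Z.
have i2P (m : int) : (`|m| <= M)%N -> exists i, i2 i = m.
  move=> hm; have im : (`|(m + M%:Z)%R| < (2 * M).+1)%N by lia.
  by exists (Ordinal im); rewrite /i2 /=; lia.
have one (a b c d : int) : a * d - b * c = 1 -> \forall z \near z0,
    fundamental_domain R (mob a b c d z) -> P (`|(mob a b c d z).1|, (mob a b c d z).2).
  move=> h; have cm := mob_continuous h z00.
  have cm1 : {for z0, continuous (fun z => (mob a b c d z).1)}.
    by apply: (@cvg_comp _ _ _ (mob a b c d) fst _ (nbhs (mob a b c d z0))) => //; exact: cvg_fst.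
  have cm2 : {for z0, continuous (fun z => (mob a b c d z).2)}.
    by apply: (@cvg_comp _ _ _ (mob a b c d) snd _ (nbhs (mob a b c d z0))) => //; exact: cvg_snd.
  have [fz|nf] := pselect (fundamental_domain R (mob a b c d z0)).
    have Ef := foldE fz; rewrite pr_mob // -(pr_mob h0 z00) (foldE f0) in Ef.
    have /cvgrPdist_lt /(_ e e0) n1 := cm1; have /cvgrPdist_lt /(_ e e0) n2 := cm2.
    apply: filterS2 n1 n2 => z k1 k2 _; apply: he => /=; rewrite distrC.
      case: Ef => -> _; apply: le_lt_trans k1; exact: ler_dist_dist.
    by case: Ef => _ ->.
  have w0 : 0 < (mob a b c d z0).2 by rewrite divr_gt0 // nrm_gt0 // (det1_neq0 h).
  suff : \forall z \near z0, ~ fundamental_domain R (mob a b c d z) by apply: filterS => z k /k.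
  have [x1|x1] := leP `|(mob a b c d z0).1| 2^-1.
    have [r1|r1] := leP 1 ((mob a b c d z0).1 ^+ 2 + (mob a b c d z0).2 ^+ 2); first by exfalso; exact: nf.
    have c2 : {for z0, continuous (fun z => (mob a b c d z).1 ^+ 2 + (mob a b c d z).2 ^+ 2)}.
      apply: cvgD.
        by apply: (@cvg_comp _ _ _ (fun z => (mob a b c d z).1) (fun t => t ^+ 2) _ (nbhs (mob a b c d z0).1)) => //; exact: exprn_continuous.
      by apply: (@cvg_comp _ _ _ (fun z => (mob a b c d z).2) (fun t => t ^+ 2) _ (nbhs (mob a b c d z0).2)) => //; exact: exprn_continuous.
    have n1 : \forall z \near z0, (mob a b c d z).1 ^+ 2 + (mob a b c d z).2 ^+ 2 < 1.
      exact: (near_lt c2 r1).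
    by apply: filterS n1 => z k [_ _]; rewrite leNgt k.
  have c2 : {for z0, continuous (fun z => `|(mob a b c d z).1|)} by exact: cvg_norm.
  have n1 : \forall z \near z0, 2^-1 < `|(mob a b c d z).1| by exact: (near_gt c2 x1).
  by apply: filterS n1 => z k [_ + _]; rewrite leNgt k.
have all4 : \forall z \near z0, forall i j k l : I, i2 i * i2 l - i2 j * i2 k = 1 ->
    fundamental_domain R (mob (i2 i) (i2 j) (i2 k) (i2 l) z) ->
    P (`|(mob (i2 i) (i2 j) (i2 k) (i2 l) z).1|, (mob (i2 i) (i2 j) (i2 k) (i2 l) z).2).
  have fa (Q : I -> set (R * R)) : (forall i, \forall z \near z0, Q i z) ->
      \forall z \near z0, forall i, Q i z by move=> h; exact: (@filter_forall (R * R)%type 'I_(2 * M).+1 Q (nbhs z0) _ h).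
  apply: (fa _) => i; apply: (fa _) => j; apply: (fa _) => k; apply: (fa _) => l.
  have [h|/eqP n] := eqVneq (i2 i * i2 l - i2 j * i2 k) 1.
    by apply: filterS (one _ _ _ _ h) => z k1 _; exact: k1.
  by apply: filterS (near_hplane z00) => z _ /n.
have nd : \forall z \near z0, 0 < z.2 /\ forall a b c d : int, a * d - b * c = 1 ->
    fundamental_domain R (mob a b c d z) ->
    [/\ (`|a| <= M)%N, (`|b| <= M)%N, (`|c| <= M)%N & (`|d| <= M)%N].
  by apply/near_pairP; exists r.
apply: filterS2 all4 nd => z k1 [zp k2] /=.
have [a [b [c [d1 [h f]]]]] := fd_reduction zp.
have [/i2P[i Ei] /i2P[j Ej] /i2P[k Ek] /i2P[l El]] := k2 a b c d1 h f.
rewrite -(pr_mob h zp) (foldE f) -Ei -Ej -Ek -El; apply: k1; by rewrite Ei Ej Ek El.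
Qed.

(** * Nodal domains and delta *)

Lemma coord_pr (R : realType) (phi : upper R -> R) (z w : R * R) :
  even_hecke_maass_cusp_form phi -> 0 < z.2 -> 0 < w.2 -> pr z = pr w ->
  coord phi z = coord phi w.
Proof.
move=> hphi z0 w0 /(pr_eq z0 w0)[a [b [c [d [h ->]]]]].
by rewrite coord_mob.
Qed.

Lemma nodal_pr (R : realType) (phi : upper R -> R) (z : R * R) :
  even_hecke_maass_cusp_form phi -> 0 < z.2 ->
  nodal_line phi (pr z) <-> coord phi z = 0.
Proof.
move=> hphi z0; split.
  move=> [w /= w0 wz]; rewrite -w0 -coord_val; apply: coord_pr => //; first exact: upper_gt0.
  by rewrite pr_val wz.
by move=> f0; exists (mkupper z0); rewrite /= -?coordE // (prE z0).
Qed.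

Lemma nodal_sigma (R : realType) (phi : upper R -> R) (q : X R) :
  even_hecke_maass_cusp_form phi -> nodal_line phi (sigmaX q) <-> nodal_line phi q.
Proof.
move=> hphi; have [[x y] /= y0 <-] := pr_surj q.
by rewrite sigmaX_pr // !nodal_pr // coord_even.
Qed.

Lemma connected_component_eq (R : realType) (T : topologicalType) (A : set T) (g : R -> T) (a b : R) :
  a <= b -> (forall t, a <= t <= b -> {for t, continuous g}) ->
  (forall t, a <= t <= b -> A (g t)) ->
  connected_component A (g a) = connected_component A (g b).
Proof.
move=> ab cg hg; apply: same_connected_component.
have c : connected (g @` `[a, b]).
  apply: connected_continuous_connected; first exact: segment_connected.
  by apply: continuous_in_subspaceT => t; rewrite inE /= in_itv /=; exact: cg.
exists (g @` `[a, b]); last by exists b => //; rewrite /= in_itv /= lexx ab.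
split=> //; first by exists a => //; rewrite /= in_itv /= lexx ab.
by move=> _ [t ht <-]; apply: hg; rewrite /= in_itv in ht.
Qed.

Definition clamp (R : realType) (s : R) : R := Num.min (Num.max s 0) 2^-1.

Lemma clamp_in (R : realType) (s : R) : 0 <= clamp s <= 2^-1.
Proof. by rewrite /clamp le_min le_max lexx orbT ge_min lexx orbT invr_ge0 ler0n. Qed.

Lemma sqrt34 (R : realType) : Num.sqrt (1 - (2^-1) ^+ 2) = Num.sqrt 3 / 2 :> R.
Proof.
have -> : 1 - (2^-1) ^+ 2 = 3 * (2^-1) ^+ 2 :> R by field.
by rewrite sqrtrM // sqrtr_sqr ger0_norm // invr_ge0.
Qed.

(** One formula for the three pieces, from which continuity at the two corners can be read off. *)
Lemma delta_coordE (R : realType) (s : R) : delta_coord s =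
  (clamp s, Num.sqrt (1 - clamp s ^+ 2) + Num.max (- s) 0 + Num.max (s - 2^-1) 0).
Proof.
rewrite /delta_coord /clamp; case: ifPn => [s0|]; last rewrite -ltNge => s0.
  rewrite (max_r s0) min_l ?invr_ge0 // expr0n subr0 sqrtr1 max_l ?oppr_ge0 // max_r; last by lra.
  by rewrite addr0.
rewrite (max_l (ltW s0)); case: ifPn => [s1|]; last rewrite -ltNge => s1.
  by rewrite min_l // !max_r ?addr0 //; lra.
by rewrite (min_r (ltW s1)) sqrt34 max_r ?max_l ?addr0 //; lra.
Qed.

Lemma delta_coord_continuous (R : realType) : continuous (@delta_coord R).
Proof.
move=> s; rewrite (_ : @delta_coord R = fun s => (clamp s, Num.sqrt (1 - clamp s ^+ 2) +
  Num.max (- s) 0 + Num.max (s - 2^-1) 0)); last by apply/funext => t; exact: delta_coordE.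
have cid : {for s, continuous (fun s : R => s)} by exact: cvg_id.
have cc : {for s, continuous (@clamp R)}.
  by apply: continuous_min; [apply: continuous_max => //; exact: cvg_cst|exact: cvg_cst].
apply: (@cvg_pair _ _ _ (nbhs s) (nbhs (clamp s)) (nbhs _)) => //.
apply: cvgD; last by apply: (@continuous_max R R (fun s => s - 2^-1) (cst 0)); [apply: cvgB => //|]; exact: cvg_cst.
apply: cvgD; last by apply: (@continuous_max R R (fun s => - s) (cst 0)); [exact: cvgN|exact: cvg_cst].
apply: (@cvg_comp _ _ _ (fun s => 1 - clamp s ^+ 2) Num.sqrt _ (nbhs (1 - clamp s ^+ 2))); last exact: sqrt_continuous.
apply: cvgB; first exact: cvg_cst.
by apply: (@cvg_comp _ _ _ (@clamp R) (fun t => t ^+ 2) _ (nbhs (clamp s))) => //; exact: exprn_continuous.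
Qed.

Lemma delta_coord_fd (R : realType) (s : R) :
  fundamental_domain R (delta_coord s) /\ 0 <= (delta_coord s).1.
Proof.
have h := delta_coord_gt0 s; move: h; rewrite delta_coordE /=.
have /andP[c0 c1] := clamp_in s; set c := clamp s in c0 c1 *.
move=> h; split=> //; split=> //=; first by rewrite ger0_norm.
have m1 : 0 <= Num.max (- s) 0 by rewrite le_max lexx orbT.
have m2 : 0 <= Num.max (s - 2^-1) 0 by rewrite le_max lexx orbT.
have c2 : 0 <= 1 - c ^+ 2 by nra.
have k1 := sqr_sqrtr c2; have k2 := sqrtr_ge0 (1 - c ^+ 2).
move: m1 m2 k1 k2; move: (Num.max _ 0) (Num.max _ 0) (Num.sqrt _) => p q r p0 q0 r2 r0.
have : r ^+ 2 <= (r + p + q) ^+ 2 by rewrite ler_pXn2r ?nnegrE //; lra.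
by rewrite r2; lra.
Qed.

Lemma delta_coord_inj (R : realType) : injective (@delta_coord R).
Proof.
have key (s t : R) : s < t -> delta_coord s <> delta_coord t.
  rewrite /delta_coord => st; case: (leP s 0) => s0; case: (leP t 0) => t0 //=.
  - by move=> [h]; lra.
  - by case: (leP t 2^-1) => t1 [h]; lra.
  - by exfalso; move: (lt_le_trans (lt_trans s0 st) t0); rewrite ltxx.
  - case: (leP s 2^-1) => s1; case: (leP t 2^-1) => t1 [h]; try lra.
    move=> h2; move: h2; rewrite h (_ : 1 - 2^-1 ^+ 2 = 1 - (2^-1) ^+ 2) // sqrt34; lra.
move=> s t e; case: (ltgtP s t) => // st; exfalso; first exact: key e.
by apply: key st _; rewrite e.
Qed.

Lemma fold_delta (R : realType) (s : R) : fold (pr (delta_coord s)) = delta_coord s.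
Proof.
have [f x0] := delta_coord_fd s; rewrite foldE // ger0_norm //.
by rewrite -surjective_pairing.
Qed.

Lemma boundary_delta_coord (R : realType) (w : R * R) :
  fundamental_domain R w -> 0 <= w.1 ->
  [\/ w.1 = 0, w.1 = 2^-1 | w.1 ^+ 2 + w.2 ^+ 2 = 1] -> exists s, delta_coord s = w.
Proof.
case: w => x y [/= y0 + xy] x0; rewrite ger0_norm // => x1.
have s32 : Num.sqrt 3 ^+ 2 = 3 :> R by rewrite sqr_sqrtr.
have s30 : 0 <= Num.sqrt 3 :> R by exact: sqrtr_ge0.
case=> [h|h|h].
- have y1 : 1 <= y by rewrite h in xy; nra.
  exists (1 - y); rewrite delta_coordE /clamp h max_r; last by lra.
  rewrite min_l ?invr_ge0 // expr0n subr0 sqrtr1 max_l; last by lra.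
  by rewrite max_r; [congr (_, _); ring|lra].
- have y1 : Num.sqrt 3 / 2 <= y by rewrite h in xy; nra.
  exists (2^-1 + (y - Num.sqrt 3 / 2)); rewrite delta_coordE /clamp h max_l; last by lra.
  rewrite min_r; last by lra.
  by rewrite sqrt34 max_r ?max_l; [congr (_, _); ring|lra|lra].
- exists x; rewrite delta_coordE /clamp max_l // min_l // max_r; last by lra.
  rewrite max_r; last by lra.
  by rewrite !addr0 (_ : 1 - x ^+ 2 = y ^+ 2) ?sqrtr_sqr ?gtr0_norm //; lra.
Qed.

Lemma delta_pr (R : realType) (w : R * R) : 0 < w.2 ->
  [\/ w.1 = 0, w.1 = 2^-1 | w.1 ^+ 2 + w.2 ^+ 2 = 1] -> delta R (pr w).
Proof.
case: w => x y /= y0 h; rewrite /delta /= sigmaX_pr //; case: h => [->|->|h].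
- by rewrite oppr0.
- have E : - 2^-1 + 1%:~R = 2^-1 :> R by rewrite mulr1z; lra.
  by have := pr_shift 1 (- 2^-1) y0; rewrite E => ->.
- exact: pr_circle.
Qed.

Lemma delta_coord_boundary (R : realType) (s : R) :
  [\/ (delta_coord s).1 = 0, (delta_coord s).1 = 2^-1 |
      (delta_coord s).1 ^+ 2 + (delta_coord s).2 ^+ 2 = 1].
Proof.
rewrite /delta_coord; case: ifPn => [_|]; first by constructor 1.
rewrite -ltNge => s0; case: ifPn => s1; last by constructor 2.
by constructor 3; rewrite /= sqr_sqrtr ?subr_ge0; [ring|nra].
Qed.

(** For a fixed point, [fold q] and its mirror image are equivalent and both in the fundamental
    domain. By [fd_unique] they either differ by the translation [2 * x], which must be 0 or 1, or
    lie on the unit circle. *)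
Lemma deltaP (R : realType) (q : X R) : delta R q <-> exists s, q = pr (delta_coord s).
Proof.
split; last by move=> [s ->]; apply: delta_pr; [exact: delta_coord_gt0|exact: delta_coord_boundary].
rewrite /delta /= => dq.
have [w0 x0 x1 xy] := fold_in q; have fw := fold_fd q.
have wq : pr (fold q) = q by have [//|h] := fold_pr q; rewrite -[LHS]sigmaX_invol h.
have wN : pr (- (fold q).1, (fold q).2) = pr (fold q).
  by rewrite -sigmaX_pr // -surjective_pairing wq.
move: w0 x0 x1 xy fw wq wN; case: (fold q) => x y /= y0 x0 x1 xy fw wq wN.
have fw' : fundamental_domain R (- x, y) by case: fw => /= h1 h2 h3; split; rewrite /= ?normrN ?sqrrN.
suff /(boundary_delta_coord fw x0)[s hs] : [\/ (x, y).1 = 0, (x, y).1 = 2^-1 | (x, y).1 ^+ 2 + (x, y).2 ^+ 2 = 1].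
  by exists s; rewrite hs.
have rel : modular_rel (mkupper (y0 : 0 < (- x, y).2)) (mkupper (y0 : 0 < (x, y).2)).
  by apply/eqmodP; move: wN; rewrite (prE (y0 : 0 < (- x, y).2)) (prE (y0 : 0 < (x, y).2)).
have [[k [/= hk]]|[/= _ h _]] := fd_unique rel fw' fw; last by constructor 3.
have k2 : 2 * x = k%:~R by rewrite mulr_natl mulr2n {1}hk addrAC addNr add0r.
have k0 : 0 <= k by rewrite -(ler_int R) -k2; lra.
have k1 : k <= 1 by rewrite -(ler_int R) -k2 mulr1z; lra.
have [k0'|k0'] := eqVneq k 0.
  by constructor 1; move: k2; rewrite k0' /= mulr0z; lra.
have k1' : k = 1 by lia.
by constructor 2; move: k2; rewrite k1' mulr1z /=; lra.
Qed.

(** The image of the component under [sigmaX] is connected, avoids the nodal line and contains the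
    fixed point [q]. *)
Lemma delta_inert (R : realType) (phi : upper R -> R) (q : X R) :
  even_hecke_maass_cusp_form phi -> delta R q -> ~ nodal_line phi q ->
  inert_nodal_domains phi (connected_component (~` nodal_line phi) q).
Proof.
move=> hphi dq nq; split; first by exists q.
set C := connected_component _ q.
have sC : @sigmaX R @` C `<=` C.
  apply: connected_component_max.
  - by exists q => //; exact: connected_component_refl.
  - move=> _ [p /connected_component_sub hp <-]; by move=> /(nodal_sigma _ hphi).
  - apply: connected_continuous_connected; first exact: component_connected.
    by apply: continuous_subspaceT; exact: sigmaX_continuous.
apply/seteqP; split=> // p Cp; exists (sigmaX p); last exact: sigmaX_invol.
by apply: sC; exists p.
Qed.

Lemma inert_delta (R : realType) (phi : upper R -> R) (Omega : set (X R)) :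
  even_hecke_maass_cusp_form phi -> inert_nodal_domains phi Omega ->
  exists2 s, ~ nodal_line phi (pr (delta_coord s)) &
    Omega = connected_component (~` nodal_line phi) (pr (delta_coord s)).
Proof.
move=> hphi [[q0 nq0 <-] /= sO]; set C := connected_component _ q0 in sO *.
have [[s Cs]|nd] := pselect (exists s, C (pr (delta_coord s))).
  exists s; first exact: connected_component_sub Cs.
  exact: (@same_connected_component (X R) (~` nodal_line phi) q0 _ Cs).
exfalso.
have dC q : C q -> sigmaX q <> q by move=> Cq /deltaP[s E]; apply: nd; exists s; rewrite -E.
have sC q : C q -> C (sigmaX q) by move=> Cq; rewrite -sO; exists q.
pose I (w : R * R) := [/\ 0 < w.1, w.1 < 2^-1, 1 < w.1 ^+ 2 + w.2 ^+ 2 & 0 < w.2].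
(* The open half of the surface over the interior of the strip, and its mirror image [U2]. If [C]
   misses delta they cover it and are disjoint on it, while [sigmaX] exchanges them and preserves
   [C]. *)
pose U1 : set (X R) := [set q | I (fold q) /\ pr (fold q) = q].
pose U2 : set (X R) := @sigmaX R @^-1` U1.
have fs (q : X R) : fold (sigmaX q) = fold q.
  have [z [fz <-]] := fd_exists q; have [h1 h2 h3] := fz.
  case: z fz h1 h2 h3 => x y /= fz h1 h2 h3.
  have fz' : fundamental_domain R (- x, y) by split; rewrite /= ?normrN ?sqrrN.
  by rewrite sigmaX_pr // !foldE //= normrN.
have oU1 : open U1.
  rewrite openE => q [[h1 h2 h3 h4] E]; rewrite /interior -E; apply/nbhs_pr => //.
  have c1 : {for fold q, continuous (@fst R R)} by exact: cvg_fst.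
  have c2 : {for fold q, continuous (@snd R R)} by exact: cvg_snd.
  have c3 : {for fold q, continuous (fun w : R * R => w.1 ^+ 2 + w.2 ^+ 2)}.
    apply: cvgD.
      by apply: (@cvg_comp _ _ _ fst (fun t => t ^+ 2) _ (nbhs (fold q).1)) => //; exact: exprn_continuous.
    by apply: (@cvg_comp _ _ _ snd (fun t => t ^+ 2) _ (nbhs (fold q).2)) => //; exact: exprn_continuous.
  have n12 : \forall w \near fold q, 0 < w.1 /\ w.1 < 2^-1.
    by apply: filterI; [exact: near_gt|exact: near_lt].
  have n34 : \forall w \near fold q, 1 < w.1 ^+ 2 + w.2 ^+ 2 /\ 0 < w.2.
    by apply: filterI; [exact: (near_gt c3 h3)|exact: near_gt].
  apply: filterS2 n12 n34 => w [k1 k2] [k3 k4].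
  have fw : fundamental_domain R w by split; rewrite ?gtr0_norm // ltW.
  have E2 : fold (pr w) = w by rewrite foldE // gtr0_norm // -surjective_pairing.
  by rewrite /U1 /= E2.
have oU2 : open U2 by apply: open_comp => // p _; exact: sigmaX_continuous.
have CU q : C q -> U1 q \/ U2 q.
  move=> Cq; have If : I (fold q).
    have [w0 x0 x1 xy] := fold_in q.
    have nb : ~ [\/ (fold q).1 = 0, (fold q).1 = 2^-1 | (fold q).1 ^+ 2 + (fold q).2 ^+ 2 = 1].
      move=> /(boundary_delta_coord (fold_fd q) x0)[s hs].
      have dq : delta R (pr (fold q)) by apply/deltaP; exists s; rewrite hs.
      apply: (dC q Cq); have [h|h] := fold_pr q; rewrite -h; first exact: dq.
      by rewrite sigmaX_invol; exact/esym.
    split=> //; rewrite lt_neqAle ?x0 ?x1 ?xy andbT; apply/eqP => e; apply: nb.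
    - by constructor 1.
    - by constructor 2.
    - by constructor 3.
  have [h|h] := fold_pr q; [left|right]; split=> //; rewrite ?fs //.
  by rewrite -[LHS]sigmaX_invol h.
have disj q : C q -> U1 q -> U2 q -> False.
  move=> Cq [_ h1] [_ h2]; apply: (dC q Cq).
  by rewrite -[LHS]h2 fs h1.
have cC : connected C by exact: component_connected.
have C0 : C q0 by exact: connected_component_refl.
have all1 : C `&` U1 !=set0 -> C `&` U1 = C.
  move=> ne; apply: cC => //; first by exists U1.
  exists (~` U2); first exact: open_closedC.
  apply/seteqP; split=> q [Cq h]; split=> //; first by move=> h2; exact: disj h h2.
  by have [//|h2] := CU q Cq.
have [h|h] := CU q0 C0.
  have e : C `&` U1 = C by apply: all1; exists q0.
  have : (C `&` U1) (sigmaX q0) by rewrite e; exact: sC.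
  by move=> [_ h2]; exact: disj C0 h h2.
have Cs := sC _ C0.
have e : C `&` U1 = C by apply: all1; exists (sigmaX q0).
have : (C `&` U1) q0 by rewrite e.
by move=> [_ h2]; exact: disj C0 h2 h.
Qed.

(** * Grids in the half strip *)

Lemma connected_locally_constant (T : topologicalType) (C : set T) (S : T -> Prop) (q : T) :
  connected C -> C q -> S q ->
  (forall p, C p -> \forall p' \near p, S p <-> S p') -> forall p, C p -> S p.
Proof.
move=> cC Cq Sq hS p Cp.
pose U : set T := [set p | \forall p' \near p, S p'].
pose V : set T := [set p | \forall p' \near p, ~ S p'].
have oI (Q : T -> Prop) : open [set p | \forall p' \near p, Q p'].
  by rewrite openE => x hx; exact: (near_join hx).
suff E : C `&` S = C by have : (C `&` S) p by [rewrite E]; case.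
apply: cC; first by exists q.
- exists U; first exact: oI.
  apply/seteqP; split=> x [Cx h]; split=> //; last exact: nbhs_singleton h.
  by apply: filterS (hS x Cx) => y k; apply/k.
- exists (~` V); first exact/open_closedC/oI.
  apply/seteqP; split=> x [Cx h]; split=> //; first by move=> /nbhs_singleton.
  apply: contrapT => nS; apply: h; apply: filterS (hS x Cx) => y k Sy.
  by apply: nS; apply/k.
Qed.

Lemma coord_fold (R : realType) (phi : upper R -> R) (z : R * R) :
  even_hecke_maass_cusp_form phi -> 0 < z.2 -> coord phi (fold (pr z)) = coord phi z.
Proof.
move=> hphi z0; have [w0 _ _ _] := fold_in (pr z).
have [h|h] := fold_pr (pr z); first exact: coord_pr.
move: h w0; case: (fold _) => x y h w0; rewrite /= in w0.
by rewrite -coord_even //; apply: coord_pr => //; rewrite -h sigmaX_pr.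
Qed.

Lemma nodal_fold (R : realType) (phi : upper R -> R) (p : X R) :
  even_hecke_maass_cusp_form phi -> nodal_line phi p <-> coord phi (fold p) = 0.
Proof.
by move=> hphi; have [z z0 <-] := pr_surj p; rewrite nodal_pr // coord_fold.
Qed.

Lemma coord_continuous (R : realType) (phi : upper R -> R) (z : R * R) :
  even_hecke_maass_cusp_form phi -> 0 < z.2 -> {for z, continuous (coord phi)}.
Proof. by move=> hphi z0; apply: C1_continuous; apply: tcd_C1 => //; exact: hm_smooth. Qed.

Lemma component_sign (R : realType) (phi : upper R -> R) (p q : X R) :
  even_hecke_maass_cusp_form phi -> ~ nodal_line phi p ->
  connected_component (~` nodal_line phi) p q ->
  (0 < coord phi (fold p)) = (0 < coord phi (fold q)).
Proof.
move=> hphi np pq; set b := 0 < coord phi (fold p).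
pose S r := b = (0 < coord phi (fold r)).
apply: (@connected_locally_constant _ _ S p _ _ _ _ q pq) => //.
- exact: component_connected.
- exact: connected_component_refl.
move=> r /connected_component_sub nr.
have [w0 _ _ _] := fold_in r.
have cf : {for r, continuous (fun r => coord phi (fold r))}.
  by apply: (@cvg_comp _ _ _ (@fold R) (coord phi) _ (nbhs (fold r))); [exact: fold_continuous|exact: coord_continuous].
have /cvgrPdist_lt cf' := cf.
have n0 : 0 < `|coord phi (fold r)|.
  by rewrite normr_gt0; apply/eqP => /(nodal_fold _ hphi).
apply: filterS (cf' _ n0) => s hs.
suff : (0 < coord phi (fold r)) = (0 < coord phi (fold s)) by rewrite /S => ->.
have [h|h] := ltP 0 (coord phi (fold r)).
  by move: hs; rewrite (gtr0_norm h) ltr_norml => /andP[]; lra.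
by move: hs; rewrite (ler0_norm h) ltr_norml => /andP[]; lra.
Qed.

(** [b] is the vertical distance above the unit circle, so the half strip becomes [[0, 1/2] x
    [0, oo)]. *)
Definition chart (R : realType) (x b : R) : R * R := (x, Num.sqrt (1 - x ^+ 2) + b).

(** For the two roots [a] and [b], [|a - b| * (a + b) = |x - x'| * (x + x')], where both roots are
    at least 1/2 and [x + x' <= 1]. *)
Lemma sqrt_circle_lip (R : realType) (x x' : R) : 0 <= x <= 2^-1 -> 0 <= x' <= 2^-1 ->
  `|Num.sqrt (1 - x ^+ 2) - Num.sqrt (1 - x' ^+ 2)| <= `|x - x'|.
Proof.
move=> /andP[x0 x1] /andP[y0 y1].
have a2 : Num.sqrt (1 - x ^+ 2) ^+ 2 = 1 - x ^+ 2 by rewrite sqr_sqrtr //; nra.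
have b2 : Num.sqrt (1 - x' ^+ 2) ^+ 2 = 1 - x' ^+ 2 by rewrite sqr_sqrtr //; nra.
have a0 := sqrtr_ge0 (1 - x ^+ 2); have b0 := sqrtr_ge0 (1 - x' ^+ 2).
move: a2 b2 a0 b0; move: (Num.sqrt _) (Num.sqrt _) => b a a2 b2 a0 b0.
have ax : 2^-1 <= a by nra.
have bx : 2^-1 <= b by nra.
have E : (a - b) * (a + b) = (x' - x) * (x + x').
  have -> : (a - b) * (a + b) = a ^+ 2 - b ^+ 2 by ring.
  by rewrite a2 b2; ring.
have h1 : `|a - b| * (a + b) = `|x - x'| * (x + x').
  have ab : 0 <= a + b by lra.
  have xx : 0 <= x + x' by lra.
  by rewrite -{1}(ger0_norm ab) -normrM E normrM (ger0_norm xx) distrC.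
have h2 := normr_ge0 (a - b); have h3 := normr_ge0 (x - x').
rewrite leNgt; apply/negP => h; move: h1 h h2 h3; move: `|a - b| `|x - x'| => p q h1 h h2 h3.
have m1 : p <= p * (a + b) by rewrite ler_peMr //; lra.
have m2 : q * (x + x') <= q by rewrite ler_piMr //; lra.
by clear -h1 h m1 m2; lra.
Qed.

Definition height (R : realType) (w : R * R) : R := w.2 - Num.sqrt (1 - w.1 ^+ 2).

Lemma height_ge0 (R : realType) (w : R * R) : fundamental_domain R w -> 0 <= w.1 -> 0 <= height w.
Proof.
move=> [w0 x1 xy] x0; rewrite ger0_norm // in x1.
have a2 : Num.sqrt (1 - w.1 ^+ 2) ^+ 2 = 1 - w.1 ^+ 2 by rewrite sqr_sqrtr //; nra.
have a0 := sqrtr_ge0 (1 - w.1 ^+ 2).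
rewrite /height; move: a2 a0; move: (Num.sqrt _) => a a2 a0.
by rewrite subr_ge0 -(@ler_pXn2r _ 2) ?nnegrE //; [lra|exact: ltW].
Qed.

(** The mesh [1 / (2 n)] places column [n] on the line [x = 1/2]; the boundary vertices are then
    equidistant in the parameter of delta. *)
Definition grid (R : realType) (n i j : nat) : R * R :=
  chart (i%:R / (2 * n)%:R) (j%:R / (2 * n)%:R).

Lemma grid_bdpt (R : realType) (n : nat) (l : int) : (0 < n)%N ->
  grid R n (bdpt n l).1 (bdpt n l).2 = delta_coord (l%:~R / (2 * n)%:R).
Proof.
move=> n0; have h0 : 0 < (2 * n)%:R :> R by rewrite ltr0n muln_gt0.
have hn := lt0r_neq0 h0.
have nh : n%:R / (2 * n)%:R = 2^-1 :> R.
  by rewrite natrM invfM mulrCA mulfV ?mulr1 // pnatr_eq0 -lt0n.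
rewrite delta_coordE /grid /chart /clamp.
have [l0|l0] := leP l 0.
  have -> : l = - `|l|%:Z by lia.
  rewrite bdpt_left /= mul0r expr0n subr0 sqrtr1 rmorphN /= mulNr.
  have p0 : 0 <= `|l|%:R / (2 * n)%:R :> R by rewrite divr_ge0.
  move: p0; rewrite -pmulrn; move: (_ / _) => p p0.
  rewrite max_r; last by lra.
  rewrite min_l ?invr_ge0 // expr0n subr0 sqrtr1 max_l; last by lra.
  by rewrite max_r ?addr0 ?opprK //; lra.
have [ln|ln] := leP l n%:Z.
  have [i [-> hi]] : exists i : nat, l = i /\ (i <= n)%N by exists `|l|%N; lia.
  rewrite bdpt_bottom //= mul0r -pmulrn.
  have p0 : 0 <= i%:R / (2 * n)%:R :> R by rewrite divr_ge0.
  have p1 : i%:R / (2 * n)%:R <= 2^-1 :> R by rewrite -nh ler_pM2r ?invr_gt0 // ler_nat.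
  move: p0 p1; move: (_ / _) => p p0 p1.
  by rewrite max_l // min_l // max_r ?max_r ?addr0 //; lra.
have [j ->] : exists j : nat, l = (n + j)%N by exists `|l - n%:Z|%N; lia.
have E : (n + j)%N%:~R / (2 * n)%:R = 2^-1 + j%:R / (2 * n)%:R :> R.
  have -> : (n + j)%N%:~R = n%:R + j%:R :> R by rewrite -natrD.
  by rewrite mulrDl nh.
rewrite bdpt_right // E /= nh.
have p0 : 0 <= j%:R / (2 * n)%:R :> R by rewrite divr_ge0.
move: p0; move: (_ / _) => p p0.
rewrite max_l; last by lra.
rewrite min_r; last by lra.
rewrite max_r; last by lra.
by rewrite max_l ?addr0; [congr (_, _); ring|lra].
Qed.

Definition mono_const (n : nat) (col f : nat -> nat -> bool) : Prop :=
  (forall i j, (i < n)%N -> col i j = col i.+1 j -> f i j = f i.+1 j) /\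
  (forall i j, (i <= n)%N -> col i j = col i j.+1 -> f i j = f i j.+1).

Lemma mono_const_box (n : nat) (col f : nat -> nat -> bool) (c : bool) (i1 i2 j1 j2 : nat) :
  mono_const n col f -> (i2 <= n)%N ->
  (forall i j, (i1 <= i <= i2)%N -> (j1 <= j <= j2)%N -> col i j = c) ->
  forall i j, (i1 <= i <= i2)%N -> (j1 <= j <= j2)%N -> f i j = f i1 j1.
Proof.
move=> [fh fv] i2n hc i j hi hj.
have k1 m : (i1 + m <= i2)%N -> f (i1 + m)%N j = f i1 j.
  elim: m => [|m IH] h; first by rewrite addn0.
  rewrite addnS -fh ?IH //; [lia|lia|].
  by rewrite -addnS !hc //; lia.
have k2 m : (j1 + m <= j2)%N -> f i1 (j1 + m)%N = f i1 j1.
  elim: m => [|m IH] h; first by rewrite addn0.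
  rewrite addnS -fv ?IH //; [lia|lia|].
  by rewrite -addnS !hc //; lia.
have -> : i = (i1 + (i - i1))%N by lia.
rewrite k1; last by lia.
have -> : j = (j1 + (j - j1))%N by lia.
by rewrite k2 //; lia.
Qed.

(** The lower left corner, in the chart, of the cell containing [w]. *)
Definition vertex (R : realType) (n : nat) (w : R * R) : nat * nat :=
  (Num.trunc (w.1 * (2 * n)%:R), Num.trunc (height w * (2 * n)%:R)).

Definition grid_col (R : realType) (phi : upper R -> R) (n i j : nat) : bool :=
  0 < coord phi (grid R n i j).

Lemma trunc_dist (R : realType) (x : R) (n : nat) : (0 < n)%N -> 0 <= x ->
  (Num.trunc (x * (2 * n)%:R))%:R / (2 * n)%:R <= x /\
  x < (Num.trunc (x * (2 * n)%:R))%:R / (2 * n)%:R + (2 * n)%:R^-1.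
Proof.
move=> n0 x0; have h0 : 0 < (2 * n)%:R :> R by rewrite ltr0n muln_gt0.
have xn : 0 <= x * (2 * n)%:R by rewrite mulr_ge0 // ltW.
have /andP[h1 h2] := truncn_itv xn.
rewrite ler_pdivrMr // h1; split=> //.
by rewrite -[X in _ + X]mul1r -mulrDl ltr_pdivlMr // natr1.
Qed.

(** Around [fold p] the sign of phi is constant in a box of radius [r]. For a mesh below [r / 8],
    the vertices of [p] and of a nearby [p'] span a rectangle of grid points inside this box, on
    which [f] is constant by [mono_const_box]. The threshold [N] is the same for all [f]. *)
Lemma vertex_local (R : realType) (phi : upper R -> R) (p : X R) :
  even_hecke_maass_cusp_form phi -> ~ nodal_line phi p ->
  \forall p' \near p, exists N, forall n, (N < n)%N -> forall f,
    mono_const n (grid_col phi n) f ->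
    f (vertex n (fold p)).1 (vertex n (fold p)).2 = f (vertex n (fold p')).1 (vertex n (fold p')).2.
Proof.
move=> hphi np; have [w0 x0 x1 xy] := fold_in p; have fw := fold_fd p.
have fn : coord phi (fold p) != 0 by apply/eqP => /(nodal_fold _ hphi).
set w := fold p in w0 x0 x1 xy fw fn *.
pose c := 0 < coord phi w.
have [r r0 hr] : exists2 r : R, 0 < r & forall x y, `|x - w.1| < r -> `|y - w.2| < r -> (0 < coord phi (x, y)) = c.
  have := @coord_continuous R phi w hphi w0.
  move=> /continuous_pairP /(_ `|coord phi w|); rewrite normr_gt0 fn => /(_ isT)[r r0 hr].
  exists r => // x y h1 h2; have := hr x y h1 h2.
  rewrite /c; have [h|h] := ltP 0 (coord phi w).
    by rewrite (gtr0_norm h) ltr_norml => /andP[]; lra.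
  by rewrite (ler0_norm h) ltr_norml => /andP[]; lra.
have r8 : 0 < r / 8 by rewrite divr_gt0.
have nf : \forall p' \near p, `|(fold p').1 - w.1| < r / 8 /\ `|(fold p').2 - w.2| < r / 8.
  have : \forall z \near w, `|z.1 - w.1| < r / 8 /\ `|z.2 - w.2| < r / 8.
    by apply/near_pairP; exists (r / 8).
  exact: (@fold_continuous R p).
apply: filterS nf => p' [h1 h2]; clearbody w.
pose N := Num.bound (8 / r).
have hN (n : nat) : (N < n)%N -> (2 * n)%:R^-1 < r / 8.
  move=> Nn; have a : 8 / r < n%:R.
    have := archi_boundP (ltW (divr_gt0 (ltr0n R 8) r0)).
    by move/lt_le_trans; apply; rewrite ler_nat ltnW.
  have n0 : 0 < n%:R :> R by apply: lt_trans a; rewrite divr_gt0.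
  have a2 : 8 / r < (2 * n)%:R by apply: lt_trans a _; rewrite natrM; lra.
  rewrite -[r / 8]invrK invf_div ltf_pV2 ?posrE ?divr_gt0 //.
  by rewrite natrM mulr_gt0.
exists N => n Nn f fm; have n0 : (0 < n)%N by apply: leq_ltn_trans Nn.
have hn := hN n Nn.
have h0 : 0 < (2 * n)%:R :> R by rewrite ltr0n muln_gt0.
have nh : n%:R / (2 * n)%:R = 2^-1 :> R.
  by rewrite natrM invfM mulrCA mulfV ?mulr1 // pnatr_eq0 -lt0n.
have near3 (a b d h e : R) : `|b - d| < e -> a <= b -> b < a + h -> h < r / 8 -> e <= r / 4 -> `|a - d| < r / 2.
  rewrite !ltr_norml => /andP[k1 k2] k3 k4 k5 k6.
  by clear -k1 k2 k3 k4 k5 k6 r0; apply/andP; split; lra.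
have key (w1 : R * R) : fundamental_domain R w1 -> 0 <= w1.1 -> w1.1 <= 2^-1 -> `|w1.1 - w.1| < r / 8 -> `|w1.2 - w.2| < r / 8 ->
    [/\ ((vertex n w1).1 <= n)%N, `|(vertex n w1).1%:R / (2 * n)%:R - w.1| < r / 2 &
        `|(vertex n w1).2%:R / (2 * n)%:R - height w| < r / 2].
  move=> fw1 u0 u1 k1 k2.
  have b0 := height_ge0 fw1 u0.
  have [t1 t2] := trunc_dist n0 u0; have [t3 t4] := trunc_dist n0 b0.
  have hh : `|height w1 - height w| < r / 4.
    have L := @sqrt_circle_lip R w1.1 w.1; rewrite u0 u1 x0 x1 in L; have {}L := L isT isT.
    rewrite /height; move: L; move: (Num.sqrt _) (Num.sqrt _) => b a L.
    have -> : w1.2 - a - (w.2 - b) = (w1.2 - w.2) - (a - b) by ring.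
    by apply: le_lt_trans (ler_normB _ _) _; clear -L k1 k2; lra.
  rewrite /vertex /=; split.
  - rewrite -(ler_nat R); have : 2^-1 * (2 * n)%:R = n%:R :> R by rewrite -nh divfK // lt0r_neq0.
    move=> <-; rewrite -ler_pdivrMr //; exact: le_trans t1 u1.
  - by apply: (near3 _ _ _ _ _ k1 t1 t2 hn); clear -r0; lra.
  - by apply: (near3 _ _ _ _ _ hh t3 t4 hn).
have r80 : `|0 : R| < r / 8 by rewrite normr0.
have [v1 a1 b1] : [/\ ((vertex n w).1 <= n)%N, `|(vertex n w).1%:R / (2 * n)%:R - w.1| < r / 2 &
        `|(vertex n w).2%:R / (2 * n)%:R - height w| < r / 2].
  by apply: key => //; rewrite subrr.
have [_ y0 y1 _] := fold_in p'.
have [v2 a2 b2] := key _ (fold_fd p') y0 y1 h1 h2.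
set u := vertex n w in v1 a1 b1 *; set v := vertex n (fold p') in v2 a2 b2 *.
clearbody u v.
have box i j : (minn u.1 v.1 <= i <= maxn u.1 v.1)%N -> (minn u.2 v.2 <= j <= maxn u.2 v.2)%N ->
    grid_col phi n i j = c.
  move=> hi hj.
  have mid (a b k : nat) (d : R) : (minn a b <= k <= maxn a b)%N ->
      `|a%:R / (2 * n)%:R - d| < r / 2 -> `|b%:R / (2 * n)%:R - d| < r / 2 -> `|k%:R / (2 * n)%:R - d| < r / 2.
    move=> hk; rewrite !ltr_norml => /andP[c1 c2] /andP[c3 c4].
    have [[l1 l2]|[l1 l2]] : (a <= k /\ k <= b)%N \/ (b <= k /\ k <= a)%N by clear -hk; lia.
      have m1 : a%:R / (2 * n)%:R <= k%:R / (2 * n)%:R :> R by rewrite ler_pM2r ?invr_gt0 // ler_nat.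
      have m2 : k%:R / (2 * n)%:R <= b%:R / (2 * n)%:R :> R by rewrite ler_pM2r ?invr_gt0 // ler_nat.
      by rewrite (lt_le_trans c1) ?(le_lt_trans _ c4) // lerD2r.
    have m1 : b%:R / (2 * n)%:R <= k%:R / (2 * n)%:R :> R by rewrite ler_pM2r ?invr_gt0 // ler_nat.
    have m2 : k%:R / (2 * n)%:R <= a%:R / (2 * n)%:R :> R by rewrite ler_pM2r ?invr_gt0 // ler_nat.
    by rewrite (lt_le_trans c3) ?(le_lt_trans _ c2) // lerD2r.
  have mi := mid _ _ _ _ hi a1 a2; have mj := mid _ _ _ _ hj b1 b2.
  have i1 : (i <= n)%N by clear -hi v1 v2; lia.
  have ih : i%:R / (2 * n)%:R <= 2^-1 :> R by rewrite -nh ler_pM2r ?invr_gt0 // ler_nat.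
  have ih0 : 0 <= i%:R / (2 * n)%:R :> R by rewrite divr_ge0.
  rewrite /grid_col /grid /chart; apply: hr; first by apply: lt_trans mi _; clear -r0; lra.
  have L := @sqrt_circle_lip R (i%:R / (2 * n)%:R) w.1; rewrite ih0 ih x0 x1 in L; have {}L := L isT isT.
  move: L mj mi; rewrite /height; move: (Num.sqrt _) (Num.sqrt _) => b a L mj mi.
  have -> : a + j%:R / (2 * n)%:R - w.2 = (j%:R / (2 * n)%:R - (w.2 - b)) + (a - b) by ring.
  by apply: le_lt_trans (ler_normD _ _) _; clear -L mj mi; lra.
have vn : (maxn u.1 v.1 <= n)%N by rewrite geq_max v1 v2.
have B := mono_const_box fm vn box.
by rewrite (B u.1 u.2) ?(B v.1 v.2) //; clear; lia.
Qed.

(** Agreement of the vertex values on all fine grids is locally constant in the second point, so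
    connectedness propagates it. The threshold obtained depends on both points. *)
Lemma vertex_connected (R : realType) (phi : upper R -> R) (p q : X R) :
  even_hecke_maass_cusp_form phi -> ~ nodal_line phi p ->
  connected_component (~` nodal_line phi) p q ->
  exists N, forall n, (N < n)%N -> forall f, mono_const n (grid_col phi n) f ->
    f (vertex n (fold p)).1 (vertex n (fold p)).2 = f (vertex n (fold q)).1 (vertex n (fold q)).2.
Proof.
move=> hphi np pq.
pose S (p q : X R) := exists N, forall n, (N < n)%N -> forall f, mono_const n (grid_col phi n) f ->
    f (vertex n (fold p)).1 (vertex n (fold p)).2 = f (vertex n (fold q)).1 (vertex n (fold q)).2.
apply: (@connected_locally_constant _ _ (S p) p _ _ _ _ q pq).
- exact: component_connected.
- exact: connected_component_refl.
- by exists 0%N.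
move=> r /connected_component_sub nr; apply: filterS (vertex_local hphi nr) => s [N1 h1].
split=> -[N2 h2]; exists (maxn N1 N2) => n; rewrite gtn_max => /andP[l1 l2] f fm.
  by rewrite (h2 n l2 f fm) (h1 n l1 f fm).
by rewrite (h2 n l2 f fm) -(h1 n l1 f fm).
Qed.

(** * Nonsingular nodal lines *)

Definition component (R : realType) (phi : upper R -> R) (z : R * R) : set (X R) :=
  connected_component (~` nodal_line phi) (pr z).

Lemma component_segment (R : realType) (phi : upper R -> R) (x y p q T : R) :
  even_hecke_maass_cusp_form phi -> 0 <= T ->
  (forall t, 0 <= t <= T -> 0 < y + t * q /\ coord phi (x + t * p, y + t * q) != 0) ->
  component phi (x, y) = component phi (x + T * p, y + T * q).
Proof.
move=> hphi T0 h.
have := @connected_component_eq R (X R) (~` nodal_line phi) (fun t => pr (x + t * p, y + t * q)) 0 T T0.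
rewrite !mul0r !addr0; apply.
  move=> t ht; have [h1 _] := h t ht.
  apply: (@cvg_comp _ _ _ (fun t => (x + t * p, y + t * q)) (@pr R) _ (nbhs (x + t * p, y + t * q))); last exact: pr_continuous.
  apply: (@cvg_pair _ _ _ (nbhs t) (nbhs (x + t * p)) (nbhs (y + t * q)));
    by apply: cvgD; [exact: cvg_cst|apply: cvgM; [exact: cvg_id|exact: cvg_cst]].
move=> t ht; have [h1 h2] := h t ht.
by move=> /(@nodal_pr R phi (x + t * p, y + t * q) hphi h1) /eqP; apply/negP.
Qed.

(** [(p, q)] is the gradient at [z]. Near [z] the derivative in this fixed direction exceeds [m],
    half the squared length of the gradient; a push for the time [T] therefore changes [F] by at
    least [m * T], which exceeds [|F|] at the starting point. *)
Lemma gradient_push (R : realType) (F : R * R -> R) (z : R * R) :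
  (forall w, 0 < w.2 -> C1_at F w) -> 0 < z.2 -> F z = 0 ->
  ('D_ex F z != 0) || ('D_ey F z != 0) ->
  exists r T p q m : R, [/\ 0 < r, 0 < T, 0 < m &
    forall x y, `|x - z.1| < r -> `|y - z.2| < r ->
      `|F (x, y)| < m * T /\ forall t, `|t| <= T -> 0 < y + t * q /\
        (0 <= t -> F (x, y) + m * t <= F (x + t * p, y + t * q)) /\
        (t <= 0 -> F (x + t * p, y + t * q) <= F (x, y) + m * t)].
Proof.
move=> C1 z0 Fz grad.
have [p pE] : exists p : R, p = 'D_ex F z by exists ('D_ex F z).
have [q qE] : exists q : R, q = 'D_ey F z by exists ('D_ey F z).
pose m := (p ^+ 2 + q ^+ 2) / 2.
have pq : 0 < p ^+ 2 + q ^+ 2.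
  rewrite lt0r addr_ge0 ?sqr_ge0 // andbT paddr_eq0 ?sqr_ge0 // !sqrf_eq0 negb_and.
  by rewrite pE qE.
have m0 : 0 < m by rewrite divr_gt0.
have [nd cx cy] := C1 z z0.
have cd : {for z, continuous (fun w => 'D_ex F w * p + 'D_ey F w * q)}.
  by apply: cvgD; [apply: (cvgM cx (cvg_cst _))|apply: (cvgM cy (cvg_cst _))].
have md : m < 'D_ex F z * p + 'D_ey F z * q by rewrite -pE -qE /m; move: pq; clear; move: p q => p q; rewrite !expr2; lra.
have /near_pairP[r0 r00 hr0] : \forall w \near z, m < 'D_ex F w * p + 'D_ey F w * q /\ 0 < w.2.
  by apply: filterI; [exact: near_gt|exact: near_hplane].
have M0 : 0 < 2 * (`|p| + `|q| + 1) by rewrite mulr_gt0 // ltr_wpDl // addr_ge0.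
pose T := r0 / (2 * (`|p| + `|q| + 1)).
have T0 : 0 < T by rewrite divr_gt0.
have TM : T * (2 * (`|p| + `|q| + 1)) = r0 by rewrite divfK // lt0r_neq0.
have mT : 0 < m * T by rewrite mulr_gt0.
have [r1 r10 hr1] := (continuous_pairP _ _).1 (C1_continuous (C1 z z0)) _ mT.
have r02 : 0 < r0 / 2 by rewrite divr_gt0.
exists (Num.min r1 (r0 / 2)), T, p, q, m; split=> //; first by rewrite lt_min r10 r02.
move=> x y; rewrite !lt_min => /andP[x1 x2] /andP[y1 y2].
split; first by have := hr1 x y x1 y1; rewrite Fz subr0.
have inbox t : `|t| <= T -> `|x + t * p - z.1| < r0 /\ `|y + t * q - z.2| < r0.
  move=> tT; have h1 : `|t * p| <= T * `|p| by rewrite normrM ler_wpM2r.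
  have h2 : `|t * q| <= T * `|q| by rewrite normrM ler_wpM2r.
  have h3 : 0 <= T * `|p| by rewrite mulr_ge0 // ltW.
  have h4 : 0 <= T * `|q| by rewrite mulr_ge0 // ltW.
  have E : T * `|p| * 2 + T * `|q| * 2 + T * 2 = r0 by rewrite -TM; ring.
  have -> : x + t * p - z.1 = (x - z.1) + t * p by ring.
  have -> : y + t * q - z.2 = (y - z.2) + t * q by ring.
  split; apply: le_lt_trans (ler_normD _ _) _; clear -E h1 h2 h3 h4 x2 y2 T0; lra.
move=> t tT; have [b1 b2] := inbox t tT.
split; first by have [] := hr0 _ _ b1 b2.
have [|c hc E] := @MVT_dist R (fun t => F (x + t * p, y + t * q))
    (fun t => 'D_ex F (x + t * p, y + t * q) * p + 'D_ey F (x + t * p, y + t * q) * q) 0 t.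
  move=> s; rewrite !subr0 => st; have sT := le_trans st tT.
  have [c1 c2] := inbox s sT; have [_ yp] := hr0 _ _ c1 c2.
  have d1 (a b : R) : is_derive s (1 : R) (fun t : R => a + t * b) b.
    by apply: is_derive_eq; rewrite /GRing.scale /=; ring.
  exact: (@is_derive_along R F (fun t => x + t * p) (fun t => y + t * q) s p q (C1 _ yp)).
rewrite !subr0 in hc E; rewrite !mul0r !addr0 in E.
have [c1 c2] := inbox c (le_trans hc tT); have [mc _] := hr0 _ _ c1 c2.
move: E mc; move: (_ * p + _ * q) => d E mc.
split=> ht.
  have h : m * t <= d * t by rewrite ler_wpM2r // ltW.
  by clear -E h; lra.
have h : d * t <= m * t by rewrite ler_wnM2r // ltW.
by clear -E h; lra.
Qed.

(** At a zero of phi, [a] is pushed for the time [T] along [e] times the gradient, where [e] is the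
    common sign; there the whole translate of the segment from [a] to [b] has this sign, and the
    path descends again to [b]. Where phi is nonzero the segment itself suffices. *)
Lemma local_component (R : realType) (phi : upper R -> R) (z : R * R) :
  even_hecke_maass_cusp_form phi -> nonsingular_nodal_line phi -> 0 < z.2 ->
  exists2 r : R, 0 < r & forall a b : R * R,
    `|a.1 - z.1| < r -> `|a.2 - z.2| < r -> `|b.1 - z.1| < r -> `|b.2 - z.2| < r ->
    0 < coord phi a * coord phi b -> component phi a = component phi b.
Proof.
move=> hphi ns z0; set F := coord phi.
have between (u v c r s : R) : `|u - c| < r -> `|v - c| < r -> 0 <= s <= 1 -> `|u + s * (v - u) - c| < r.
  move=> h1 h2 /andP[s0 s1].
  have -> : u + s * (v - u) - c = (1 - s) * (u - c) + s * (v - c) by ring.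
  apply: le_lt_trans (ler_normD _ _) _; rewrite !normrM (ger0_norm s0) ger0_norm ?subr_ge0 //.
  have [->|sn] := eqVneq s 0; first by rewrite subr0 mul1r mul0r addr0.
  have sp : 0 < s by rewrite lt0r sn.
  have k1 : (1 - s) * `|u - c| <= (1 - s) * r by rewrite ler_wpM2l ?subr_ge0 // ltW.
  have k2 : s * `|v - c| < s * r by rewrite ltr_pM2l.
  by lra.
have [Fz|Fz] := eqVneq (F z) 0; last first.
  have cF := coord_continuous hphi z0.
  have Fn : 0 < `|F z| by rewrite normr_gt0.
  have [r r0 hr] := (continuous_pairP _ _).1 cF _ Fn.
  have /near_pairP[r1 r10 hr1] := near_hplane z0.
  exists (Num.min r r1); first by rewrite lt_min r0 r10.
  move=> [a1 a2] [b1 b2] /= h1 h2 h3 h4 _.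
  have := @component_segment R phi a1 a2 (b1 - a1) (b2 - a2) 1 hphi ler01.
  rewrite !mul1r !(addrC _ (_ - _)) !subrK; apply=> t ht.
  have := between _ _ _ _ _ h1 h3 ht; have := between _ _ _ _ _ h2 h4 ht.
  rewrite !lt_min => /andP[k1 k2] /andP[k3 k4].
  split; first exact: (hr1 _ _ k4 k2).
  have := hr _ _ k3 k1; apply: contraTneq; rewrite -/F => ->.
  by rewrite sub0r normrN ltxx.
have grad : ('D_ex F z != 0) || ('D_ey F z != 0).
  rewrite -negb_and; apply/negP => /andP[/eqP g1 /eqP g2]; apply: (ns (mkupper z0)).
  by split; [rewrite -coordE|exact: g1|exact: g2].
have C1 w : 0 < w.2 -> C1_at F w by move=> w0; apply: tcd_C1 => //; exact: hm_smooth.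
have [r [T [p [q [m [r0 T0 m0 hr]]]]]] := gradient_push C1 z0 Fz grad.
have mT : 0 < m * T by rewrite mulr_gt0.
have TT : `|T| <= T by rewrite gtr0_norm.
have TN : `|- T| <= T by rewrite normrN gtr0_norm.
exists r => // -[a1 a2] [b1 b2] /= h1 h2 h3 h4.
have mid t : 0 <= t <= 1 -> `|a1 + t * (b1 - a1) - z.1| < r /\ `|a2 + t * (b2 - a2) - z.2| < r.
  by move=> ht; split; exact: between.
suff key (e : R) : e = 1 \/ e = -1 -> 0 < e * F (a1, a2) -> 0 < e * F (b1, b2) ->
    component phi (a1, a2) = component phi (b1, b2).
  have [Fa|Fa|Fa] := ltgtP (F (a1, a2)) 0.
  - rewrite nmulr_rgt0 // => Fb; apply: (key (-1)); [by right| |]; rewrite mulN1r oppr_gt0 //.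
  - by rewrite pmulr_rgt0 // => Fb; apply: (key 1); [by left| |]; rewrite mul1r.
  - by rewrite -/F Fa mul0r ltxx.
move=> e1 Fa Fb.
have eT t : 0 <= t <= T -> `|t * e| <= T.
  by move=> /andP[t0 tT]; case: e1 => ->; rewrite ?mulr1 ?mulrN1 ?normrN ger0_norm.
have nz x y t : `|x - z.1| < r -> `|y - z.2| < r -> 0 <= t <= T -> - (m * t) < e * F (x, y) ->
    0 < y + t * (e * q) /\ F (x + t * (e * p), y + t * (e * q)) != 0.
  move=> hx hy ht hF; have [_ /(_ _ (eT t ht))[yp [up dn]]] := hr x y hx hy.
  rewrite !mulrA; split=> //; have /andP[t0 _] := ht.
  case: e1 up dn hF yp => ->; rewrite ?mulr1 ?mul1r ?mulrN1 ?mulN1r => up dn hF yp.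
    by rewrite gt_eqF //; apply: lt_le_trans (up t0); rewrite -ltrBlDr sub0r.
  rewrite oppr_le0 in dn; have := dn t0; rewrite mulrN => h.
  by rewrite lt_eqF //; apply: le_lt_trans h _; rewrite subr_lt0 -ltrN2.
have leg x y : `|x - z.1| < r -> `|y - z.2| < r -> 0 < e * F (x, y) ->
    component phi (x, y) = component phi (x + T * (e * p), y + T * (e * q)).
  move=> hx hy hF; apply: component_segment => //; first exact: ltW.
  move=> t ht; apply: nz => //; apply: le_lt_trans hF.
  by rewrite oppr_le0 mulr_ge0 ?(ltW m0) //; case/andP: ht.
rewrite (leg a1 a2) // (leg b1 b2) //.
have := @component_segment R phi (a1 + T * (e * p)) (a2 + T * (e * q)) (b1 - a1) (b2 - a2) 1 hphi ler01.
rewrite !mul1r.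
have -> : a1 + T * (e * p) + (b1 - a1) = b1 + T * (e * p) by ring.
have -> : a2 + T * (e * q) + (b2 - a2) = b2 + T * (e * q) by ring.
apply=> t ht; have [u1 u2] := mid t ht.
have -> : a1 + T * (e * p) + t * (b1 - a1) = a1 + t * (b1 - a1) + T * (e * p) by ring.
have -> : a2 + T * (e * q) + t * (b2 - a2) = a2 + t * (b2 - a2) + T * (e * q) by ring.
apply: nz => //; first by rewrite lexx ltW.
have [small _] := hr _ _ u1 u2; move: small; rewrite ltr_norml => /andP[s1 s2].
by case: e1 => ->; [rewrite mul1r|rewrite mulN1r ltrN2].
Qed.

(** A short push along the gradient, or against it, gives either sign. *)
Lemma nonsingular_signs (R : realType) (phi : upper R -> R) (z : R * R) (e : R) (b : bool) :
  even_hecke_maass_cusp_form phi -> nonsingular_nodal_line phi -> 0 < z.2 -> 0 < e ->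
  coord phi z = 0 ->
  exists w : R * R, [/\ 0 < w.2, `|w.1 - z.1| < e, `|w.2 - z.2| < e, coord phi w != 0 &
    (0 < coord phi w) = b].
Proof.
move=> hphi ns z0 e0 Fz; set F := coord phi.
have grad : ('D_ex F z != 0) || ('D_ey F z != 0).
  rewrite -negb_and; apply/negP => /andP[/eqP g1 /eqP g2]; apply: (ns (mkupper z0)).
  by split; [rewrite -coordE|exact: g1|exact: g2].
have C1 w : 0 < w.2 -> C1_at F w by move=> w0; apply: tcd_C1 => //; exact: hm_smooth.
have [r [T [p [q [m [r0 T0 m0 hr]]]]]] := gradient_push C1 z0 Fz grad.
have rr (x : R) : `|x - x| < r by rewrite subrr normr0.
have Fz' : F z = 0 := Fz.
have [_ ht] := hr _ _ (rr z.1) (rr z.2); rewrite -surjective_pairing Fz' in ht.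
have M0 : 0 < `|p| + `|q| + 1 by rewrite ltr_wpDl // addr_ge0.
pose t := Num.min T (e / 2 / (`|p| + `|q| + 1)).
have t0 : 0 < t by rewrite lt_min T0 !divr_gt0.
have tT : t <= T by rewrite ge_min lexx.
have te : t * (`|p| + `|q| + 1) <= e / 2 by rewrite -ler_pdivlMr // ge_min lexx orbT.
have small (s : R) : `|s| = t -> `|z.1 + s * p - z.1| < e /\ `|z.2 + s * q - z.2| < e.
  move=> st; rewrite !(addrAC _ _ (- _)) !subrr !add0r !normrM st.
  have h1 : 0 <= t * `|p| by rewrite mulr_ge0 // ltW.
  have h2 : 0 <= t * `|q| by rewrite mulr_ge0 // ltW.
  move: te h1 h2 t0; rewrite !mulrDr mulr1; move: (t * `|p|) (t * `|q|) => A B te h1 h2 t0.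
  by clear -te h1 h2 t0 e0; split; lra.
have mt : 0 < m * t by rewrite mulr_gt0.
case: b.
  have st : `|t| = t by rewrite gtr0_norm.
  have [s1 s2] := small t st; have [yp [up _]] := ht t (eq_ind_r (fun x => x <= T) tT st).
  exists (z.1 + t * p, z.2 + t * q); have := up (ltW t0); rewrite add0r => h.
  have h2 : 0 < F (z.1 + t * p, z.2 + t * q) by exact: lt_le_trans h.
  by split; rewrite //= ?gt_eqF.
have st : `|- t| = t by rewrite normrN gtr0_norm.
have [s1 s2] := small (- t) st; have [yp [_ dn]] := ht (- t) (eq_ind_r (fun x => x <= T) tT st).
exists (z.1 + - t * p, z.2 + - t * q).
have := dn; rewrite oppr_le0 add0r mulrN => /(_ (ltW t0)) h.
have h2 : F (z.1 + - t * p, z.2 + - t * q) < 0 by apply: le_lt_trans h _; rewrite oppr_lt0.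
by split; rewrite //= ?lt_eqF // ltNge (ltW h2).
Qed.

(** A Lebesgue number for the neighbourhoods of [local_component]: half of the local radius serves
    all centres near [z]. *)
Lemma uniform_component (R : realType) (phi : upper R -> R) (K : set (R * R)) :
  even_hecke_maass_cusp_form phi -> nonsingular_nodal_line phi -> compact K ->
  (forall z, K z -> 0 < z.2) ->
  exists2 r : R, 0 < r & forall z a b : R * R, K z ->
    `|a.1 - z.1| < r -> `|a.2 - z.2| < r -> `|b.1 - z.1| < r -> `|b.2 - z.2| < r ->
    0 < coord phi a * coord phi b -> component phi a = component phi b.
Proof.
move=> hphi ns cK K0.
pose P (r : R) (z : R * R) := forall a b : R * R,
    `|a.1 - z.1| < r -> `|a.2 - z.2| < r -> `|b.1 - z.1| < r -> `|b.2 - z.2| < r ->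
    0 < coord phi a * coord phi b -> component phi a = component phi b.
have nc := (compact_near_coveringP K).1 cK.
have [|e /= e0 he] := nc R (0 : R)^'+ P _.
  move=> z Kz; have [r r0 hr] := local_component hphi ns (K0 z Kz).
  have r2 : 0 < r / 2 by rewrite divr_gt0.
  have nz : \forall z' \near z, `|z'.1 - z.1| < r / 2 /\ `|z'.2 - z.2| < r / 2.
    by apply/near_pairP; exists (r / 2).
  have nr : \forall s \near (0 : R)^'+, s < r / 2 by exact: nbhs_right_lt.
  exists ([set z' | `|z'.1 - z.1| < r / 2 /\ `|z'.2 - z.2| < r / 2], [set s : R | s < r / 2]) => //=.
  move=> [z' s] [/= [d1 d2] sr] a b k1 k2 k3 k4.
  have tri (u v w : R) : `|u - v| < s -> `|v - w| < r / 2 -> `|u - w| < r.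
    move=> j1 j2; have -> : u - w = (u - v) + (v - w) by ring.
    by apply: le_lt_trans (ler_normD _ _) _; lra.
  by apply: hr; [exact: (tri _ z'.1)|exact: (tri _ z'.2)|exact: (tri _ z'.1)|exact: (tri _ z'.2)].
exists (e / 2); first by rewrite divr_gt0.
move=> z a b Kz; apply: (he (e / 2)) => //=; last by rewrite divr_gt0.
by rewrite sub0r normrN gtr0_norm ?divr_gt0 //; lra.
Qed.

(** As phi decreases in x at this height, a positive point is joined to the left side by a
    horizontal segment of positive values, and a negative one to the right side; above [Y] each side
    keeps its sign. *)
Lemma top_component (R : realType) (phi : upper R -> R) (Y : R) :
  even_hecke_maass_cusp_form phi -> 1 <= Y ->
  (forall y, Y <= y -> [/\ 0 < coord phi (0, y), coord phi (2^-1, y) < 0 &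
        forall x x', 0 <= x -> x <= x' -> x' <= 2^-1 -> coord phi (x', y) <= coord phi (x, y)]) ->
  forall x y, 0 <= x <= 2^-1 -> Y <= y ->
    (0 < coord phi (x, y) -> component phi (x, y) = component phi (0, Y)) /\
    (coord phi (x, y) < 0 -> component phi (x, y) = component phi (2^-1, Y)).
Proof.
move=> hphi Y1 hY x y /andP[x0 x1] Yy.
have vert (a : R) : (forall y, Y <= y -> coord phi (a, y) != 0) -> component phi (a, Y) = component phi (a, y).
  move=> ha; have yY : 0 <= y - Y by lra.
  have := @component_segment R phi a Y 0 1 (y - Y) hphi yY.
  have E : Y + (y - Y) * 1 = y by ring.
  rewrite E mulr0 addr0; apply=> t /andP[t0 _].
  rewrite mulr0 addr0 mulr1; split; first by lra.
  by apply: ha; lra.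
have [p0 n0 mon] := hY y Yy.
split=> h.
  rewrite (vert 0); last by move=> y' /hY[h' _ _]; rewrite gt_eqF.
  apply: esym; have := @component_segment R phi 0 y 1 0 x hphi x0.
  rewrite mulr0 mulr1 add0r addr0; apply=> t /andP[t0 tx].
  rewrite mulr0 mulr1 addr0 add0r; split; first by lra.
  by rewrite gt_eqF //; apply: lt_le_trans h _; apply: mon.
rewrite (vert 2^-1); last by move=> y' /hY[_ h' _]; rewrite lt_eqF.
have x2 : 0 <= 2^-1 - x by lra.
have := @component_segment R phi x y 1 0 (2^-1 - x) hphi x2.
have E : x + (2^-1 - x) * 1 = 2^-1 by ring.
rewrite E mulr0 addr0; apply=> t /andP[t0 tx].
rewrite mulr0 mulr1 addr0; split; first by lra.
by rewrite lt_eqF //; apply: le_lt_trans h; apply: mon; lra.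
Qed.

(** * Zeros on delta *)

Lemma delta_coord_left (R : realType) (s : R) : s <= 0 -> delta_coord s = (0, 1 - s).
Proof. by rewrite /delta_coord => ->. Qed.

Lemma delta_coord_mid (R : realType) (s : R) : 0 <= s <= 2^-1 ->
  delta_coord s = (s, Num.sqrt (1 - s ^+ 2)).
Proof.
move=> /andP[s0 s1]; rewrite /delta_coord s1; case: ifP => // s0'.
have -> : s = 0 by apply/eqP; rewrite eq_le s0' s0.
by rewrite expr0n !subr0 sqrtr1.
Qed.

Lemma delta_coord_right (R : realType) (s : R) : 2^-1 <= s ->
  delta_coord s = (2^-1, Num.sqrt 3 / 2 + (s - 2^-1)).
Proof.
move=> s1; rewrite /delta_coord ifF; last by apply/negbTE; rewrite -ltNge; lra.
case: ifP => // s1'; have -> : s = 2^-1 by apply/eqP; rewrite eq_le s1' s1.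
by rewrite sqrt34 subrr addr0.
Qed.

(** The pieces of delta lie on the geodesics [x = 0], [|z| = 1] and [x = 1/2], each fixed by a
    reflection that preserves phi. Every piece yields a radius, so corners are treated from both
    sides; a piece not containing [s0] contributes the distance of the parameters. *)
Lemma delta_zero_isolated (R : realType) (phi : upper R -> R) (s0 : R) :
  even_hecke_maass_cusp_form phi -> coord phi (delta_coord s0) = 0 ->
  exists2 r : R, 0 < r & forall s, `|s - s0| < r -> s != s0 -> coord phi (delta_coord s) != 0.
Proof.
move=> hphi g0; have hf := hm_smooth hphi; have [l l0 pde] := coord_pde hphi.
have nz : exists2 z : R * R, 0 < z.2 & coord phi z != 0.
  have [Y Y1 hY] := cusp_behaviour hphi; have [p _ _] := hY Y (lexx Y).
  by exists (0, Y); [rewrite /=; lra|rewrite gt_eqF].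
have s32 : Num.sqrt 3 ^+ 2 = 3 :> R by rewrite sqr_sqrtr.
have s30 : 0 < Num.sqrt 3 :> R by rewrite sqrtr_gt0.
have [r1 r10 h1] : exists2 r : R, 0 < r & forall s, s <= 0 -> `|s - s0| < r -> s != s0 -> coord phi (delta_coord s) != 0.
  have [s00|s00] := leP s0 0; last first.
    by exists s0 => // s hs; rewrite ltr_norml => /andP[]; lra.
  have y0 : 0 < 1 - s0 by lra.
  rewrite (delta_coord_left s00) in g0.
  have [|r r0 hr] := vertical_isolated_zero hf pde l0 y0 g0 _ nz.
    by move=> x y yp; rewrite mulr0 sub0r coord_even.
  exists r => // s hs sr sn; rewrite delta_coord_left //; apply: hr; first by lra.
    by rewrite (_ : 1 - s - (1 - s0) = - (s - s0)) ?normrN //; ring.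
  by apply: contra sn => /eqP e; apply/eqP; lra.
have [r2 r20 h2] : exists2 r : R, 0 < r & forall s, 0 <= s <= 2^-1 -> `|s - s0| < r -> s != s0 -> coord phi (delta_coord s) != 0.
  have [s00|s00] := ltP s0 0.
    by exists (- s0); [lra|move=> s /andP[hs _]; rewrite ltr_norml => /andP[]; lra].
  have [s01|s01] := ltP 2^-1 s0.
    by exists (s0 - 2^-1); [lra|move=> s /andP[_ hs]; rewrite ltr_norml => /andP[]; lra].
  have sI : 0 <= s0 <= 2^-1 by rewrite s00.
  rewrite (delta_coord_mid sI) in g0.
  have p0 : 0 < 1 - s0 ^+ 2 by nra.
  have y0 : 0 < Num.sqrt (1 - s0 ^+ 2) by rewrite sqrtr_gt0.
  have c0 : s0 ^+ 2 + Num.sqrt (1 - s0 ^+ 2) ^+ 2 = 1 by rewrite sqr_sqrtr ?(ltW p0) //; ring.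
  have [|r r0 hr] := circle_isolated_zero hf pde l0 y0 c0 g0 _ nz.
    by move=> x y yp; exact: coord_inversion.
  exists r => // s sI2 sr sn; rewrite delta_coord_mid //.
  have p1 : 0 < 1 - s ^+ 2 by case/andP: sI2 => k1 k2; nra.
  apply: hr => //; first by rewrite sqrtr_gt0.
  - by rewrite sqr_sqrtr ?(ltW p1) //; ring.
  - by apply: le_lt_trans sr; exact: sqrt_circle_lip.
  - rewrite paddr_eq0 ?sqr_ge0 // !sqrf_eq0 subr_eq0 negb_and sn //.
have [r3 r30 h3] : exists2 r : R, 0 < r & forall s, 2^-1 <= s -> `|s - s0| < r -> s != s0 -> coord phi (delta_coord s) != 0.
  have [s00|s00] := ltP s0 2^-1.
    by exists (2^-1 - s0); [lra|move=> s hs; rewrite ltr_norml => /andP[]; lra].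
  have y0 : 0 < Num.sqrt 3 / 2 + (s0 - 2^-1) by lra.
  rewrite (delta_coord_right s00) in g0.
  have [|r r0 hr] := vertical_isolated_zero hf pde l0 y0 g0 _ nz.
    by move=> x y yp; rewrite mulfV // coord_shift.
  exists r => // s hs sr sn; rewrite delta_coord_right //; apply: hr; first by lra.
    by rewrite (_ : _ - _ = s - s0) //; ring.
  by apply: contra sn => /eqP e; apply/eqP; lra.
exists (Num.min r1 (Num.min r2 r3)); first by rewrite !lt_min r10 r20 r30.
move=> s; rewrite !lt_min => /and3P[k1 k2 k3] sn.
have [hs|hs] := leP s 0; first exact: h1.
have [hs2|hs2] := leP s 2^-1; first by apply: h2 => //; rewrite ltW.
by apply: h3 => //; exact: ltW.
Qed.

Lemma delta_coord_top (R : realType) (Y s : R) : 1 <= Y -> Y <= `|s| -> Y <= (delta_coord s).2 /\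
  ((s <= 0 /\ (delta_coord s).1 = 0) \/ (0 <= s /\ (delta_coord s).1 = 2^-1)).
Proof.
move=> Y1; have [s0|s0] := leP s 0.
  rewrite (ler0_norm s0) delta_coord_left //= => h; split; first by lra.
  by left.
rewrite (gtr0_norm s0) => h; rewrite delta_coord_right //=; last by lra.
have s32 : Num.sqrt 3 ^+ 2 = 3 :> R by rewrite sqr_sqrtr.
have s30 : 0 < Num.sqrt 3 :> R by rewrite sqrtr_gt0.
by split; [nra|right; split=> //; exact: ltW].
Qed.

Lemma delta_sign_ends (R : realType) (phi : upper R -> R) :
  even_hecke_maass_cusp_form phi -> exists2 Y : R, 1 <= Y & forall s, Y <= `|s| ->
    (s <= 0 -> 0 < coord phi (delta_coord s)) /\ (0 <= s -> coord phi (delta_coord s) < 0).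
Proof.
move=> hphi; have [Y Y1 hY] := cusp_behaviour hphi; exists Y => // s sY.
have [h1 h2] := delta_coord_top Y1 sY; have [p n _] := hY _ h1.
case: h2 => -[h2 h3]; rewrite [delta_coord s]surjective_pairing h3.
  split=> // s0; have e : s = 0 by apply/eqP; rewrite eq_le h2 s0.
  by move: sY; rewrite e normr0; lra.
split=> // s0; have e : s = 0 by apply/eqP; rewrite eq_le h2 s0.
by move: sY; rewrite e normr0; lra.
Qed.

Lemma coord_delta_continuous (R : realType) (phi : upper R -> R) :
  even_hecke_maass_cusp_form phi -> continuous (fun s => coord phi (delta_coord s)).
Proof.
move=> hphi s.
apply: (@cvg_comp _ _ _ (@delta_coord R) (coord phi) _ (nbhs (delta_coord s))).
  exact: delta_coord_continuous.
by apply: coord_continuous => //; exact: delta_coord_gt0.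
Qed.

(** Beyond [Y] the sign is known, and [[- Y, Y]] is covered by finitely many intervals in which only
    the centre can be a zero. *)
Lemma delta_zeros_sorted (R : realType) (phi : upper R -> R) :
  even_hecke_maass_cusp_form phi -> exists2 zs : seq R, sorted <%R zs &
    forall s, (s \in zs) = (coord phi (delta_coord s) == 0).
Proof.
move=> hphi; have [Y Y1 hY] := delta_sign_ends hphi.
set g := fun s => coord phi (delta_coord s).
have iso s : exists2 r : R, 0 < r & forall s', `|s' - s| < r -> s' != s -> g s' != 0.
  have [g0|g0] := eqVneq (g s) 0; first exact: delta_zero_isolated.
  have /cvgrPdist_lt cg : {for s, continuous g} by exact: coord_delta_continuous.
  have gn : 0 < `|g s| by rewrite normr_gt0.
  have [r /= r0 hr] := cg _ gn; exists r => // s' hs _.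
  apply: contraTneq (hr s' _) => [->|]; first by rewrite subr0 ltxx.
  by rewrite /= distrC.
have /choice[r hr] : forall s, exists r : R, 0 < r /\ forall s', `|s' - s| < r -> s' != s -> g s' != 0.
  by move=> s; have [r r0 h] := iso s; exists r.
have cpt : cover_compact (`[- Y, Y]%classic : set R) by rewrite -compact_cover; exact: segment_compact.
have [D' _ hD] : finite_subset_cover setT (fun s : R => ball s (r s)) (`[- Y, Y]%classic : set R).
  apply: cpt; first by move=> s _; exact: ball_open.
  by move=> s _; exists s => //; apply: ballxx; have [] := hr s.
have sub : [set s | g s = 0] `<=` [set` D'].
  move=> s /= gs.
  have sI : (`[- Y, Y]%classic : set R) s.
    rewrite /= in_itv /= -ler_norml leNgt; apply/negP => /ltW /hY[h1 h2].
    by have [s0|s0] := leP s 0; [have := h1 s0|have := h2 (ltW s0)]; rewrite -/(g s) gs ltxx.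
  have [d Dd] := hD s sI; rewrite /ball /= distrC => sd.
  have [->//|sn] := eqVneq s d.
  by have [_ /(_ s sd sn)] := hr d; rewrite gs eqxx.
have /finite_fsetP[A hA] : finite_set [set s | g s = 0] by exact: (sub_finite_set sub (finite_fset _)).
exists (sort <=%R A); first by rewrite sort_lt_sorted fset_uniq.
move=> s; rewrite mem_sort; apply/idP/eqP => h.
  by have : [set` A] s by []; rewrite -hA.
by have : [set s | g s = 0] s by []; rewrite hA.
Qed.

(* The sorted zeros [zs] cut the line into arcs; [idx zs s] is the number of the arc
   containing [s], and [sample zs i] is a point of the i-th arc. *)
Definition idx (R : realType) (zs : seq R) (s : R) : nat := find (fun z => s <= z) zs.

Definition sample (R : realType) (zs : seq R) (i : nat) : R :=
  if i == 0%N then nth 0 zs 0 - 1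
  else if (i < size zs)%N then (nth 0 zs i.-1 + nth 0 zs i) / 2 else nth 0 zs i.-1 + 1.

Lemma sorted_nth_le (R : realType) (zs : seq R) (i j : nat) : sorted <%R zs ->
  (i <= j)%N -> (j < size zs)%N -> nth 0 zs i <= nth 0 zs j.
Proof. by move=> sz ij js; rewrite (lt_sorted_leq_nth 0 sz) ?inE //; exact: leq_ltn_trans js. Qed.

Lemma sorted_nth_lt (R : realType) (zs : seq R) (i j : nat) : sorted <%R zs ->
  (i < j)%N -> (j < size zs)%N -> nth 0 zs i < nth 0 zs j.
Proof. by move=> sz ij js; rewrite (lt_sorted_ltn_nth 0 sz) ?inE //; exact: ltn_trans js. Qed.

Lemma idx_size (R : realType) (zs : seq R) (s : R) : (idx zs s <= size zs)%N.
Proof. exact: find_size. Qed.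

Lemma idx_lt (R : realType) (zs : seq R) (s : R) (k : nat) : (k < idx zs s)%N -> nth 0 zs k < s.
Proof. by move=> /(before_find 0) /negbT; rewrite -ltNge. Qed.

Lemma idx_ge (R : realType) (zs : seq R) (s : R) (k : nat) : sorted <%R zs ->
  (idx zs s <= k)%N -> (k < size zs)%N -> s <= nth 0 zs k.
Proof.
move=> sz ik ks.
have h : has (fun z => s <= z) zs by rewrite has_find; exact: leq_ltn_trans ks.
apply: le_trans (nth_find 0 h) _; rewrite -/(idx zs s).
exact: sorted_nth_le.
Qed.

Lemma idx_eq (R : realType) (zs : seq R) (s : R) (i : nat) : sorted <%R zs -> (i <= size zs)%N ->
  ((0 < i)%N -> nth 0 zs i.-1 < s) -> ((i < size zs)%N -> s <= nth 0 zs i) -> idx zs s = i.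
Proof.
move=> sz iz h1 h2; case: (ltngtP (idx zs s) i) => // h.
  have i0 : (0 < i)%N by apply: leq_ltn_trans h.
  have := idx_ge sz (_ : (idx zs s <= i.-1)%N) (_ : (i.-1 < size zs)%N).
  rewrite leNgt h1 // => /(_ _ _) H; suff : false by []; apply: H; lia.
have k := idx_size zs s.
have := idx_lt h; rewrite ltNge h2 //; exact: leq_trans h k.
Qed.

Lemma sample_lt (R : realType) (zs : seq R) (i : nat) : sorted <%R zs -> (i < size zs)%N ->
  sample zs i < nth 0 zs i /\ nth 0 zs i < sample zs i.+1.
Proof.
move=> sz iz; rewrite /sample /=; split.
  case: i iz => [|i] iz /=; first by lra.
  by rewrite iz; have := sorted_nth_lt sz (ltnSn i) iz; lra.
case: ifP => h; last by lra.
by have := sorted_nth_lt sz (ltnSn i) h; lra.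
Qed.

(** With the margin [d], a parameter closer than [d] to a sample lies in the same arc, and a step of
    length at most [d] cannot jump over an arc. *)
Lemma sample_gap (R : realType) (zs : seq R) : sorted <%R zs -> exists2 d : R, 0 < d &
  forall i, (i < size zs)%N -> sample zs i + d <= nth 0 zs i /\ nth 0 zs i + d <= sample zs i.+1.
Proof.
move=> sz.
have fin (F : nat -> R) (n : nat) : (forall i, (i < n)%N -> 0 < F i) -> exists2 d : R, 0 < d & forall i, (i < n)%N -> d <= F i.
  elim: n => [|n IH] h; first by exists 1.
  have [|d d0 hd] := IH; first by move=> i ni; apply: h; exact: ltnW.
  exists (Num.min d (F n)); first by rewrite lt_min d0 h.
  by move=> i; rewrite ltnS leq_eqVlt => /predU1P[->|ni]; rewrite ge_min ?lexx ?orbT ?hd.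
have [|d d0 hd] := fin (fun i => Num.min (nth 0 zs i - sample zs i) (sample zs i.+1 - nth 0 zs i)) (size zs).
  by move=> i iz; have [h1 h2] := sample_lt sz iz; rewrite lt_min !subr_gt0 h1 h2.
by exists d => // i iz; have := hd i iz; rewrite le_min => /andP[]; lra.
Qed.

Lemma idx_sample (R : realType) (zs : seq R) (d : R) (i : nat) (s : R) : sorted <%R zs -> 0 < d ->
  (forall i, (i < size zs)%N -> sample zs i + d <= nth 0 zs i /\ nth 0 zs i + d <= sample zs i.+1) ->
  (i <= size zs)%N -> `|s - sample zs i| < d -> idx zs s = i /\ s \notin zs.
Proof.
move=> sz d0 hd iz; rewrite ltr_norml => /andP[s1 s2].
have h1 : (0 < i)%N -> nth 0 zs i.-1 < s.
  move=> i0; have [|_] := hd i.-1; first by lia.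
  by rewrite prednK //; lra.
have h2 : (i < size zs)%N -> s < nth 0 zs i by move=> iz'; have [] := hd i iz'; lra.
have ii : idx zs s = i by apply: idx_eq => // /h2 /ltW.
split=> //; apply/negP => /(nthP 0)[k kz E].
have [ki|ik] := ltnP k i.
  have : nth 0 zs k <= nth 0 zs i.-1 by apply: sorted_nth_le => //; case: (i) ki iz.
  by have := h1 (leq_ltn_trans (leq0n k) ki); lra.
have : nth 0 zs i <= nth 0 zs k by exact: sorted_nth_le.
by have := h2 (leq_ltn_trans ik kz); lra.
Qed.

Lemma component_arc (R : realType) (phi : upper R -> R) (zs : seq R) (s s' : R) :
  even_hecke_maass_cusp_form phi -> sorted <%R zs ->
  (forall s, (s \in zs) = (coord phi (delta_coord s) == 0)) ->
  s \notin zs -> s' \notin zs -> idx zs s = idx zs s' ->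
  component phi (delta_coord s) = component phi (delta_coord s') /\
  (0 < coord phi (delta_coord s)) = (0 < coord phi (delta_coord s')).
Proof.
move=> hphi sz hz.
wlog ss : s s' / s <= s'.
  move=> H ns ns' e; case/orP: (le_total s s') => h; first exact: H.
  by have [h1 h2] := H s' s h ns' ns (esym e); rewrite h1 h2.
move=> ns ns' e.
have nz u : s <= u <= s' -> u \notin zs.
  move=> /andP[su us]; apply/negP => uz; have /(nthP 0)[k kz E] := uz.
  have [ki|ik] := ltnP k (idx zs s); first by have := idx_lt ki; lra.
  have : s' <= nth 0 zs k by apply: idx_ge => //; rewrite -e.
  rewrite E => s'u; have eu : u = s' by apply/eqP; rewrite eq_le us s'u.
  by move: ns'; rewrite -eu uz.
have E : component phi (delta_coord s) = component phi (delta_coord s').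
  apply: (@connected_component_eq R (X R) (~` nodal_line phi) (fun s => pr (delta_coord s))) => // u hu.
    apply: (@cvg_comp _ _ _ (@delta_coord R) (@pr R) _ (nbhs (delta_coord u))).
      exact: delta_coord_continuous.
    by apply: pr_continuous; exact: delta_coord_gt0.
  move=> /(@nodal_pr R phi (delta_coord u) hphi (delta_coord_gt0 u)) /eqP.
  by rewrite -hz; apply/negP/nz.
split=> //.
have n1 : ~ nodal_line phi (pr (delta_coord s)).
  by move=> /(@nodal_pr R phi (delta_coord s) hphi (delta_coord_gt0 s)) /eqP; rewrite -hz; apply/negP.
have n2 : ~ nodal_line phi (pr (delta_coord s')).
  by move=> /(@nodal_pr R phi (delta_coord s') hphi (delta_coord_gt0 s')) /eqP; rewrite -hz; apply/negP.
have := @component_sign R phi (pr (delta_coord s)) (pr (delta_coord s')) hphi n1.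
rewrite !fold_delta; apply; rewrite -/(component phi (delta_coord s)) E.
exact: connected_component_refl.
Qed.

(** * Colourings of the inert domains *)

Lemma idx_strict (R : realType) (zs : seq R) (i : nat) (s : R) : sorted <%R zs -> (i <= size zs)%N ->
  ((0 < i)%N -> nth 0 zs i.-1 < s) -> ((i < size zs)%N -> s < nth 0 zs i) ->
  idx zs s = i /\ s \notin zs.
Proof.
move=> sz iz h1 h2.
have ii : idx zs s = i by apply: idx_eq => // /h2 /ltW.
split=> //; apply/negP => /(nthP 0)[k kz E].
have [ki|ik] := ltnP k i.
  have : nth 0 zs k <= nth 0 zs i.-1 by apply: sorted_nth_le => //; case: (i) ki iz.
  by have := h1 (leq_ltn_trans (leq0n k) ki); lra.
have : nth 0 zs i <= nth 0 zs k by exact: sorted_nth_le.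
by have := h2 (leq_ltn_trans ik kz); lra.
Qed.

Lemma vertex_delta (R : realType) (n : nat) (s : R) : (0 < n)%N ->
  exists2 l : int, vertex n (delta_coord s) = bdpt n l & `|l%:~R / (2 * n)%:R - s| <= (2 * n)%:R^-1.
Proof.
move=> n0; have h0 : 0 < (2 * n)%:R :> R by rewrite ltr0n muln_gt0.
have nh : 2^-1 * (2 * n)%:R = n%:R :> R by rewrite natrM mulrA mulVf ?mul1r.
have nh' : n%:R / (2 * n)%:R = 2^-1 :> R by rewrite -nh mulfK ?gt_eqF.
have [s0|s0] := leP s 0.
  rewrite delta_coord_left // /vertex /height /= expr0n subr0 sqrtr1 mul0r trunc0.
  have -> : 1 - s - 1 = - s by ring.
  have s1 : 0 <= - s by lra.
  have [k1 k2] := trunc_dist n0 s1.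
  exists (- (Num.trunc (- s * (2 * n)%:R))%:Z); first by rewrite bdpt_left.
  move: k1 k2; move: (Num.trunc _) => k k1 k2.
  rewrite mulrNz mulNr -pmulrn ler_norml; move: k1 k2; move: (k%:R / _) => a; move: (_^-1) => b k1 k2.
  by apply/andP; split; lra.
have [s1|s1] := leP s 2^-1.
  rewrite delta_coord_mid ?s1 ?ltW // /vertex /height /= subrr mul0r trunc0.
  have [k1 k2] := trunc_dist n0 (ltW s0).
  exists (Num.trunc (s * (2 * n)%:R))%:Z.
    by rewrite bdpt_bottom // -(ler_nat R) -nh -ler_pdivrMr //; exact: le_trans k1 s1.
  rewrite -pmulrn ler_norml; move: k1 k2; move: (_%:R / _) => a; move: (_%:R^-1) => b k1 k2.
  by apply/andP; split; lra.
rewrite delta_coord_right ?(ltW s1) // /vertex /height /= nh natrK -sqrt34.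
have -> : Num.sqrt (1 - 2^-1 ^+ 2) + (s - 2^-1) - Num.sqrt (1 - 2^-1 ^+ 2) = s - 2^-1 :> R by ring.
have s2 : 0 <= s - 2^-1 by lra.
have [k1 k2] := trunc_dist n0 s2.
exists (n + Num.trunc ((s - 2^-1) * (2 * n)%:R))%N%:Z; first by rewrite bdpt_right.
rewrite -pmulrn natrD mulrDl nh' ler_norml; move: k1 k2; move: (Num.trunc _)%:R => t.
move: (t / _) => a; move: (_%:R^-1) => b k1 k2.
by apply/andP; split; lra.
Qed.

Lemma mono_bdpt (n : nat) (col f : nat -> nat -> bool) (l : int) : (0 < n)%N -> mono_const n col f ->
  col (bdpt n l).1 (bdpt n l).2 = col (bdpt n (l + 1)).1 (bdpt n (l + 1)).2 ->
  f (bdpt n l).1 (bdpt n l).2 = f (bdpt n (l + 1)).1 (bdpt n (l + 1)).2.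
Proof.
move=> n0 [fh fv]; case: (bdpt_step l n0) => -[j] => [[_ -> ->]|[jn _ -> ->]|[_ -> ->]] /= E.
- by apply/esym/fv.
- exact: fh.
- exact: fv.
Qed.

Lemma int_climb (a b : int) (P : int -> Prop) : a <= b -> P a ->
  (forall m, a <= m -> m <= b -> a <= m + 1 -> m + 1 <= b -> P m -> P (m + 1)) -> P b.
Proof.
move=> ab Pa h; have k (k : nat) : a + k%:Z <= b -> P (a + k%:Z).
  elim: k => [|k IH] kb; first by rewrite addr0.
  have -> : a + k.+1%:Z = a + k%:Z + 1 by lia.
  by apply: h; [lia|lia|lia|lia|apply: IH; lia].
have -> : b = a + `|b - a|%N%:Z by lia.
by apply: k; lia.
Qed.

Lemma fine_mesh (R : realType) (d : R) (N : nat) : 0 < d ->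
  exists n : nat, [/\ (0 < n)%N, (N < n)%N & (2 * n)%:R^-1 < d].
Proof.
move=> d0; exists (N + Num.trunc d^-1).+1; split=> //; first by rewrite ltnS leq_addr.
rewrite invf_plt ?posrE // ?ltr0n //.
have := truncnS_gt d^-1 => /lt_le_trans -> //; rewrite ler_nat.
by move: (Num.trunc _) => m; lia.
Qed.

Definition positive_arc (R : realType) (phi : upper R -> R) (zs : seq R) (i : nat) : bool :=
  0 < coord phi (delta_coord (sample zs i)).

Definition arc_domain (R : realType) (phi : upper R -> R) (zs : seq R) (i : nat) : set (X R) :=
  component phi (delta_coord (sample zs i)).

Lemma sample_idx (R : realType) (zs : seq R) (i : nat) : sorted <%R zs -> (i <= size zs)%N ->
  idx zs (sample zs i) = i /\ sample zs i \notin zs.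
Proof.
move=> sz iz; have [d d0 hd] := sample_gap sz.
by apply: (idx_sample sz d0 hd iz); rewrite subrr normr0.
Qed.

Lemma arc_val (R : realType) (phi : upper R -> R) (zs : seq R) (s : R) :
  even_hecke_maass_cusp_form phi -> sorted <%R zs ->
  (forall s, (s \in zs) = (coord phi (delta_coord s) == 0)) -> s \notin zs ->
  component phi (delta_coord s) = arc_domain phi zs (idx zs s) /\
  (0 < coord phi (delta_coord s)) = positive_arc phi zs (idx zs s).
Proof.
move=> hphi sz hz ns; have [h1 h2] := sample_idx sz (idx_size zs s).
by have := component_arc hphi sz hz ns h2 (esym h1).
Qed.

(* A vertex function is constant on a domain only for grids that are fine with respect
   to the pair of points considered; one grid serves all pairs of samples. *)
Lemma domain_coloring (R : realType) (phi : upper R -> R) (zs : seq R) (c : bool) (hh : nat -> bool) :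
  even_hecke_maass_cusp_form phi -> sorted <%R zs ->
  (forall s, (s \in zs) = (coord phi (delta_coord s) == 0)) ->
  exists g : nat -> bool, [/\ g 0%N = c,
    forall i j, (i <= size zs)%N -> (j <= size zs)%N -> arc_domain phi zs i = arc_domain phi zs j -> g i = g j &
    forall i, (i < size zs)%N -> positive_arc phi zs i -> ~~ positive_arc phi zs i.+1 -> g i (+) g i.+1 = hh i].
Proof.
move=> hphi sz hz; set M := size zs; pose t := sample zs.
have tn i : (i <= M)%N -> ~ nodal_line phi (pr (delta_coord (t i))).
  move=> iM /(@nodal_pr R phi _ hphi (delta_coord_gt0 _)) /eqP; rewrite -hz.
  by apply/negP; have [] := sample_idx sz iM.
have /choice[N hN] : forall ij : nat * nat, exists N, (ij.1 <= M)%N -> (ij.2 <= M)%N ->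
    arc_domain phi zs ij.1 = arc_domain phi zs ij.2 ->
    forall n, (N < n)%N -> forall f, mono_const n (grid_col phi n) f ->
    f (vertex n (delta_coord (t ij.1))).1 (vertex n (delta_coord (t ij.1))).2 =
    f (vertex n (delta_coord (t ij.2))).1 (vertex n (delta_coord (t ij.2))).2.
  move=> [i j] /=; have [iM|iM] := leqP i M; last by exists 0%N.
  have [jM|jM] := leqP j M; last by exists 0%N.
  have [E|E] := pselect (arc_domain phi zs i = arc_domain phi zs j); last by exists 0%N.
  have cij : connected_component (~` nodal_line phi) (pr (delta_coord (t i))) (pr (delta_coord (t j))).
    rewrite -/(component phi (delta_coord (t i))) -/(arc_domain phi zs i) E.
    by apply: connected_component_refl; exact: tn.
  have [N hN] := vertex_connected hphi (tn i iM) cij; exists N => _ _ _ n nN f hf.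
  by have := hN n nN f hf; rewrite !fold_delta.
have [d d0 hd] := sample_gap sz.
have [n [n0 nN nd]] := fine_mesh (\max_(i < M.+1) \max_(j < M.+1) N (i : nat, j : nat)) d0.
pose s (l : int) : R := l%:~R / (2 * n)%:R.
have h0 : 0 < (2 * n)%:R :> R by rewrite ltr0n muln_gt0.
have sM l l' : l <= l' -> s l <= s l' by move=> ll; rewrite /s ler_pM2r ?invr_gt0 // ler_int.
(* The jump prescribed at an entry is the one belonging to the arc of its first vertex. *)
have [f [f00 fh fv fent]] := strip_potential (grid_col phi n) (fun l => hh (idx zs (s l))) false n0.
have fm : mono_const n (grid_col phi n) f by [].
have /choice[l hl] : forall i, exists l : int, vertex n (delta_coord (t i)) = bdpt n l /\ `|s l - t i| < d.
  by move=> i; have [l l1 l2] := vertex_delta (t i) n0; exists l; split=> //; exact: le_lt_trans nd.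
pose F (l : int) := f (bdpt n l).1 (bdpt n l).2.
have step i : (i < M)%N -> positive_arc phi zs i -> ~~ positive_arc phi zs i.+1 -> F (l i) (+) F (l i.+1) = hh i.
  move=> iM p1 p2.
  have [g1 g2] := hd i iM.
  have [_ ] := hl i; rewrite ltr_norml => /andP[]; rewrite /t => a1 a2.
  have [_ ] := hl i.+1; rewrite ltr_norml => /andP[]; rewrite /t => b1 b2.
  (* Between the samples of arcs [i] and [i.+1] the colour changes exactly at the zero; a vertex on
     the zero itself counts as negative, like arc [i.+1]. *)
  have colE m : l i <= m <= l i.+1 -> grid_col phi n (bdpt n m).1 (bdpt n m).2 = (s m < nth 0 zs i) /\
      (s m < nth 0 zs i -> idx zs (s m) = i).
    move=> /andP[m1 m2]; have s1 := sM _ _ m1; have s2 := sM _ _ m2.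
    rewrite /grid_col grid_bdpt // -/(s m).
    have [sm|sm|sm] := ltgtP (s m) (nth 0 zs i).
    - have [|_|e ns] := @idx_strict R zs i (s m) sz (ltnW iM) => //.
        by move=> i0; have [|_] := hd i.-1; [exact: leq_ltn_trans (leq_pred i) iM|rewrite prednK // => k; clear -k s1 a1; lra].
      by split=> //; have [_ ->] := arc_val hphi sz hz ns; rewrite e.
    - have [//| |e ns] := @idx_strict R zs i.+1 (s m) sz iM => //.
        by move=> i1; have [|k _] := hd i.+1; [exact: i1|clear -k s2 b2; lra].
      by split=> //; have [_ ->] := arc_val hphi sz hz ns; rewrite e; apply/negbTE.
    - have : s m \in zs by rewrite sm; apply: mem_nth.
      by rewrite hz => /eqP ->; rewrite ltxx; split.
  have li : l i <= l i.+1.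
    rewrite leNgt; apply/negP => ll.
    by have := sM _ _ (ltW ll); lra.
  (* Induction over the boundary vertices from one sample to the next: [F] is constant except for
     the jump [hh i] at the single entry. *)
  have -> : F (l i.+1) = if s (l i.+1) < nth 0 zs i then F (l i) else F (l i) (+) hh i.
    apply: (@int_climb (l i) (l i.+1) (fun m => F m = if s m < nth 0 zs i then F (l i) else F (l i) (+) hh i)) => //.
      by rewrite ifT //; lra.
    move=> m m1 m2 m3 m4 IH.
    have [|c1 c2] := colE m; first by rewrite m1 m2.
    have [|c3 _] := colE (m + 1); first by rewrite m3 m4.
    have [cc|cc] := eqVneq (s m < nth 0 zs i) (s (m + 1) < nth 0 zs i).
      by rewrite -cc -IH; apply/esym/(mono_bdpt n0 fm); rewrite c1 c3.
    have s12 : s m <= s (m + 1) by apply: sM; rewrite lerDl.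
    have k1 : s m < nth 0 zs i.
      by rewrite ltNge; apply/negP => k; move: cc; rewrite !ltNge k (le_trans k s12).
    have k2 : (s (m + 1) < nth 0 zs i) = false by move: cc; rewrite k1; case: (_ < _).
    have := fent m; rewrite /= c1 c3 k1 k2 => /(_ isT isT); rewrite c2 // -/(F m) -/(F (m + 1)).
    by move: IH; rewrite k1 => -> <-; case: (F (l i)); case: (F (m + 1)).
  rewrite ifF; first by case: (F (l i)); case: (hh i).
  by apply/negbTE; rewrite -leNgt; lra.
(* Adding a constant modulo 2 sets the value on arc 0 to [c] and keeps all jumps. *)
exists (fun i => F (l i) (+) F (l 0%N) (+) c); split.
- by case: (F _); case: c.
- move=> i j iM jM E; congr (_ (+) _ (+) _).
  have Nn : (N (i, j) < n)%N.
    apply: leq_ltn_trans nN.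
    have iM1 : (i < M.+1)%N by []; have jM1 : (j < M.+1)%N by [].
    apply: leq_trans (leq_bigmax (Ordinal iM1)) => /=.
    exact: (leq_bigmax (Ordinal jM1)).
  have : f (vertex n (delta_coord (t i))).1 (vertex n (delta_coord (t i))).2 =
    f (vertex n (delta_coord (t j))).1 (vertex n (delta_coord (t j))).2 := hN (i, j) iM jM E n Nn f fm.
  by rewrite (hl i).1 (hl j).1.
- move=> i iM p1 p2; rewrite -(step i iM p1 p2).
  by case: (F (l i)); case: (F _); case: (F _); case: c.
Qed.

Lemma idx_mono (R : realType) (zs : seq R) (s s' : R) : sorted <%R zs -> s <= s' -> (idx zs s <= idx zs s')%N.
Proof.
move=> sz ss; rewrite leqNgt; apply/negP => h; have h1 := idx_lt h.
have := idx_ge sz (leqnn (idx zs s')) (leq_trans h (idx_size zs s)).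
by rewrite leNgt (lt_le_trans h1 ss).
Qed.

Lemma idx_next (R : realType) (zs : seq R) (d s s' : R) : sorted <%R zs -> 0 < d ->
  (forall i, (i < size zs)%N -> sample zs i + d <= nth 0 zs i /\ nth 0 zs i + d <= sample zs i.+1) ->
  s <= s' -> s' <= s + d -> idx zs s' = idx zs s \/ idx zs s' = (idx zs s).+1.
Proof.
move=> sz d0 hd ss sd; have := idx_mono sz ss; rewrite leq_eqVlt => /predU1P[->|h1]; first by left.
right; apply/eqP; rewrite eqn_leq h1 andbT leqNgt; apply/negP => h2.
have k2 := leq_trans h2 (idx_size zs s'); have k1 := ltnW k2.
have := idx_lt h2; have := idx_ge sz (leqnn (idx zs s)) k1.
by have [_ a] := hd _ k1; have [b _] := hd _ k2; lra.
Qed.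

Lemma grid_in (R : realType) (n i j : nat) : (0 < n)%N -> (i <= n)%N ->
  0 <= (grid R n i j).1 <= 2^-1 /\
  2^-1 + j%:R / (2 * n)%:R <= (grid R n i j).2 <= 1 + j%:R / (2 * n)%:R.
Proof.
move=> n0 i_n; have h0 : 0 < (2 * n)%:R :> R by rewrite ltr0n muln_gt0.
have x01 : 0 <= (i%:R / (2 * n)%:R : R) <= 2^-1.
  rewrite divr_ge0 // ler_pdivrMr //= natrM mulrA mulVf ?mul1r ?ler_nat //.
rewrite /grid /chart /=; split=> //; move: x01; move: (i%:R / _) => x /andP[x0 x1].
have x2 : Num.sqrt (1 - x ^+ 2) ^+ 2 = 1 - x ^+ 2 by rewrite sqr_sqrtr //; nra.
by have a0 := sqrtr_ge0 (1 - x ^+ 2); rewrite !lerD2r; apply/andP; split; nra.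
Qed.

Lemma grid_lip (R : realType) (n i i' j j' : nat) : (0 < n)%N -> (i <= i' <= i.+1)%N -> (i' <= n)%N ->
  (j <= j' <= j.+1)%N ->
  `|(grid R n i' j').1 - (grid R n i j).1| <= (2 * n)%:R^-1 /\
  `|(grid R n i' j').2 - (grid R n i j).2| <= 2 * (2 * n)%:R^-1.
Proof.
move=> n0 ii i_n jj; have h0 : 0 <= (2 * n)%:R^-1 :> R by rewrite invr_ge0.
have step (a b : nat) : (a <= b <= a.+1)%N -> 0 <= (b%:R / (2 * n)%:R - a%:R / (2 * n)%:R : R) <= (2 * n)%:R^-1.
  move=> /andP[ab ba]; rewrite -mulrBl mulr_ge0 ?subr_ge0 ?ler_nat //=.
  by rewrite ler_piMl // lerBlDr addrC natr1 ler_nat.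
have i_n0 : (i <= n)%N by case/andP: ii => k1 _; exact: leq_trans i_n.
have [x1 _] := grid_in R j n0 i_n0; have [x2 _] := grid_in R j' n0 i_n.
have /andP[a0 a1] := step _ _ ii; have /andP[b0 b1] := step _ _ jj.
rewrite /grid /chart /= in x1 x2 *;
have := sqrt_circle_lip x2 x1.
move: a0 a1 b0 b1; move: (i%:R / _) (i'%:R / _) (j%:R / _) (j'%:R / _) => x x' b b' a0 a1 b0 b1.
rewrite [X in _ <= X]ger0_norm // ler_norml => /andP[c1 c2].
rewrite ger0_norm //; split=> //; rewrite ler_norml.
by apply/andP; split; lra.
Qed.

Definition bdpt_pos (u : nat * nat) : int := if u.1 == 0%N then - u.2%:Z else (u.1 + u.2)%N%:Z.

Lemma bdptK (n : nat) (l : int) : (0 < n)%N -> bdpt_pos (bdpt n l) = l.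
Proof.
move=> n0; rewrite /bdpt_pos; case: (bdpt_step l n0) => -[j] => [[-> -> _]|[_ -> -> _]|[-> -> _]] //=.
  by case: eqP => [->|]; rewrite ?addn0.
by case: eqP n0 => [->|].
Qed.

(** A vertex on the nodal line is moved to a nearby point of the sign [c], available in the
    nonsingular case; every other vertex stays where it is. *)
Lemma star_point (R : realType) (phi : upper R -> R) (z : R * R) (e : R) (c : bool) :
  even_hecke_maass_cusp_form phi -> nonsingular_nodal_line phi -> 0 < z.2 -> 0 < e ->
  exists w : R * R, [/\ 0 < w.2, `|w.1 - z.1| < e, `|w.2 - z.2| < e, coord phi w != 0 &
    (0 < coord phi w) = (if coord phi z == 0 then c else 0 < coord phi z) /\
    (coord phi z != 0 -> w = z)].
Proof.
move=> hphi ns z0 e0; have [z1|z1] := eqVneq (coord phi z) 0.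
  by have [w [h1 h2 h3 h4 h5]] := nonsingular_signs c hphi ns z0 e0 z1; exists w.
by exists z; rewrite !subrr normr0.
Qed.

Lemma same_sign (R : realType) (a b : R) : a != 0 -> b != 0 -> (0 < a) = (0 < b) -> 0 < a * b.
Proof.
case: (ltgtP 0 a) => // a0 _; case: (ltgtP 0 b) => // b0 _ _; first exact: mulr_gt0.
by rewrite nmulr_rgt0.
Qed.

Lemma bounded_seq (R : realType) (F : nat -> R) (B : R) (n : nat) :
  exists2 S : R, B <= S & forall i, (i < n)%N -> F i <= S.
Proof.
elim: n => [|n [S BS hS]]; first by exists B.
exists (Num.max S (F n)); first by rewrite le_max BS.
by move=> i; rewrite ltnS leq_eqVlt => /predU1P[->|/hS h]; rewrite le_max ?lexx ?orbT ?h.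
Qed.

Lemma delta_coord_near (R : realType) (s r : R) : 0 < r -> exists2 m : R, 0 < m & forall s',
  `|s' - s| < m -> `|(delta_coord s').1 - (delta_coord s).1| < r /\ `|(delta_coord s').2 - (delta_coord s).2| < r.
Proof.
move=> r0; have c := @delta_coord_continuous R s.
have : \forall w \near delta_coord s, `|w.1 - (delta_coord s).1| < r /\ `|w.2 - (delta_coord s).2| < r.
  by apply/near_pairP; exists r.
move=> /c [m /= m0 hm]; exists m => // s' hs; apply: hm.
by rewrite /= distrC.
Qed.

Lemma bdpt_height (n L : nat) (l : int) : (0 < n)%N -> - L%:Z <= l <= (n + L)%:Z -> ((bdpt n l).2 <= L)%N.
Proof. by move=> n0; case: (bdpt_step l n0) => -[j] [] => [-> -> _|_ _ -> _|-> -> _] /=; lia. Qed.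

(* [G] is carried to the grid by points off the nodal line near the vertices. The top
   row, where phi decreases in x, is coloured + at its left end only: it creates no entry. *)
Lemma rigid_coloring (R : realType) (phi : upper R -> R) (zs : seq R) (G : set (X R) -> bool) :
  even_hecke_maass_cusp_form phi -> nonsingular_nodal_line phi -> sorted <%R zs ->
  (forall s, (s \in zs) = (coord phi (delta_coord s) == 0)) ->
  G (arc_domain phi zs 0) = false ->
  (forall i, (i < size zs)%N -> positive_arc phi zs i -> ~~ positive_arc phi zs i.+1 ->
    G (arc_domain phi zs i) = G (arc_domain phi zs i.+1)) ->
  forall i, (i <= size zs)%N -> G (arc_domain phi zs i) = false.
Proof.
move=> hphi ns sz hz G0 Gent.
have [Y Y1 hY] := cusp_behaviour hphi; have [d d0 hd] := sample_gap sz.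
(* [S] lies above [Y] and beyond all samples, with room for the mesh; the grid will be cut off at
   the first row above [S]. *)
have [S YS tS] := bounded_seq (fun i => `|sample zs i| + 1) (Y + 2) (size zs).+1.
have [r r0 hr] : exists2 r : R, 0 < r & forall z a b : R * R, 0 <= z.1 <= 2^-1 -> 2^-1 <= z.2 <= S + 3 ->
    `|a.1 - z.1| < r -> `|a.2 - z.2| < r -> `|b.1 - z.1| < r -> `|b.2 - z.2| < r ->
    0 < coord phi a * coord phi b -> component phi a = component phi b.
  have cK : compact ((`[0, 2^-1] : set R) `*` (`[2^-1, S + 3] : set R)).
    by apply: compact_setX; exact: segment_compact.
  have [|r r0 hr] := uniform_component hphi ns cK.
    by move=> z [_]; rewrite /= in_itv /= => /andP[h _]; lra.
  by exists r => // z a b z1 z2; apply: hr; split; rewrite /= in_itv.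
have m0 : 0 < Num.min (Num.min d 1) (r / 4) by rewrite !lt_min d0 ltr01 divr_gt0.
have [n [n0 _ ]] := fine_mesh 0 m0; rewrite !lt_min => /andP[/andP[hd1 h1] hr1].
set h : R := (2 * n)%:R^-1 in hd1 h1 hr1.
have n20 : 0 < (2 * n)%:R :> R by rewrite ltr0n muln_gt0.
have h0 : 0 < h by rewrite invr_gt0.
(* [r / 4], with a mesh below [r / 4], keeps two adjacent perturbed vertices within [r] of one grid
   point. [h] keeps those of row [L.-1] in the strip and above [Y]. *)
pose e : R := Num.min (r / 4) h.
have e0 : 0 < e by rewrite /e lt_min h0 divr_gt0.
have [er eh] : e <= r / 4 /\ e <= h by rewrite /e !ge_min !lexx orbT.
pose s (l : int) : R := l%:~R / (2 * n)%:R.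
(* At a zero on delta the sign of the preceding arc is chosen, since [idx] counts a zero to the arc
   that it ends. For a zero inside the strip any choice will do. *)
pose col0 i j := if coord phi (grid R n i j) == 0 then positive_arc phi zs (idx zs (s (bdpt_pos (i, j))))
                 else 0 < coord phi (grid R n i j).
have [v hv] : exists v : nat -> nat -> R * R, forall i j, (i <= n)%N ->
    [/\ 0 < (v i j).2, `|(v i j).1 - (grid R n i j).1| < e, `|(v i j).2 - (grid R n i j).2| < e,
      coord phi (v i j) != 0 & (0 < coord phi (v i j)) = col0 i j /\
      (coord phi (grid R n i j) != 0 -> v i j = grid R n i j)].
  have /choice[v hv] : forall ij : nat * nat, exists w : R * R, (ij.1 <= n)%N ->
      [/\ 0 < w.2, `|w.1 - (grid R n ij.1 ij.2).1| < e, `|w.2 - (grid R n ij.1 ij.2).2| < e, coord phi w != 0 &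
      (0 < coord phi w) = col0 ij.1 ij.2 /\ (coord phi (grid R n ij.1 ij.2) != 0 -> w = grid R n ij.1 ij.2)].
    move=> [i j]; case: (boolP (i <= n)%N) => i_n; last by exists 0 => k; case/negP: i_n.
    have [_ /andP[g2 _]] := grid_in R j n0 i_n.
    have g0 : 0 < (grid R n i j).2 by apply: lt_le_trans g2; rewrite ltr_wpDr ?divr_ge0 // invr_gt0.
    by have [w hw] := star_point (positive_arc phi zs (idx zs (s (bdpt_pos (i, j))))) hphi ns g0 e0; exists w.
  by exists (fun i j => v (i, j)) => i j i_n; exact: (hv (i, j) i_n).
have S0 : 0 <= S * (2 * n)%:R by rewrite mulr_ge0 //; clear -YS Y1; lra.
have [L L0 [L1 L2 L1h]] : exists2 L : nat, (0 < L)%N & [/\ S < L%:R * h, L.-1%:R * h <= S & L%:R * h = L.-1%:R * h + h].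
  have /andP[k1 k2] := truncn_itv S0; exists (Num.trunc (S * (2 * n)%:R)).+1 => //.
  by split; rewrite /h ?ler_pdivrMr ?ltr_pdivlMr //= -natr1 mulrDl mul1r.
have gin i j : (i <= n)%N -> (j <= L)%N -> 0 <= (grid R n i j).1 <= 2^-1 /\ 2^-1 <= (grid R n i j).2 <= S + 3.
  move=> i_n jL; have [g1 /andP[g2 g3]] := grid_in R j n0 i_n; split=> //.
  have : j%:R * h <= L%:R * h by rewrite ler_pM2r // ler_nat.
  have : 0 <= j%:R * h by rewrite mulr_ge0 // ltW.
  by rewrite -/h in g2 g3 * => k1 k2; clear -g2 g3 k1 k2 L2 L1h h1; apply/andP; split; lra.
have nb i j i' j' : (i <= i' <= i.+1)%N -> (i' <= n)%N -> (j <= j' <= j.+1)%N -> (j' <= L)%N ->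
    col0 i j = col0 i' j' -> component phi (v i j) = component phi (v i' j').
  move=> ii i_n jj jL E.
  have i_n0 : (i <= n)%N by case/andP: ii => k1 _; exact: leq_trans i_n.
  have jL0 : (j <= L)%N by case/andP: jj => k1 _; exact: leq_trans jL.
  have [g1 g2] := gin i j i_n0 jL0; have [a1 a2] := grid_lip R n0 ii i_n jj.
  have [_ b1 b2 b3 [b4 _]] := hv i j i_n0; have [_ c1 c2 c3 [c4 _]] := hv i' j' i_n.
  apply: (hr (grid R n i j)) => //.
  - by apply: lt_le_trans b1 _; clear -er r0; lra.
  - by apply: lt_le_trans b2 _; clear -er r0; lra.
  - by apply: le_lt_trans (ler_distD (grid R n i' j').1 _ _) _; rewrite -/h in a1; clear -c1 a1 er hr1 r0; lra.
  - by apply: le_lt_trans (ler_distD (grid R n i' j').2 _ _) _; rewrite -/h in a2; clear -c2 a2 er hr1 r0; lra.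
  - by apply: same_sign => //; rewrite b4 c4.
(* Row [L.-1] already lies above [Y], so only two components occur on it; this allows the artificial
   top row to be attached. *)
have top i : (i <= n)%N -> component phi (v i L.-1) =
    if col0 i L.-1 then component phi (0, Y) else component phi (2^-1, Y).
  move=> i_n; have [/andP[g1 g1'] /andP[g2 g2']] := grid_in R L.-1 n0 i_n.
  have [w0 w1 w2 w3 [w4 w5]] := hv i L.-1 i_n.
  rewrite -/h in g2 g2'.
  have [x01 wY] : 0 <= (v i L.-1).1 <= 2^-1 /\ Y <= (v i L.-1).2.
    have yY : Y <= (grid R n i L.-1).2 by clear -g2 L1 L1h h1 YS; lra.
    have [z|z] := eqVneq (coord phi (grid R n i L.-1)) 0; last by rewrite w5 // g1 g1'.
    split; last by move: w2; rewrite ltr_norml => /andP[k _]; clear -k eh g2 L1 L1h h1 YS; lra.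
    have xE : (grid R n i L.-1).1 = i%:R * h by [].
    have [p q _] := hY _ yY.
    (* Above [Y] phi is nonzero on both sides, so a vertex that is moved lies in an inner column,
       and a move by less than [h] stays in the strip. *)
    have i1 : (0 < i)%N.
      rewrite lt0n; apply/eqP => i0; move: p.
      by rewrite (_ : (0, _) = grid R n i L.-1) ?z ?ltxx // [RHS]surjective_pairing xE i0 mul0r.
    have nE : n%:R * h = 2^-1 by rewrite /h natrM invfM mulrCA mulfV ?mulr1 // pnatr_eq0 -lt0n.
    have i2 : (i.+1 <= n)%N.
      rewrite ltn_neqAle i_n andbT; apply/eqP => i0; move: q.
      by rewrite (_ : (2^-1, _) = grid R n i L.-1) ?z ?ltxx // [RHS]surjective_pairing xE i0 nE.
    have k1 : h <= i%:R * h by rewrite ler_peMl ?(ltW h0) // ler1n.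
    have k2 : i%:R * h + h <= 2^-1 by rewrite -nE -[X in _ + X]mul1r -mulrDl natr1 ler_pM2r // ler_nat.
    by move: w1; rewrite xE ltr_norml => /andP[k3 k4]; clear -k1 k2 k3 k4 eh; lra.
  have [t1 t2] := top_component hphi Y1 hY x01 wY.
  move: t1 t2; rewrite -surjective_pairing -w4 => t1 t2; case: ifPn => c; first exact: t1.
  by apply: t2; rewrite lt_neqAle w3 leNgt.
pose col i j := if j == L then (i < 1)%N else col0 i j.
pose f i j := if j == L then (if (i < 1)%N then G (component phi (0, Y)) else G (component phi (2^-1, Y)))
              else G (component phi (v i j)).
have sN l : s l = l%:~R * h by [].
have arcE l u : grid R n u.1 u.2 = delta_coord (s l) -> coord phi (grid R n u.1 u.2) != 0 ->
    component phi (grid R n u.1 u.2) = arc_domain phi zs (idx zs (s l)) /\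
    (0 < coord phi (grid R n u.1 u.2)) = positive_arc phi zs (idx zs (s l)).
  by move=> -> nz; apply: arc_val => //; rewrite hz.
have bd l : - L%:Z <= l <= (n + L)%:Z -> let u := bdpt n l in
    f u.1 u.2 = G (arc_domain phi zs (idx zs (s l))) /\ col u.1 u.2 = positive_arc phi zs (idx zs (s l)).
  move=> lL u; have un : (u.1 <= n)%N := bdpt_strip n l.
  have gE : grid R n u.1 u.2 = delta_coord (s l) by exact: grid_bdpt.
  have uK : bdpt_pos (u.1, u.2) = l by rewrite -surjective_pairing; exact: bdptK.
  have uside : [\/ u.1 = 0%N, u.1 = n | u.2 = 0%N].
    rewrite /u; case: (bdpt_step l n0) => -[j] => [[_ -> _]|[_ _ -> _]|[_ -> _]] /=.
    - exact: Or31.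
    - exact: Or33.
    - exact: Or32.
  have u2 : (u.2 <= L)%N by apply: bdpt_height.
  have {arcE} := arcE l u gE; rewrite /f /col.
  move: gE uK uside un u2; clearbody u; case: u => i j /= gE uK uside un jL' arcE.
  case: eqP => [jL|jL]; last first.
    have [w0 w1 w2 w3 [w4 w5]] := hv i j un; rewrite /= in w1 w2 w4 w5.
    rewrite /col0 in w4 *; rewrite uK in w4 *.
    have [z|z] := eqVneq (coord phi (grid R n i j)) 0; last first.
      by rewrite w5 //; have [-> ->] := arcE z.
    rewrite z eqxx in w4; split=> //; congr G.
    have sz' : s l \in zs by rewrite hz -gE z.
    have ik : (idx zs (s l) < size zs)%N by rewrite -has_find; apply/hasP; exists (s l) => //=.
    have zk : nth 0 zs (idx zs (s l)) = s l.
      apply/eqP; rewrite eq_le idx_ge // andbT.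
      have /(nthP 0)[k kz kE] := sz'; rewrite -kE; apply: sorted_nth_le => //.
      by rewrite leqNgt; apply/negP => /idx_lt; rewrite kE ltxx.
    have [_ kd] := hd _ ik; have [kd' _] := hd _ ik; rewrite zk in kd kd'.
    have [m m0' hm] := delta_coord_near (s l) r0.
    (* A point of the arc just before the zero, near enough to lie in the same ball as the moved
       vertex; both have the sign of that arc. *)
    have [s' [s1 s2 s3]] : exists s' : R, [/\ sample zs (idx zs (s l)) < s', s' < s l & s l - s' < m].
      exists (s l - Num.min (d / 2) (m / 2)).
      have : Num.min (d / 2) (m / 2) <= d / 2 by rewrite ge_min lexx.
      have : Num.min (d / 2) (m / 2) <= m / 2 by rewrite ge_min lexx orbT.
      have : 0 < Num.min (d / 2) (m / 2) by rewrite lt_min !divr_gt0.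
      by clear -kd'; move: (Num.min _ _) (s l) kd' => c sl kd' c0 c1 c2; split; lra.
    have [||e' ns'] := @idx_strict R zs (idx zs (s l)) s' sz (ltnW ik).
    - move=> i0; apply: le_lt_trans s1; have pk : ((idx zs (s l)).-1 < size zs)%N := leq_ltn_trans (leq_pred _) ik.
      by have [_] := hd _ pk; rewrite prednK //; clear -d0; lra.
    - by rewrite zk.
    have [a1 a2] := arc_val hphi sz hz ns'; rewrite e' in a1 a2; rewrite -a1.
    have [|h2 h3] := hm s'; first by rewrite distrC ger0_norm // subr_ge0 ltW.
    
    have [g1 g2] := gin i j un jL'.
    have s'0 : coord phi (delta_coord s') != 0 by rewrite -hz.
    apply: (hr (grid R n i j)) => //.
    - by apply: lt_le_trans w1 _; clear -er r0; lra.
    - by apply: lt_le_trans w2 _; clear -er r0; lra.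
    - by rewrite gE.
    - by rewrite gE.
    by apply: same_sign => //; rewrite w4 a2.
  have iE : i = 0%N \/ i = n by case: uside => [->|->|j0]; [left|right|move: L0; rewrite -jL j0].
  have [g1 /andP[g2 _]] := grid_in R j n0 un; rewrite -/h in g2.
  have Yy : Y <= (grid R n i j).2 by rewrite jL in g2 *; clear -g2 L1 YS; lra.
  have [t1 t2] := top_component hphi Y1 hY g1 Yy; have [p q _] := hY _ Yy.
  rewrite -surjective_pairing in t1 t2.
  have xE : (grid R n i j).1 = i%:R * h by [].
  case: iE => iE.
    have gE0 : (0, (grid R n i j).2) = grid R n i j by rewrite [RHS]surjective_pairing xE iE mul0r.
    rewrite gE0 in p; have [|<- <-] := arcE; first by rewrite gt_eqF.
    have i1 : (i < 1)%N = true by rewrite iE.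
    by rewrite i1 p t1.
  have nE : n%:R * h = 2^-1 by rewrite /h natrM invfM mulrCA mulfV ?mulr1 // pnatr_eq0 -lt0n.
  have gE1 : (2^-1, (grid R n i j).2) = grid R n i j by rewrite [RHS]surjective_pairing xE iE nE.
  rewrite gE1 in q; have [|<- <-] := arcE; first by rewrite lt_eqF.
  have i1 : (i < 1)%N = false by rewrite iE ltnNge n0.
  by rewrite i1 t2 // ltNge (ltW q).
have near i : (i <= size zs)%N -> exists2 l : int, - L%:Z <= l <= (n + L)%:Z &
    f (bdpt n l).1 (bdpt n l).2 = G (arc_domain phi zs i).
  move=> iM; have [l _ lt] := vertex_delta (sample zs i) n0.
  have [il _] : idx zs (s l) = i /\ s l \notin zs by apply: (idx_sample sz d0 hd iM); exact: le_lt_trans hd1.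
  have lL : - L%:Z <= l <= (n + L)%:Z.
    have k := tS i iM; rewrite -/(s l) -/h ler_norml in lt; case/andP: lt => l1 l2.
    have [k1 k2] : sample zs i <= `|sample zs i| /\ - sample zs i <= `|sample zs i|.
      by rewrite ler_norm -normrN ler_norm.
    have m1 : l%:~R * h < L%:~R * h :> R by rewrite -(sN l) -pmulrn; clear -l2 k k1 L1 h1; lra.
    have m2 : (- L%:Z)%:~R * h < l%:~R * h :> R by rewrite -(sN l) mulrNz mulNr -pmulrn; clear -l1 k k2 L1 h1; lra.
    rewrite !ltr_pM2r // !ltr_int in m1 m2.
    by clear -m1 m2; lia.
  by exists l => //; have [-> _] := bd l lL; rewrite il.
have rig : forall l, - L%:Z <= l <= (n + L)%:Z -> f (bdpt n l).1 (bdpt n l).2 = f 0%N 0%N.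
  move=> l lL; suff : f (bdpt n l).1 (bdpt n l).2 (+) f 0%N 0%N = false by case: (f _ _); case: (f _ _).
  apply: (@rect_rigid n L col (fun i j => f i j (+) f 0%N 0%N) 1 n0 L0) lL.
  - by move=> i _; rewrite /col eqxx.
  - move=> i j i_n jL; rewrite /col /f; case: eqP => [_|jL'] E; first by rewrite E.
    by rewrite (nb i j i.+1 j) ?leqnn ?leqnSn.
  - move=> i j i_n jL; rewrite /col /f (ltn_eqF jL); case: eqP => [jE|_] E; last first.
      by rewrite (nb i j i j.+1) ?leqnn ?leqnSn.
    by have := top i i_n; rewrite -jE /= E => ->; case: ifP.
  - move=> i j i_n jL; rewrite /col /f (ltn_eqF jL); case: eqP => [jE|_] E; last first.
      by rewrite (nb i j i.+1 j.+1) ?leqnn ?leqnSn.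
    by have := top i (ltnW i_n); rewrite -jE /= E => ->.
  - by rewrite addbb.
  - move=> m /andP[m1 m2] u w cu cw; congr (_ (+) _).
    have mI : - L%:Z <= m <= (n + L)%:Z by rewrite m1 ltW.
    have mI' : - L%:Z <= m + 1 <= (n + L)%:Z by rewrite (le_trans m1) ?lerDl // lezD1.
    have [fu gu] := bd m mI; have [fw gw] := bd (m + 1) mI'.
    rewrite /u /w fu fw; rewrite /u gu in cu; rewrite /w gw in cw.
    have [||E|E] := @idx_next R zs d (s m) (s (m + 1)) sz d0 hd.
    - by rewrite !sN ler_pM2r // ler_int lerDl.
    - by rewrite !sN intrD mulrDl mul1r lerD2l ltW.
    - by rewrite E.
    rewrite E in cw *; apply: Gent => //.
    by have := idx_size zs (s (m + 1)); rewrite E.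
move=> i iM; have [l lL <-] := near i iM; have [l0 lL0 E0] := near 0%N (leq0n _).
by rewrite rig // -(rig l0 lL0) E0.
Qed.

(** * Counting *)

Lemma card_bool_colorings (T : finType) (m : nat) :
  (#|{ffun T -> bool}| = 2 ^ #|T|)%N /\ (#|{: bool * {ffun 'I_m -> bool}}| = 2 ^ m.+1)%N.
Proof. by rewrite card_prod !card_ffun card_bool card_ord expnS. Qed.

(* Both inequalities compare the number of two-valued functions on the classes with
   that of pairs (value at 0, jumps along [ent]). *)
Lemma separated_classes (T : choiceType) (A : nat -> T) (M : nat) (ent : seq nat) :
  uniq ent -> (forall i, i \in ent -> (i < M)%N) ->
  (forall (c : bool) (hh : nat -> bool), exists g : nat -> bool, [/\ g 0%N = c,
     forall i j, (i <= M)%N -> (j <= M)%N -> A i = A j -> g i = g j &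
     forall i, i \in ent -> g i (+) g i.+1 = hh i]) ->
  ((size ent).+1 <= size (undup [seq A i | i <- iota 0 M.+1]))%N.
Proof.
move=> ue eM hg; set D := undup _.
have inD i : (i <= M)%N -> A i \in D by move=> iM; rewrite mem_undup map_f // mem_iota add0n ltnS.
pose k i (iM : (i <= M)%N) : seq_sub D := SeqSub (inD i iM).
have k0 : (0 <= M)%N by [].
have ent1 (j : 'I_(size ent)) : (nth 0%N ent j <= M)%N by apply/ltnW/eM/mem_nth.
have ent2 (j : 'I_(size ent)) : ((nth 0%N ent j).+1 <= M)%N by apply/eM/mem_nth.
pose F (G : {ffun seq_sub D -> bool}) := (G (k _ k0), [ffun j : 'I_(size ent) => G (k _ (ent1 j)) (+) G (k _ (ent2 j))]).
have [c1 c2] := card_bool_colorings (seq_sub D) (size ent).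
rewrite -(card_seq_sub (undup_uniq _)) -(@leq_exp2l 2) // -c1 -c2.
(* [hg] provides a preimage under [F] for every pair of data, so there are at least as many
   functions on the classes as data. *)
apply: leq_trans (leq_image_card F _); apply/subset_leq_card/fintype.subsetP => -[c hv] _.
pose hh i := oapp hv false (insub (index i ent)).
have [g [g1 g2 g3]] := hg c hh.
pose G := [ffun u : seq_sub D => g (index (val u) [seq A i | i <- iota 0 M.+1])].
have GE i (iM : (i <= M)%N) : G (k i iM) = g i.
  rewrite ffunE /=.
  have Ai : A i \in [seq A i | i <- iota 0 M.+1] by rewrite -mem_undup inD.
  have ix : (index (A i) [seq A i | i <- iota 0 M.+1] < M.+1)%N by rewrite -[M.+1 in X in (_ < X)%N](size_iota 0) -(size_map A) index_mem.
  apply: g2 => //; rewrite -[RHS](nth_index (A 0%N) Ai) (nth_map 0%N) ?size_iota // nth_iota //.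
apply/fintype.imageP; exists G => //; rewrite /F GE g1; congr pair; apply/ffunP => j.
rewrite ffunE !GE g3 ?mem_nth // /hh index_uniq //.
by rewrite (insubT (fun m => m < size ent)%N (ltn_ord j)) /=; congr (hv _); apply: val_inj.
Qed.

(** Two functions with the same data differ by one that is 0 at [A 0] and has no jump along [ent],
    hence vanishes: the map to the data is injective. *)
Lemma rigid_classes (T : choiceType) (A : nat -> T) (M : nat) (ent : seq nat) :
  (forall i, i \in ent -> (i < M)%N) ->
  (forall G : T -> bool, G (A 0%N) = false -> (forall i, i \in ent -> G (A i) = G (A i.+1)) ->
     forall i, (i <= M)%N -> G (A i) = false) ->
  (size (undup [seq A i | i <- iota 0 M.+1]) <= (size ent).+1)%N.
Proof.
move=> eM hG; set D := undup _.
have inD i : (i <= M)%N -> A i \in D by move=> iM; rewrite mem_undup map_f // mem_iota add0n ltnS.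
pose k i (iM : (i <= M)%N) : seq_sub D := SeqSub (inD i iM).
have k0 : (0 <= M)%N by [].
have ent1 (j : 'I_(size ent)) : (nth 0%N ent j <= M)%N by apply/ltnW/eM/mem_nth.
have ent2 (j : 'I_(size ent)) : ((nth 0%N ent j).+1 <= M)%N by apply/eM/mem_nth.
pose F (G : {ffun seq_sub D -> bool}) := (G (k _ k0), [ffun j : 'I_(size ent) => G (k _ (ent1 j)) (+) G (k _ (ent2 j))]).
have [c1 c2] := card_bool_colorings (seq_sub D) (size ent).
rewrite -(card_seq_sub (undup_uniq _)) -(@leq_exp2l 2) // -c1 -c2.
apply: (@leq_card _ _ F) => G1 G2 [E0 E1].
pose G t := oapp (fun u : seq_sub D => G1 u (+) G2 u) false (insub t).
have GE i (iM : (i <= M)%N) : G (A i) = G1 (k i iM) (+) G2 (k i iM).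
  by rewrite /G (insubT (fun t => t \in D) (inD i iM)) /=.
apply/ffunP => -[t tD].
have tA : t \in [seq A i | i <- iota 0 M.+1] by rewrite -mem_undup.
have /seq.mapP[i iI tE] := tA; rewrite mem_iota add0n ltnS in iI; subst t.
have -> : SeqSub tD = k i iI by exact: val_inj.
suff : G (A i) = false by rewrite GE; case: (G1 _); case: (G2 _).
apply: hG => //; first by rewrite GE E0 addbb.
move=> j je; have jn : (index j ent < size ent)%N by rewrite index_mem.
have := congr1 (fun f : {ffun 'I_(size ent) -> bool} => f (Ordinal jn)) E1; rewrite !ffunE.
move: (ent1 _) (ent2 _); rewrite /= nth_index // => a b.
by rewrite !GE; do 4 case: (_ (k _ _)).
Qed.

Lemma fset_set_seq (T : choiceType) (A : set T) (s : seq T) : uniq s -> (forall x, A x <-> x \in s) ->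
  finite_set A /\ #|` fset_set A| = size s.
Proof.
move=> us h; have E : A = [set` [fset x in s]%fset].
  by apply/seteqP; split=> x /=; rewrite inE => /h.
rewrite E; split; first exact: finite_fset.
rewrite set_fsetK card_fseq undup_id //.
Qed.

(** Falls and rises alternate, beginning and ending with a fall. The successor on the left will
    account for the change at the cusp. *)
Lemma count_changes (p : nat -> bool) (M : nat) : p 0%N -> ~~ p M ->
  (count (fun i => p i != p i.+1) (iota 0 M)).+1 = ((count (fun i => p i && ~~ p i.+1) (iota 0 M)).*2)%N.
Proof.
move=> p0 pM; suff : (count (fun i => p i != p i.+1) (iota 0 M) + ~~ p M =
    (count (fun i => p i && ~~ p i.+1) (iota 0 M)).*2)%N by rewrite pM addn1.
elim: M {pM} => [|M IH]; first by rewrite p0.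
rewrite -addn1 iotaD !count_cat doubleD /= add0n -IH addn1.
by case: (p M); case: (p M.+1); rewrite /= ?addn0 ?addn1 ?addn2.
Qed.

(** * The sets of the theorem in terms of arcs and zeros on the line *)

Lemma phi_delta_path (R : realType) (phi : upper R -> R) (s : R) :
  phi (delta_path s) = coord phi (delta_coord s).
Proof. by rewrite -coord_val. Qed.

Lemma proj_delta_path (R : realType) (s : R) : proj (delta_path s) = pr (delta_coord s).
Proof. by rewrite -pr_val. Qed.

Lemma pr_delta_inj (R : realType) : injective (fun s : R => pr (delta_coord s)).
Proof.
move=> s t /(congr1 (@fold R)); rewrite !fold_delta; exact: delta_coord_inj.
Qed.

Lemma inert_nodal_domainsE (R : realType) (phi : upper R -> R) (zs : seq R) :
  even_hecke_maass_cusp_form phi -> sorted <%R zs ->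
  (forall s, (s \in zs) = (coord phi (delta_coord s) == 0)) ->
  forall Omega, inert_nodal_domains phi Omega <->
    Omega \in undup [seq arc_domain phi zs i | i <- iota 0 (size zs).+1].
Proof.
move=> hphi sz hz Omega; rewrite mem_undup; split.
  move=> /(inert_delta hphi)[s ns ->]; apply/seq.mapP.
  have sn : s \notin zs.
    by rewrite hz; apply/eqP => h; apply: ns; apply/(@nodal_pr R phi _ hphi (delta_coord_gt0 _)).
  exists (idx zs s); first by rewrite mem_iota add0n ltnS idx_size.
  by have [<- _] := arc_val hphi sz hz sn.
move=> /seq.mapP[i iM ->]; rewrite mem_iota add0n ltnS in iM; apply: delta_inert => //.
  by apply/deltaP; exists (sample zs i).
move=> /(@nodal_pr R phi _ hphi (delta_coord_gt0 _)) /eqP; rewrite -hz; apply/negP.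
by have [] := sample_idx sz iM.
Qed.

Lemma delta_zerosE (R : realType) (phi : upper R -> R) (zs : seq R) :
  even_hecke_maass_cusp_form phi ->
  (forall s, (s \in zs) = (coord phi (delta_coord s) == 0)) ->
  forall p, delta_zeros phi p <-> p \in None :: [seq Some (pr (delta_coord s)) | s <- zs].
Proof.
move=> hphi hz p; rewrite inE; split.
  move=> [->|[q [/deltaP[s ->] hq] <-]]; first by rewrite eqxx.
  apply/orP; right; apply/seq.mapP; exists s => //; rewrite hz.
  by apply/eqP/(@nodal_pr R phi _ hphi (delta_coord_gt0 _)).
move=> /orP[/eqP ->|/seq.mapP [s sz ->]]; first by left.
right; exists (pr (delta_coord s)) => //; split; first by apply/deltaP; exists s.
by apply/(@nodal_pr R phi _ hphi (delta_coord_gt0 _))/eqP; rewrite -hz.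
Qed.

Lemma zero_sides (R : realType) (phi : upper R -> R) (zs : seq R) (i : nat) :
  even_hecke_maass_cusp_form phi -> sorted <%R zs ->
  (forall s, (s \in zs) = (coord phi (delta_coord s) == 0)) -> (i < size zs)%N ->
  let f := phi \o @delta_path R in let z := nth 0 zs i in
  (\forall s \near z^'-, f s != 0 /\ (0 < f s) = positive_arc phi zs i) /\
  (\forall s \near z^'+, f s != 0 /\ (0 < f s) = positive_arc phi zs i.+1).
Proof.
move=> hphi sz hz iM f z; have [d d0 hd] := sample_gap sz; have [g1 g2] := hd i iM.
split.
  near=> s; have [||e ns] := @idx_strict R zs i s sz (ltnW iM).
  - move=> i0; have [|_] := hd i.-1; first exact: leq_ltn_trans (leq_pred i) iM.
    rewrite prednK // => k; apply: lt_trans (_ : sample zs i < _); first by lra.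
    by near: s; apply: nbhs_left_gt; rewrite /z; lra.
  - by move=> _; near: s; exact: nbhs_left_lt.
  rewrite /f /= phi_delta_path -hz ns; split=> //.
  by have [_ ->] := arc_val hphi sz hz ns; rewrite e.
near=> s; have [||e ns] := @idx_strict R zs i.+1 s sz iM.
- by move=> _; near: s; exact: nbhs_right_gt.
- move=> i1; have [k _] := hd i.+1 i1.
  apply: lt_trans (_ : sample zs i.+1 < _); last by lra.
  by near: s; apply: nbhs_right_lt; rewrite /z; lra.
rewrite /f /= phi_delta_path -hz ns; split=> //.
by have [_ ->] := arc_val hphi sz hz ns; rewrite e.
Unshelve. all: by end_near.
Qed.

Lemma opposite_signsP (R : realType) (f : R -> R) (F G : set_system R) (a b : bool) :
  ProperFilter F -> ProperFilter G ->
  (\forall s \near F, f s != 0 /\ (0 < f s) = a) -> (\forall s \near G, f s != 0 /\ (0 < f s) = b) ->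
  opposite_signs f F G <-> a != b.
Proof.
move=> FF GG hF hG.
have ex (H : set_system R) (P : R -> Prop) : ProperFilter H -> (\forall s \near H, P s) -> exists s, P s.
  by move=> HH h; have [s] := filter_ex h; exists s.
have pos H c : ProperFilter H -> (\forall s \near H, f s != 0 /\ (0 < f s) = c) -> (\forall s \near H, 0 < f s) <-> c.
  move=> HH h; split=> [k|cT].
    have [s [k1 [_ <-]]] : exists s, 0 < f s /\ (f s != 0 /\ (0 < f s) = c) by apply: (ex H) => //; exact: filterI.
    exact: k1.
  by apply: filterS h => s [_ ->].
have neg H c : ProperFilter H -> (\forall s \near H, f s != 0 /\ (0 < f s) = c) -> (\forall s \near H, f s < 0) <-> ~~ c.
  move=> HH h; split=> [k|cT].
    have [s [k1 [_ <-]]] : exists s, f s < 0 /\ (f s != 0 /\ (0 < f s) = c) by apply: (ex H) => //; exact: filterI.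
    by rewrite -leNgt ltW.
  by apply: filterS h => s [s0 sc]; rewrite lt_neqAle s0 leNgt sc.
have [p1 p2] := (pos F a FF hF, pos G b GG hG); have [n1 n2] := (neg F a FF hF, neg G b GG hG).
split.
  by move=> [[/n1 h1 /p2 h2]|[/p1 h1 /n2 h2]]; [rewrite (negbTE h1) h2|rewrite h1 (negbTE h2)].
case: a b p1 p2 n1 n2 {hF hG} => [] [] //= p1 p2 n1 n2 _.
  by right; split; [apply/p1|apply/n2].
by left; split; [apply/n1|apply/p2].
Qed.

(** The cusp always belongs to the list: phi is positive towards the end [-oo] of delta and negative
    towards [+oo]. At any other zero the signs of the two adjoining arcs decide. *)
Lemma sign_changesE (R : realType) (phi : upper R -> R) (zs : seq R) :
  even_hecke_maass_cusp_form phi -> sorted <%R zs ->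
  (forall s, (s \in zs) = (coord phi (delta_coord s) == 0)) ->
  [/\ positive_arc phi zs 0, ~~ positive_arc phi zs (size zs) &
    forall p, sign_changes phi p <-> p \in None :: [seq Some (pr (delta_coord (nth 0 zs i))) |
      i <- iota 0 (size zs) & positive_arc phi zs i != positive_arc phi zs i.+1]].
Proof.
move=> hphi sz hz; have [Y Y1 hY] := delta_sign_ends hphi.
have ends (s : R) : Y <= `|s| -> s \notin zs.
  move=> sY; have [h1 h2] := hY s sY; rewrite hz.
  by case: (leP s 0) => s0; [rewrite gt_eqF ?h1|rewrite lt_eqF ?h2 // ltW].
have [S S0 hS] := bounded_seq (fun i => `|nth 0 zs i|) Y (size zs).
have low (i : nat) : (i < size zs)%N -> - S <= nth 0 zs i <= S by move=> /hS; rewrite ler_norml.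
have [Y0 S1] : Y <= `|- S - 1| /\ Y <= `|S + 1|.
  by rewrite -opprD normrN ger0_norm; lra.
have p0 : positive_arc phi zs 0.
  have [||e ns] := @idx_strict R zs 0 (- S - 1) sz (leq0n _) => //.
    by move=> /low /andP[]; lra.
  by have [_] := arc_val hphi sz hz ns; rewrite e => <-; apply: (hY _ Y0).1; lra.
have pM : ~~ positive_arc phi zs (size zs).
  have [||e ns] := @idx_strict R zs (size zs) (S + 1) sz (leqnn _) => //.
  - by move=> z0; have /low/andP[] : ((size zs).-1 < size zs)%N by [rewrite prednK]; lra.
  - by rewrite ltnn.
  have [_] := arc_val hphi sz hz ns; rewrite e => <-.
  by rewrite -leNgt ltW //; apply: (hY _ S1).2; lra.
split=> // p; rewrite inE /sign_changes; split.
  move=> [/(delta_zerosE hphi hz)]; rewrite inE => /orP[->//|/seq.mapP[z zz ->]] [s]; rewrite proj_delta_path.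
  move=> /pr_delta_inj -> op; apply/orP; right; apply/seq.mapP.
  have /(nthP 0)[i iM iz] := zz; exists i; last by rewrite iz.
  rewrite mem_filter mem_iota leq0n add0n iM !andbT.
  have [l r] := zero_sides hphi sz hz iM; rewrite iz in l r.
  by apply/(opposite_signsP _ _ l r).
move=> /orP[/eqP ->|/seq.mapP[i iM ->]].
  split; first by left.
  right; split.
    near=> s; rewrite /= phi_delta_path.
    have sY : s < - Y by near: s; apply: nbhs_ninfty_lt; exact: num_real.
    by have [|h _] := hY s; [rewrite ltr0_norm|apply: h]; lra.
  near=> s; rewrite /= phi_delta_path.
  have sY : Y < s by near: s; apply: nbhs_pinfty_gt; exact: num_real.
  by have [|_ h] := hY s; [rewrite gtr0_norm|apply: h]; lra.
move: iM; rewrite mem_filter mem_iota add0n => /andP[ch iM].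
split.
  apply/(delta_zerosE hphi hz); rewrite inE; apply/orP; right; apply: map_f; exact: mem_nth.
exists (nth 0 zs i); first exact: proj_delta_path.
have [l r] := zero_sides hphi sz hz iM.
by apply/(opposite_signsP _ _ l r).
Unshelve. all: by end_near.
Qed.

Theorem theorem2p1 (R : realType) (phi : upper R -> R)
    (hphi : even_hecke_maass_cusp_form phi) :
  (* the numbers below are well defined *)
  [/\ finite_set (delta_zeros phi), finite_set (inert_nodal_domains phi),
      (num_sign_changes phi)%:R / 2 + 1 <= (num_inert phi)%:R :> R,
      (num_inert phi <= num_zeros phi)%N &
      nonsingular_nodal_line phi ->
      (num_inert phi)%:R = (num_sign_changes phi)%:R / 2 + 1 :> R].
Proof.
have [zs sz hz] := delta_zeros_sorted hphi.
have uz : uniq zs by apply: sorted_uniq sz; [exact: lt_trans|exact: ltxx].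
have inj : injective (fun s : R => Some (pr (delta_coord s))) by move=> s t [] /pr_delta_inj.
have nN (t : seq R) : None \notin [seq Some (pr (delta_coord s)) | s <- t] by apply/negP => /seq.mapP[].
set ent := [seq i <- iota 0 (size zs) | positive_arc phi zs i && ~~ positive_arc phi zs i.+1].
have [p0 pM hsc] := sign_changesE hphi sz hz.
have [fz nz] : finite_set (delta_zeros phi) /\ num_zeros phi = (size zs).+1.
  have [|f e] := fset_set_seq _ (delta_zerosE hphi hz); first by rewrite /= nN map_inj_uniq.
  by split=> //; rewrite /num_zeros e /= size_map.
have [fi ni] := fset_set_seq (undup_uniq _) (inert_nodal_domainsE hphi sz hz).
(* The changes on the line number one less than twice the falls, which are the entries; the cusp
   supplies the missing one. *)
have nsc : num_sign_changes phi = ((size ent).*2)%N.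
  have [|_ e] := fset_set_seq _ hsc.
    rewrite cons_uniq; apply/andP; split; first by apply/negP => /seq.mapP[].
    rewrite map_inj_in_uniq ?filter_uniq ?iota_uniq // => i j.
    rewrite !mem_filter !mem_iota !add0n => /andP[_ iM] /andP[_ jM] /inj e.
    by apply/eqP; rewrite -(nth_uniq 0 iM jM uz) e.
  by rewrite /num_sign_changes e /= size_map !size_filter; exact: count_changes.
have entM i : i \in ent -> (i < size zs)%N by rewrite mem_filter mem_iota add0n => /andP[].
have lb : ((size ent).+1 <= num_inert phi)%N.
  rewrite /num_inert ni; apply: separated_classes => //; first by rewrite filter_uniq ?iota_uniq.
  move=> c hh; have [g [g1 g2 g3]] := domain_coloring c hh hphi sz hz; exists g; split=> // i.
  by rewrite mem_filter mem_iota add0n => /andP[/andP[h1 h2] h3]; exact: g3.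
have half : (num_sign_changes phi)%:R / 2 + 1 = (size ent).+1%:R :> R.
  by rewrite nsc -muln2 natrM mulfK // natr1.
split=> //.
- by rewrite half ler_nat.
(* There is one arc more than there are zeros on the line, and [num_zeros] has one more as well, the
   cusp. *)
- by rewrite nz /num_inert ni (leq_trans (size_undup _)) // size_map size_iota.
move=> ns; rewrite half; apply/eqP; rewrite eqr_nat eqn_leq lb andbT /num_inert ni.
apply: rigid_classes => // G G0 Gent; apply: (rigid_coloring hphi ns sz hz G0) => i iM h1 h2.
by apply: Gent; rewrite mem_filter mem_iota add0n iM h1 h2.
Qed.
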